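(* Let $f$ be a nonconstant meromorphic function on $\mathbb{C}$ with hyper order $\rho_2(f)<1$, let $c\in\mathbb{C}\setminus\{0\}$, and let $A$ be a nonzero constant. If $$E(0,f(z))\subseteq E(0,f(z+c)),\quad E(\infty,f(z+c))\subseteq E(\infty,f(z)),\quad \overline{E}(1,f(z))\subseteq\overline{E}(A,f(z+c)),$$ then $f(z+c)\equiv Af(z)$ or $f(z+c)\equiv f(z)$. In particular, if $A=1$, then $f(z+c)\equiv f(z)$.
   Context: For a meromorphic function $g$ and $a\in\mathbb{C}\cup\{\infty\}$, $E(a,g)$ denotes the set of zeros of $g-a$ (poles of $g$ if $a=\infty$) counted with multiplicity (a zero of multiplicity $m$ counted $m$ times), and $\overline{E}(a,g)$ denotes the set of such points each counted once. An inclusion $E(a,g)\subseteq E(b,h)$ means every $a$-point of $g$ of multiplicity $m$ is a $b$-point of $h$ of multiplicity at least $m$; $\overline{E}(a,g)\subseteq\overline{E}(b,h)$ means every $a$-point of $g$ is a $b$-point of $h$. The hyper order is $\rho_2(f)=\limsup_{r\to\infty}\frac{\log\log T(r,f)}{\log r}$, where $T(r,f)$ is the Nevanlinna characteristic. *)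

(* Defs.v *)
From HB Require Import structures.
From mathcomp Require Import all_boot all_order all_algebra.
From mathcomp Require Import all_classical all_reals all_analysis.
From mathcomp Require Import complex.
Set Implicit Arguments. Unset Strict Implicit. Unset Printing Implicit Defensive.
Import Order.TTheory GRing.Theory Num.Theory numFieldTopology.Exports.
Local Open Scope classical_set_scope.
Local Open Scope ring_scope.

Section Nevanlinna.
Variable R : realType.
Local Notation C := (complex R).

Definition cnorm (z : C) : R := Num.sqrt (complex.Re z ^+ 2 + complex.Im z ^+ 2).

Definition cdiff (f : C -> C) (z : C) : Prop :=
  exists l : C, forall e : R, 0 < e -> exists d : R, 0 < d /\
    forall h : C, h != 0 -> cnorm h < d -> cnorm ((f (z + h) - f z) / h - l) < e.

Definition is_pole (f : C -> C) (z : C) : Prop :=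
  (exists r : R, 0 < r /\ forall w, w != z -> cnorm (w - z) < r -> cdiff f w) /\
  (forall M : R, exists d : R, 0 < d /\
      forall w, w != z -> cnorm (w - z) < d -> M < cnorm (f w)).

(* meromorphic on C: at every point, f is holomorphic or has a pole
   (the value of f at a pole is irrelevant junk) *)
Definition meromorphic (f : C -> C) : Prop := forall z, cdiff f z \/ is_pole f z.

Definition nonconstant (f : C -> C) : Prop :=
  ~ (exists a : C, forall z, ~ is_pole f z -> f z = a).

(* a-points: [a = Some b] is the finite value b, [a = None] is infinity.
   [amult f a z m] : z is an a-point of f of multiplicity m (m >= 1). *)
Definition amult (f : C -> C) (a : option C) (z : C) (m : nat) : Prop :=
  (0 < m)%N /\
  match a with
  | Some b => ~ is_pole f z /\ exists r : R, 0 < r /\ exists h : C -> C,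
      (forall w, cnorm (w - z) < r -> cdiff h w) /\ h z != 0 /\
      (forall w, cnorm (w - z) < r -> f w - b = (w - z) ^+ m * h w)
  | None => is_pole f z /\ exists r : R, 0 < r /\ exists h : C -> C,
      (forall w, cnorm (w - z) < r -> cdiff h w) /\ h z != 0 /\
      (forall w, w != z -> cnorm (w - z) < r -> f w = h w / (w - z) ^+ m)
  end.

Definition Esub (g : C -> C) (a : option C) (h : C -> C) (b : option C) : Prop :=
  forall z m, amult g a z m -> exists m', (m <= m')%N /\ amult h b z m'.

Definition Ebarsub (g : C -> C) (a : option C) (h : C -> C) (b : option C) : Prop :=
  forall z, (exists m, amult g a z m) -> exists m', amult h b z m'.

(* order of the pole of f at z (0 if z is not a pole) *)
Definition pole_order (f : C -> C) (z : C) : nat := xget 0%N [set m | amult f None z m].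

Definition npoles (f : C -> C) (t : R) : \bar R :=
  \esum_(z in [set z : C | cnorm z <= t /\ is_pole f z]) ((pole_order f z)%:R)%:E.

Definition expi (t : R) : C := Complex (cos t) (sin t).

Definition logplus (x : R) : R := Num.max 0 (ln x).

Definition proximity (f : C -> C) (r : R) : \bar R :=
  ((2 * pi)^-1)%:E *
  \int[@lebesgue_measure R]_(t in `[0%R, (2 * pi)%R]) (logplus (cnorm (f (Complex r 0 * expi t))))%:E.

Definition Ncount (f : C -> C) (r : R) : \bar R :=
  (\int[@lebesgue_measure R]_(t in `]0%R, r]) ((npoles f t - npoles f 0) * (t^-1)%:E))%E
  + (npoles f 0 * (ln r)%:E)%E.

Definition charT (f : C -> C) (r : R) : \bar R := (proximity f r + Ncount f r)%E.

Definition hyper_order (f : C -> C) : \bar R :=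
  limf_esup (fun r : R => (ln (ln (fine (charT f r))) / ln r)%:E) (pinfty_nbhs R).

Definition fshift (f : C -> C) (c : C) : C -> C := fun z => f (z + c).

Definition meq (g h : C -> C) : Prop :=
  forall z, ~ is_pole g z -> ~ is_pole h z -> g z = h z.

End Nevanlinna.

(* Main.v *)
Require Import Defs.
From HB Require Import structures.
From mathcomp Require Import all_boot all_order all_algebra.
From mathcomp Require Import all_classical all_reals all_analysis.
From mathcomp Require Import measurable_realfun complex ring lra zify.
Set Implicit Arguments. Unset Strict Implicit. Unset Printing Implicit Defensive.
Import Order.TTheory GRing.Theory Num.Theory numFieldTopology.Exports.
Local Open Scope classical_set_scope.
Local Open Scope ring_scope.

(* By the first two hypotheses the quotients K_n(z) = f(z) / f(z - nc), n = 1, 2, 3, are entire, and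
   since f has hyper order < 1 the lemma on logarithmic differences makes them small with respect to f
   on suitable circles. A zero of f - K_n is a zero of f or a 1-point of f(z - nc), hence by the third
   hypothesis a zero of K_n or of K_n - A K_(n-1), and these are few. If none of f(z+c) = f,
   f(z+c) = A f, f(z+2c) = f holds identically, then the second main theorem for f and the three small
   functions K_1, K_2, K_3, applied through their cross ratio with f, bounds the characteristic of f by
   a small multiple of its value at a slightly larger radius; along a grid of radii on which the
   characteristic at most doubles (one exists, by the growth of f) this is absurd.
   If f(z+2c) = f(z), then h(z) = f(z+c) / f(z) has no zeros or poles and h(z+c) h(z) = 1; comparing
   h(z+c) with h(z) by the lemma on logarithmic differences shows that h is constant, so h = 1 or
   h = -1. If h = -1 and A <> -1, then f omits 1 and -1, and the same argument applied to
   (1+f) / (1-f) makes f constant. *)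

(** Contour integrals are replaced by averages over roots of unity: Cauchy's theorem, Jensen's
    formula and the lemma on logarithmic differences are stated for them, up to errors that vanish
    as the number of roots grows, and [proximity_mlim] and [charT_mlim] tie them to the Nevanlinna
    characteristic. No exceptional set of radii is measured. At scale X the radii advance by K = lam
    ln X between X and 3X. A logarithmic difference for a shift b costs about (|b| + 1) (ln X) / K
    times the characteristic, a fixed small factor once lam is large. There are about X / (lam ln X)
    radii; if the characteristic doubled within every few of them it would outgrow exp (X^q) for
    each q < 1, and this is what hyper order < 1 forbids. As to the case distinction: f(z+c) <> f(z)
    and f(z+2c) <> f(z) make K_1, K_2, K_3 distinct, and f(z+c) <> A f(z) keeps K_n - A K_(n-1) from
    vanishing identically. If f(z+2c) = f(z), then K_1 = K_3 and the cross ratio degenerates, hence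
    the separate argument. *)

Section ComplexNorm.
Variable R : realType.
Local Notation C := (complex R).
Local Notation "x %:C" := (real_complex R x).
Implicit Types (x y z w a b : C) (r e d : R).

(** * Modulus inequalities; filters of full and punctured neighbourhoods *)

Lemma cnorm_normc z : cnorm z = ComplexField.Normc.normc z.
Proof. by case: z. Qed.

Lemma cnorm_ge0 z : 0 <= cnorm z. Proof. exact: sqrtr_ge0. Qed.

Lemma cnorm0 : cnorm (0 : C) = 0.
Proof. by rewrite cnorm_normc ComplexField.Normc.normc0. Qed.

Lemma cnorm1 : cnorm (1 : C) = 1.
Proof. by rewrite cnorm_normc ComplexField.Normc.normc1. Qed.

Lemma cnormM x y : cnorm (x * y) = cnorm x * cnorm y.
Proof. by rewrite !cnorm_normc ComplexField.Normc.normcM. Qed.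

Lemma cnormV x : cnorm x^-1 = (cnorm x)^-1.
Proof. by rewrite !cnorm_normc ComplexField.Normc.normcV. Qed.

Lemma cnormf x y : cnorm (x / y) = cnorm x / cnorm y.
Proof. by rewrite cnormM cnormV. Qed.

Lemma cnormX x n : cnorm (x ^+ n) = cnorm x ^+ n.
Proof. by elim: n => [|n IH]; rewrite ?expr0 ?cnorm1// !exprS cnormM IH. Qed.

Lemma cnormN x : cnorm (- x) = cnorm x.
Proof. by case: x => a b; rewrite /cnorm /= !sqrrN. Qed.

Lemma cnormD x y : cnorm (x + y) <= cnorm x + cnorm y.
Proof. by rewrite !cnorm_normc le_normcD. Qed.

Lemma cnormBC x y : cnorm (x - y) = cnorm (y - x).
Proof. by rewrite -cnormN opprB. Qed.

Lemma cnormB x y : cnorm (x - y) <= cnorm x + cnorm y.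
Proof. by rewrite -(cnormN y) cnormD. Qed.

Lemma cnorm_triangle y x z : cnorm (x - z) <= cnorm (x - y) + cnorm (y - z).
Proof. by rewrite -[x - z](_ : (x - y) + (y - z) = _) ?cnormD//; ring. Qed.

Lemma cnorm_subl x y : cnorm x - cnorm y <= cnorm (x - y).
Proof. by rewrite lerBlDr -{1}[x](subrK y) cnormD. Qed.

Lemma cnorm_eq0 x : (cnorm x == 0) = (x == 0).
Proof.
apply/eqP/eqP => [|->]; last exact: cnorm0.
by rewrite cnorm_normc; exact: ComplexField.Normc.eq0_normc.
Qed.

Lemma cnorm_gt0 x : (0 < cnorm x) = (x != 0).
Proof. by rewrite lt_neqAle cnorm_ge0 andbT eq_sym cnorm_eq0. Qed.

Lemma cnorm_le0 x : (cnorm x <= 0) = (x == 0).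
Proof. by rewrite -cnorm_eq0 eq_le cnorm_ge0 andbT. Qed.

Lemma cnormR r : cnorm r%:C = `|r|.
Proof. by rewrite /cnorm /= expr0n addr0 sqrtr_sqr. Qed.

Lemma cnormn n : cnorm (n%:R : C) = n%:R.
Proof. by rewrite -(rmorph_nat (real_complex R)) cnormR ger0_norm. Qed.

Lemma cnorm_sqr z : cnorm z ^+ 2 = complex.Re z ^+ 2 + complex.Im z ^+ 2.
Proof. by rewrite sqr_sqrtr// addr_ge0// sqr_ge0. Qed.

Lemma Re_cnorm z : `|complex.Re z| <= cnorm z.
Proof.
rewrite -(ler_pXn2r (_ : 0 < 2)%N)// ?nnegrE ?cnorm_ge0//.
by rewrite cnorm_sqr real_normK ?num_real// lerDl sqr_ge0.
Qed.

Lemma Im_cnorm z : `|complex.Im z| <= cnorm z.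
Proof.
rewrite -(ler_pXn2r (_ : 0 < 2)%N)// ?nnegrE ?cnorm_ge0//.
by rewrite cnorm_sqr real_normK ?num_real// lerDr sqr_ge0.
Qed.

Lemma cnorm_ReIm z : cnorm z <= `|complex.Re z| + `|complex.Im z|.
Proof.
rewrite -(ler_pXn2r (_ : 0 < 2)%N)// ?nnegrE ?cnorm_ge0// ?addr_ge0//.
rewrite cnorm_sqr sqrrD !real_normK ?num_real// -addrA lerD2l lerDr.
by rewrite mulrn_wge0// mulr_ge0.
Qed.

Lemma cnorm_sum I (s : seq I) (P : pred I) (F : I -> C) :
  cnorm (\sum_(i <- s | P i) F i) <= \sum_(i <- s | P i) cnorm (F i).
Proof.
elim/big_rec2: _ => [|i y x _ h]; first by rewrite cnorm0.
by rewrite (le_trans (cnormD _ _))// lerD2l.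
Qed.

Lemma cnorm_prod I (s : seq I) (P : pred I) (F : I -> C) :
  cnorm (\prod_(i <- s | P i) F i) = \prod_(i <- s | P i) cnorm (F i).
Proof. by elim/big_rec2: _ => [|i y x _ <-]; rewrite ?cnorm1 ?cnormM. Qed.

Lemma cnorm_conj z : cnorm (conjc z) = cnorm z.
Proof. by case: z => a b; rewrite /cnorm /= sqrrN. Qed.

Lemma mul_conjc z : z * conjc z = (cnorm z ^+ 2)%:C.
Proof.
by rewrite cnorm_sqr; case: z => a b; apply/eqP; rewrite eq_complex /=; apply/andP; split; apply/eqP; ring.
Qed.

Lemma small_cnorm_eq x y : (forall e, 0 < e -> cnorm (x - y) <= e) -> x = y.
Proof.
move=> h; apply/eqP; rewrite -subr_eq0 -cnorm_le0.
by apply/ler_addgt0Pr => e e0; rewrite add0r h.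
Qed.

(** Stated directly in terms of [cnorm], so that [near] reasoning applies to the epsilon-delta
    definitions of [cdiff] and [is_pole]. [pn] is the punctured version. *)
Definition nb z : set_system C :=
  [set A | exists2 d : R, 0 < d & forall w, cnorm (w - z) < d -> A w].

Definition pn z : set_system C :=
  [set A | exists2 d : R, 0 < d & forall w, w != z -> cnorm (w - z) < d -> A w].

Global Instance nb_filter z : ProperFilter (nb z).
Proof.
split; first by move=> [d d0 /(_ z)]; apply; rewrite subrr cnorm0.
split.
- by exists 1.
- move=> P Q [d d0 hd] [e e0 he]; exists (Num.min d e); first by rewrite lt_min d0.
  by move=> w; rewrite lt_min => /andP[wd we]; split; [exact: hd|exact: he].
- by move=> P Q PQ [d d0 hd]; exists d => // w /hd/PQ.
Qed.

Lemma exists_near_ne z d : 0 < d -> exists2 w, w != z & cnorm (w - z) < d.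
Proof.
move=> d0; exists (z + (d / 2)%:C).
  rewrite -subr_eq0 addrC addKr -cnorm_gt0 cnormR; rewrite normr_gt0 gt_eqF//; lra.
by rewrite addrC addKr cnormR gtr0_norm; lra.
Qed.

Global Instance pn_filter z : ProperFilter (pn z).
Proof.
split.
  by move=> [d d0 h]; have [w wz wd] := exists_near_ne z d0; exact: (h w).
split.
- by exists 1.
- move=> P Q [d d0 hd] [e e0 he]; exists (Num.min d e); first by rewrite lt_min d0.
  by move=> w wz; rewrite lt_min => /andP[wd we]; split; [exact: hd|exact: he].
- by move=> P Q PQ [d d0 hd]; exists d => // w wz /hd; move=> /(_ wz)/PQ.
Qed.

Lemma nb_pn z (A : set C) : nb z A -> pn z A.
Proof. by move=> [d d0 h]; exists d => // w _; exact: h. Qed.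

Lemma nb_self z (A : set C) : nb z A -> A z.
Proof. by move=> [d d0]; apply; rewrite subrr cnorm0. Qed.

Lemma nb_ball z r : 0 < r -> \forall w \near nb z, cnorm (w - z) < r.
Proof. by exists r. Qed.

Lemma nb_disc z r : cnorm z < r -> \forall w \near nb z, cnorm w < r.
Proof.
move=> zr; exists (r - cnorm z); rewrite ?subr_gt0// => w h.
by rewrite -(subrK z w); apply: le_lt_trans (cnormD _ _) _; rewrite -ltrBrDr.
Qed.

Lemma nb_nb z (A : set C) : nb z A -> \forall w \near nb z, nb w A.
Proof.
move=> [d d0 h]; exists d => // w wz; exists (d - cnorm (w - z)); rewrite ?subr_gt0// => v vw.
by apply: h; apply: le_lt_trans (cnorm_triangle w _ _) _; rewrite -ltrBrDr.
Qed.

Lemma pn_ne z : \forall w \near pn z, w != z.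
Proof. by exists 1. Qed.

(** The punctured disc is open: a radius below both |w - z| and d - |w - z| keeps the ball around w
    inside the disc and off z. *)
Lemma pn_nb z (A : set C) : pn z A -> \forall w \near pn z, nb w A.
Proof.
move=> [d d0 h]; exists d => // w wz wd.
exists (Num.min (cnorm (w - z)) (d - cnorm (w - z))).
  by rewrite lt_min cnorm_gt0 subr_eq0 wz subr_gt0.
move=> v; rewrite lt_min => /andP[h1 h2]; apply: h.
  by apply: contraTneq h1 => ->; rewrite cnormBC ltxx.
by apply: le_lt_trans (cnorm_triangle w _ _) _; rewrite -ltrBrDr.
Qed.

Lemma nb_pnP z (A : set C) : nb z A <-> A z /\ pn z A.
Proof.
split=> [h|[Az [d d0 h]]]; first by split; [exact: nb_self h|exact: nb_pn].
by exists d => // w wd; have [->//|wz] := eqVneq w z; exact: h.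
Qed.

Lemma nb_add z c (A : set C) : nb (z + c) A -> nb z (fun w => A (w + c)).
Proof. by move=> [d d0 h]; exists d => // w wd; apply: h; rewrite (_ : _ - _ = w - z)//; ring. Qed.

Lemma pn_add z c (A : set C) : pn (z + c) A -> pn z (fun w => A (w + c)).
Proof.
move=> [d d0 h]; exists d => // w wz wd; apply: h; first by rewrite (inj_eq (addIr _)).
by rewrite (_ : _ - _ = w - z)//; ring.
Qed.

End ComplexNorm.

(** * Rules of complex differentiation *)

Section ComplexDerivative.
Variable R : realType.
Local Notation C := (complex R).
Local Notation "x %:C" := (real_complex R x).
Implicit Types (x y z w a b l m : C) (r e d : R) (f g : C -> C).

(** Multiplied out and with a weak inequality, so that w = z is allowed and no division has to be
    cleared; [cdiffP] is the passage from the quotient form. *)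
Definition cder f z l := forall e, 0 < e ->
  \forall w \near nb z, cnorm (f w - f z - l * (w - z)) <= e * cnorm (w - z).

Definition ccont f z := forall e, 0 < e -> \forall w \near nb z, cnorm (f w - f z) < e.

Lemma cdiffP f z : cdiff f z <-> exists l, cder f z l.
Proof.
split=> -[l h]; exists l => e e0.
- have [d [d0 hd]] := h _ e0; exists d => // w wd.
  have [->|wz] := eqVneq w z; first by rewrite !subrr mulr0 subr0 cnorm0 mulr0.
  have hz : w - z != 0 by rewrite subr_eq0.
  have := hd _ hz wd; rewrite (addrC z) subrK => /ltW.
  rewrite -(ler_pM2r (_ : 0 < cnorm (w - z))) ?cnorm_gt0// -cnormM.
  by rewrite mulrBl divfK.
- have [d d0 hd] := h (e / 2) ltac:(lra); exists d; split=> // v v0 vd.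
  have := hd (z + v); rewrite (addrC z) addrK => /(_ vd) hh.
  rewrite -(ltr_pM2r (_ : 0 < cnorm v)) ?cnorm_gt0// -cnormM mulrBl divfK//.
  apply: le_lt_trans hh _; rewrite ltr_pM2r ?cnorm_gt0//; lra.
Qed.

Lemma cder_ccont f z l : cder f z l -> ccont f z.
Proof.
move=> h e e0; near=> w.
have h1 : cnorm (f w - f z - l * (w - z)) <= 1 * cnorm (w - z) by near: w; exact: h.
have h2 : cnorm (w - z) < e / (2 + cnorm l).
  by near: w; apply: nb_ball; rewrite divr_gt0// ltr_pwDl// cnorm_ge0.
have hl := cnorm_ge0 l.
rewrite -(subrK (l * (w - z)) (f w - f z)); apply: le_lt_trans (cnormD _ _) _.
rewrite cnormM; rewrite ltr_pdivlMr in h2; last lra.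
have := cnorm_ge0 (w - z); nra.
Unshelve. all: by end_near. Qed.

Lemma cdiff_ccont f z : cdiff f z -> ccont f z.
Proof. by move=> /cdiffP[l]; exact: cder_ccont. Qed.

Lemma cder_eq f g z l : (\forall w \near nb z, f w = g w) -> cder f z l -> cder g z l.
Proof.
move=> fg h e e0; have fz := nb_self fg; near=> w.
by rewrite -(near fg w)// -?fz//; near: w; exact: h.
Unshelve. all: by end_near. Qed.

Lemma cdiff_eq f g z : (\forall w \near nb z, f w = g w) -> cdiff f z -> cdiff g z.
Proof. by move=> fg /cdiffP[l h]; apply/cdiffP; exists l; exact: cder_eq h. Qed.

Lemma cder_cst a z : cder (fun=> a) z 0.
Proof.
move=> e e0; near=> w; rewrite subrr mul0r subr0 cnorm0.
by rewrite mulr_ge0 ?cnorm_ge0// ltW.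
Unshelve. all: by end_near. Qed.

Lemma cder_id z : cder id z 1.
Proof.
move=> e e0; near=> w; rewrite mul1r subrr cnorm0.
by rewrite mulr_ge0 ?cnorm_ge0// ltW.
Unshelve. all: by end_near. Qed.

Lemma cderD f g z l m : cder f z l -> cder g z m -> cder (fun w => f w + g w) z (l + m).
Proof.
move=> hf hg e e0; near=> w.
have h1 : cnorm (f w - f z - l * (w - z)) <= e / 2 * cnorm (w - z).
  by near: w; apply: hf; lra.
have h2 : cnorm (g w - g z - m * (w - z)) <= e / 2 * cnorm (w - z).
  by near: w; apply: hg; lra.
rewrite (_ : _ - _ = (f w - f z - l * (w - z)) + (g w - g z - m * (w - z))); last ring.
by apply: le_trans (cnormD _ _) _; lra.
Unshelve. all: by end_near. Qed.

Lemma ccont_bounded f z : ccont f z -> \forall w \near nb z, cnorm (f w) <= cnorm (f z) + 1.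
Proof.
move=> h; near=> w.
have : cnorm (f w - f z) < 1 by near: w; exact: h.
by move=> /ltW h1; rewrite -(subrK (f z) (f w)) addrC; apply: le_trans (cnormD _ _) _; rewrite lerD2l.
Unshelve. all: by end_near. Qed.

Lemma cderM f g z l m : cder f z l -> cder g z m ->
  cder (fun w => f w * g w) z (l * g z + f z * m).
Proof.
move=> hf hg e e0.
have Hg := ccont_bounded (cder_ccont hg).
pose B := cnorm (g z) + 1; pose D := cnorm (f z) + 1; pose E := cnorm l + 1.
have B0 : 0 < B by rewrite ltr_wpDl// cnorm_ge0.
have D0 : 0 < D by rewrite ltr_wpDl// cnorm_ge0.
have E0 : 0 < E by rewrite ltr_wpDl// cnorm_ge0.
near=> w.
have h1 : cnorm (f w - f z - l * (w - z)) <= e / 3 / B * cnorm (w - z).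
  by near: w; apply: hf; rewrite !divr_gt0.
have h2 : cnorm (g w - g z - m * (w - z)) <= e / 3 / D * cnorm (w - z).
  by near: w; apply: hg; rewrite !divr_gt0.
have h3 : cnorm (g w) <= B by near: w.
have h4 : cnorm (g w - g z) < e / 3 / E.
  by near: w; apply: (cder_ccont hg); rewrite !divr_gt0.
rewrite (_ : _ - _ = (f w - f z - l * (w - z)) * g w + f z * (g w - g z - m * (w - z))
   + l * (w - z) * (g w - g z)); last ring.
apply: le_trans (cnormD _ _) _; apply: le_trans (lerD (cnormD _ _) (lexx _)) _.
rewrite !cnormM.
have k1 : cnorm (f w - f z - l * (w - z)) * cnorm (g w) <= e / 3 * cnorm (w - z).
  apply: le_trans (ler_pM (cnorm_ge0 _) (cnorm_ge0 _) h1 h3) _.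
  by rewrite mulrAC divfK// gt_eqF.
have k2 : cnorm (f z) * cnorm (g w - g z - m * (w - z)) <= e / 3 * cnorm (w - z).
  apply: le_trans (ler_pM (cnorm_ge0 _) (cnorm_ge0 _) (_ : _ <= D) h2) _; first by rewrite /D lerDl.
  by rewrite mulrA [D * _]mulrC divfK // gt_eqF.
have k3 : cnorm l * cnorm (w - z) * cnorm (g w - g z) <= e / 3 * cnorm (w - z).
  rewrite mulrAC ler_wpM2r ?cnorm_ge0//.
  apply: le_trans (ler_pM (cnorm_ge0 _) (cnorm_ge0 _) (_ : _ <= E) (ltW h4)) _; first by rewrite /E lerDl.
  by rewrite mulrC divfK// gt_eqF.
by lra.
Unshelve. all: by end_near. Qed.

Lemma ccont_neq0 f z : ccont f z -> f z != 0 -> \forall w \near nb z, cnorm (f z) / 2 <= cnorm (f w).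
Proof.
move=> h fz; have p : 0 < cnorm (f z) by rewrite cnorm_gt0.
near=> w.
have h1 : cnorm (f w - f z) < cnorm (f z) / 2 by near: w; apply: h; lra.
by have := cnorm_subl (f z) (f w); rewrite cnormBC; lra.
Unshelve. all: by end_near. Qed.

Lemma cderV f z l : f z != 0 -> cder f z l -> cder (fun w => (f w)^-1) z (- l / f z ^+ 2).
Proof.
move=> fz hf e e0.
have p : 0 < cnorm (f z) by rewrite cnorm_gt0.
pose E := cnorm l + 1.
have E0 : 0 < E by rewrite ltr_wpDl// cnorm_ge0.
have Hf := ccont_neq0 (cder_ccont hf) fz.
pose q := cnorm (f z) ^+ 2 * e.
have q0 : 0 < q by rewrite mulr_gt0// exprn_gt0.
near=> w.
have h0 : cnorm (f z) / 2 <= cnorm (f w) by near: w.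
have fw : f w != 0 by rewrite -cnorm_gt0; lra.
have h1 : cnorm (f w - f z - l * (w - z)) <= q / 4 * cnorm (w - z).
  by near: w; apply: hf; rewrite divr_gt0//.
have h2 : cnorm (f w - f z) < q * cnorm (f z) / 4 / E.
  by near: w; apply: (cder_ccont hf); rewrite !divr_gt0// mulr_gt0.
rewrite (_ : _ - _ = (- (f w - f z - l * (w - z)) * f z + l * (w - z) * (f w - f z)) / (f w * f z ^+ 2)); last first.
  by field; apply/andP.
rewrite cnormf ler_pdivrMr ?cnorm_gt0 ?mulf_neq0 ?expf_neq0//.
apply: le_trans (cnormD _ _) _; rewrite !cnormM cnormN.
have k3 : cnorm l * cnorm (f w - f z) <= q * cnorm (f z) / 4.
  apply: le_trans (ler_pM (cnorm_ge0 _) (cnorm_ge0 _) (_ : _ <= E) (ltW h2)) _; first by rewrite /E lerDl.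
  by rewrite mulrC divfK// gt_eqF.
have wz := cnorm_ge0 (w - z).
have k1 : cnorm (f w - f z - l * (w - z)) * cnorm (f z) <= q * cnorm (f z) / 4 * cnorm (w - z) by nra.
have k4 : cnorm l * cnorm (w - z) * cnorm (f w - f z) <= q * cnorm (f z) / 4 * cnorm (w - z).
  by rewrite mulrAC ler_wpM2r.
apply: le_trans (lerD k1 k4) _.
rewrite (_ : e * _ * _ = q * cnorm (f w) * cnorm (w - z)); last by rewrite /q; ring.
by rewrite -mulrDl ler_wpM2r//; nra.
Unshelve. all: by end_near. Qed.

Lemma cderB f g z l m : cder f z l -> cder g z m -> cder (fun w => f w - g w) z (l - m).
Proof.
move=> hf hg; have := cderD hf (cderM (cder_cst (-1) z) hg).
rewrite mul0r add0r mulN1r => h e e0; apply: filterS (h e e0) => w; by rewrite !mulN1r.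
Qed.

Lemma cder_unique f z l m : cder f z l -> cder f z m -> l = m.
Proof.
move=> hl hm; apply: small_cnorm_eq => e e0.
have e2 : 0 < e / 2 by lra.
have := filterI (hl _ e2) (hm _ e2).
move=> [d d0 hd]; have [w wz wd] := exists_near_ne z d0.
have [h1 h2] := hd _ wd.
rewrite -(ler_pM2r (_ : 0 < cnorm (w - z))) ?cnorm_gt0 ?subr_eq0// -cnormM.
rewrite (_ : (l - m) * (w - z) = (f w - f z - m * (w - z)) - (f w - f z - l * (w - z))); last ring.
by apply: le_trans (cnormB _ _) _; lra.
Qed.

Lemma cder_add f c z l : cder f (z + c) l -> cder (fun w => f (w + c)) z l.
Proof.
move=> h e e0; apply: filterS (nb_add (h e e0)) => w.
by rewrite (_ : w + c - (z + c) = w - z)//; ring.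
Qed.

Lemma cdiff_add f c z : cdiff f (z + c) -> cdiff (fun w => f (w + c)) z.
Proof. by move=> /cdiffP[l h]; apply/cdiffP; exists l; exact: cder_add. Qed.

Lemma cdiff_cst a z : cdiff (fun=> a) z.
Proof. by apply/cdiffP; eexists; exact: cder_cst. Qed.

Lemma cdiff_id z : cdiff id z.
Proof. by apply/cdiffP; eexists; exact: cder_id. Qed.

Lemma cdiffD f g z : cdiff f z -> cdiff g z -> cdiff (fun w => f w + g w) z.
Proof. by move=> /cdiffP[l h] /cdiffP[m k]; apply/cdiffP; eexists; exact: cderD h k. Qed.

Lemma cdiffB f g z : cdiff f z -> cdiff g z -> cdiff (fun w => f w - g w) z.
Proof. by move=> /cdiffP[l h] /cdiffP[m k]; apply/cdiffP; eexists; exact: cderB h k. Qed.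

Lemma cdiffM f g z : cdiff f z -> cdiff g z -> cdiff (fun w => f w * g w) z.
Proof. by move=> /cdiffP[l h] /cdiffP[m k]; apply/cdiffP; eexists; exact: cderM h k. Qed.

Lemma cdiffV f z : f z != 0 -> cdiff f z -> cdiff (fun w => (f w)^-1) z.
Proof. by move=> f0 /cdiffP[l h]; apply/cdiffP; eexists; exact: cderV f0 h. Qed.

Lemma cdiffX f n z : cdiff f z -> cdiff (fun w => f w ^+ n) z.
Proof.
move=> h; elim: n => [|n IH].
  by apply: (cdiff_eq (f := fun=> 1)); [near=> w; rewrite expr0|exact: cdiff_cst].
apply: (cdiff_eq (f := fun w => f w * f w ^+ n)); last exact: cdiffM.
by near=> w; rewrite exprS.
Unshelve. all: by end_near. Qed.

Lemma cdiff_sum I (s : seq I) (F : I -> C -> C) z :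
  (forall i, cdiff (F i) z) -> cdiff (fun w => \sum_(i <- s) F i w) z.
Proof.
move=> h; elim: s => [|i s IH].
  by apply: (cdiff_eq (f := fun=> 0)); [near=> w; rewrite big_nil|exact: cdiff_cst].
apply: (cdiff_eq (f := fun w => F i w + \sum_(i <- s) F i w)); last exact: cdiffD.
by near=> w; rewrite big_cons.
Unshelve. all: by end_near. Qed.

End ComplexDerivative.

(** * Dyadic bisection of the unit square *)

Section Bisection.
Variable R : realType.

(** The left endpoints [u k / 2 ^ k] increase and every right endpoint bounds them, so their
    supremum lies in all the intervals. *)
Lemma nested_dyadic (u : nat -> nat) :
  u 0%N = 0%N -> (forall k, (u k).*2 <= u k.+1 <= (u k).*2.+1)%N ->
  exists s : R, forall k, (u k)%:R / 2 ^+ k <= s <= (u k).+1%:R / 2 ^+ k.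
Proof.
move=> u0 hu.
have p2 k : 0 < 2 ^+ k :> R by rewrite exprn_gt0.
have lo n k : (u k)%:R / 2 ^+ k <= (u (k + n)%N)%:R / 2 ^+ (k + n) :> R.
  elim: n => [|n IH]; first by rewrite addn0.
  apply: le_trans IH _; rewrite addnS exprS [leLHS](_ : _ = (u (k + n)%N)%:R * 2 / (2 * 2 ^+ (k + n))).
    rewrite ler_pM2r ?invr_gt0 ?mulr_gt0// -natrM ler_nat muln2.
    by have /andP[] := hu (k + n)%N.
  by field; rewrite gt_eqF.
have hi n k : (u (k + n)%N).+1%:R / 2 ^+ (k + n) <= (u k).+1%:R / 2 ^+ k :> R.
  elim: n => [|n IH]; first by rewrite addn0.
  apply: le_trans IH; rewrite addnS exprS [leRHS](_ : _ = 2 * (u (k + n)%N).+1%:R / (2 * 2 ^+ (k + n))).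
    rewrite ler_pM2r ?invr_gt0 ?mulr_gt0// -natrM ler_nat.
    have /andP[_ h] := hu (k + n)%N; lia.
  by field; rewrite gt_eqF.
pose A := [set x : R | exists k, x = (u k)%:R / 2 ^+ k].
have ub k x : A x -> x <= (u k).+1%:R / 2 ^+ k.
  move=> [n ->]; have [kn|nk] := leqP k n.
    rewrite -(subnKC kn); apply: le_trans (hi (n - k)%N _).
    by rewrite ler_pM2r ?invr_gt0// ler_nat.
  rewrite -(subnKC (ltnW nk)); apply: le_trans (lo (k - n)%N _) _.
  by rewrite ler_pM2r ?invr_gt0// ler_nat.
exists (sup A) => k; apply/andP; split.
  apply: ub_le_sup; last by exists k.
  by exists ((u 0%N).+1%:R / 2 ^+ 0) => x /(ub 0%N).
apply: ge_sup; first by exists ((u 0%N)%:R / 2 ^+ 0), 0%N.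
by move=> x; exact: ub.
Qed.

(** The common engine of Goursat's argument, of the mean value inequality and of the compactness of
    discs: a defect that always passes to one of the four quarters of a dyadic square is traced down
    to a point (s, t). *)
Lemma bisect (P : nat -> nat -> nat -> Prop) :
  P 0%N 0%N 0%N ->
  (forall k i j, P k i j -> exists x y : bool, P k.+1 (i.*2 + x)%N (j.*2 + y)%N) ->
  exists s t : R, forall k, exists i j : nat, [/\ P k i j,
    i%:R / 2 ^+ k <= s <= i.+1%:R / 2 ^+ k & j%:R / 2 ^+ k <= t <= j.+1%:R / 2 ^+ k].
Proof.
move=> P0 step.
have step' (q : nat * nat * nat) : exists xy : bool * bool,
    P q.1.1 q.1.2 q.2 -> P q.1.1.+1 (q.1.2.*2 + xy.1)%N (q.2.*2 + xy.2)%N.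
  case: (pselect (P q.1.1 q.1.2 q.2)) => [/step[x [y h]]|nP]; first by exists (x, y).
  (* A dummy pair: [choice] needs a total relation, and off [P] nothing is required. *)
  by exists (true, true).
have [c hc] := choice step'.
pose nxt q := (q.1.1.+1, (q.1.2.*2 + (c q).1)%N, (q.2.*2 + (c q).2)%N).
pose w k := iter k nxt (0%N, 0%N, 0%N).
have w1 k : (w k).1.1 = k by elim: k => //= k ->.
have Pw k : P k (w k).1.2 (w k).2.
  elim: k => // k IH; rewrite /w iterS -/(w k).
  by have := hc (w k); rewrite w1 => /(_ IH).
have [|k|s hs] := @nested_dyadic (fun k => (w k).1.2) => //.
  by rewrite /w iterS -/(w k) /=; case: (c _).1; rewrite ?addn0 ?addn1 leqnn /= ?leqnSn.
have [|k|t ht] := @nested_dyadic (fun k => (w k).2) => //.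
  by rewrite /w iterS -/(w k) /=; case: (c _).2; rewrite ?addn0 ?addn1 leqnn /= ?leqnSn.
by exists s, t => k; exists (w k).1.2, (w k).2.
Qed.

End Bisection.

(** * Points of a circle and averages over roots of unity *)

Section CircleMean.
Variable R : realType.
Local Notation C := (complex R).
Local Notation "x %:C" := (real_complex R x).
Implicit Types (x y z w a b : C) (r e d : R).

Lemma expi0 : expi (0 : R) = 1.
Proof. by rewrite /expi cos0 sin0. Qed.

Lemma expiD (s t : R) : expi (s + t) = expi s * expi t.
Proof. by apply/eqP; rewrite eq_complex /= cosD sinD; apply/andP; split; apply/eqP => //; ring. Qed.

Lemma cnorm_expi (t : R) : cnorm (expi t) = 1.
Proof. by rewrite /cnorm /= cos2Dsin2 sqrtr1. Qed.

Lemma expiX (t : R) n : expi t ^+ n = expi (n%:R * t).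
Proof.
elim: n => [|n IH]; first by rewrite expr0 mul0r expi0.
by rewrite exprS IH -expiD -natr1 mulrDl mul1r addrC.
Qed.

Lemma expi_pi : expi (pi : R) = -1.
Proof. by apply/eqP; rewrite eq_complex /= cospi sinpi oppr0 !eqxx. Qed.

Lemma expi_2pi : expi (2 * pi : R) = 1.
Proof. by rewrite mulrDl mul1r expiD expi_pi mulrNN mulr1. Qed.

Lemma real_lip (f df : R -> R) (M : R) : (forall s : R, is_derive s 1 f (df s)) ->
  (forall s, `|df s| <= M) -> forall s t, `|f s - f t| <= M * `|s - t|.
Proof.
move=> fd hM.
have key (a b : R) : a <= b -> `|f b - f a| <= M * `|b - a|.
  move=> ab; have [|c _ ->] := @MVT_segment R f df a b ab.
  - apply: continuous_subspaceT => x; apply: differentiable_continuous.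
    by apply/derivable1_diffP.
  - by rewrite normrM ler_wpM2r.
move=> s t; have [st|/ltW st] := leP s t; last exact: key.
by rewrite distrC (distrC s) key.
Qed.

(** The factor 2 is the price of treating cos and sin separately, each being 1-Lipschitz. *)
Lemma expi_lip (s t : R) : cnorm (expi s - expi t) <= 2 * `|s - t|.
Proof.
apply: le_trans (cnorm_ReIm _) _; rewrite /= mulrDl mul1r; apply: lerD.
  have := @real_lip cos (fun x : R => - sin x) 1 _ _ s t; rewrite mul1r; apply => // x.
  by rewrite normrN sin_max.
have := @real_lip sin cos 1 _ _ s t; rewrite mul1r; apply => // x.
by rewrite cos_max.
Qed.

Definition rt N k : C := expi (2 * pi * (k%:R / 2 ^+ N)).

(* Circle means are averages over the 2^N-th roots of unity, used only in the limit N -> oo. *)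
Definition Mc N r (G : C -> C) : C := (2 ^+ N)^-1 * \sum_(k < 2 ^ N) G (r%:C * rt N k).

Lemma cnorm_rt N k : cnorm (rt N k) = 1. Proof. exact: cnorm_expi. Qed.

Lemma cnorm_Mc N r G B : (forall w, cnorm w = `|r| -> cnorm (G w) <= B) -> cnorm (Mc N r G) <= B.
Proof.
move=> h; have p : 0 < 2 ^+ N :> R by rewrite exprn_gt0.
rewrite /Mc cnormM cnormV cnormX (cnormn _ 2) mulrC ler_pdivrMr//.
apply: le_trans (cnorm_sum _ _ _) _.
apply: le_trans (_ : \sum_(k < 2 ^ N) B <= _).
  by apply: ler_sum => k _; apply: h; rewrite cnormM cnorm_rt mulr1 cnormR.
by rewrite sumr_const card_ord -natrX mulr_natr.
Qed.

Lemma Mc_lin N r G H a b :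
  Mc N r (fun w => a * G w + b * H w) = a * Mc N r G + b * Mc N r H.
Proof.
rewrite /Mc big_split /= -!mulr_sumr mulrDr; congr (_ + _); ring.
Qed.

Lemma Mc_cst N r a : Mc N r (fun=> a) = a.
Proof.
rewrite /Mc sumr_const card_ord -[a *+ _]mulr_natl mulrA natrX mulVf ?mul1r//.
Qed.

Lemma eq_Mc N r G H : (forall w, cnorm w = `|r| -> G w = H w) -> Mc N r G = Mc N r H.
Proof.
by move=> h; congr (_ * _); apply: eq_bigr => k _; rewrite h// cnormM cnorm_rt mulr1 cnormR.
Qed.

End CircleMean.

(** * Goursat's theorem on an annulus, in discrete form *)

Section Goursat.
Variable R : realType.
Local Notation C := (complex R).
Local Notation "x %:C" := (real_complex R x).
Implicit Types (x y z w a b : C) (e d : R).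

Variables (r0 L : R).
Hypotheses (r0_gt0 : 0 < r0) (L_ge0 : 0 <= L).

(** Logarithmic polar coordinates on the annulus r0 <= |w| <= r0 e^L. An angular or radial step of
    the grid multiplies by the constant [om N] or [qq N], which makes discrete contour sums
    telescope. *)
Let pt (s t : R) : C := (r0 * expR (L * s))%:C * expi (2 * pi * t).
Let om N := expi (2 * pi / 2 ^+ N) : C.
Let qq N := (expR (L / 2 ^+ N))%:C.
Let grid N u v := pt (u%:R / 2 ^+ N) (v%:R / 2 ^+ N).

Let p2 N : 2 ^+ N != 0 :> R. Proof. by rewrite expf_neq0// pnatr_eq0. Qed.

Let grid_ang N u v : grid N u v.+1 = om N * grid N u v.
Proof.
rewrite /grid /pt /om [RHS]mulrCA -expiD; congr (_ * expi _).
by rewrite -natr1; field.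
Qed.

Let grid_rad N u v : grid N u.+1 v = qq N * grid N u v.
Proof.
rewrite /grid /pt /qq mulrA -rmorphM; congr (_%:C * _).
rewrite [RHS]mulrCA -expRD; congr (_ * expR _).
by rewrite -natr1; field.
Qed.

Let arc G N u v n := \sum_(t < n) G (grid N u (v + t)%N) : C.
Let ray G N u v n := \sum_(t < n) G (grid N (u + t)%N v) : C.
(** Discrete contour integral of G(w) dw / w around a cell: along an arc dw is ([om N] - 1) w, along
    a ray it is ([qq N] - 1) w. *)
Let con G N u v n := (om N - 1) * (arc G N (u + n) v n - arc G N u v n)
  - (qq N - 1) * (ray G N u (v + n) n - ray G N u v n).

Let conB G H N u v n : con G N u v n - con H N u v n = con (fun w => G w - H w) N u v n.
Proof. by rewrite /con /arc /ray !sumrB; ring. Qed.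

(** The constant parts of opposite sides cancel and the linear parts telescope to the corners,
    without error term. This lets the tangent map be subtracted before any limit is taken. *)
Let con_affine a b N u v n : con (fun w => a + b * w) N u v n = 0.
Proof.
have ha u' : (om N - 1) * arc (fun w => a + b * w) N u' v n =
    (om N - 1) * (a *+ n) + b * (grid N u' (v + n) - grid N u' v).
  rewrite /arc big_split /= sumr_const card_ord mulrDr; congr (_ + _).
  elim: n => [|n IH]; first by rewrite big_ord0 addn0 subrr !mulr0.
  by rewrite big_ord_recr /= mulrDr IH addnS grid_ang; ring.
have hr v' : (qq N - 1) * ray (fun w => a + b * w) N u v' n =
    (qq N - 1) * (a *+ n) + b * (grid N (u + n) v' - grid N u v').
  rewrite /ray big_split /= sumr_const card_ord mulrDr; congr (_ + _).
  clear ha; elim: n => [|n IH]; first by rewrite big_ord0 addn0 subrr !mulr0.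
  by rewrite big_ord_recr /= mulrDr IH addnS grid_rad; ring.
by rewrite /con !mulrBr !ha !hr; ring.
Qed.

Let con_quarter G N u v n : con G N u v (n + n) =
  con G N u v n + con G N (u + n) v n + con G N u (v + n) n + con G N (u + n) (v + n) n.
Proof.
have ha u' v' : arc G N u' v' (n + n) = arc G N u' v' n + arc G N u' (v' + n) n.
  rewrite /arc big_split_ord /=; congr (_ + _).
  by apply: eq_bigr => i _; rewrite addnA.
have hr u' v' : ray G N u' v' (n + n) = ray G N u' v' n + ray G N (u' + n) v' n.
  rewrite /ray big_split_ord /=; congr (_ + _).
  by apply: eq_bigr => i _; rewrite addnA.
by rewrite /con !ha !hr !addnA; ring.
Qed.

(** [k] fixes the dyadic cell (i, j) and [m] the number 2^m of sample points per side, so that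
    subdivision trades one unit of [m] for one of [k]. *)
Let cell G k i j m := con G (k + m) (i * 2 ^ m) (j * 2 ^ m) (2 ^ m).

Let cell_quarter G k i j m : cell G k i j m.+1 =
  cell G k.+1 i.*2 j.*2 m + cell G k.+1 (i.*2 + 1) j.*2 m +
  cell G k.+1 i.*2 (j.*2 + 1) m + cell G k.+1 (i.*2 + 1) (j.*2 + 1) m.
Proof.
rewrite /cell addSnnS expnS mul2n -addnn con_quarter addnn.
have e1 n : (n * (2 ^ m).*2 = n.*2 * 2 ^ m)%N by rewrite -!muln2 mulnAC mulnA.
by rewrite !mulnDl !mul1n !e1.
Qed.

Let expR_lip (s t : R) : s <= t -> expR t - expR s <= expR t * (t - s).
Proof.
move=> st; have := expR_ge1Dx (s - t).
rewrite -(ler_pM2l (expR_gt0 t)) -expRD subrKC; lra.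
Qed.

(** Lipschitz constant of [pt]: the angular part is 2 pi times the factor 2 of [expi_lip], the
    radial part comes from the derivative of the exponential. *)
Let D := 4 * pi * r0 * expR L + r0 * expR L * L.

Let pt_lip s t s' t' d : 0 <= s <= 1 -> 0 <= s' <= 1 -> `|s - s'| <= d -> `|t - t'| <= d ->
  cnorm (pt s t - pt s' t') <= D * d.
Proof.
move=> /andP[s0 s1] /andP[s'0 s'1] ss tt.
have key (x : R) : 0 <= x <= 1 -> expR (L * x) <= expR L.
  by move=> /andP[x0 x1]; rewrite ler_expR ler_piMr.
have lip (x y : R) : 0 <= x -> x <= y -> y <= 1 -> `|expR (L * y) - expR (L * x)| <= expR L * L * `|y - x|.
  move=> x0 xy y1; have h : L * x <= L * y by rewrite ler_wpM2l.
  rewrite !ger0_norm ?subr_ge0 ?ler_expR//.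
  apply: le_trans (expR_lip h) _; rewrite -mulrBr mulrA ler_wpM2r ?subr_ge0//.
  by rewrite ler_wpM2r// key// y1 (le_trans x0).
have lip2 : `|expR (L * s) - expR (L * s')| <= expR L * L * `|s - s'|.
  have [h|/ltW h] := leP s s'; last exact: lip.
  by rewrite distrC (distrC s) lip.
rewrite /pt (_ : _ - _ = (r0 * expR (L * s))%:C * (expi (2 * pi * t) - expi (2 * pi * t'))
  + (r0 * (expR (L * s) - expR (L * s')))%:C * expi (2 * pi * t')); last first.
  by rewrite !rmorphM rmorphB /=; ring.
apply: le_trans (cnormD _ _) _; rewrite !cnormM !cnormR cnorm_expi mulr1 !normrM.
rewrite (gtr0_norm r0_gt0) (gtr0_norm (expR_gt0 _)) /D [leRHS]mulrDl; apply: lerD.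
  have h1 : cnorm (expi (2 * pi * t) - expi (2 * pi * t')) <= 4 * pi * d.
    apply: le_trans (expi_lip _ _) _; rewrite -mulrBr normrM gtr0_norm ?mulr_gt0 ?pi_gt0//.
    by rewrite mulrA mulrA -natrM ler_wpM2l// mulr_ge0// pi_ge0.
  rewrite (_ : 4 * pi * r0 * expR L * d = r0 * expR L * (4 * pi * d)); last ring.
  apply: ler_pM; rewrite ?mulr_ge0 ?cnorm_ge0 ?expR_ge0 ?(ltW r0_gt0)//.
  by rewrite ler_pM2l// key// s0.
rewrite -!mulrA ler_pM2l// mulrA.
by apply: le_trans lip2 _; rewrite ler_wpM2l// mulr_ge0// expR_ge0.
Qed.

Let E := 4 * pi + expR L * L.

Let om_q_bound N : cnorm (om N - 1) + cnorm (qq N - 1) <= E / 2 ^+ N.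
Proof.
have p : 0 < 2 ^+ N :> R by rewrite exprn_gt0.
rewrite /E mulrDl; apply: lerD.
  rewrite /om -expi0; apply: le_trans (expi_lip _ _) _.
  rewrite subr0 gtr0_norm ?divr_gt0 ?mulr_gt0 ?pi_gt0// mulrA mulrA -natrM//.
have i1 : (2 ^+ N)^-1 <= 1 :> R by rewrite invf_le1// exprn_ege1// ler1n.
have q0 : 0 <= L / 2 ^+ N by rewrite divr_ge0// ltW.
rewrite /qq -(rmorph1 (real_complex R)) -rmorphB cnormR ger0_norm; last first.
  by rewrite subr_ge0 -[leLHS]expR0 ler_expR.
rewrite -[X in _ - X]expR0; apply: le_trans (expR_lip q0) _.
by rewrite subr0 mulrA !ler_wpM2r// ?invr_ge0 ?ler_expR// ?(ltW p)// ler_piMr.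
Qed.

Let con_bound H N u v n B : (forall u' v', (u <= u' <= u + n)%N -> (v <= v' <= v + n)%N ->
    cnorm (H (grid N u' v')) <= B) ->
  cnorm (con H N u v n) <= E / 2 ^+ N * (2 * (n%:R * B)).
Proof.
move=> h.
have ha u' : (u <= u' <= u + n)%N -> cnorm (arc H N u' v n) <= n%:R * B.
  move=> uu; apply: le_trans (cnorm_sum _ _ _) _.
  rewrite -[n in n%:R]card_ord mulr_natl -sumr_const; apply: ler_sum => t _.
  by rewrite h// leq_addr leq_add2l ltnW.
have hr v' : (v <= v' <= v + n)%N -> cnorm (ray H N u v' n) <= n%:R * B.
  move=> uu; apply: le_trans (cnorm_sum _ _ _) _.
  rewrite -[n in n%:R]card_ord mulr_natl -sumr_const; apply: ler_sum => t _.
  by rewrite h// leq_addr leq_add2l ltnW.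
have nB : 0 <= n%:R * B by apply: le_trans (cnorm_ge0 _) (ha u _); rewrite leqnn leq_addr.
apply: le_trans (_ : _ <= (cnorm (om N - 1) + cnorm (qq N - 1)) * (2 * (n%:R * B))) _; last first.
  by rewrite ler_wpM2r ?om_q_bound// mulr_ge0.
rewrite /con [leRHS]mulrDl; apply: le_trans (cnormB _ _) _; rewrite !cnormM.
apply: lerD; apply: ler_wpM2l; rewrite ?cnorm_ge0// [leRHS]mulrDl mul1r.
  by apply: le_trans (cnormB _ _) _; apply: lerD; apply: ha; rewrite ?leqnn ?leq_addr.
by apply: le_trans (cnormB _ _) _; apply: lerD; apply: hr; rewrite ?leqnn ?leq_addr.
Qed.

(** Goursat's bisection. If the sum over the unit cell exceeds e for arbitrarily large m, some
    quarter violates e / 4, and so on down to a point; near it G is affine up to eta |w - z|, and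
    the affine part contributes nothing. *)
Lemma goursat_cell G : (forall w, r0 <= cnorm w <= r0 * expR L -> cdiff G w) ->
  forall e, 0 < e -> \forall m \near \oo, cnorm (cell G 0 0 0 m) <= e.
Proof.
move=> Gd e e0; apply: contrapT => bad0.
pose good k i j := \forall m \near \oo, cnorm (cell G k i j m) <= e / 4 ^+ k.
pose P k i j := [/\ ~ good k i j, (i < 2 ^ k)%N & (j < 2 ^ k)%N].
have [||s [t lim]] := @bisect R P.
- by split=> //; rewrite /good expr0 divr1.
- move=> k i j [nG ik jk]; apply: contrapT => np.
  (* If all four quarters were good, additivity at resolution m + 1 would make the parent good. *)
  have g (x y : bool) : good k.+1 (i.*2 + x)%N (j.*2 + y)%N.
    apply: contrapT => ng; apply: np; exists x, y; split=> //.
      by rewrite expnS mul2n; case: x {ng} => /=; lia.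
    by rewrite expnS mul2n; case: y {ng} => /=; lia.
  have [a _ ha] := g false false; have [b _ hb] := g true false.
  have [c _ hc] := g false true; have [d _ hd] := g true true.
  apply: nG; exists (a + b + c + d).+1%N => // -[//|m] /= m0m; rewrite ltnS in m0m.
  have key (x y : bool) : cnorm (cell G k.+1 (i.*2 + x)%N (j.*2 + y)%N m) <= e / 4 ^+ k.+1.
    by case: x; case: y; [apply: hd|apply: hb|apply: hc|apply: ha] => /=; apply: leq_trans m0m; lia.
  have := key false false; have := key true false; have := key false true; have := key true true.
  rewrite !addn0 cell_quarter exprS => h1 h2 h3 h4.
  apply: le_trans (cnormD _ _) _; apply: le_trans (lerD (cnormD _ _) (lexx _)) _.
  apply: le_trans (lerD (lerD (cnormD _ _) (lexx _)) (lexx _)) _.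
  have -> : e / 4 ^+ k = 4 * (e / (4 * 4 ^+ k)).
    by field; rewrite expf_neq0.
  rewrite /=; lra.
have s01 : 0 <= s <= 1 by have [i [j [[_ + _]]]] := lim 0%N; rewrite expr0 divr1 expn0; case: i => // _; rewrite divr1.
have zr : r0 <= cnorm (pt s t) <= r0 * expR L.
  have /andP[s0 s1] := s01.
  rewrite cnormM cnorm_expi mulr1 cnormR ger0_norm ?mulr_ge0 ?expR_ge0 ?(ltW r0_gt0)//.
  rewrite ler_pMr// ler_pM2l// ler_expR ler_piMr// andbT -expR0 ler_expR mulr_ge0//.
have /cdiffP[l hl] := Gd _ zr.
have D0 : 0 < D.
  by rewrite /D ltr_pwDl ?mulr_gt0 ?mulr_ge0 ?expR_gt0 ?expR_ge0 ?pi_gt0 ?(ltW r0_gt0).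
have E0 : 0 < E.
  by rewrite /E ltr_pwDl ?mulr_gt0 ?mulr_ge0 ?expR_gt0 ?expR_ge0 ?pi_gt0.
(* Chosen so that eta, times the diameter D / 2^k, times the perimeter factor 2 E / 2^k of
   [con_bound], is exactly e / 4^k. *)
pose eta := e / (2 * D * E).
have eta0 : 0 < eta by rewrite divr_gt0// !mulr_gt0.
have [d d0 hd] := hl _ eta0.
have [k hk] : exists k, D / 2 ^+ k < d.
  exists (Num.bound (D / d)); rewrite ltr_pdivrMr ?exprn_gt0//.
  have := archi_boundP (ltW (divr_gt0 D0 d0)); rewrite ltr_pdivrMr// mulrC => h.
  apply: lt_le_trans h _; rewrite ler_wpM2l ?(ltW d0)// -natrX ler_nat.
  by rewrite ltnW// ltn_expl.
have [i [j [[nG ik jk] hi hj]]] := lim k.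
apply: nG; apply: nearW => m; rewrite /cell.
set N := (k + m)%N; set z := pt s t in zr hl hd *.
have -> : con G N (i * 2 ^ m) (j * 2 ^ m) (2 ^ m) =
  con (fun w => G w - (G z - l * z + l * w)) N (i * 2 ^ m) (j * 2 ^ m) (2 ^ m).
  by rewrite -conB con_affine subr0.
apply: le_trans (@con_bound _ _ _ _ _ (eta * (D / 2 ^+ k)) _) _.
  move=> u v hu hv.
  have pk : 0 < 2 ^+ k :> R by rewrite exprn_gt0.
  have pm : 0 < 2 ^+ m :> R by rewrite exprn_gt0.
  have conv n u' (x : R) : n%:R / 2 ^+ k <= x <= n.+1%:R / 2 ^+ k ->
      (n * 2 ^ m <= u' <= n * 2 ^ m + 2 ^ m)%N -> `|u'%:R / 2 ^+ N - x| <= 1 / 2 ^+ k.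
    move=> /andP[x1 x2] /andP[]; rewrite -[(_ + 2 ^ m)%N]mulSnr -!(ler_nat R) !natrM !natrX => u1 u2.
    have e2 : 2 ^+ N = 2 ^+ k * 2 ^+ m :> R by rewrite exprD.
    have y1 : n%:R / 2 ^+ k <= u'%:R / 2 ^+ N :> R.
      by rewrite e2 ler_pdivlMr ?mulr_gt0// mulrA divfK ?gt_eqF.
    have y2 : u'%:R / 2 ^+ N <= n.+1%:R / 2 ^+ k :> R.
      by rewrite e2 ler_pdivrMr ?mulr_gt0// mulrA divfK ?gt_eqF//.
    move: x1 x2 y1 y2; rewrite -[n.+1%:R]natr1 [(_ + _) / _]mulrDl !div1r ler_norml; lra.
  have le : cnorm (grid N u v - z) <= D * (1 / 2 ^+ k).
    apply: (pt_lip _ s01 (conv _ _ _ hi hu) (conv _ _ _ hj hv)).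
    rewrite divr_ge0 ?exprn_ge0//= ler_pdivrMr ?exprn_gt0// mul1r -natrX ler_nat /N expnD.
    have /andP[_ h] := hu; apply: leq_trans h _; rewrite -mulSnr leq_mul2r ik orbT//.
  rewrite mul1r in le; have := hd (grid N u v) (le_lt_trans le hk).
  rewrite (_ : G (grid N u v) - (G z - l * z + l * grid N u v) =
     G (grid N u v) - G z - l * (grid N u v - z)); last ring.
  by move=> h; apply: le_trans h _; rewrite ler_pM2l.
rewrite le_eqVlt; apply/orP; left; apply/eqP; rewrite /N /eta exprD natrX.
have -> : 4 ^+ k = 2 ^+ k * 2 ^+ k :> R by rewrite -exprMn -natrM.
by field; rewrite !expf_neq0 ?gt_eqF.
Unshelve. all: by end_near. Qed.

(** The two rays bounding the slit annulus coincide, since the angles 0 and 2 pi give the same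
    points; only the difference of the two circle sums remains, with a factor ([om m] - 1) 2^m of
    modulus at least 1. *)
Lemma goursat_mean G : (forall w, r0 <= cnorm w <= r0 * expR L -> cdiff G w) ->
  forall e, 0 < e -> \forall N \near \oo, cnorm (Mc N (r0 * expR L) G - Mc N r0 G) <= e.
Proof.
move=> Gd e e0; have := goursat_cell Gd e0.
apply: filter_app; near=> m.
have m0 : (0 < m)%N by near: m; exists 1%N.
rewrite /cell add0n !mul0n /con.
have r1 : ray G m 0 (0 + 2 ^ m) (2 ^ m) = ray G m 0 0 (2 ^ m).
  apply: eq_bigr => t _; congr G; rewrite /grid /pt add0n; congr (_ * _).
  by rewrite natrX divff// mulr1 mul0r mulr0 expi0 expi_2pi.
have a1 : arc G m (0 + 2 ^ m) 0 (2 ^ m) = 2 ^+ m * Mc m (r0 * expR L) G.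
  rewrite /Mc mulrA divff ?expf_neq0 ?pnatr_eq0// mul1r; apply: eq_bigr => t _.
  by rewrite /grid /pt !add0n natrX divff// mulr1.
have a0 : arc G m 0 0 (2 ^ m) = 2 ^+ m * Mc m r0 G.
  rewrite /Mc mulrA divff ?expf_neq0 ?pnatr_eq0// mul1r; apply: eq_bigr => t _.
  by rewrite /grid /pt !add0n mul0r mulr0 expR0 mulr1.
rewrite r1 subrr mulr0 subr0 a1 a0 -mulrBr mulrA cnormM => h.
apply: le_trans h; rewrite ler_peMl ?cnorm_ge0//.
(* Applied with n = 2^(m-1), for which the power of [om m] is -1: hence 2 <= 2^(m-1) |[om m] - 1|, a
   lower bound uniform in m. *)
have pw n x : cnorm x = 1 -> cnorm (x ^+ n - 1) <= n%:R * cnorm (x - 1).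
  move=> x1; elim: n => [|n IH]; first by rewrite expr0 subrr cnorm0 mul0r.
  rewrite exprS (_ : _ - 1 = x * (x ^+ n - 1) + (x - 1)); last ring.
  by apply: le_trans (cnormD _ _) _; rewrite cnormM x1 mul1r -natr1 mulrDl mul1r lerD2r.
have := pw (2 ^ m.-1)%N (om m) (cnorm_expi _).
have -> : om m ^+ (2 ^ m.-1) = -1.
  rewrite expiX natrX -[in X in _ / X](prednK m0) exprS -expi_pi; congr expi.
  by field; rewrite expf_neq0// pnatr_eq0.
rewrite (_ : -1 - 1 = - (2%:R)) ?cnormN ?cnormn; last ring.
rewrite cnormM cnormX (cnormn _ 2) natrX => h2.
have -> : 2 ^+ m = 2 * 2 ^+ m.-1 :> R by rewrite -exprS prednK.
have := cnorm_ge0 (om m - 1); have : 0 < 2 ^+ m.-1 :> R by rewrite exprn_gt0.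
nra.
Unshelve. all: by end_near. Qed.

End Goursat.

(** * Mean value inequality on the unit interval *)

Section MeanValueInequality.
Variable R : realType.
Local Notation C := (complex R).
Local Notation "x %:C" := (real_complex R x).

(** An increment above (M + e) times the length survives in one of the two halves of an interval,
    which contradicts the local bound at the limit point. Only pointwise slopes enter, so indicator
    functions are allowed; [open_closed_all] relies on this. *)
Lemma mean_value_ineq (phi : R -> C) (M : R) :
  (forall t e : R, 0 <= t <= 1 -> 0 < e -> exists2 d : R, 0 < d &
     forall s, 0 <= s <= 1 -> `|s - t| < d -> cnorm (phi s - phi t) <= (M + e) * `|s - t|) ->
  cnorm (phi 1 - phi 0) <= M.
Proof.
move=> h; apply/ler_addgt0Pr => e e0; rewrite leNgt; apply/negP => big.
(* The second index is idle: the planar [bisect] is used for an interval. *)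
pose P (k i j : nat) := (i < 2 ^ k)%N /\
  (M + e) / 2 ^+ k < cnorm (phi (i.+1%:R / 2 ^+ k) - phi (i%:R / 2 ^+ k)).
have p2 k : 0 < 2 ^+ k :> R by rewrite exprn_gt0.
have [||s [s' lim]] := @bisect R P.
- by split; rewrite // expr0 !divr1.
- move=> k i j [ik Pk].
  have e1 : i.+1%:R / 2 ^+ k = (i.*2 + 1).+1%:R / 2 ^+ k.+1 :> R.
    rewrite exprS addn1 -doubleS -muln2 natrM; field.
    by rewrite gt_eqF.
  have e0' : i%:R / 2 ^+ k = (i.*2 + 0)%:R / 2 ^+ k.+1 :> R.
    rewrite exprS addn0 -muln2 natrM; field.
    by rewrite gt_eqF.
  have e2 : (M + e) / 2 ^+ k = (M + e) / 2 ^+ k.+1 + (M + e) / 2 ^+ k.+1.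
    by rewrite exprS; field; rewrite gt_eqF.
  have [h1|h1] := ltP ((M + e) / 2 ^+ k.+1) (cnorm (phi ((i.*2 + 0).+1%:R / 2 ^+ k.+1) - phi ((i.*2 + 0)%:R / 2 ^+ k.+1))).
    by exists false, false; split=> //; rewrite expnS; lia.
  exists true, false; split; first by rewrite expnS /=; lia.
  rewrite ltNge; apply/negP => h2; move: Pk; rewrite ltNge; move/negP; apply.
  rewrite e1 e0' e2; apply: le_trans (cnorm_triangle (phi ((i.*2 + 1)%:R / 2 ^+ k.+1)) _ _) _.
  apply: lerD; first exact: h2.
  by have -> : (i.*2 + 1 = (i.*2 + 0).+1)%N by rewrite addn1 addn0.
have s01 : 0 <= s <= 1.
  by have [i [j [[+ _] + _]]] := lim 0%N; rewrite expr0 !divr1 expn0; case: i.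
have [d d0 hd] := h s (e / 2) s01 ltac:(lra).
have [k hk] : exists k, 1 / 2 ^+ k < d.
  exists (Num.bound (1 / d)); rewrite ltr_pdivrMr//.
  have := archi_boundP (ltW (divr_gt0 ltr01 d0)); rewrite ltr_pdivrMr// mulrC => h1.
  apply: lt_le_trans h1 _; rewrite ler_wpM2l ?(ltW d0)// -natrX ler_nat.
  by rewrite ltnW// ltn_expl.
have [i [j [[ik Pk] /andP[s1 s2] _]]] := lim k.
have e1 : i.+1%:R / 2 ^+ k = i%:R / 2 ^+ k + 1 / 2 ^+ k :> R by rewrite -[i.+1%:R]natr1 mulrDl.
have q0 : 0 <= i%:R / 2 ^+ k :> R by rewrite divr_ge0// ltW.
have q1 : i.+1%:R / 2 ^+ k <= 1 :> R by rewrite ler_pdivrMr// mul1r -natrX ler_nat.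
move: Pk; rewrite ltNge => /negP; apply.
set x := i.+1%:R / 2 ^+ k in e1 q1 s2 *; set y := i%:R / 2 ^+ k in e1 q0 s1 *.
set t := 1 / 2 ^+ k in e1 hk.
have t0 : 0 <= t by rewrite divr_ge0// ltW.
have h1 : cnorm (phi x - phi s) <= (M + e / 2) * (x - s).
  by have := hd x; rewrite ger0_norm ?subr_ge0//; apply; lra.
have h2 : cnorm (phi s - phi y) <= (M + e / 2) * (s - y).
  by rewrite cnormBC; have := hd y; rewrite distrC ger0_norm ?subr_ge0//; apply; lra.
apply: le_trans (cnorm_triangle (phi s) _ _) _.
have -> : (M + e) / 2 ^+ k = (M + e) * t by rewrite /t div1r.
nra.
Qed.

End MeanValueInequality.

(** * Mean value property, Cauchy estimate, holomorphy of derivatives and divided differences *)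

Section Holomorphic.
Variable R : realType.
Local Notation C := (complex R).
Local Notation "x %:C" := (real_complex R x).
Implicit Types (z w a b c l m : C) (r e d s B : R) (G H E : C -> C).

Definition hol a r G := forall w, cnorm (w - a) < r -> cdiff G w.

Lemma hol_shift a r G : hol a r G -> hol 0 r (fun w => G (a + w)).
Proof.
move=> h w; rewrite subr0 => wr.
apply: (cdiff_eq (f := fun v => G (v + a))); first by apply: nearW => v; rewrite addrC.
by apply: cdiff_add; apply: h; rewrite addrK.
Qed.

Lemma hol_sub a b r s G : hol a r G -> cnorm (b - a) + s <= r -> hol b s G.
Proof.
move=> h bs w ws; apply: h; apply: le_lt_trans (cnorm_triangle b _ _) _; lra.
Qed.

Lemma segment_bound G (D : C -> C) z h M :
  (forall t : R, 0 <= t <= 1 -> cder G (z + t%:C * h) (D (z + t%:C * h))) ->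
  (forall t : R, 0 <= t <= 1 -> cnorm (D (z + t%:C * h)) <= M) ->
  cnorm (G (z + h) - G z) <= M * cnorm h.
Proof.
move=> hD hM.
have h1 : 0 < cnorm h + 1 by rewrite ltr_wpDl// cnorm_ge0.
have := @mean_value_ineq R (fun t => G (z + t%:C * h)) (M * cnorm h).
rewrite /= !rmorph1 mul1r rmorph0 mul0r addr0; apply => t e t01 e0.
have [d d0 hd] := hD t t01 _ (divr_gt0 e0 h1).
exists (d / (cnorm h + 1)); first exact: divr_gt0.
move=> s s01; rewrite ltr_pdivlMr// => sd.
have es : (z + s%:C * h) - (z + t%:C * h) = (s - t)%:C * h by rewrite rmorphB /=; ring.
have := hd (z + s%:C * h); rewrite es cnormM cnormR => h2.
have st := normr_ge0 (s - t); have hh := cnorm_ge0 h.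
rewrite -(subrK (D (z + t%:C * h) * ((s - t)%:C * h)) (_ - _)).
apply: le_trans (cnormD _ _) _.
apply: le_trans (lerD (h2 _) (lexx _)) _; first by nra.
rewrite cnormM cnormM cnormR addrC mulrDl; apply: lerD.
  by rewrite -mulrA [cnorm h * _]mulrC ler_wpM2r ?mulr_ge0 ?hM.
rewrite mulrCA [leRHS]mulrC ler_wpM2l// mulrAC ler_pdivrMr// ler_wpM2l ?(ltW e0)//; lra.
Qed.

Lemma goursat_annulus (a b : R) G : 0 < a -> a <= b ->
  (forall w, a <= cnorm w <= b -> cdiff G w) ->
  forall e, 0 < e -> \forall N \near \oo, cnorm (Mc N b G - Mc N a G) <= e.
Proof.
move=> a0 ab Gd e e0; have b0 : 0 < b by exact: lt_le_trans ab.
have L0 : 0 <= ln (b / a) by apply: ln_ge0; rewrite ler_pdivlMr// mul1r.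
have eb : a * expR (ln (b / a)) = b.
  by rewrite lnK ?posrE ?divr_gt0// mulrC divfK// gt_eqF.
by have := @goursat_mean R a _ a0 L0 G; rewrite eb; apply.
Qed.

Lemma Mc_sub N r G b B : (forall w, cnorm w = `|r| -> cnorm (G w - b) <= B) ->
  cnorm (Mc N r G - b) <= B.
Proof.
move=> h; rewrite -(Mc_cst N r b).
have -> : Mc N r G - Mc N r (fun=> b) = Mc N r (fun w => G w - b).
  rewrite -[RHS](_ : 1 * Mc N r G + (-1) * Mc N r (fun=> b) = _); first ring.
  by rewrite -Mc_lin; apply: eq_Mc => w _; ring.
exact: cnorm_Mc.
Qed.

Lemma McD N r G H : Mc N r (fun w => G w + H w) = Mc N r G + Mc N r H.
Proof.
rewrite -[RHS](_ : 1 * Mc N r G + 1 * Mc N r H = _); last ring.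
by rewrite -Mc_lin; apply: eq_Mc => w _; ring.
Qed.

Lemma McZ N r a G : Mc N r (fun w => a * G w) = a * Mc N r G.
Proof.
rewrite -[RHS](_ : a * Mc N r G + 0 * Mc N r G = _); last ring.
by rewrite -Mc_lin; apply: eq_Mc => w _; ring.
Qed.

(** The mean over |w| = r agrees in the limit with the mean over a circle so small that G is nearly
    constant on it. *)
Lemma mvp r s G : hol 0 s G -> 0 < r < s ->
  forall e, 0 < e -> \forall N \near \oo, cnorm (Mc N r G - G 0) <= e.
Proof.
move=> hG /andP[r0 rs] e e0.
have e2 : 0 < e / 2 by lra.
have G0 : cdiff G 0 by apply: hG; rewrite subrr cnorm0 (lt_trans r0).
have [d d0 hd] := cdiff_ccont G0 e2.
pose a := Num.min r (d / 2).
have a0 : 0 < a by rewrite lt_min r0 divr_gt0.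
have ad : a < d by rewrite gt_min; apply/orP; right; lra.
have ar : a <= r by rewrite ge_min lexx.
have : forall w, a <= cnorm w <= r -> cdiff G w.
  by move=> w /andP[_ wr]; apply: hG; rewrite subr0 (le_lt_trans wr).
move/(goursat_annulus a0 ar)/(_ _ e2); apply: filterS => N hN.
apply: le_trans (cnorm_triangle (Mc N a G) _ _) _.
rewrite [leRHS](_ : _ = e / 2 + e / 2); last lra.
apply: lerD => //; apply: Mc_sub => w wa; apply/ltW/hd.
by rewrite subr0 wa gtr0_norm.
Qed.

Lemma Mc_conj N r G : Mc N r (fun w => conjc (G w)) = conjc (Mc N r G).
Proof. by rewrite /Mc rmorphM rmorph_sum fmorphV rmorphXn rmorph_nat. Qed.

Lemma inv_circle r w : cnorm w = r -> w^-1 = conjc w / (r ^+ 2)%:C.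
Proof.
move=> <-; have [->|w0] := eqVneq w 0; first by rewrite invr0 conjc0 mul0r.
have n0 : (cnorm w ^+ 2)%:C != 0 :> C.
  by rewrite -cnorm_eq0 cnormR normr_eq0 expf_neq0// cnorm_eq0.
by apply: (mulfI w0); rewrite mulfV// mulrA mul_conjc divff.
Qed.

(** On |w| = r the inverse of w is conj w / r^2, so the mean value property of the identity
    applies. *)
Lemma Mc_inv r : 0 < r -> forall e, 0 < e -> \forall N \near \oo, cnorm (Mc N r (fun w => w^-1)) <= e.
Proof.
move=> r0 e e0; have r2 : 0 < r ^+ 2 by rewrite exprn_gt0.
have hid : hol 0 (r + 1) id by move=> w _; exact: cdiff_id.
have : 0 < r < r + 1 by lra.
move/(mvp hid)/(_ _ (mulr_gt0 e0 r2)); apply: filterS => N; rewrite subr0 => hN.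
rewrite (@eq_Mc _ _ _ _ (fun w => (r ^+ 2)%:C^-1 * conjc w)); last first.
  by move=> w; rewrite gtr0_norm// => /inv_circle ->; rewrite mulrC.
rewrite McZ (Mc_conj N r id) cnormM cnormV cnormR cnorm_conj gtr0_norm// mulrC.
by rewrite ler_pdivrMr.
Qed.

(** Cauchy's formula for the derivative: on a small circle G(z + w) / w is G(z) / w plus nearly l,
    and the first term has vanishing mean. *)
Lemma derivative_mean z r s G l : hol z s G -> 0 < r < s -> cder G z l ->
  forall e, 0 < e -> \forall N \near \oo, cnorm (Mc N r (fun w => G (z + w) / w) - l) <= e.
Proof.
move=> hG /andP[r0 rs] dG e e0.
have e3 : 0 < e / 3 by lra.
have [d d0 hd] := dG _ e3.
pose a := Num.min r (d / 2).
have a0 : 0 < a by rewrite lt_min r0 divr_gt0.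
have ad : a < d by rewrite gt_min; apply/orP; right; lra.
have ar : a <= r by rewrite ge_min lexx.
have hH w : a <= cnorm w <= r -> cdiff (fun w => G (z + w) / w) w.
  move=> /andP[aw wr]; have w0 : w != 0 by rewrite -cnorm_gt0 (lt_le_trans a0).
  apply: cdiffM; last by apply: cdiffV => //; exact: cdiff_id.
  by apply: (hol_shift hG); rewrite subr0 (le_lt_trans wr).
have B0 : 0 < cnorm (G z) + 1 by rewrite ltr_wpDl// cnorm_ge0.
have h1 := goursat_annulus a0 ar hH e3.
have h2 := Mc_inv a0 (divr_gt0 e3 B0).
apply: filterS2 h1 h2 => N hN1 hN2.
apply: le_trans (cnorm_triangle (Mc N a (fun w => G (z + w) / w)) _ _) _.
rewrite [leRHS](_ : _ = e / 3 + (e / 3 + e / 3)); last lra.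
apply: lerD => //.
have -> : Mc N a (fun w => G (z + w) / w) =
   Mc N a (fun w => (G (z + w) - G z) / w) + G z * Mc N a (fun w => w^-1).
  by rewrite -McZ -McD; apply: eq_Mc => w _; ring.
rewrite addrAC; apply: le_trans (cnormD _ _) _; apply: lerD.
  apply: Mc_sub => w wa; have w0 : w != 0 by rewrite -cnorm_gt0 wa gtr0_norm.
  have := hd (z + w); rewrite addrC addKr wa gtr0_norm// => /(_ ad) h.
  rewrite (_ : _ - l = (G (z + w) - G z - l * w) / w); last by field.
  by rewrite cnormf wa gtr0_norm// ler_pdivrMr.
rewrite cnormM; apply: le_trans (ler_pM (cnorm_ge0 _) (cnorm_ge0 _) (_ : _ <= cnorm (G z) + 1) hN2) _.
  by rewrite lerDl.
by rewrite mulrC divfK// gt_eqF.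
Qed.

Lemma cauchy_estimate z r s G l B : hol z s G -> 0 < r < s -> cder G z l ->
  (forall w, cnorm (w - z) = r -> cnorm (G w) <= B) -> cnorm l <= B / r.
Proof.
move=> hG rs dG hB; have /andP[r0 _] := rs; apply/ler_addgt0Pr => e e0.
have [N hN] := filter_ex (derivative_mean hG rs dG e0).
rewrite -(subrK (Mc N r (fun w => G (z + w) / w)) l) addrC.
apply: le_trans (cnormD _ _) _; rewrite cnormBC lerD//.
apply: cnorm_Mc => w; rewrite gtr0_norm// => wr.
by rewrite cnormf wr ler_pM2r ?invr_gt0// hB// addrC addKr.
Qed.

(** The default 0 is taken where G is not differentiable. *)
Definition cD G z := xget 0 [set l | cder G z l].

Lemma cDP G z : cdiff G z -> cder G z (cD G z).
Proof. by move=> /cdiffP[l h]; rewrite /cD; apply: xgetPex; exists l. Qed.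

Lemma cDE G z l : cder G z l -> cD G z = l.
Proof.
by move=> h; apply: (cder_unique _ h); apply: cDP; apply/cdiffP; exists l.
Qed.

(** Completeness of the plane, through suprema for the real and the imaginary part; the 2 comes from
    adding the two coordinates. *)
Lemma cauchy_limit (q : C -> C) d K : 0 < d -> 0 <= K ->
  (forall h k, h != 0 -> k != 0 -> cnorm h < d -> cnorm k < d ->
     cnorm (q h - q k) <= K * (cnorm h + cnorm k)) ->
  exists m, forall h, h != 0 -> cnorm h < d -> cnorm (q h - m) <= 2 * K * cnorm h.
Proof.
move=> d0 K0 hq.
have key (p : C -> R) : (forall h k, `|p h - p k| <= cnorm (q h - q k)) ->
    exists m : R, forall h, h != 0 -> cnorm h < d -> `|p h - m| <= K * cnorm h.
  move=> hp; pose A := [set x : R | exists h, [/\ h != 0, cnorm h < d & x = p h - K * cnorm h]].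
  have ub k : k != 0 -> cnorm k < d -> forall x, A x -> x <= p k + K * cnorm k.
    move=> k0 kd x [h [h0 hd ->]].
    by have := le_trans (hp h k) (hq h k h0 k0 hd kd); rewrite ler_norml; nra.
  exists (sup A) => h h0 hd; rewrite ler_norml; apply/andP; split.
    suff : sup A <= p h + K * cnorm h by lra.
    apply: ge_sup; last exact: ub.
    by exists (p h - K * cnorm h), h.
  suff : p h - K * cnorm h <= sup A by lra.
  apply: ub_le_sup; last by exists h.
  by exists (p h + K * cnorm h) => x; exact: ub.
have [m1 h1] : exists m : R, forall h, h != 0 -> cnorm h < d -> `|complex.Re (q h) - m| <= K * cnorm h.
  by apply: key => h k; rewrite -raddfB; exact: Re_cnorm.
have [m2 h2] : exists m : R, forall h, h != 0 -> cnorm h < d -> `|complex.Im (q h) - m| <= K * cnorm h.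
  by apply: key => h k; rewrite -raddfB; exact: Im_cnorm.
exists (Complex m1 m2) => h h0 hd.
apply: le_trans (cnorm_ReIm _) _; have := h1 h h0 hd; have := h2 h h0 hd.
by case: (q h) => x y /=; lra.
Qed.

(** * Second derivative at the centre of a disc *)

Section SecondDerivative.
Variables (a : C) (s B : R) (G : C -> C).
Hypotheses (s0 : 0 < s) (hG : hol a s G) (GB : forall w, cnorm (w - a) < s -> cnorm (G w) <= B).

Let D := cD G.
Let DP z : cnorm (z - a) < s -> cder G z (D z).
Proof. by move=> zs; apply: cDP; exact: hG. Qed.

(** [B1], [B2] and [B3] are Cauchy bounds for the first, second and third derivatives, obtained from
    [cauchy_estimate] for G, for its increments and for differences of its difference quotients, on
    discs that shrink each time. *)
Let B1 := B / (s / 4).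
Let D_bound z : cnorm (z - a) < s / 2 -> cnorm (D z) <= B1.
Proof.
have s_gt0 := s0.
move=> zs; apply: (@cauchy_estimate z (s / 4) (s / 2) G); last 2 first.
- by apply: DP; lra.
- move=> w wz; apply: GB; apply: le_lt_trans (cnorm_triangle z _ _) _; lra.
- by apply: hol_sub hG _; lra.
- lra.
Qed.

Let B0 : 0 <= B. Proof. by apply: le_trans (cnorm_ge0 _) (GB (w := a) _); rewrite subrr cnorm0. Qed.
Let B1_ge0 : 0 <= B1. Proof. by rewrite /B1 divr_ge0// divr_ge0// ltW. Qed.

Let seg z h (t e : R) : cnorm (z - a) < e -> cnorm (z + h - a) < e -> 0 <= t <= 1 ->
  cnorm (z + t%:C * h - a) < e.
Proof.
move=> h1 h2 /andP[t0 t1].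
rewrite (_ : z + t%:C * h - a = (1 - t)%:C * (z - a) + t%:C * (z + h - a)); last first.
  by rewrite rmorphB rmorph1; ring.
apply: le_lt_trans (cnormD _ _) _; rewrite !cnormM !cnormR !ger0_norm ?subr_ge0//.
have := cnorm_ge0 (z - a); have := cnorm_ge0 (z + h - a).
move: t0; rewrite le_eqVlt => /orP[/eqP <-|t0]; nra.
Qed.

Let G_lip z h : cnorm (z - a) < s / 2 -> cnorm (z + h - a) < s / 2 ->
  cnorm (G (z + h) - G z) <= B1 * cnorm h.
Proof.
have s_gt0 := s0.
move=> h1 h2; apply: (segment_bound (D := D)) => t t01.
  by apply: DP; have := seg h1 h2 t01; lra.
by apply: D_bound; exact: seg.
Qed.

Let B2 := B1 / (s / 8).
Let B2_ge0 : 0 <= B2. Proof. by rewrite /B2 divr_ge0// divr_ge0// ltW. Qed.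

Let D_lip z h : cnorm (z - a) < s / 8 -> cnorm (z + h - a) < s / 8 ->
  cnorm (D (z + h) - D z) <= B2 * cnorm h.
Proof.
have s_gt0 := s0.
move=> h1 h2; have hh : cnorm h < s / 4.
  rewrite (_ : h = (z + h - a) - (z - a)); last ring.
  by apply: le_lt_trans (cnormB _ _) _; lra.
rewrite /B2 mulrAC; apply: (@cauchy_estimate z (s / 8) (s / 7) (fun w => G (w + h) - G w)).
- move=> w wz; have h3 := cnorm_triangle z w a.
  apply: cdiffB; last by apply: hG; lra.
  apply: cdiff_add; apply: hG.
  rewrite (_ : w + h - a = (w - z) + (z + h - a)); last ring.
  by apply: le_lt_trans (cnormD _ _) _; lra.
- lra.
- by apply: cderB; [apply: cder_add; apply: DP; lra|apply: DP; lra].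
- move=> w wz; have h3 := cnorm_triangle z w a.
  apply: G_lip; first lra.
  rewrite (_ : w + h - a = (w - z) + (z + h - a)); last ring.
  by apply: le_lt_trans (cnormD _ _) _; lra.
Qed.

Let G_taylor1 z h : cnorm (z - a) < s / 8 -> cnorm (z + h - a) < s / 8 ->
  cnorm (G (z + h) - G z - D z * h) <= B2 * cnorm h ^+ 2.
Proof.
have s_gt0 := s0.
move=> h1 h2; have := @segment_bound (fun w => G w - D z * w) (fun w => D w - D z) z h (B2 * cnorm h).
rewrite (_ : _ - _ - _ = G (z + h) - G z - D z * h); last ring.
rewrite -(mulrA B2) -expr2; apply => t t01.
  apply: cderB; first by apply: DP; have := seg h1 h2 t01; lra.
  by have := cderM (cder_cst (D z) (z + t%:C * h)) (cder_id _); rewrite mul0r add0r mulr1.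
have h3 := seg h1 h2 t01.
apply: le_trans (D_lip h1 h3) _; rewrite ler_wpM2l// cnormM cnormR ger0_norm; last by case/andP: t01.
by rewrite ler_piMl ?cnorm_ge0//; case/andP: t01.
Qed.

Let B3 := B2 / (s / 32).
Let B3_ge0 : 0 <= B3. Proof. by rewrite /B3 divr_ge0// divr_ge0// ltW. Qed.

(** Two difference quotients of G differ by at most B2 (|h| + |k|); [cauchy_estimate] at [a] turns
    this into a bound of the same kind for those of D, which therefore form a Cauchy family. *)
Lemma second_derivative : exists m, forall h, h != 0 -> cnorm h < s / 16 ->
  cnorm ((D (a + h) - D a) / h - m) <= 2 * B3 * cnorm h.
Proof.
have s_gt0 := s0.
apply: (cauchy_limit (q := fun h => (D (a + h) - D a) / h)) => //; first lra.
move=> h k h0 k0 hs ks.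
rewrite /B3 mulrAC.
have aux (w e' : C) : cnorm (w - a) < s / 16 -> cnorm e' < s / 16 -> cnorm (w + e' - a) < s / 8.
  move=> w1 w2; rewrite (_ : w + e' - a = (w - a) + e'); last ring.
  by apply: le_lt_trans (cnormD _ _) _; lra.
apply: (@cauchy_estimate a (s / 32) (s / 16) (fun w => (G (w + h) - G w) / h - (G (w + k) - G w) / k)).
- move=> w wa; have h1 := aux w h wa hs; have h2 := aux w k wa ks.
  by apply: cdiffB; (apply: cdiffM; last exact: cdiff_cst); (apply: cdiffB; last by apply: hG; lra);
    apply: cdiff_add; apply: hG; lra.
- lra.
- have d x : x != 0 -> cnorm x < s / 16 -> cder (fun w => (G (w + x) - G w) / x) a ((D (a + x) - D a) / x).
    move=> x0 xs; have aa : cnorm (a - a) < s / 16 by rewrite subrr cnorm0; lra.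
    have h1 := aux a x aa xs.
    have h2 : cder (fun w => G (w + x) - G w) a (D (a + x) - D a).
      by apply: cderB; [apply: cder_add; apply: DP; lra|apply: DP; lra].
    by have := cderM h2 (cder_cst x^-1 a); rewrite mulr0 addr0.
  by apply: cderB; exact: d.
- move=> w wa.
  have key x : x != 0 -> cnorm x < s / 16 -> cnorm ((G (w + x) - G w) / x - D w) <= B2 * cnorm x.
    move=> x0 xs; rewrite (_ : _ - D w = (G (w + x) - G w - D w * x) / x); last by field.
    rewrite cnormf ler_pdivrMr ?cnorm_gt0// -mulrA -expr2; apply: G_taylor1; first lra.
    by apply: aux; lra.
  rewrite (_ : _ - _ = ((G (w + h) - G w) / h - D w) - ((G (w + k) - G w) / k - D w)); last ring.
  by apply: le_trans (cnormB _ _) _; rewrite mulrDr lerD// key.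
Qed.

Lemma cD_cdiff_center : cdiff D a.
Proof.
have s_gt0 := s0.
have [m hm] := second_derivative; apply/cdiffP; exists m => e e0.
have K0 : 0 < 2 * B3 + 1 by rewrite ltr_wpDl// mulr_ge0.
near=> w; have [->|wa] := eqVneq w a; first by rewrite !subrr mulr0 subr0 cnorm0 mulr0.
have h0 : w - a != 0 by rewrite subr_eq0.
have w1 : cnorm (w - a) < s / 16 by near: w; apply: nb_ball; lra.
have w2 : cnorm (w - a) < e / (2 * B3 + 1) by near: w; apply: nb_ball; rewrite divr_gt0.
have := hm _ h0 w1; rewrite subrKC => h1.
rewrite (_ : _ - _ = ((D w - D a) / (w - a) - m) * (w - a)); last by field.
rewrite cnormM ler_wpM2r ?cnorm_ge0//; apply: le_trans h1 _.
move: w2; rewrite ltr_pdivlMr//; have := cnorm_ge0 (w - a); nra.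
Unshelve. all: by end_near. Qed.

(** Removable singularity of the divided difference: G minus its second-order Taylor polynomial has
    derivative O(|v - a|^2) on the segment, so its increment is O(|w - a|^3), and dividing by w - a
    leaves a quantity small compared with |w - a|. *)
Lemma quotient_cdiff_center :
  cdiff (fun w => if w == a then D a else (G w - G a) / (w - a)) a.
Proof.
have s_gt0 := s0.
have [m hm] := second_derivative; apply/cdiffP; exists (m / 2) => e e0.
have K0 : 0 < 2 * B3 + 1 by rewrite ltr_wpDl// mulr_ge0.
near=> w; rewrite eqxx.
have [->|wa] := eqVneq w a; first by rewrite !subrr mulr0 subr0 cnorm0 mulr0.
have h0 : w - a != 0 by rewrite subr_eq0.
have w1 : cnorm (w - a) < s / 16 by near: w; apply: nb_ball; lra.
have w2 : cnorm (w - a) < e / (2 * B3 + 1) by near: w; apply: nb_ball; rewrite divr_gt0.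
have := @segment_bound (fun v => G v - D a * v - m / 2 * (v - a) ^+ 2)
   (fun v => D v - D a - m * (v - a)) a (w - a) (2 * B3 * cnorm (w - a) ^+ 2).
rewrite subrKC => key.
rewrite (_ : _ - _ = ((G w - D a * w - m / 2 * (w - a) ^+ 2) - (G a - D a * a - m / 2 * (a - a) ^+ 2))/ (w - a)); last by field.
rewrite cnormf ler_pdivrMr ?cnorm_gt0//; apply: le_trans (key _ _) _.
- move=> t /andP[t0 t1].
  have tw : cnorm (a + t%:C * (w - a) - a) < s.
    rewrite addrC addKr cnormM cnormR ger0_norm//; apply: le_lt_trans (_ : cnorm (w - a) < s); last lra.
    by rewrite ler_piMl// cnorm_ge0.
  set v := a + _.
  apply: cderB; first apply: cderB; first exact: DP.
    by have := cderM (cder_cst (D a) v) (cder_id _); rewrite mul0r add0r mulr1.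
  have h1 : cder (fun v => v - a) v 1 by have := cderB (cder_id v) (cder_cst a v); rewrite subr0.
  have := cderM (cder_cst (m / 2) v) (cderM h1 h1); rewrite mul0r add0r mul1r mulr1.
  by rewrite (_ : m / 2 * _ = m * (v - a))//; field.
- move=> t /andP[t0 t1]; set v := a + _.
  have [->|va] := eqVneq v a.
    by rewrite !subrr mulr0 subr0 cnorm0 mulr_ge0 ?sqr_ge0// mulr_ge0.
  have va0 : v - a != 0 by rewrite subr_eq0.
  have vw : cnorm (v - a) <= cnorm (w - a).
    by rewrite /v addrC addKr cnormM cnormR ger0_norm// ler_piMl// cnorm_ge0.
  have := hm _ va0 (le_lt_trans vw w1); rewrite subrKC => h1.
  rewrite (_ : _ - _ = ((D v - D a) / (v - a) - m) * (v - a)); last by field.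
  rewrite cnormM; apply: le_trans (ler_pM (cnorm_ge0 _) (cnorm_ge0 _) h1 vw) _.
  rewrite [leRHS](_ : _ = 2 * B3 * cnorm (w - a) * cnorm (w - a)); last ring.
  by rewrite ler_wpM2r ?cnorm_ge0// ler_wpM2l// mulr_ge0.
- move: w2; rewrite ltr_pdivlMr// => w2; have c0 := cnorm_ge0 (w - a).
  have h1 : 2 * B3 * cnorm (w - a) <= e by nra.
  rewrite [leLHS](_ : _ = (2 * B3 * cnorm (w - a)) * (cnorm (w - a) * cnorm (w - a))); last ring.
  by rewrite -[leRHS]mulrA ler_wpM2r ?mulr_ge0.
Unshelve. all: by end_near. Qed.

End SecondDerivative.

Lemma near_cdiff_bounded a G : (\forall w \near nb a, cdiff G w) ->
  exists s B, [/\ 0 < s, hol a s G & forall w, cnorm (w - a) < s -> cnorm (G w) <= B].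
Proof.
move=> hG; have Ga := nb_self hG.
have := filterI hG (ccont_bounded (cdiff_ccont Ga)).
by move=> [d d0 hd]; exists d, (cnorm (G a) + 1); split=> // w wd; have [] := hd w wd.
Qed.

Lemma cD_cdiff a G : (\forall w \near nb a, cdiff G w) -> cdiff (cD G) a.
Proof. by move=> /near_cdiff_bounded[s [B [s0 h1 h2]]]; exact: cD_cdiff_center h1 h2. Qed.

Lemma hol_cD a r G : hol a r G -> hol a r (cD G).
Proof.
move=> hG w wr; apply: cD_cdiff.
have := nb_ball w (_ : 0 < r - cnorm (w - a)); rewrite subr_gt0 => /(_ wr); apply: filterS => v vw.
by apply: hG; apply: le_lt_trans (cnorm_triangle w _ _) _; lra.
Qed.

Lemma hol_near a r G w : hol a r G -> cnorm (w - a) < r -> \forall v \near nb w, cdiff G v.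
Proof.
move=> hG wr; have := nb_ball w (_ : 0 < r - cnorm (w - a)); rewrite subr_gt0 => /(_ wr).
apply: filterS => v vw; apply: hG; apply: le_lt_trans (cnorm_triangle w _ _) _; lra.
Qed.

(** Divided difference completed by the derivative. It is holomorphic where G is ([cdiff_cquo]), and
    serves to split off zeros and to generate Taylor coefficients. *)
Definition cquo G a w := if w == a then cD G a else (G w - G a) / (w - a).

Lemma cquoE G a w : G w = G a + (w - a) * cquo G a w.
Proof.
rewrite /cquo; have [->|wa] := eqVneq w a; first by rewrite subrr mul0r addr0.
by field; rewrite subr_eq0.
Qed.

Lemma cdiff_cquo G a w : (\forall v \near nb w, cdiff G v) -> cdiff (cquo G a) w.
Proof.
move=> hw; have [wa|wa] := eqVneq w a.
  move: hw; rewrite wa => /near_cdiff_bounded[s [B [s0 h1 h2]]].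
  exact: quotient_cdiff_center h1 h2.
apply: (cdiff_eq (f := fun v => (G v - G a) / (v - a))).
  exists (cnorm (w - a)); first by rewrite cnorm_gt0 subr_eq0.
  move=> v vw; rewrite /cquo ifN//; apply: contraTneq vw => ->.
  by rewrite cnormBC ltxx.
apply: cdiffM; first by apply: cdiffB; [exact: nb_self hw|exact: cdiff_cst].
apply: cdiffV; first by rewrite subr_eq0.
by apply: cdiffB; [exact: cdiff_id|exact: cdiff_cst].
Qed.

Lemma hol_cquo b r G a : hol b r G -> hol b r (cquo G a).
Proof. by move=> hG w wr; apply: cdiff_cquo; exact: hol_near hG wr. Qed.

End Holomorphic.

(** * Compactness of closed discs *)

Section Compactness.
Variable R : realType.
Local Notation C := (complex R).
Local Notation "x %:C" := (real_complex R x).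

Lemma dyadic_small (a e : R) : 0 < a -> 0 < e -> exists k, a / 2 ^+ k < e.
Proof.
move=> a0 e0; exists (Num.bound (a / e)); rewrite ltr_pdivrMr ?exprn_gt0//.
have := archi_boundP (ltW (divr_gt0 a0 e0)); rewrite ltr_pdivrMr// => h1.
apply: lt_le_trans h1 _; rewrite mulrC ler_wpM2l ?(ltW e0)// -natrX ler_nat.
by rewrite ltnW// ltn_expl.
Qed.

(** Heine-Borel as an induction principle: boundedness, finiteness and uniform continuity are all
    properties of sets that pass to subsets and finite unions, so no covering has to be made
    explicit. *)
Lemma disc_compact (P : set C -> Prop) (r : R) : 0 < r ->
  (forall A B, A `<=` B -> P B -> P A) ->
  (forall A B, P A -> P B -> P (A `|` B)) ->
  (forall z, cnorm z <= r -> exists2 U, nb z U & P U) ->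
  P [set z | cnorm z <= r].
Proof.
move=> r0 mono union loc.
pose cell (k i j : nat) := [set z : C | [/\ cnorm z <= r,
  - r + 2 * r * (i%:R / 2 ^+ k) <= complex.Re z <= - r + 2 * r * (i.+1%:R / 2 ^+ k) &
  - r + 2 * r * (j%:R / 2 ^+ k) <= complex.Im z <= - r + 2 * r * (j.+1%:R / 2 ^+ k)]].
apply: contrapT => nP.
have p2 k : 0 < 2 ^+ k :> R by rewrite exprn_gt0.
have [||s [t lim]] := @bisect R (fun k i j => ~ P (cell k i j)).
- apply: contra_not nP; apply: mono => z /= zr; split=> //.
    have := Re_cnorm z; rewrite ler_norml expr0 !divr1 => /andP[h1 h2]; apply/andP; split; lra.
  have := Im_cnorm z; rewrite ler_norml expr0 !divr1 => /andP[h1 h2]; apply/andP; split; lra.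
- move=> k i j nPc; apply: contrapT => nq; apply: nPc.
  have q (x y : bool) : P (cell k.+1 (i.*2 + x)%N (j.*2 + y)%N).
    by apply: contrapT => h; apply: nq; exists x, y.
  have := union _ _ (union _ _ (q false false) (q true false)) (union _ _ (q false true) (q true true)).
  apply: mono => z [zr].
  have dy n : [/\ n%:R / 2 ^+ k = (n.*2 + false)%:R / 2 ^+ k.+1 :> R,
      (n.*2 + false).+1%:R / 2 ^+ k.+1 = (n.*2 + true)%:R / 2 ^+ k.+1 :> R &
      n.+1%:R / 2 ^+ k = (n.*2 + true).+1%:R / 2 ^+ k.+1 :> R].
    split; rewrite ?addn0 ?addn1// exprS.
      by rewrite -muln2 natrM; field; rewrite gt_eqF.
    by rewrite -doubleS -muln2 natrM; field; rewrite gt_eqF.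
  have [-> mi ->] := dy i; have [-> mj ->] := dy j.
  have [h1|/ltW h1] := leP (complex.Re z) (- r + 2 * r * ((i.*2 + true)%:R / 2 ^+ k.+1));
  have [h2|/ltW h2] := leP (complex.Im z) (- r + 2 * r * ((j.*2 + true)%:R / 2 ^+ k.+1));
    move=> /andP[a1 a2] /andP[b1 b2].
  + by left; left; split=> //; rewrite ?mi ?mj ?a1 ?h1 ?b1 ?h2.
  + by right; left; split=> //; rewrite ?mi ?mj ?a1 ?h1 ?b2 ?h2.
  + by left; right; split=> //; rewrite ?mi ?mj ?a2 ?h1 ?b1 ?h2.
  + by right; right; split=> //; rewrite ?mi ?mj ?a2 ?h1 ?b2 ?h2.
pose z0 : C := Complex (- r + 2 * r * s) (- r + 2 * r * t).
have small e : 0 < e -> exists k i j, ~ P (cell k i j) /\ cell k i j `<=` [set z | cnorm (z - z0) < e].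
  move=> e0; have r4 : 0 < 4 * r by rewrite mulr_gt0.
  have [k hk] := dyadic_small r4 e0.
  have [i [j [nPc hi hj]]] := lim k; exists k, i, j; split=> // z [zr hx hy] /=.
  apply: le_lt_trans (cnorm_ReIm _) _; rewrite !raddfB /=.
  have conv n (x y : R) : n%:R / 2 ^+ k <= x <= n.+1%:R / 2 ^+ k ->
      - r + 2 * r * (n%:R / 2 ^+ k) <= y <= - r + 2 * r * (n.+1%:R / 2 ^+ k) ->
      `|y - (- r + 2 * r * x)| <= 2 * r / 2 ^+ k.
    rewrite -[n.+1%:R]natr1 [(_ + _) / _]mulrDl div1r => /andP[x1 x2] /andP[y1 y2].
    move: (n%:R / 2 ^+ k : R) ((2 ^+ k)^-1 : R) x1 x2 y1 y2 => u v x1 x2 y1 y2.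
    rewrite ler_norml; apply/andP; split; nra.
  have := conv i _ _ hi hx; have := conv j _ _ hj hy.
  move=> h1 h2; apply: le_lt_trans (lerD h2 h1) _.
  by rewrite -mulrDl -mulrDl -natrD.
(* The limit point may lie outside the disc; the cells around it are then eventually empty. *)
have P0 : P set0.
  have [|U _ hU] := loc 0; first by rewrite cnorm0 ltW.
  by apply: mono hU.
have [z0r|z0r] := leP (cnorm z0) r.
  have [U [d d0 hd] PU] := loc z0 z0r.
  have [k [i [j [nPc sub]]]] := small d d0; apply: nPc.
  by apply: mono PU => z /sub; exact: hd.
have [k [i [j [nPc sub]]]] := small (cnorm z0 - r) (ltac:(by rewrite subr_gt0)).
apply: nPc; apply: mono P0 => z zc; have /= := sub z zc; case: zc => zr _ _.
by rewrite cnormBC; have := cnorm_subl z0 z; lra.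
Qed.

End Compactness.

(** * Small powers *)

Section RealSequences.
Variable R : realType.
Implicit Types (q t e : R).

Lemma bernoulli t n : 0 <= t -> 1 + n%:R * t <= (1 + t) ^+ n.
Proof.
move=> t0; elim: n => [|n IH]; first by rewrite mul0r addr0 expr0.
rewrite exprS -[n.+1%:R]natr1; have n0 : 0 <= n%:R :> R by [].
apply: le_trans (ler_wpM2l _ IH); last lra.
nra.
Qed.

Lemma expr_small q e : 0 <= q < 1 -> 0 < e -> exists n, q ^+ n < e.
Proof.
move=> /andP[q0 q1] e0; have : `|q| < 1 by rewrite ger0_norm.
move=> /cvg_expr /cvgrPdist_lt /(_ e e0) [n _ /(_ n (leqnn n))].
by rewrite /= sub0r normrN ger0_norm ?exprn_ge0//; exists n.
Qed.

(** With p = sqrt q, write q^n = p^n p^n: the sequence (n + 1) p^n stays below 1 / (1 - p) and the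
    other factor p^n tends to 0. *)
Lemma nexpr_small q e : 0 <= q < 1 -> 0 < e -> exists n, n.+1%:R * q ^+ n < e.
Proof.
move=> /andP[q0 q1] e0; pose p := Num.sqrt q.
have p0 : 0 <= p by exact: sqrtr_ge0.
have p1 : p < 1 by rewrite -sqrtr1 ltr_sqrt.
have [n hn] : exists n, p ^+ n < e * (1 - p).
  by apply: expr_small; rewrite ?p0// mulr_gt0// subr_gt0.
exists n; rewrite -(sqr_sqrtr q0) -/p -exprM mulnC exprM expr2.
have pn : 0 <= p ^+ n by rewrite exprn_ge0.
have h : (1 - p) * (n.+1%:R * p ^+ n) <= 1.
  elim: n {hn} pn => [|n IH] pn; first by rewrite expr0 !mulr1; lra.
  have pn' : 0 <= p ^+ n by rewrite exprn_ge0.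
  have := IH pn'; rewrite exprS -[n.+2%:R]natr1; set x := p ^+ n in pn' *.
  have n0 : 0 <= n.+1%:R :> R by [].
  have x1 : x <= 1 by rewrite exprn_ile1// ltW.
  set m := n.+1%:R in n0 *.
  have : 0 <= m * x by rewrite mulr_ge0.
  set y := m * x => y0 h; have -> : (1 - p) * ((m + 1) * (p * x)) = (1 - p) * y * p + (1 - p) * x * p by rewrite /y; ring.
  have : (1 - p) * y * p <= 1 * p by rewrite ler_wpM2r.
  have : (1 - p) * x * p <= (1 - p) * 1 * 1.
    by rewrite -!mulrA ler_wpM2l ?subr_ge0 ?(ltW p1)// ler_pM// ltW.
  lra.
rewrite mulrA -(ltr_pM2l (_ : 0 < 1 - p)) ?subr_gt0// mulrA.
apply: le_lt_trans (ler_wpM2r pn h) _; rewrite mul1r mulrC//.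
Qed.

End RealSequences.

(** * Cauchy's formula, maximum principle, orders of zeros, Taylor approximation *)

Section Cauchy.
Variable R : realType.
Local Notation C := (complex R).
Local Notation "x %:C" := (real_complex R x).
Implicit Types (z w a b l m : C) (r e d s B : R) (G H E : C -> C).

Lemma hol_bounded r s G : hol 0 s G -> r < s -> exists B, forall w, cnorm w <= r -> cnorm (G w) <= B.
Proof.
move=> hG rs; have [r0|r0] := ltP 0 r; last first.
  exists (cnorm (G 0)) => w wr; suff -> : w = 0 by [].
  by apply/eqP; rewrite -cnorm_le0 (le_trans wr).
have := @disc_compact R (fun A => exists B, forall w, A w -> cnorm (G w) <= B) r r0.
apply.
- by move=> A A' AA' [B hB]; exists B => w /AA'; exact: hB.
- move=> A A' [B hB] [B' hB']; exists (Num.max B B') => w [/hB|/hB'] h; rewrite le_max h ?orbT//.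
- move=> z zr; exists [set w | cnorm (G w) <= cnorm (G z) + 1]; last by exists (cnorm (G z) + 1).
  by apply: ccont_bounded; apply: cdiff_ccont; apply: hG; rewrite subr0 (le_lt_trans zr).
Qed.

Lemma circle_ne z w r : cnorm z < r -> cnorm w = r -> w - z != 0.
Proof. by move=> zr wr; rewrite subr_eq0; apply: contraTneq zr => <-; rewrite wr ltxx. Qed.

(** On |w| = r the kernel w / (w - z) is the conjugate of H(w) = 1 / (1 - conj z w / r^2), which is
    holomorphic beyond the circle with H(0) = 1. *)
Lemma kernel_mean r z : cnorm z < r -> forall e, 0 < e ->
  \forall N \near \oo, cnorm (Mc N r (fun w => w / (w - z)) - 1) <= e.
Proof.
move=> zr e e0; have r0 : 0 < r by apply: le_lt_trans zr; exact: cnorm_ge0.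
(* A radius between r and r^2 / |z|, the modulus of the pole of H, written without dividing by |z|,
   which may be 0. *)
pose s := 2 * r ^+ 2 / (cnorm z + r).
have zr0 : 0 < cnorm z + r by rewrite ltr_wpDl// cnorm_ge0.
have rs : r < s by rewrite ltr_pdivlMr//; nra.
have r2 : r ^+ 2 != 0 by rewrite expf_neq0// gt_eqF.
have r2C : (r ^+ 2)%:C != 0 :> C by rewrite -cnorm_eq0 cnormR normr_eq0.
pose H w := (1 - conjc z / (r ^+ 2)%:C * w)^-1.
have hH : hol 0 s H.
  move=> w; rewrite subr0 => ws; apply: cdiffV; last first.
    by apply: cdiffB; [exact: cdiff_cst|apply: cdiffM; [exact: cdiff_cst|exact: cdiff_id]].
  rewrite subr_eq0 eq_sym; apply: contraTneq ws => h.
  have : cnorm (conjc z / (r ^+ 2)%:C * w) = 1 by rewrite h cnorm1.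
  rewrite cnormM cnormf cnorm_conj cnormR ger0_norm ?sqr_ge0// => h1.
  rewrite -leNgt /s ler_pdivrMr//.
  have -> : r ^+ 2 = cnorm z * cnorm w.
    by move: h1; rewrite mulrAC => /divr1_eq ->.
  have := cnorm_ge0 z; have := cnorm_ge0 w; nra.
have : 0 < r < s by rewrite r0.
move/(mvp hH)/(_ _ e0); apply: filterS => N; rewrite /H mulr0 subr0 invr1 => hN.
rewrite (@eq_Mc _ _ _ _ (fun w => conjc (H w))); last first.
  move=> w; rewrite gtr0_norm// => wr; have w0 : w != 0 by rewrite -cnorm_gt0 wr.
  have wz := circle_ne zr wr.
  have cw : conjc w = (r ^+ 2)%:C / w by rewrite -wr -mul_conjc mulrAC divff ?mul1r.
  rewrite /H; move: (conjc_real (r ^+ 2)) r2C cw.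
  move: ((r ^+ 2)%:C) => q qq q0 cw.
  rewrite conjc_inv rmorphB rmorph1 rmorphM rmorphM fmorphV /= conjcK qq cw.
  by field; rewrite w0 q0 wz.
by rewrite Mc_conj -(conjc1 R) -rmorphB cnorm_conj.
Qed.

(** Splitting G(w) = G(z) + (w - z) [cquo G z w] leaves the mean of the kernel and the mean of w
    [cquo G z w], a holomorphic function vanishing at 0. *)
Lemma cauchy_formula r s z G : hol 0 s G -> cnorm z < r -> r < s -> forall e, 0 < e ->
  \forall N \near \oo, cnorm (Mc N r (fun w => G w * (w / (w - z))) - G z) <= e.
Proof.
move=> hG zr rs e e0; have r0 : 0 < r by apply: le_lt_trans zr; exact: cnorm_ge0.
have e2 : 0 < e / 2 by lra.
have B0 : 0 < cnorm (G z) + 1 by rewrite ltr_wpDl// cnorm_ge0.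
have hE : hol 0 s (fun w => w * cquo G z w).
  by move=> w ws; apply: cdiffM; [exact: cdiff_id|exact: (hol_cquo _ hG)].
have h1 := mvp hE (_ : 0 < r < s) e2; rewrite r0 rs in h1; have {}h1 := h1 isT.
have h2 := kernel_mean zr (divr_gt0 e2 B0).
apply: filterS2 h1 h2 => N; rewrite mul0r subr0 => hN1 hN2.
rewrite (@eq_Mc _ _ _ _ (fun w => G z * (w / (w - z)) + w * cquo G z w)); last first.
  move=> w; rewrite gtr0_norm// => wr; rewrite {1}(cquoE G z w).
  by have := circle_ne zr wr => wz; field.
rewrite McD McZ (_ : _ - G z = G z * (Mc N r (fun w => w / (w - z)) - 1) + Mc N r (fun w => w * cquo G z w)); last ring.
apply: le_trans (cnormD _ _) _; rewrite [leRHS](_ : _ = e / 2 + e / 2); last lra.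
apply: lerD => //; rewrite cnormM.
apply: le_trans (ler_pM (cnorm_ge0 _) (cnorm_ge0 _) (_ : _ <= cnorm (G z) + 1) hN2) _.
  by rewrite lerDl.
by rewrite mulrC divfK// gt_eqF.
Qed.

(** Power trick: Cauchy's formula for G^n loses only the factor r / (r - |z|), independent of n,
    which would disappear under n-th roots; Bernoulli's inequality replaces the roots. *)
Lemma max_principle0 r s z G B : hol 0 s G -> r < s -> cnorm z < r ->
  (forall w, cnorm w = r -> cnorm (G w) <= B) -> cnorm (G z) <= B.
Proof.
move=> hG rs zr hB; have r0 : 0 < r by apply: le_lt_trans zr; exact: cnorm_ge0.
have B0 : 0 <= B by apply: le_trans (cnorm_ge0 _) (hB r%:C _); rewrite cnormR gtr0_norm.
have rz : 0 < r - cnorm z by rewrite subr_gt0.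
pose K := r / (r - cnorm z).
have K0 : 0 < K by rewrite divr_gt0.
have key n : cnorm (G z) ^+ n <= B ^+ n * K.
  apply/ler_addgt0Pr => e e0.
  have hGn : hol 0 s (fun w => G w ^+ n) by move=> w ws; apply: cdiffX; exact: hG.
  have [N hN] := filter_ex (cauchy_formula hGn zr rs e0).
  rewrite -cnormX -(subrK (Mc N r (fun w => G w ^+ n * (w / (w - z)))) (G z ^+ n)) addrC.
  apply: le_trans (cnormD _ _) _; rewrite cnormBC lerD//.
  apply: cnorm_Mc => w; rewrite gtr0_norm// => wr.
  rewrite cnormM cnormX ler_pM ?exprn_ge0 ?cnorm_ge0//.
    by rewrite lerXn2r ?nnegrE ?cnorm_ge0// hB.
  rewrite cnormf wr /K ler_pM2l// lef_pV2 ?posrE ?cnorm_gt0 ?(circle_ne zr wr)//.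
  by have := cnorm_subl w z; rewrite wr.
rewrite leNgt; apply/negP => lt.
have Bp : 0 < B.
  rewrite lt_neqAle B0 andbT eq_sym; apply: contraTneq (key 1%N) => B00.
  by rewrite B00 !expr1 mul0r -ltNge -B00.
pose t := cnorm (G z) / B - 1.
have t0 : 0 < t by rewrite /t subr_gt0 ltr_pdivlMr// mul1r.
have key2 n : 1 + n%:R * t <= K.
  apply: le_trans (bernoulli n (ltW t0)) _.
  by rewrite /t subrKC expr_div_n ler_pdivrMr ?exprn_gt0// mulrC key.
have := key2 (Num.bound (K / t)).
have := archi_boundP (ltW (divr_gt0 K0 t0)); rewrite ltr_pdivrMr//; lra.
Qed.

Lemma max_principle a r s z G B : hol a s G -> r < s -> cnorm (z - a) < r ->
  (forall w, cnorm (w - a) = r -> cnorm (G w) <= B) -> cnorm (G z) <= B.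
Proof.
move=> /hol_shift hG rs zr hB; rewrite -(subrKC a z).
apply: (max_principle0 hG rs zr) => w wr; apply: hB.
by rewrite addrC addKr.
Qed.

(** If every iterated divided difference of G at [a] vanishes there, G is divisible by every power
    of w - a, and the maximum principle gives |G(w)| <= (|w - a| / r)^k B for all k. *)
Lemma hol_order b s a G : hol b s G -> cnorm (a - b) < s ->
  (\forall w \near nb a, G w = 0) \/
  exists k E, [/\ hol b s E, E a != 0 & forall w, G w = (w - a) ^+ k * E w].
Proof.
move=> hG as_; case: (pselect (exists k E, [/\ hol b s E, E a != 0 & forall w, G w = (w - a) ^+ k * E w])).
  by right.
move=> nk; left.
have hE k : exists2 E, hol b s E & forall w, G w = (w - a) ^+ k * E w.
  elim: k => [|k [E hE GE]]; first by exists G => // w; rewrite expr0 mul1r.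
  exists (cquo E a); first exact: hol_cquo.
  move=> w; rewrite GE (cquoE E a w) exprSr.
  have [->|Ea] := eqVneq (E a) 0; first by rewrite add0r mulrA.
  by exfalso; apply: nk; exists k, E.
have [d [B [d0 hGd GB]]] := near_cdiff_bounded (hol_near hG as_).
have d2 : 0 < d / 2 by lra.
have d21 : d / 2 < d by lra.
exists (Num.min (d / 2) (s - cnorm (a - b))); first by rewrite lt_min d2 subr_gt0.
move=> w; rewrite lt_min => /andP[wd ws].
have B0 : 0 <= B by apply: le_trans (cnorm_ge0 _) (GB a _); rewrite subrr cnorm0.
pose r := Num.min (d / 2) ((cnorm (w - a) + (s - cnorm (a - b))) / 2).
have wr : cnorm (w - a) < r by rewrite lt_min wd; lra.
have rd : r < d by rewrite gt_min; apply/orP; left.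
have rs : r < s - cnorm (a - b) by rewrite gt_min; apply/orP; right; lra.
have r0 : 0 < r by apply: le_lt_trans wr; exact: cnorm_ge0.
have key k : cnorm (G w) <= (cnorm (w - a) / r) ^+ k * B.
  have [E hEk GE] := hE k.
  have hEa : hol a (s - cnorm (a - b)) E by apply: hol_sub hEk _; lra.
  have EB : cnorm (E w) <= B / r ^+ k.
    apply: (max_principle hEa rs wr) => v vr.
    rewrite ler_pdivlMr ?exprn_gt0// -vr -cnormX -cnormM mulrC -GE.
    by apply: GB; rewrite vr.
  rewrite GE cnormM cnormX expr_div_n -mulrA [_^-1 * _]mulrC.
  by rewrite ler_wpM2l// exprn_ge0// cnorm_ge0.
apply: contrapT => /eqP; rewrite -cnorm_gt0 => Gw.
have q01 : 0 <= cnorm (w - a) / r < 1.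
  by rewrite divr_ge0 ?cnorm_ge0 ?(ltW r0)//= ltr_pdivrMr// mul1r.
have B1 : 0 < B + 1 by lra.
have [n hn] := expr_small q01 (divr_gt0 Gw B1).
have := key n; rewrite leNgt => /negP; apply.
rewrite ltr_pdivlMr// in hn; apply: le_lt_trans hn.
by rewrite ler_wpM2l ?lerDl// exprn_ge0//; case/andP: q01.
Qed.

Lemma Mc_powN r n : 0 < r -> (0 < n)%N -> forall e, 0 < e ->
  \forall N \near \oo, cnorm (Mc N r (fun w => w ^- n)) <= e.
Proof.
move=> r0 n0 e e0.
have rn : 0 < (r ^+ 2) ^+ n by rewrite !exprn_gt0.
have hid : hol 0 (r + 1) (fun w => w ^+ n) by move=> w _; apply: cdiffX; exact: cdiff_id.
have : 0 < r < r + 1 by lra.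
move/(mvp hid)/(_ _ (mulr_gt0 e0 rn)); apply: filterS => N.
rewrite expr0n gtn_eqF// subr0 => hN.
rewrite (@eq_Mc _ _ _ _ (fun w => ((r ^+ 2) ^+ n)%:C^-1 * conjc (w ^+ n))); last first.
  move=> w; rewrite gtr0_norm// => /inv_circle h.
  by rewrite -exprVn h expr_div_n !rmorphXn /= mulrC.
rewrite McZ Mc_conj cnormM cnormV cnormR cnorm_conj gtr0_norm// mulrC.
by rewrite ler_pdivrMr.
Qed.

Lemma Mc_sum N r I (t : seq I) (F : I -> C -> C) :
  Mc N r (fun w => \sum_(i <- t) F i w) = \sum_(i <- t) Mc N r (F i).
Proof. by rewrite /Mc exchange_big mulr_sumr. Qed.

(** The Taylor coefficients are the values at 0 of the iterated divided differences [E k]. The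
    remainder is z^n [E n z], and [E n] is bounded on a larger circle by comparing G with its
    partial sum there. *)
Lemma taylor_approx r s G : hol 0 s G -> 0 < r < s -> forall e, 0 < e ->
  exists n (c : nat -> C), forall z, cnorm z <= r -> cnorm (G z - \sum_(k < n) c k * z ^+ k) <= e.
Proof.
move=> hG /andP[r0 rs] e e0.
(* Estimates on |w| = p give |[E n]| <= (n + 1) B / p^n, so the error (n + 1) B (r / p)^n tends to 0
   because r < p. *)
pose p := (r + s) / 2.
have rp : r < p by rewrite /p; lra.
have ps : p < s by rewrite /p; lra.
have p0 : 0 < p by lra.
have [B hB] := hol_bounded hG ps.
pose E k := iter k (fun H => cquo H 0) G.
have hE k : hol 0 s (E k) by elim: k => //= k IH; exact: hol_cquo.
pose c k := E k 0.
have GE n w : G w = \sum_(k < n) c k * w ^+ k + w ^+ n * E n w.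
  elim: n => [|n IH]; first by rewrite big_ord0 add0r expr0 mul1r.
  by rewrite big_ord_recr /= IH {1}(cquoE (E n) 0 w) subr0 exprSr; rewrite -/(c n); ring.
have cB k : cnorm (c k) * p ^+ k <= B.
  rewrite -ler_pdivlMr ?exprn_gt0//; apply/ler_addgt0Pr => d d0.
  have d2 : 0 < d / 2 by lra.
  have h1 := mvp (hE k) (_ : 0 < p < s) d2; rewrite p0 ps in h1; have {}h1 := h1 isT.
  have [N [hN1 hN2]] : exists N, cnorm (Mc N p (E k) - c k) <= d / 2 /\
      forall j, (j < k)%N -> cnorm (Mc N p (fun w => c j * w ^- (k - j))) <= d / 2 / k.+1%:R.
    have h2 : \forall N \near \oo, forall j : 'I_k, cnorm (Mc N p (fun w => c j * w ^- (k - j))) <= d / 2 / k.+1%:R.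
      apply: filter_forall => j; have kj : (0 < k - j)%N by rewrite subn_gt0.
      have cj : 0 < cnorm (c j) + 1 by rewrite ltr_wpDl// cnorm_ge0.
      have dd : 0 < d / 2 / k.+1%:R / (cnorm (c j) + 1) by rewrite !divr_gt0.
      apply: filterS (Mc_powN p0 kj dd) => N hN; rewrite McZ cnormM.
      apply: le_trans (ler_pM (cnorm_ge0 _) (cnorm_ge0 _) (_ : _ <= cnorm (c j) + 1) hN) _; first by rewrite lerDl.
      by rewrite mulrC divfK// gt_eqF.
    have [N [hN1 hN2]] := filter_ex (filterI h1 h2).
    by exists N; split=> // j jk; exact: (hN2 (Ordinal jk)).
  have := cnorm_Mc N (r := p) (G := fun w => G w / w ^+ k) (B := B / p ^+ k) => hM.
  have e1 : Mc N p (fun w => G w / w ^+ k) = \sum_(j < k) Mc N p (fun w => c j * w ^- (k - j)) + Mc N p (E k).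
    rewrite -Mc_sum -McD; apply: eq_Mc => w; rewrite gtr0_norm// => wp.
    have w0 : w != 0 by rewrite -cnorm_gt0 wp.
    rewrite (GE k) mulrDl mulrAC divff ?expf_neq0// mul1r mulr_suml; congr (_ + _).
    apply: eq_bigr => j _; rewrite -mulrA; congr (_ * _).
    by rewrite -{2}(subnKC (ltnW (ltn_ord j))) exprD invfM mulrA divff ?expf_neq0// mul1r.
  rewrite (_ : c k = Mc N p (fun w => G w / w ^+ k) - \sum_(j < k) Mc N p (fun w => c j * w ^- (k - j)) - (Mc N p (E k) - c k)); last first.
    by rewrite e1; ring.
  apply: le_trans (cnormB _ _) _; apply: le_trans (lerD (cnormB _ _) (lexx _)) _.
  have hs : cnorm (\sum_(j < k) Mc N p (fun w => c j * w ^- (k - j))) <= d / 2.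
    apply: le_trans (cnorm_sum _ _ _) _.
    apply: le_trans (_ : \sum_(j < k) (d / 2 / k.+1%:R) <= _).
      by apply: ler_sum => j _; exact: hN2.
    rewrite sumr_const card_ord -(mulr_natl (_ / k.+1%:R)) mulrCA ger_pMr// ler_pdivrMr// mul1r ler_nat//.
  have hM' : cnorm (Mc N p (fun w => G w / w ^+ k)) <= B / p ^+ k.
    apply: hM => w; rewrite gtr0_norm// => wp; rewrite cnormf cnormX wp.
    by rewrite ler_pM2r ?invr_gt0 ?exprn_gt0// hB// wp.
  lra.
have B0 : 0 <= B by apply: le_trans (cnorm_ge0 _) (hB 0 _); rewrite cnorm0 ltW.
have q01 : 0 <= r / p < 1 by rewrite divr_ge0 ?(ltW r0) ?(ltW p0)//= ltr_pdivrMr// mul1r.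
have B1 : 0 < B + 1 by lra.
have [n hn] := nexpr_small q01 (divr_gt0 e0 B1).
exists n, c => z zr; rewrite (GE n) addrC addKr cnormM cnormX.
have En : cnorm (E n z) <= n.+1%:R * B / p ^+ n.
  apply: (max_principle0 (hE n) ps (le_lt_trans zr rp)) => w wp.
  rewrite ler_pdivlMr ?exprn_gt0// -wp -cnormX -cnormM mulrC.
  rewrite (_ : w ^+ n * E n w = G w - \sum_(k < n) c k * w ^+ k); last first.
    by rewrite (GE n) addrC addKr.
  apply: le_trans (cnormB _ _) _; rewrite -[n.+1%:R]natr1 mulrDl mul1r addrC.
  apply: lerD; last by rewrite hB// wp.
  apply: le_trans (cnorm_sum _ _ _) _; rewrite mulr_natl -[n in _ *+ n]card_ord -sumr_const.
  by apply: ler_sum => k _; rewrite cnormM cnormX wp.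
have zn : cnorm z ^+ n <= r ^+ n by rewrite lerXn2r ?nnegrE ?cnorm_ge0 ?(ltW r0).
apply: le_trans (ler_pM _ (cnorm_ge0 _) zn En) _; first by rewrite exprn_ge0// cnorm_ge0.
rewrite (_ : r ^+ n * _ = n.+1%:R * (r / p) ^+ n * B); last first.
  by rewrite (expr_div_n r p) mulrCA [RHS]mulrAC.
rewrite ltr_pdivlMr// in hn; apply: le_trans (ltW hn).
rewrite ler_wpM2l ?lerDl// mulr_ge0// exprn_ge0//; by case/andP: q01.
Qed.

End Cauchy.

(** * Real circle averages *)

Section RealMean.
Variable R : realType.
Local Notation C := (complex R).
Local Notation "x %:C" := (real_complex R x).
Implicit Types (z w a b c : C) (r e d s B : R) (G H u : C -> C) (v phi psi : C -> R).

Definition Mr N r phi : R := (2 ^+ N)^-1 * \sum_(k < 2 ^ N) phi (r%:C * rt R N k).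

Lemma Re_real (t : R) z : complex.Re (t%:C * z) = t * complex.Re z.
Proof. by case: z => x y; rewrite /= mul0r subr0. Qed.

Lemma Mr_Re N r G : Mr N r (fun w => complex.Re (G w)) = complex.Re (Mc N r G).
Proof.
rewrite /Mc (_ : (2 ^+ N)^-1 = ((2 ^+ N)^-1)%:C); last by rewrite fmorphV rmorphXn rmorph_nat.
by rewrite Re_real raddf_sum.
Qed.

Lemma Mr_ext N r phi psi : (forall w, cnorm w = `|r| -> phi w = psi w) -> Mr N r phi = Mr N r psi.
Proof.
by move=> h; congr (_ * _); apply: eq_bigr => k _; rewrite h// cnormM cnorm_rt mulr1 cnormR.
Qed.

Lemma ler_Mr N r phi psi : (forall w, cnorm w = `|r| -> phi w <= psi w) -> Mr N r phi <= Mr N r psi.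
Proof.
move=> h; rewrite /Mr ler_pM2l ?invr_gt0 ?exprn_gt0//; apply: ler_sum => k _.
by rewrite h// cnormM cnorm_rt mulr1 cnormR.
Qed.

Lemma Mr_cst N r (x : R) : Mr N r (fun=> x) = x.
Proof.
rewrite /Mr sumr_const card_ord -(mulr_natl x) mulrA natrX mulVf ?mul1r//.
Qed.

Lemma MrD N r phi psi : Mr N r (fun w => phi w + psi w) = Mr N r phi + Mr N r psi.
Proof. by rewrite /Mr big_split mulrDr. Qed.

Lemma MrZ N r (x : R) phi : Mr N r (fun w => x * phi w) = x * Mr N r phi.
Proof. by rewrite /Mr -mulr_sumr mulrCA. Qed.

Lemma MrN N r phi : Mr N r (fun w => - phi w) = - Mr N r phi.
Proof. by rewrite /Mr sumrN mulrN. Qed.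

Lemma MrB N r phi psi : Mr N r (fun w => phi w - psi w) = Mr N r phi - Mr N r psi.
Proof. by rewrite MrD MrN. Qed.

Lemma Mr_sum N r I (t : seq I) (F : I -> C -> R) :
  Mr N r (fun w => \sum_(i <- t) F i w) = \sum_(i <- t) Mr N r (F i).
Proof. by rewrite /Mr exchange_big mulr_sumr. Qed.

(** Fubini for finite sums; it serves to average a Poisson integral over the points at which it is
    evaluated. *)
Lemma Mr_exchange N M r s (F : C -> C -> R) :
  Mr N r (fun z => Mr M s (fun w => F z w)) = Mr M s (fun w => Mr N r (fun z => F z w)).
Proof.
rewrite /Mr mulr_sumr; under eq_bigr do rewrite mulrCA.
rewrite -mulr_sumr; congr (_ * _); under eq_bigr do rewrite mulr_sumr.
by rewrite exchange_big; apply: eq_bigr => k _; rewrite mulr_sumr.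
Qed.

Lemma norm_Mr N r phi : `|Mr N r phi| <= Mr N r (fun w => `|phi w|).
Proof.
rewrite /Mr normrM ger0_norm ?invr_ge0 ?exprn_ge0//.
by rewrite ler_pM2l ?invr_gt0 ?exprn_gt0// ler_norm_sum.
Qed.

Lemma Mr_ge0 N r phi : (forall w, cnorm w = `|r| -> 0 <= phi w) -> 0 <= Mr N r phi.
Proof. by move=> h; rewrite -(Mr_cst N r 0); apply: ler_Mr. Qed.

End RealMean.

(** * Algebra of the roots of unity *)

Section Roots.
Variable R : realType.
Local Notation C := (complex R).
Local Notation "x %:C" := (real_complex R x).
Implicit Types (z w a b c : C) (r e d s B : R).

(** The order divides 2^N, hence is a power of 2; were it smaller it would divide 2^(N-1), but that
    power of the root is -1. *)
Lemma rt_prim N : (2 ^ N).-primitive_root (rt R N 1).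
Proof.
have h1 : rt R N 1 ^+ (2 ^ N) = 1.
  rewrite expiX natrX -[RHS](expi_2pi R); congr expi; rewrite mul1r; field.
  by rewrite expf_neq0.
have n0 : (0 < 2 ^ N)%N by rewrite expn_gt0.
have [m pm] := prim_order_exists n0 h1.
move=> /(dvdn_pfactor _ _ (isT : prime 2))[j jN mj].
case: (ltnP j N) => [lt|ge]; last first.
  by move: pm; rewrite mj (_ : j = N)//; apply/eqP; rewrite eqn_leq jN ge.
have : rt R N 1 ^+ (2 ^ N.-1) = 1.
  apply/eqP; rewrite -(prim_order_dvd pm) mj dvdn_Pexp2l// -ltnS prednK// (leq_trans _ lt)//.
have N0 : (0 < N)%N by apply: leq_trans lt.
rewrite expiX natrX => h.
have : expi (pi : R) = 1.
  rewrite -h; congr expi; rewrite mul1r -{2}(prednK N0) exprS; field.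
  by rewrite expf_neq0.
rewrite expi_pi => /eqP; rewrite eq_sym -subr_eq0 opprK (_ : 1 + 1 = 2%:R)//.
by rewrite pnatr_eq0.
Qed.

Lemma rtE N k : rt R N k = rt R N 1 ^+ k.
Proof. by rewrite /rt expiX; congr expi; ring. Qed.

Lemma rt_expn N k : rt R N k ^+ (2 ^ N) = 1.
Proof. by rewrite rtE exprAC (prim_expr_order (rt_prim N)) expr1n. Qed.

Lemma sum_rt N l : (0 < l < 2 ^ N)%N -> \sum_(k < 2 ^ N) rt R N k ^+ l = 0.
Proof.
move=> /andP[l0 lN].
have h1 : rt R N 1 ^+ l != 1.
  by rewrite -(prim_order_dvd (rt_prim N)) gtnNdvd.
have := subrX1 (rt R N 1 ^+ l) (2 ^ N).
rewrite exprAC (prim_expr_order (rt_prim N)) expr1n subrr => /esym/eqP.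
rewrite mulf_eq0 subr_eq0 (negPf h1) /= => /eqP h2.
by rewrite -[RHS]h2; apply: eq_bigr => k _; rewrite rtE exprAC.
Qed.

Lemma prod_rt N r a : 0 < r -> \prod_(k < 2 ^ N) (a - r%:C * rt R N k) = a ^+ (2 ^ N) - r%:C ^+ (2 ^ N).
Proof.
move=> r0; have rC : r%:C != 0 :> C by rewrite -cnorm_eq0 cnormR normr_eq0 gt_eqF.
have := factor_Xn_sub_1 (rt_prim N); move/(congr1 (horner^~ (a / r%:C))).
rewrite !hornerE horner_prod => /esym h.
transitivity (r%:C ^+ (2 ^ N) * \prod_(0 <= k < 2 ^ N) (a / r%:C - rt R N 1 ^+ k)).
  rewrite big_mkord -[X in _ ^+ X]card_ord -prodr_const -big_split /=; apply: eq_bigr => k _.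
  by rewrite rtE; field.
have hE i : ('X - (rt R N 1 ^+ i)%:P).[a / r%:C] = a / r%:C - rt R N 1 ^+ i by rewrite !hornerE.
rewrite -(eq_bigr _ (fun i _ => hE i)) -h expr_div_n mulrBr mulr1 mulrCA divff ?mulr1// expf_neq0//.
Qed.

End Roots.

(** * Averages of logarithms over circles *)

Section LogMean.
Variable R : realType.
Local Notation C := (complex R).
Local Notation "x %:C" := (real_complex R x).
Implicit Types (z w a b c : C) (r e d s B : R).

Lemma ln_prod I (t : seq I) (F : I -> R) : (forall i, 0 < F i) ->
  ln (\prod_(i <- t) F i) = \sum_(i <- t) ln (F i).
Proof.
move=> h; elim: t => [|i t IH]; first by rewrite !big_nil ln1.
by rewrite !big_cons lnM ?IH// posrE// prodr_gt0.
Qed.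

Lemma ln_near1 (x : R) : `|x - 1| <= 2^-1 -> `|ln x| <= 1.
Proof.
rewrite ler_norml => /andP[h1 h2]; have x0 : 0 < x by lra.
have l1 := ln_sublinear x0.
have : ln x^-1 < x^-1 by apply: ln_sublinear; rewrite invr_gt0.
rewrite lnV ?posrE// => l2.
have h3 : ln x <= x - 1 by have := le_ln1Dx (_ : -1 < x - 1); rewrite subrKC; apply; lra.
have xi : 0 < x^-1 by rewrite invr_gt0.
have h4 : ln x^-1 <= x^-1 - 1 by have := le_ln1Dx (_ : -1 < x^-1 - 1); rewrite subrKC; apply; lra.
rewrite lnV ?posrE// in h4.
have h5 : x^-1 <= 2 by rewrite -[2]invrK lef_pV2 ?posrE//; lra.
by rewrite ler_norml; apply/andP; split; lra.
Qed.

Lemma pow2_small (q e : R) : 0 <= q < 1 -> 0 < e -> \forall N \near \oo, q ^+ (2 ^ N) < e.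
Proof.
move=> q01 e0; have [n hn] := expr_small q01 e0; exists n => // N /= nN.
apply: le_lt_trans hn; have /andP[q0 q1] := q01.
apply: ler_wiXn2l => //; first exact: ltW.
by apply: leq_trans nN _; rewrite ltnW// ltn_expl.
Qed.

Lemma pow2_inv (e : R) : 0 < e -> \forall N \near \oo, (2 ^+ N)^-1 <= e :> R.
Proof.
move=> e0; have [k hk] := dyadic_small (ltr01 : 0 < (1 : R)) e0.
exists k => // N /= kN; rewrite div1r in hk; apply: le_trans (ltW hk).
by rewrite lef_pV2 ?posrE ?exprn_gt0// ler_eXn2l ?ltr1n.
Qed.

(** By [prod_rt] the average is ln |a^n - r^n| / n with n = 2^N, and the larger of |a| and r
    dominates. On |a| = r a sample point could be a itself, hence the exclusion. *)
Lemma mean_log_linear r a : 0 < r -> cnorm a != r -> forall e, 0 < e ->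
  \forall N \near \oo, `|Mr N r (fun w => ln (cnorm (w - a))) - ln (Num.max r (cnorm a))| <= e.
Proof.
move=> r0 ar e e0; set m := Num.max r (cnorm a).
have m0 : 0 < m by rewrite lt_max r0.
(* Once q^n < 1/2, the logarithm of |a^n - r^n| is within 1 of n ln m, and dividing by n = 2^N
   leaves an error 1 / 2^N. *)
pose q := Num.min r (cnorm a) / m.
have q01 : 0 <= q < 1.
  rewrite divr_ge0 ?(ltW m0) ?le_min ?(ltW r0) ?cnorm_ge0//= ltr_pdivrMr// mul1r.
  rewrite /m; case: (ltgtP r (cnorm a)) => // h; first by rewrite h in ar; rewrite eqxx in ar.
near=> N; have h1 : (2 ^+ N)^-1 <= e :> R by near: N; exact: pow2_inv.
have h2 : q ^+ (2 ^ N) < 2^-1 by near: N; apply: pow2_small.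
pose n := (2 ^ N)%N; have n0 : 0 < 2 ^+ N :> R by rewrite exprn_gt0.
have e1 : Mr N r (fun w => ln (cnorm (w - a))) = (2 ^+ N)^-1 * ln (cnorm (a ^+ n - r%:C ^+ n)).
  rewrite -prod_rt// cnorm_prod ln_prod; last first.
    move=> k; rewrite cnorm_gt0 subr_eq0; apply: contraNneq ar => ->.
    by rewrite cnormM cnorm_rt mulr1 cnormR gtr0_norm.
  by congr (_ * _); apply: eq_bigr => k _; rewrite cnormBC.
have e2 : ln (cnorm (a ^+ n - r%:C ^+ n)) = 2 ^+ N * ln m + ln (cnorm (a ^+ n - r%:C ^+ n) / m ^+ n).
  have h : 0 < cnorm (a ^+ n - r%:C ^+ n).
    rewrite cnorm_gt0 subr_eq0; apply: contraNneq ar => /(congr1 (@cnorm R)).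
    rewrite !cnormX cnormR gtr0_norm// => /eqP; rewrite eqrXn2 ?cnorm_ge0 ?(ltW r0)//.
    by rewrite expn_gt0.
  rewrite ln_div ?posrE ?exprn_gt0// lnXn// -(mulr_natl (ln m)) natrX; ring.
rewrite e1 e2 mulrDr mulrA mulVf ?gt_eqF// mul1r addrAC subrr add0r normrM.
rewrite ger0_norm ?invr_ge0 ?(ltW n0)//.
apply: le_trans h1; rewrite ler_piMr ?invr_ge0 ?(ltW n0)//; apply: ln_near1.
apply: le_trans (ltW h2); rewrite -(ler_pM2r (_ : 0 < m ^+ n)) ?exprn_gt0//.
rewrite -[X in _ * X](gtr0_norm (exprn_gt0 n m0)) -normrM mulrBl divfK ?mul1r; last by rewrite gt_eqF// exprn_gt0.
rewrite -/n (_ : q ^+ n * m ^+ n = Num.min r (cnorm a) ^+ n); last by rewrite -exprMn /q divfK ?gt_eqF.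
rewrite /m; have [ra|ra] := ltP r (cnorm a).
  have := cnorm_subl (a ^+ n) (r%:C ^+ n); have := cnormB (a ^+ n) (r%:C ^+ n).
  by rewrite !cnormX cnormR (gtr0_norm r0) => k1 k2; rewrite ler_norml; apply/andP; split; lra.
have := cnorm_subl (r%:C ^+ n) (a ^+ n); have := cnormB (a ^+ n) (r%:C ^+ n).
rewrite [cnorm (r%:C ^+ n - _)]cnormBC.
by rewrite !cnormX cnormR (gtr0_norm r0) => k1 k2; rewrite ler_norml; apply/andP; split; lra.
Unshelve. all: by end_near. Qed.

(* On |w| = r, |w - a|^2 + b^2 = lam |w - a / lam|^2 for the larger root X = lam r^2 of a quadratic,
   so the mean is a difference of two Jensen means. *)
Lemma mean_log_quad r a (b : R) : 0 < r -> 0 < b -> cnorm a != r -> forall e, 0 < e ->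
  \forall N \near \oo, Mr N r (fun w => ln (1 + b ^+ 2 / cnorm (w - a) ^+ 2)) <= 2 * b / r + e.
Proof.
move=> r0 b0 ar e e0.
pose S := r ^+ 2 + cnorm a ^+ 2 + b ^+ 2.
pose D := S ^+ 2 - 4 * r ^+ 2 * cnorm a ^+ 2.
pose X := (S + Num.sqrt D) / 2.
have a0 := cnorm_ge0 a.
have DE : D = (r ^+ 2 - cnorm a ^+ 2) ^+ 2 + 2 * (r ^+ 2 + cnorm a ^+ 2) * b ^+ 2 + b ^+ 4.
  by rewrite /D /S; ring.
have D0 : 0 <= D.
  rewrite DE; apply: addr_ge0; last exact: exprn_even_ge0.
  apply: addr_ge0; first exact: sqr_ge0.
  apply: mulr_ge0; last exact: sqr_ge0.
  by apply: mulr_ge0 => //; apply: addr_ge0; exact: sqr_ge0.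
have S0 : 0 < S by rewrite /S; have := exprn_gt0 2 r0; have := sqr_ge0 (cnorm a); have := exprn_gt0 2 b0; lra.
have X0 : 0 < X by rewrite /X divr_gt0// ltr_pwDl// sqrtr_ge0.
have sD := sqr_sqrtr D0; have sD0 := sqrtr_ge0 D.
have XE : X ^+ 2 - S * X + r ^+ 2 * cnorm a ^+ 2 = 0.
  have : X ^+ 2 - S * X = (Num.sqrt D ^+ 2 - S ^+ 2) / 4 by rewrite /X; field.
  by rewrite sD => ->; rewrite {1}/D; lra.
pose lam := X / r ^+ 2.
have r2 : 0 < r ^+ 2 by rewrite exprn_gt0.
have lam0 : 0 < lam by rewrite divr_gt0.
pose a' := a / lam%:C.
have a'n : cnorm a' = cnorm a / lam by rewrite cnormf cnormR gtr0_norm.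
have a'r : cnorm a' < r.
  rewrite a'n ltr_pdivrMr// (_ : r * lam = X / r); last by rewrite /lam; field; rewrite gt_eqF.
  rewrite ltr_pdivlMr//; have : cnorm a * r < S / 2.
    rewrite ltr_pdivlMr// /S; have : 0 <= (cnorm a - r) ^+ 2 by rewrite sqr_ge0.
    have : 0 < b ^+ 2 by rewrite exprn_gt0.
    by rewrite sqrrB; lra.
  by rewrite /X; lra.
have circ w : cnorm w = r -> cnorm (w - a) ^+ 2 + b ^+ 2 = lam * cnorm (w - a') ^+ 2.
  move=> wr; have E1 c : cnorm (w - c) ^+ 2 = r ^+ 2 + cnorm c ^+ 2 - 2 * (complex.Re w * complex.Re c + complex.Im w * complex.Im c).
    by rewrite -wr !cnorm_sqr !raddfB /=; ring.
  rewrite !E1 a'n expr_div_n.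
  have ai : a' = (lam^-1)%:C * a by rewrite /a' fmorphV mulrC.
  have -> : complex.Re a' = lam^-1 * complex.Re a by rewrite ai Re_real.
  have -> : complex.Im a' = lam^-1 * complex.Im a.
    by rewrite ai; case: (a) => x y /=; rewrite mul0r addr0.
  have -> : r ^+ 2 = X / lam by rewrite /lam; field; rewrite !gt_eqF.
  have e1 : X + cnorm a ^+ 2 / lam = S.
    rewrite /lam; apply: (mulfI (_ : X != 0)); first by rewrite gt_eqF.
    rewrite mulrDr -[RHS]addr0 -XE; field.
    by rewrite !gt_eqF.
  have e2 : X / lam = r ^+ 2 by rewrite /lam; field; rewrite !gt_eqF.
  have e3 : lam * (X / lam) = X by field; rewrite gt_eqF.
  transitivity (S - 2 * (complex.Re w * complex.Re a + complex.Im w * complex.Im a)).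
    by rewrite e2 /S; ring.
  rewrite -e1; field; rewrite gt_eqF//.
pose m := Num.max r (cnorm a).
have m0 : 0 < m by rewrite lt_max r0.
have rm : r <= m by rewrite le_max lexx.
have am : cnorm a <= m by rewrite le_max lexx orbT.
(* The right side is at most (m + b)^2, which is what gives 2 ln (1 + b / m) in the end; the bound
   rests on sqrt D <= |r^2 - |a|^2| + 2 b m + b^2. *)
have XB : X <= m ^+ 2 + b ^+ 2 + b * m.
  have h : Num.sqrt D <= `|r ^+ 2 - cnorm a ^+ 2| + 2 * b * m + b ^+ 2.
    rewrite -(ler_pXn2r (_ : 0 < 2)%N) ?nnegrE// ?addr_ge0 ?mulr_ge0 ?sqr_ge0 ?(ltW m0) ?(ltW b0)//.
    rewrite sD DE -[X in X + _ + _](real_normK (num_real _)).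
    have : r ^+ 2 + cnorm a ^+ 2 <= 2 * m ^+ 2.
      have : r ^+ 2 <= m ^+ 2 by rewrite lerXn2r ?nnegrE ?(ltW r0) ?(ltW m0).
      have : cnorm a ^+ 2 <= m ^+ 2 by rewrite lerXn2r ?nnegrE ?(ltW m0).
      lra.
    set y := `|_|; have y0 : 0 <= y by rewrite normr_ge0.
    set p := _ + _ => hp; have b2 : 0 <= b ^+ 2 by rewrite sqr_ge0.
    have : 2 * p * b ^+ 2 <= 4 * m ^+ 2 * b ^+ 2 by rewrite ler_wpM2r//; lra.
    have : 0 <= y * b * m by rewrite !mulr_ge0 ?(ltW b0) ?(ltW m0).
    have : 0 <= y * b ^+ 2 by rewrite mulr_ge0.
    have : 0 <= b ^+ 3 * m by rewrite mulr_ge0 ?exprn_ge0 ?(ltW b0) ?(ltW m0).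
    move=> k1 k2 k3 k4.
    rewrite (_ : (y + 2 * b * m + b ^+ 2) ^+ 2 = y ^+ 2 + 4 * m ^+ 2 * b ^+ 2 + b ^+ 4
       + 4 * (y * b * m) + 2 * (y * b ^+ 2) + 4 * (b ^+ 3 * m)); last ring.
    lra.
  rewrite /X ler_pdivrMr//; have h2 : r ^+ 2 + cnorm a ^+ 2 + `|r ^+ 2 - cnorm a ^+ 2| <= 2 * m ^+ 2.
    rewrite /m; have [ra|ra] := ltP r (cnorm a).
      rewrite ler0_norm; first lra.
      by rewrite subr_le0 lerXn2r ?nnegrE ?(ltW r0)// ltW.
    rewrite ger0_norm; first lra.
    by rewrite subr_ge0 lerXn2r ?nnegrE ?(ltW r0).
  by rewrite /S; lra.
(* The limit of the mean: since |a'| < r, the Jensen mean of [a'] is ln r, and that of [a] is ln m.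
   The combination equals ln (X / m^2). *)
have key : ln lam + 2 * ln r - 2 * ln m <= 2 * b / r.
  have -> : ln lam + 2 * ln r - 2 * ln m = ln (X / m ^+ 2).
    have l1 (x : R) : 0 < x -> ln (X / x ^+ 2) = ln X - 2 * ln x.
      by move=> x0; rewrite ln_div ?posrE ?exprn_gt0// lnXn// mulr_natl.
    by rewrite !l1//; ring.
  apply: le_trans (_ : ln ((1 + b / m) ^+ 2) <= _).
    have q1 : 0 < X / m ^+ 2 by rewrite divr_gt0// exprn_gt0.
    have q2 : 0 < (1 + b / m) ^+ 2 by rewrite exprn_gt0// addr_gt0// divr_gt0.
    rewrite ler_ln ?posrE// ler_pdivrMr ?exprn_gt0//.
    apply: le_trans XB _; rewrite -exprMn mulrDl mul1r divfK ?gt_eqF//.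
    by have := mulr_gt0 b0 m0; rewrite sqrrD; lra.
  have bm : 0 < b / m by rewrite divr_gt0.
  rewrite lnXn; last by rewrite addr_gt0.
  have bm1 : b / m <= b / r by rewrite ler_pM2l// lef_pV2 ?posrE.
  have l1 : ln (1 + b / m) <= b / m by apply: le_ln1Dx; lra.
  by rewrite mulr2n -[2 * b / r]mulrA; lra.
have e3 : 0 < e / 4 by lra.
have ar' : cnorm a' != r by rewrite lt_eqF.
apply: filterS2 (mean_log_linear r0 ar e3) (mean_log_linear r0 ar' e3) => N.
rewrite (max_l (ltW a'r)) -/m => h1 h2.
rewrite (@Mr_ext _ _ _ _ (fun w => ln lam + 2 * ln (cnorm (w - a')) - 2 * ln (cnorm (w - a)))); last first.
  move=> w; rewrite gtr0_norm// => wr.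
  have wa : 0 < cnorm (w - a).
    by rewrite cnorm_gt0 subr_eq0; apply: contraNneq ar => <-; rewrite wr.
  have wa' : 0 < cnorm (w - a').
    by rewrite cnorm_gt0 subr_eq0; apply: contraNneq ar' => <-; rewrite wr.
  have -> : 1 + b ^+ 2 / cnorm (w - a) ^+ 2 = lam * cnorm (w - a') ^+ 2 / cnorm (w - a) ^+ 2.
    by rewrite -circ//; field; rewrite gt_eqF.
  have l2 (x y t : R) : 0 < x -> 0 < y -> 0 < t -> ln (x * y ^+ 2 / t ^+ 2) = ln x + 2 * ln y - 2 * ln t.
    move=> x0 y0 t0; have y2 : 0 < y ^+ 2 by rewrite exprn_gt0.
    have t2 : 0 < t ^+ 2 by rewrite exprn_gt0.
    rewrite ln_div ?posrE ?mulr_gt0// lnM ?posrE// !lnXn//; ring.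
  exact: l2.
by rewrite MrB MrD !MrZ Mr_cst; move: h1 h2 key; rewrite !ler_norml; clear; lra.
Qed.

End LogMean.

(** * Harmonic functions, Poisson's formula and estimates of its kernel *)

Section HarmonicApproximation.
Variable R : realType.
Local Notation C := (complex R).
Local Notation "x %:C" := (real_complex R x).
Implicit Types (z w a b l : C) (r e d s B : R) (G H u : C -> C) (v phi psi : C -> R).

(** Harmonicity on the closed disc, encoded as uniform approximability by real parts of polynomials:
    Poisson's formula then passes from polynomials to the limit. *)
Definition happ r v := forall e, 0 < e -> exists n (c : nat -> C),
  forall z, cnorm z <= r -> `|v z - complex.Re (\sum_(k < n) c k * z ^+ k)| <= e.

Lemma ReD z w : complex.Re (z + w) = complex.Re z + complex.Re w.
Proof. by case: z; case: w. Qed.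

Lemma ReB z w : complex.Re (z - w) = complex.Re z - complex.Re w.
Proof. by case: z; case: w. Qed.

Lemma happD r v phi : happ r v -> happ r phi -> happ r (fun z => v z + phi z).
Proof.
move=> hv hp e e0; have e2 : 0 < e / 2 by lra.
have [n [c hc]] := hv _ e2; have [m [d hd]] := hp _ e2.
exists (n + m)%N, (fun k => (if (k < n)%N then c k else 0) + (if (k < m)%N then d k else 0)) => z zr.
have ext (p q : nat) (f : nat -> C) : (p <= q)%N ->
    \sum_(k < q) (if (k < p)%N then f k else 0) * z ^+ k = \sum_(k < p) f k * z ^+ k.
  move=> pq; rewrite -(big_mkord xpredT (fun k => (if (k < p)%N then f k else 0) * z ^+ k)).
  rewrite -(big_mkord xpredT (fun k => f k * z ^+ k)) (big_cat_nat _ pq)//= [X in _ + X]big_nat_cond.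
  rewrite [X in _ + X]big1 ?addr0; last first.
    by move=> k /andP[/andP[pk _] _]; rewrite ltnNge pk mul0r.
  by apply: eq_big_nat => k /andP[_ ->].
have h1 := hc z zr; have h2 := hd z zr.
under eq_bigr do rewrite mulrDl.
rewrite big_split /= ReD !ext ?leq_addr ?leq_addl//.
by move: h1 h2; rewrite !ler_norml; lra.
Qed.

Lemma happZ r (t : R) v : happ r v -> happ r (fun z => t * v z).
Proof.
move=> hv e e0; have t0 : 0 < `|t| + 1 by rewrite ltr_wpDl.
have [n [c hc]] := hv _ (divr_gt0 e0 t0).
exists n, (fun k => t%:C * c k) => z zr.
under eq_bigr do rewrite -mulrA.
rewrite -mulr_sumr Re_real -mulrBr normrM.
have := hc z zr; rewrite ler_pdivlMr// => h; apply: le_trans h.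
by rewrite mulrC ler_wpM2l// lerDl.
Qed.

Lemma happ_cst r (t : R) : happ r (fun=> t).
Proof.
move=> e e0; exists 1%N, (fun=> t%:C) => z _.
by rewrite big_ord1 expr0 mulr1 /= subrr normr0 ltW.
Qed.

Lemma happ_eq r v phi : (forall z, cnorm z <= r -> v z = phi z) -> happ r v -> happ r phi.
Proof. by move=> h hv e /hv[n [c hc]]; exists n, c => z zr; rewrite -h// hc. Qed.

Lemma happ_sum r (I : eqType) (t : seq I) (F : I -> C -> R) : (forall i, i \in t -> happ r (F i)) ->
  happ r (fun z => \sum_(i <- t) F i z).
Proof.
elim: t => [|i t IH] h.
  by apply: happ_eq (@happ_cst r 0) => z _; rewrite big_nil.
apply: (@happ_eq _ (fun z => F i z + \sum_(j <- t) F j z)) => [z _|]; first by rewrite big_cons.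
by apply: happD; [apply: h; rewrite mem_head|apply: IH => j jt; apply: h; rewrite inE jt orbT].
Qed.

(** Through |1 + z|^2 = 1 + 2 Re z + |z|^2, and ln (1 + t) between t / (1 + t) and t; no complex
    logarithm is involved. *)
Lemma ln_cnorm1D z : cnorm z <= 4^-1 -> `|ln (cnorm (1 + z)) - complex.Re z| <= 4 * cnorm z ^+ 2.
Proof.
move=> z4; have z0 := cnorm_ge0 z; have := Re_cnorm z; rewrite ler_norml => /andP[x1 x2].
pose t := 2 * complex.Re z + cnorm z ^+ 2.
have e1 : cnorm (1 + z) ^+ 2 = 1 + t.
  by rewrite cnorm_sqr /t cnorm_sqr; case: (z) => x y /=; ring.
have n0 : 0 < cnorm (1 + z) by have := cnorm_subl 1 (- z); rewrite opprK cnormN cnorm1; lra.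
have t1 : 0 < 1 + t by rewrite -e1 exprn_gt0.
have e2 : ln (cnorm (1 + z)) = ln (1 + t) / 2 by rewrite -e1 lnXn// mulr2n; lra.
have up : ln (1 + t) <= t by apply: le_ln1Dx; lra.
have i0 : 0 < (1 + t)^-1 by rewrite invr_gt0.
have lo : - ln (1 + t) <= (1 + t)^-1 - 1.
  by rewrite -lnV ?posrE//; have := le_ln1Dx (_ : -1 < (1 + t)^-1 - 1); rewrite subrKC; apply; lra.
have ti : (1 + t)^-1 * (1 + t) = 1 by rewrite mulVf// gt_eqF.
have q : 9 / 16 <= 1 + t.
  rewrite -e1 (_ : 9 / 16 = (3 / 4) ^+ 2); last by field.
  rewrite lerXn2r ?nnegrE ?cnorm_ge0//; have := cnorm_subl 1 (- z); rewrite opprK cnormN cnorm1; lra.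
have i1 : (1 + t)^-1 <= 16 / 9.
  rewrite -(ler_pM2r t1) ti; lra.
have tn : `|t| <= 9 / 4 * cnorm z.
  rewrite ler_norml /t; apply/andP; split; nra.
have t2 : t ^+ 2 <= 81 / 16 * cnorm z ^+ 2.
  rewrite -(real_normK (num_real t)) (_ : 81 / 16 * _ = (9 / 4 * cnorm z) ^+ 2); last by field.
  by rewrite lerXn2r ?nnegrE ?normr_ge0// mulr_ge0.
have key : 1 - (1 + t)^-1 >= t - 9 * cnorm z ^+ 2.
  rewrite (_ : 1 - (1 + t)^-1 = t - t ^+ 2 * (1 + t)^-1); last by field; rewrite gt_eqF.
  rewrite lerD2l lerN2; apply: le_trans (ler_pM (sqr_ge0 _) (ltW i0) t2 i1) _; lra.
rewrite e2 ler_norml; have := sqr_ge0 (cnorm z); rewrite /t in key up *; lra.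
Qed.

Lemma ln_cder u z l : u z != 0 -> cder u z l -> forall e, 0 < e -> \forall w \near nb z,
  `|ln (cnorm (u w)) - ln (cnorm (u z)) - complex.Re (l / u z * (w - z))| <= e * cnorm (w - z).
Proof.
move=> uz du e e0; have p : 0 < cnorm (u z) by rewrite cnorm_gt0.
pose A := cnorm l / cnorm (u z) + 1.
have A0 : 0 < A by rewrite ltr_wpDl// divr_ge0// cnorm_ge0.
have e2 : 0 < Num.min (e / 2) 1 * cnorm (u z) by rewrite mulr_gt0// lt_min ltr01 andbT divr_gt0.
have d1 : 0 < Num.min (A^-1 / 4) (e / 8 / A ^+ 2).
  by rewrite lt_min !divr_gt0 ?invr_gt0 ?exprn_gt0.
near=> w.
have h1 : cnorm (u w - u z - l * (w - z)) <= Num.min (e / 2) 1 * cnorm (u z) * cnorm (w - z).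
  by near: w; exact: du.
have : cnorm (w - z) < Num.min (A^-1 / 4) (e / 8 / A ^+ 2) by near: w; exact: nb_ball.
rewrite lt_min => /andP[w1 w2].
have wz := cnorm_ge0 (w - z).
pose y := (u w - u z) / u z.
have yl : cnorm (y - l / u z * (w - z)) <= Num.min (e / 2) 1 * cnorm (w - z).
  rewrite (_ : y - _ = (u w - u z - l * (w - z)) / u z); last by rewrite /y; field.
  by rewrite cnormf ler_pdivrMr// mulrAC.
have m1 : Num.min (e / 2) 1 <= 1 by rewrite ge_min lexx orbT.
have m2 : Num.min (e / 2) 1 <= e / 2 by rewrite ge_min lexx.
have yA : cnorm y <= A * cnorm (w - z).
  rewrite -(subrK (l / u z * (w - z)) y); apply: le_trans (cnormD _ _) _.
  rewrite cnormM cnormf /A mulrDl mul1r addrC lerD2l; apply: le_trans yl _.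
  by rewrite ler_piMl.
have y4 : cnorm y <= 4^-1.
  apply: le_trans yA _; rewrite -(ler_pM2l (_ : 0 < A^-1)) ?invr_gt0// mulrA mulVf ?gt_eqF// mul1r.
  exact: ltW.
have uw : u w != 0.
  apply/eqP => u0; move: y4; rewrite /y u0 sub0r mulNr divff// cnormN cnorm1; lra.
have -> : ln (cnorm (u w)) = ln (cnorm (u z)) + ln (cnorm (1 + y)).
  rewrite -lnM ?posrE ?cnorm_gt0//; last by rewrite /y mulrBl divff// subrKC mulf_neq0 ?invr_eq0.
  by rewrite -cnormM; congr (ln (cnorm _)); rewrite /y; field.
have h2 := ln_cnorm1D y4.
have h3 : `|complex.Re y - complex.Re (l / u z * (w - z))| <= e / 2 * cnorm (w - z).
  rewrite -ReB; apply: le_trans (Re_cnorm _) _; apply: le_trans yl _.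
  by rewrite ler_wpM2r.
have h4 : 4 * cnorm y ^+ 2 <= e / 2 * cnorm (w - z).
  have : cnorm y ^+ 2 <= (A * cnorm (w - z)) ^+ 2 by rewrite lerXn2r ?nnegrE ?cnorm_ge0// mulr_ge0// ltW.
  move=> h; apply: le_trans (_ : 4 * (A * cnorm (w - z)) ^+ 2 <= _); first by rewrite ler_pM2l.
  rewrite exprMn [cnorm (w - z) ^+ 2]expr2 !mulrA ler_wpM2r//.
  move: w2; rewrite ltr_pdivlMr ?exprn_gt0// => /ltW; lra.
move: h2 h3; rewrite !ler_norml; lra.
Unshelve. all: by end_near. Qed.

Lemma cder_poly n (c : nat -> C) z :
  cder (fun w => \sum_(k < n) c k / k.+1%:R * w ^+ k.+1) z (\sum_(k < n) c k * z ^+ k).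
Proof.
have cX k : cder (fun w => w ^+ k.+1) z (k.+1%:R * z ^+ k).
  elim: k => [|k IH]; first by rewrite expr0 mulr1; apply: cder_eq (cder_id z); near=> w; rewrite expr1.
  have := cderM (cder_id z) IH; rewrite mul1r => h.
  rewrite (_ : k.+2%:R * _ = z ^+ k.+1 + z * (k.+1%:R * z ^+ k)); last first.
    by rewrite -[k.+2%:R]natr1 exprS; ring.
  by apply: cder_eq h; near=> w; rewrite [RHS]exprS.
elim: n => [|n IH].
  by rewrite big_ord0; apply: cder_eq (cder_cst 0 z); near=> w; rewrite big_ord0.
rewrite big_ord_recr /=.
have := cderD IH (cderM (cder_cst (c n / n.+1%:R) z) (cX n)).
rewrite mul0r add0r (_ : c n / n.+1%:R * _ = c n * z ^+ n); last by rewrite mulrA divfK// pnatr_eq0.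
by apply: cder_eq; near=> w; rewrite big_ord_recr.
Unshelve. all: by end_near. Qed.

(** u' / u is approximated by a polynomial whose primitive Q has real part close to ln |u| - ln
    |u(0)|: along each segment from 0 the difference has slope at most e / r. No branch of log u is
    chosen. *)
Lemma happ_log r s u : hol 0 s u -> (forall w, cnorm w < s -> u w != 0) -> 0 < r < s ->
  happ r (fun z => ln (cnorm (u z))).
Proof.
move=> hu u0 rs e e0; have /andP[r0 rs'] := rs.
have hq : hol 0 s (fun w => cD u w / u w).
  by move=> w ws; apply: cdiffM; [exact: (hol_cD hu)|apply: cdiffV; [rewrite u0// -(subr0 w)|exact: hu]].
have er : 0 < e / r by rewrite divr_gt0.
have [n [c hc]] := taylor_approx hq rs er.
pose Q w := \sum_(k < n) c k / k.+1%:R * w ^+ k.+1.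
have key z : cnorm z <= r -> `|ln (cnorm (u z)) - complex.Re (Q z) - ln (cnorm (u 0))| <= e.
  move=> zr; pose phi w := ln (cnorm (u w)) - complex.Re (Q w).
  have Q0 : complex.Re (Q 0) = 0.
    by rewrite /Q big1// => k _; rewrite exprS mul0r mulr0.
  have := @mean_value_ineq R (fun t => (phi (t%:C * z))%:C) (e / r * cnorm z).
  have phi0 : phi 0 = ln (cnorm (u 0)) by rewrite /phi Q0 subr0.
  rewrite -rmorphB cnormR rmorph1 mul1r rmorph0 mul0r phi0 => h.
  apply: le_trans (h _) _; last first.
    by rewrite mulrAC ler_pdivrMr// ler_wpM2l// ltW.
  move=> t d /andP[t0 t1] d0; pose x := t%:C * z.
  have xr : cnorm x <= r by rewrite cnormM cnormR ger0_norm// (le_trans _ zr)// ler_piMl// cnorm_ge0.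
  have xs : cnorm x < s by exact: le_lt_trans xr rs'.
  have dx : cder u x (cD u x) by apply: cDP; apply: hu; rewrite subr0.
  pose z1 := cnorm z + 1.
  have z10 : 0 < z1 by rewrite ltr_wpDl// cnorm_ge0.
  have d2 : 0 < d / 2 / z1 by rewrite !divr_gt0.
  have [f1 f10 hf1] := ln_cder (u0 _ xs) dx d2.
  have [f2 f20 hf2] := cder_poly n c x d2.
  have m0 : 0 < Num.min f1 f2 by rewrite lt_min f10.
  exists (Num.min f1 f2 / z1); first by rewrite divr_gt0.
  move=> y _; rewrite ltr_pdivlMr// => yt.
  have yx : y%:C * z - x = (y - t)%:C * z by rewrite /x rmorphB /=; ring.
  have yn : cnorm (y%:C * z - x) = `|y - t| * cnorm z by rewrite yx cnormM cnormR.
  have ny : cnorm (y%:C * z - x) < Num.min f1 f2.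
    rewrite yn; apply: le_lt_trans yt; rewrite ler_wpM2l// lerDl//.
  have /andP[n1 n2] : (cnorm (y%:C * z - x) < f1) && (cnorm (y%:C * z - x) < f2) by rewrite -lt_min.
  have h1 := hf1 _ n1; have h2 := hf2 _ n2.
  rewrite -rmorphB cnormR.
  set P := \sum_(k < n) c k * x ^+ k in h2.
  have h3 : `|complex.Re (cD u x / u x * (y%:C * z - x)) - complex.Re (P * (y%:C * z - x))| <= e / r * (`|y - t| * cnorm z).
    rewrite -ReB -mulrBl; apply: le_trans (Re_cnorm _) _; rewrite cnormM yn.
    by rewrite ler_wpM2r ?mulr_ge0 ?cnorm_ge0// hc.
  have h4 : `|complex.Re (Q (y%:C * z)) - complex.Re (Q x) - complex.Re (P * (y%:C * z - x))| <= d / 2 / z1 * cnorm (y%:C * z - x).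
    by rewrite -!ReB; apply: le_trans (Re_cnorm _) h2.
  have h5 : d / 2 / z1 * cnorm (y%:C * z - x) <= d / 2 * `|y - t|.
    rewrite yn -mulrA ler_pM2l; last lra.
    rewrite mulrC ler_pdivrMr// ler_wpM2l// lerDl//.
  rewrite /phi -/x mulrDl -mulrA [cnorm z * _]mulrC.
  by move: h1 h3 h4 h5; rewrite !ler_norml; clear; lra.
exists n.+1, (fun k => if k is k'.+1 then c k' / k'.+1%:R else (ln (cnorm (u 0)))%:C) => z zr.
rewrite big_ord_recl /= expr0 mulr1 ReD.
have -> : \sum_(i < n) c i / (lift ord0 i)%:R * z ^+ lift ord0 i = Q z by [].
by have := key z zr; rewrite addrAC -addrA -opprD.
Qed.

(** Poisson kernel: for |w| = r it equals (r^2 - |z|^2) / |w - z|^2. *)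
Definition pk z w : R := complex.Re ((w + z) / (w - z)).

Lemma pkE z w r : cnorm w = r -> cnorm z < r ->
  (pk z w)%:C = w / (w - z) + conjc (z / (w - z)).
Proof.
move=> wr zr; have wz := circle_ne zr wr.
have e1 : w / (w - z) = 1 + z / (w - z) by field.
have e2 : (w + z) / (w - z) = 1 + (z / (w - z) + z / (w - z)) by field.
rewrite /pk e1 e2; case: (z / (w - z)) => x y.
by apply/eqP; rewrite eq_complex /=; apply/andP; split; apply/eqP; ring.
Qed.

Lemma pk_bound z w r : cnorm w = r -> cnorm z < r -> `|pk z w| <= (r + cnorm z) / (r - cnorm z).
Proof.
move=> wr zr; apply: le_trans (Re_cnorm _) _; rewrite cnormf.
have rz : 0 < r - cnorm z by rewrite subr_gt0.
rewrite ler_pM ?cnorm_ge0 ?invr_ge0 ?cnorm_ge0//.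
  by apply: le_trans (cnormD _ _) _; rewrite wr.
rewrite lef_pV2 ?posrE ?cnorm_gt0 ?(circle_ne zr wr)//.
by have := cnorm_subl w z; rewrite wr.
Qed.

(** [pkE] splits the kernel into the Cauchy kernel, which returns G(z), and a conjugate part equal
    on the circle to conj z w / (r^2 - conj z w). The latter is holomorphic beyond the circle and 0
    at the origin, so its mean against G vanishes. *)
Lemma poisson_hol r z G : (forall s, hol 0 s G) -> cnorm z < r -> forall e, 0 < e ->
  \forall N \near \oo, `|Mr N r (fun w => pk z w * complex.Re (G w)) - complex.Re (G z)| <= e.
Proof.
move=> hG zr e e0; have r0 : 0 < r by apply: le_lt_trans zr; exact: cnorm_ge0.
pose s := 2 * r ^+ 2 / (cnorm z + r).
have zr0 : 0 < cnorm z + r by rewrite ltr_wpDl// cnorm_ge0.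
have rs : r < s by rewrite ltr_pdivlMr//; nra.
have r2 : r ^+ 2 != 0 by rewrite expf_neq0// gt_eqF.
pose q := (r ^+ 2)%:C.
have q0 : q != 0 by rewrite -cnorm_eq0 cnormR normr_eq0.
pose H w := G w * (conjc z * w / (q - conjc z * w)).
have hH : hol 0 s H.
  move=> w; rewrite subr0 => ws; apply: cdiffM; first by apply: (hG s); rewrite subr0.
  apply: cdiffM; first by apply: cdiffM; [exact: cdiff_cst|exact: cdiff_id].
  apply: cdiffV; last by apply: cdiffB; [exact: cdiff_cst|apply: cdiffM; [exact: cdiff_cst|exact: cdiff_id]].
  rewrite subr_eq0 eq_sym; apply: contraTneq ws => /(congr1 (@cnorm R)).
  rewrite cnormM cnorm_conj cnormR ger0_norm ?sqr_ge0// => h1.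
  rewrite -leNgt /s ler_pdivrMr// -h1.
  have := cnorm_ge0 z; have := cnorm_ge0 w; nra.
have e2 : 0 < e / 2 by lra.
have h1 := cauchy_formula (hG (r + 1)) zr (_ : r < r + 1) e2.
have h2 := mvp hH (_ : 0 < r < s) e2; rewrite r0 rs in h2.
have {}h1 := h1 ltac:(lra); have {}h2 := h2 isT.
apply: filterS2 h1 h2 => N; rewrite /H mulr0 mul0r mulr0 subr0 => h1 h2.
have -> : Mr N r (fun w => pk z w * complex.Re (G w)) = complex.Re (Mc N r (fun w => G w * (w / (w - z))) + Mc N r H).
  rewrite -McD -Mr_Re; apply: Mr_ext => w; rewrite gtr0_norm// => wr.
  rewrite -Re_real (pkE wr zr); congr complex.Re; rewrite /H mulrDl mulrC; congr (_ + _).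
  rewrite mulrC; congr (_ * _); have wz := circle_ne zr wr.
  have w0 : w != 0 by rewrite -cnorm_gt0 wr.
  have qE : q = w * conjc w by rewrite mul_conjc wr.
  have cwz : conjc w - conjc z != 0 by rewrite -rmorphB conjc_eq0.
  have qw : q - conjc z * w = w * (conjc w - conjc z) by rewrite qE; ring.
  by rewrite rmorphM fmorphV rmorphB /= qw; field; rewrite w0 cwz.
rewrite -ReB; apply: le_trans (Re_cnorm _) _; rewrite addrAC.
by apply: le_trans (cnormD _ _) _; lra.
Qed.

Lemma poisson r z v : happ r v -> cnorm z < r -> forall e, 0 < e ->
  \forall N \near \oo, `|Mr N r (fun w => pk z w * v w) - v z| <= e.
Proof.
move=> hv zr e e0.
have rz : 0 < r - cnorm z by rewrite subr_gt0.
pose K := (r + cnorm z) / (r - cnorm z).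
have z0 := cnorm_ge0 z.
have r0 : 0 < r by lra.
have K0 : 0 <= K by rewrite divr_ge0 ?(ltW rz)//; lra.
pose d := e / 2 / (K + 1).
have d0 : 0 < d by rewrite /d !divr_gt0// ltr_wpDl.
have [n [c hc]] := hv d d0.
pose Q w := \sum_(k < n) c k * w ^+ k.
have hQ s : hol 0 s Q.
  by move=> w _; apply: cdiff_sum => k; apply: cdiffM; [exact: cdiff_cst|apply: cdiffX; exact: cdiff_id].
have e2 : 0 < e / 2 by lra.
apply: filterS (poisson_hol hQ zr e2) => N hN.
have h1 : `|Mr N r (fun w => pk z w * v w) - Mr N r (fun w => pk z w * complex.Re (Q w))| <= K * d.
  rewrite -MrB; apply: le_trans (norm_Mr _ _ _) _; rewrite -[leRHS](Mr_cst N r); apply: ler_Mr => w.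
  rewrite gtr0_norm// => wr; rewrite -mulrBr normrM ler_pM// ?pk_bound//.
  by rewrite hc// wr.
have h2 : `|v z - complex.Re (Q z)| <= d by apply: hc; exact: ltW.
have h3 : (K + 1) * d = e / 2 by rewrite /d mulrC divfK// gt_eqF// ltr_wpDl.
move: h1 h2 hN; rewrite !ler_norml; lra.
Qed.

Lemma pk0 w : w != 0 -> pk 0 w = 1.
Proof. by move=> w0; rewrite /pk addr0 subr0 divff. Qed.

Lemma happ_mean r v : happ r v -> 0 < r -> forall e, 0 < e ->
  \forall N \near \oo, `|Mr N r v - v 0| <= e.
Proof.
move=> hv r0 e e0; have z0 : cnorm (0 : C) < r by rewrite cnorm0.
apply: filterS (poisson hv z0 e0) => N; rewrite (@Mr_ext _ _ _ _ v)// => w.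
by rewrite gtr0_norm// => wr; rewrite pk0 ?mul1r// -cnorm_gt0 wr.
Qed.

(** The condition |z| + 2 |b| <= r gives |w - z| <= 2 |w - z - b|, so the increment of the kernel is
    controlled by |w - z|^-2 alone. *)
Lemma pk_diff z b w r : cnorm w = r -> cnorm z + 2 * cnorm b <= r -> cnorm z < r ->
  cnorm (z + b) < r ->
  `|pk (z + b) w - pk z w| <= 4 * r * cnorm b / cnorm (w - z) ^+ 2.
Proof.
move=> wr zb zr zbr; rewrite /pk -ReB; apply: le_trans (Re_cnorm _) _.
have wz := circle_ne zr wr; have wzb := circle_ne zbr wr.
rewrite (_ : _ - _ = 2%:R * w * b / ((w - (z + b)) * (w - z))); last first.
  have wzb' : w - z - b != 0 by rewrite -addrA -opprD.
  by field; rewrite ?wz ?wzb' ?wzb.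
rewrite cnormf !cnormM cnormn wr.
have n1 : 0 < cnorm (w - z) by rewrite cnorm_gt0.
have n2 : 0 < cnorm (w - (z + b)) by rewrite cnorm_gt0.
have h : cnorm (w - z) <= 2 * cnorm (w - (z + b)).
  have := cnorm_subl (w - z) b; rewrite -addrA -opprD => h1.
  by have := cnorm_subl w z; rewrite wr; lra.
rewrite ler_pdivrMr ?mulr_gt0// [leRHS]mulrAC ler_pdivlMr ?exprn_gt0//.
have b0 := cnorm_ge0 b; have r0 : 0 < r by apply: le_lt_trans zr; exact: cnorm_ge0.
rewrite [leLHS](_ : _ = 2 * r * cnorm b * cnorm (w - z) * cnorm (w - z)); last ring.
rewrite [leRHS](_ : _ = 2 * r * cnorm b * cnorm (w - z) * (2 * cnorm (w - (z + b)))); last ring.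
by rewrite ler_wpM2l// !mulr_ge0// ltW.
Qed.

(** (s^2 - r^2) / |w - z|^2 is the real part of (w + z) / (w - z), whose average over the sample
    points is exactly (1 + Y) / (1 - Y) with Y = (r / w)^(2^N); |Y| <= 1/2 gives the 3. One N serves
    all w at once, as the later exchange of averages requires. *)
Lemma mean_inv_sqr r s : 0 < r < s -> \forall N \near \oo, forall w, cnorm w = s ->
  Mr N r (fun z => (cnorm (w - z) ^+ 2)^-1) <= 3 / (s ^+ 2 - r ^+ 2).
Proof.
move=> /andP[r0 rs]; have s0 : 0 < s by lra.
have q01 : 0 <= r / s < 1 by rewrite divr_ge0 ?(ltW r0) ?(ltW s0)//= ltr_pdivrMr// mul1r.
have h2 : 0 < (2^-1 : R) by lra.
apply: filterS (pow2_small q01 h2) => N hN w ws.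
have d0 : 0 < s ^+ 2 - r ^+ 2 by rewrite subr_gt0 ltrXn2r ?(ltW r0).
have w0 : w != 0 by rewrite -cnorm_gt0 ws.
pose n := (2 ^ N)%N.
pose Y := (r%:C / w) ^+ n.
have Yn : cnorm Y <= 2^-1 by rewrite cnormX cnormf cnormR gtr0_norm// ws ltW.
have Y1 : 1 - Y != 0.
  by rewrite subr_eq0 eq_sym; apply: contraTneq Yn => ->; rewrite cnorm1 -ltNge; lra.
(* A geometric sum at each sample point, whose non-constant terms average to 0 by [sum_rt]. *)
have geo : Mc N r (fun z => (1 - z / w)^-1) = (1 - Y)^-1.
  transitivity ((1 - Y)^-1 * Mc N r (fun z => \sum_(l < n) (z / w) ^+ l)).
    rewrite -McZ /Mc; congr (_ * _); apply: eq_bigr => k _.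
    set y := _ / w.
    have yn : y ^+ n = Y by rewrite /y mulrAC exprMn rt_expn mulr1.
    have y1 : 1 - y != 0.
      rewrite subr_eq0 eq_sym; apply/eqP => y1; move: Y1.
      by rewrite -yn y1 expr1n subrr eqxx.
    apply: (mulfI Y1); rewrite mulrA divff// mul1r -yn -[1 - y ^+ n]opprB subrX1.
    by rewrite -mulNr opprB mulrC mulrA mulVf ?mul1r.
  rewrite Mc_sum (bigD1 (Ordinal (expn_gt0 2 N : 0 < n)%N))//= big1 ?addr0.
    rewrite (_ : Mc N r _ = 1) ?mulr1//.
    by rewrite -[RHS](Mc_cst N r); congr (_ * _); apply: eq_bigr => k _; rewrite expr0.
  move=> l l0; rewrite /Mc.
  under eq_bigr do rewrite mulrAC exprMn.
  rewrite -mulr_sumr sum_rt ?mulr0//.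
  rewrite ltn_ord andbT lt0n; apply: contraNneq l0 => l0.
  by apply/eqP/val_inj.
rewrite ler_pdivlMr// mulrC -MrZ.
rewrite (@Mr_ext _ _ _ _ (fun z => complex.Re (-1 + 2%:R * (1 - z / w)^-1))).
  rewrite (Mr_Re N r (fun z => -1 + 2%:R * (1 - z / w)^-1)) McD Mc_cst McZ geo.
  apply: le_trans (ler_norm _) _; apply: le_trans (Re_cnorm _) _.
  rewrite (_ : -1 + _ = (1 + Y) / (1 - Y)); last by field.
  rewrite cnormf ler_pdivrMr ?cnorm_gt0//.
  have := cnormD 1 Y; have := cnorm_subl 1 Y; rewrite cnorm1; lra.
move=> z; rewrite gtr0_norm// => zr.
have zs : cnorm z < s by rewrite zr.
have wz := circle_ne zs ws.
have -> : -1 + 2%:R * (1 - z / w)^-1 = (w + z) / (w - z) by field; rewrite w0 wz.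
have -> : (w + z) / (w - z) = (w + z) * conjc (w - z) * ((cnorm (w - z) ^+ 2)^-1)%:C.
  rewrite (_ : ((cnorm (w - z) ^+ 2)^-1)%:C = ((w - z) * conjc (w - z))^-1); last by rewrite mul_conjc fmorphV.
  rewrite -mulrA; congr (_ * _).
  by rewrite invfM mulrCA divff ?mulr1// conjc_eq0.
rewrite [X in complex.Re X]mulrC Re_real [RHS]mulrC; congr (_ * _).
by rewrite -ws -zr !cnorm_sqr; case: (w) => x y; case: (z) => x' y' /=; ring.
Qed.

End HarmonicApproximation.

(** * Laurent forms, orders, finiteness of zeros and poles, derivatives *)

Section MeromorphicGerms.
Variable R : realType.
Local Notation C := (complex R).
Local Notation "x %:C" := (real_complex R x).
Implicit Types (z w a b c : C) (r d s B : R) (e f g h u : C -> C) (k l m : int).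

(** Connectedness of the plane: the indicator of P along the segment from z to w is locally
    constant, so [mean_value_ineq] with slope 0 forbids it to go from 1 to 0. *)
Lemma open_closed_all (P : C -> Prop) :
  (forall z, P z -> \forall w \near nb z, P w) ->
  (forall z, ~ P z -> \forall w \near nb z, ~ P w) ->
  forall z w, P z -> P w.
Proof.
move=> hP hN z w Pz; apply: contrapT => nPw.
pose phi (t : R) : C := if pselect (P (z + t%:C * (w - z))) then 1 else 0.
have := @mean_value_ineq R phi 0.
have -> : phi 0 = 1 by rewrite /phi rmorph0 mul0r addr0; case: pselect.
have -> : phi 1 = 0 by rewrite /phi rmorph1 mul1r subrKC; case: pselect.
rewrite sub0r cnormN cnorm1 => h.
suff : (1 : R) <= 0 by lra.
apply: h => t e _ e0; pose x := z + t%:C * (w - z).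
have n0 : 0 < cnorm (w - z) + 1 by rewrite ltr_wpDl// cnorm_ge0.
have loc (Q : C -> Prop) : (\forall v \near nb x, Q v) -> exists2 d, 0 < d &
    forall s : R, `|s - t| < d -> Q (z + s%:C * (w - z)).
  move=> [d d0 hd]; exists (d / (cnorm (w - z) + 1)); first exact: divr_gt0.
  move=> s; rewrite ltr_pdivlMr// => sd; apply: hd.
  rewrite (_ : _ - x = (s - t)%:C * (w - z)); last by rewrite /x rmorphB /=; ring.
  rewrite cnormM cnormR; apply: le_lt_trans sd; rewrite ler_wpM2l// lerDl//.
case: (pselect (P x)) => Px.
  have [d d0 hd] := loc _ (hP _ Px); exists d => // s _ sd.
  have Ps := hd _ sd; rewrite /phi; case: pselect => // ?; case: pselect => // ?.
  by rewrite subrr cnorm0 mulr_ge0//; lra.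
have [d d0 hd] := loc _ (hN _ Px); exists d => // s _ sd.
have Ps := hd _ sd; rewrite /phi; case: pselect => // ?; case: pselect => // ?.
by rewrite subrr cnorm0 mulr_ge0//; lra.
Qed.

(** The equation is required off z only: values at single points carry no information, since f is
    arbitrary at its poles and quotients have a default value at zeros of the denominator. *)
Definition lform g z k e :=
  (\forall w \near nb z, cdiff e w) /\ \forall w \near pn z, g w = (w - z) ^ k * e w.

(** [mf] admits the zero function, [mer] does not; the identity theorem [mf_dichotomy] decides
    between [mer] and [null]. *)
Definition mf g := forall z, exists k e, lform g z k e.
Definition mer g := forall z, exists k e, lform g z k e /\ e z != 0.
Definition null g := forall z, \forall w \near pn z, g w = 0.
Definition aeq g h := forall z, \forall w \near pn z, g w = h w.

Lemma near_neq0 e z : cdiff e z -> e z != 0 -> \forall w \near nb z, e w != 0.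
Proof.
move=> ez e0; apply: filterS (ccont_neq0 (cdiff_ccont ez) e0) => w.
by apply: contraTneq => ->; rewrite cnorm0 -ltNge divr_gt0// cnorm_gt0.
Qed.

Lemma lform_uniq g z k e l h : lform g z k e -> e z != 0 -> lform g z l h -> h z != 0 -> k = l.
Proof.
suff wl k' e' l' h' : lform g z k' e' -> e' z != 0 -> lform g z l' h' -> h' z != 0 -> ~ (k' < l').
  move=> h1 h2 h3 h4; apply/eqP; rewrite eq_le !leNgt; apply/andP.
  by split; apply/negP; [apply: (wl _ _ _ _ h3 h4 h1 h2)|apply: (wl _ _ _ _ h1 h2 h3 h4)].
move=> [ce ge] ez [ch gh] hz kl.
have [n ln] : exists n : nat, l' = k' + n.+1%:Z.
  by exists `|(l' - k' - 1)%R|%N; lia.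
have ce0 := cdiff_ccont (nb_self ce); have ch0 := cdiff_ccont (nb_self ch).
have p : 0 < cnorm (e' z) by rewrite cnorm_gt0.
have q : 0 < cnorm (h' z) + 1 by rewrite ltr_wpDl// cnorm_ge0.
have d0 : 0 < Num.min 1 (cnorm (e' z) / 2 / (cnorm (h' z) + 1)).
  by rewrite lt_min ltr01 !divr_gt0.
have : \forall w \near pn z, False; last by move/filter_ex => [].
near=> w.
have wz : w != z by near: w; exact: pn_ne.
have h1 : g w = (w - z) ^ k' * e' w by near: w.
have h2 : g w = (w - z) ^ l' * h' w by near: w.
have h3 : cnorm (e' z) / 2 <= cnorm (e' w) by near: w; apply: nb_pn; exact: ccont_neq0.
have h4 : cnorm (h' w) <= cnorm (h' z) + 1 by near: w; apply: nb_pn; exact: ccont_bounded.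
have : cnorm (w - z) < Num.min 1 (cnorm (e' z) / 2 / (cnorm (h' z) + 1)).
  by near: w; apply: nb_pn; exact: nb_ball.
rewrite lt_min => /andP[w1 w2].
have wz0 : w - z != 0 by rewrite subr_eq0.
have : e' w = (w - z) ^+ n.+1 * h' w.
  apply: (mulfI (_ : (w - z) ^ k' != 0)); first by rewrite expfz_neq0.
  by rewrite -h1 h2 ln expfzDr// mulrA.
move/(congr1 (@cnorm R)); rewrite cnormM cnormX => h5.
have n0 := cnorm_ge0 (w - z).
have h6 : cnorm (w - z) ^+ n.+1 <= cnorm (w - z).
  by rewrite exprS ler_piMr// exprn_ile1// ltW.
have h7 : cnorm (e' w) <= cnorm (w - z) * (cnorm (h' z) + 1).
  by rewrite h5 ler_pM ?exprn_ge0 ?cnorm_ge0.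
by move: w2; rewrite ltr_pdivlMr// => /(le_lt_trans (le_trans h3 h7)); rewrite ltxx.
Unshelve. all: by end_near. Qed.

(* Meaningful only where g is not identically zero near z, which mer g guarantees. *)
Definition ord g z : int := xget 0 [set k | exists e, lform g z k e /\ e z != 0].

Lemma ordP g z : mer g -> exists e, lform g z (ord g z) e /\ e z != 0.
Proof.
move=> /(_ z)[k [e h]].
by apply: (@xgetPex _ (0 : int) [set k | exists e, lform g z k e /\ e z != 0]); exists k, e.
Qed.

Lemma ordE g z k e : lform g z k e -> e z != 0 -> ord g z = k.
Proof.
move=> h e0; have : exists e, lform g z (ord g z) e /\ e z != 0.
  by apply: (@xgetPex _ (0 : int) [set k | exists e, lform g z k e /\ e z != 0]); exists k, e.
by move=> [e' [h' e0']]; exact: lform_uniq h' e0' h e0.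
Qed.

Lemma lform_aeq g h z k e : (\forall w \near pn z, g w = h w) -> lform g z k e -> lform h z k e.
Proof.
move=> gh [ce ge]; split=> //; near=> w.
by rewrite -(near gh w)//; near: w.
Unshelve. all: by end_near. Qed.

Lemma aeq_sym g h : aeq g h -> aeq h g.
Proof. by move=> gh z; apply: filterS (gh z) => w ->. Qed.

Lemma mf_aeq g h : aeq g h -> mf g -> mf h.
Proof. by move=> gh mg z; have [k [e H]] := mg z; exists k, e; exact: lform_aeq H. Qed.

Lemma mer_aeq g h : aeq g h -> mer g -> mer h.
Proof.
by move=> gh mg z; have [k [e [H e0]]] := mg z; exists k, e; split=> //; exact: lform_aeq H.
Qed.

Lemma ord_aeq g h z : aeq g h -> mer g -> ord h z = ord g z.
Proof. by move=> gh mg; have [e [H e0]] := ordP z mg; apply: ordE e0; exact: lform_aeq H. Qed.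

Lemma mer_mf g : mer g -> mf g.
Proof. by move=> mg z; have [k [e [h _]]] := mg z; exists k, e. Qed.

Lemma mer_neq0 g z : mer g -> \forall w \near pn z, g w != 0.
Proof.
move=> mg; have [k [e [[ce ge] e0]]] := mg z; near=> w.
rewrite (near ge w)// mulf_neq0//.
  by rewrite expfz_neq0// subr_eq0; near: w; exact: pn_ne.
by near: w; apply: nb_pn; apply: near_neq0 => //; exact: nb_self ce.
Unshelve. all: by end_near. Qed.

Lemma mer_not_null g : mer g -> ~ null g.
Proof.
move=> mg ng; have [w [/negP + w0]] := filter_ex (filterI (mer_neq0 0 mg) (ng 0)).
by rewrite w0 eqxx; apply.
Qed.

Lemma mf_local g z : mf g -> (\forall w \near pn z, g w = 0) \/
  exists k e, lform g z k e /\ e z != 0.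
Proof.
move=> /(_ z)[k [e [[d d0 hd] ge]]].
have he : hol z d e by [].
have zz : cnorm (z - z) < d by rewrite subrr cnorm0.
have [e0|[n [E [hE Ez eE]]]] := hol_order he zz.
  by left; apply: filterS2 ge (nb_pn e0) => w -> ->; rewrite mulr0.
right; exists (k + n%:Z), E; split=> //; split; first exact: hol_near hE zz.
near=> w; rewrite (near ge w)// eE mulrA; congr (_ * _).
by rewrite expfzDr// subr_eq0; near: w; exact: pn_ne.
Unshelve. all: by end_near. Qed.

(** By [mf_local], vanishing near a point and being non-zero on a punctured neighbourhood are
    complementary and both open conditions, so connectedness decides. *)
Lemma mf_dichotomy g : mf g -> mer g \/ null g.
Proof.
move=> mg; case: (pselect (exists z, \forall w \near pn z, g w = 0)) => [[z0 hz0]|nz].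
  right => z; apply: (@open_closed_all (fun v => \forall w \near pn v, g w = 0)) hz0.
    move=> v gv; apply/nb_pnP; split=> //.
    by apply: filterS (pn_nb gv) => w; exact: nb_pn.
  move=> v gv; have [//|[k [e [[ce ge] e0]]]] := mf_local v mg.
  have gne : \forall w \near pn v, g w != 0.
    near=> w; rewrite (near ge w)// mulf_neq0//.
      by rewrite expfz_neq0// subr_eq0; near: w; exact: pn_ne.
    by near: w; apply: nb_pn; apply: near_neq0 => //; exact: nb_self ce.
  apply/nb_pnP; split=> //; apply: filterS (pn_nb gne) => w gw /filterI /(_ (nb_pn gw)).
  by move=> /filter_ex[x [-> /eqP]].
by left => z; have [h|//] := mf_local z mg; exfalso; apply: nz; exists z.
Unshelve. all: by end_near. Qed.

Lemma cdiff_subX a n z : cdiff (fun w => (w - a) ^+ n) z.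
Proof. by apply: cdiffX; apply: cdiffB; [exact: cdiff_id|exact: cdiff_cst]. Qed.

Lemma lformM g h z k l e u : lform g z k e -> lform h z l u ->
  lform (fun w => g w * h w) z (k + l) (fun w => e w * u w).
Proof.
move=> [ce ge] [cu hu]; split.
  by near=> w; apply: cdiffM; near: w.
near=> w; rewrite (near ge w)// (near hu w)// expfzDr; first ring.
by rewrite subr_eq0; near: w; exact: pn_ne.
Unshelve. all: by end_near. Qed.

Lemma lformV g z k e : lform g z k e -> e z != 0 ->
  lform (fun w => (g w)^-1) z (- k) (fun w => (e w)^-1).
Proof.
move=> [ce ge] e0; split.
  near=> w; apply: cdiffV; last by near: w.
  by near: w; apply: near_neq0 => //; exact: nb_self ce.
near=> w; rewrite (near ge w)// invfM; congr (_ * _).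
by rewrite invr_expz.
Unshelve. all: by end_near. Qed.

Lemma lformD g h z k l e u : lform g z k e -> lform h z l u -> k <= l ->
  lform (fun w => g w + h w) z k (fun w => e w + (w - z) ^+ `|l - k|%N * u w).
Proof.
move=> [ce ge] [cu hu] kl; split.
  near=> w; apply: cdiffD; first by near: w.
  by apply: cdiffM; [exact: cdiff_subX|near: w].
near=> w; rewrite (near ge w)// (near hu w)// mulrDr mulrA; congr (_ + _ * _).
rewrite exprnP -expfzDr; first by congr (_ ^ _); lia.
by rewrite subr_eq0; near: w; exact: pn_ne.
Unshelve. all: by end_near. Qed.

Lemma mfM g h : mf g -> mf h -> mf (fun w => g w * h w).
Proof.
move=> mg mh z; have [k [e H]] := mg z; have [l [u K]] := mh z.
by exists (k + l), (fun w => e w * u w); exact: lformM.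
Qed.

Lemma mfD g h : mf g -> mf h -> mf (fun w => g w + h w).
Proof.
move=> mg mh z; have [k [e H]] := mg z; have [l [u K]] := mh z.
have [kl|/ltW lk] := leP k l; first by eexists _, _; exact: lformD H K kl.
have := lformD K H lk => L; eexists _, _; apply: lform_aeq L.
by near=> w; exact: addrC.
Unshelve. all: by end_near. Qed.

Lemma mf_hol g : (forall z, cdiff g z) -> mf g.
Proof.
move=> hg z; exists 0, g; split; first by near=> w; exact: hg.
by near=> w; rewrite expr0z mul1r.
Unshelve. all: by end_near. Qed.

Lemma mf_cst a : mf (fun=> a).
Proof. by apply: mf_hol => z; exact: cdiff_cst. Qed.

Lemma mfN g : mf g -> mf (fun w => - g w).
Proof.
move=> mg; apply: (@mf_aeq (fun w => -1 * g w)); last exact: mfM (mf_cst _) mg.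
by move=> z; near=> w; rewrite mulN1r.
Unshelve. all: by end_near. Qed.

Lemma mfB g h : mf g -> mf h -> mf (fun w => g w - h w).
Proof. by move=> mg mh; apply: mfD mg (mfN mh). Qed.

Lemma merM g h : mer g -> mer h -> mer (fun w => g w * h w).
Proof.
move=> mg mh z; have [k [e [H e0]]] := mg z; have [l [u [K u0]]] := mh z.
by exists (k + l), (fun w => e w * u w); split; [exact: lformM|rewrite mulf_neq0].
Qed.

Lemma merV g : mer g -> mer (fun w => (g w)^-1).
Proof.
move=> mg z; have [k [e [H e0]]] := mg z.
by exists (- k), (fun w => (e w)^-1); split; [exact: lformV|rewrite invr_eq0].
Qed.

Lemma mer_cst a : a != 0 -> mer (fun=> a).
Proof.
move=> a0 z; exists 0, (fun=> a); split=> //; split; first by near=> w; exact: cdiff_cst.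
by near=> w; rewrite expr0z mul1r.
Unshelve. all: by end_near. Qed.

Lemma merN g : mer g -> mer (fun w => - g w).
Proof.
move=> mg; apply: (@mer_aeq (fun w => -1 * g w)).
  by move=> z; near=> w; rewrite mulN1r.
by apply: merM mg; apply: mer_cst; rewrite oppr_eq0 oner_eq0.
Unshelve. all: by end_near. Qed.

Lemma ordM g h z : mer g -> mer h -> ord (fun w => g w * h w) z = ord g z + ord h z.
Proof.
move=> mg mh; have [e [H e0]] := ordP z mg; have [u [K u0]] := ordP z mh.
by apply: ordE (lformM H K) _; rewrite mulf_neq0.
Qed.

Lemma ordV g z : mer g -> ord (fun w => (g w)^-1) z = - ord g z.
Proof.
move=> mg; have [e [H e0]] := ordP z mg.
by apply: ordE (lformV H e0) _; rewrite invr_eq0.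
Qed.

Lemma ord_cst a z : a != 0 -> ord (fun=> a) z = 0.
Proof.
move=> a0; apply: (@ordE _ _ _ (fun=> a)) => //; split; first by near=> w; exact: cdiff_cst.
by near=> w; rewrite expr0z mul1r.
Unshelve. all: by end_near. Qed.

Lemma ordN g z : mer g -> ord (fun w => - g w) z = ord g z.
Proof.
move=> mg; have m1 : mer (fun=> -1 : C) by apply: mer_cst; rewrite oppr_eq0 oner_eq0.
rewrite -[RHS]add0r -(ord_cst z (_ : -1 != 0 :> C)) ?oppr_eq0 ?oner_eq0//.
rewrite -ordM//; apply: ord_aeq; last exact: merM.
by move=> v; near=> w; rewrite mulN1r.
Unshelve. all: by end_near. Qed.

Lemma mer_shift g c : mer g -> mer (fun w => g (w + c)).
Proof.
move=> mg z; have [k [e [[ce ge] e0]]] := mg (z + c).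
exists k, (fun w => e (w + c)); split=> //; split.
  by apply: filterS (nb_add ce) => w; exact: cdiff_add.
by apply: filterS (pn_add ge) => w ->; rewrite opprD addrACA subrr addr0.
Qed.

Lemma mf_shift g c : mf g -> mf (fun w => g (w + c)).
Proof.
move=> mg z; have [k [e [ce ge]]] := mg (z + c).
exists k, (fun w => e (w + c)); split.
  by apply: filterS (nb_add ce) => w; exact: cdiff_add.
by apply: filterS (pn_add ge) => w ->; rewrite opprD addrACA subrr addr0.
Qed.

Lemma ord_shift g c z : mer g -> ord (fun w => g (w + c)) z = ord g (z + c).
Proof.
move=> mg; have [e [[ce ge] e0]] := ordP (z + c) mg.
apply: (@ordE _ _ _ (fun w => e (w + c))) => //; split.
  by apply: filterS (nb_add ce) => w; exact: cdiff_add.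
by apply: filterS (pn_add ge) => w ->; rewrite opprD addrACA subrr addr0.
Qed.

Lemma mf_mer g : mf g -> ~ null g -> mer g.
Proof. by move=> /mf_dichotomy[]. Qed.

(** e may vanish at z; extracting its zero by [hol_order] only raises the exponent. *)
Lemma ord_geP g z k e : mer g -> lform g z k e -> k <= ord g z.
Proof.
move=> mg [ce ge]; have [d d0 hd] := ce; have he : hol z d e by [].
have zz : cnorm (z - z) < d by rewrite subrr cnorm0.
have [e0|[n [E [hE Ez eE]]]] := hol_order he zz.
  have [w [/eqP + [gw w0]]] := filter_ex (filterI (mer_neq0 z mg) (filterI ge (nb_pn e0))).
  by rewrite gw w0 mulr0.
suff -> : ord g z = k + n%:Z by lia.
apply: (ordE (e := E)) => //; split; first exact: hol_near hE zz.
near=> w; rewrite (near ge w)// eE mulrA; congr (_ * _).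
by rewrite expfzDr// subr_eq0; near: w; exact: pn_ne.
Unshelve. all: by end_near. Qed.

Lemma ordD_ge g h z k : mer g -> mer h -> mer (fun w => g w + h w) ->
  k <= ord g z -> k <= ord h z -> k <= ord (fun w => g w + h w) z.
Proof.
move=> mg mh mgh kg kh; have [e [H _]] := ordP z mg; have [u [K _]] := ordP z mh.
have [kl|/ltW lk] := leP (ord g z) (ord h z).
  by apply: le_trans kg _; exact: ord_geP (lformD H K kl).
apply: le_trans kh _; apply: (ord_geP mgh); apply: lform_aeq (lformD K H lk).
by near=> w; exact: addrC.
Unshelve. all: by end_near. Qed.

Lemma ordD_lt g h z : mer g -> mer h -> ord g z < ord h z ->
  ord (fun w => g w + h w) z = ord g z.
Proof.
move=> mg mh lt; have [e [H e0]] := ordP z mg; have [u [K _]] := ordP z mh.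
apply: (ordE (lformD H K (ltW lt))).
by rewrite subrr expr0n (_ : `|_|%N == 0%N = false) ?mul0r ?addr0//; lia.
Qed.

(** Besides zeros and poles this includes points with a wrong value or a removable singularity, so
    that away from special points g is holomorphic and non-zero as a function, not only as a
    germ. *)
Definition special g a := ~ \forall w \near nb a, cdiff g w /\ g w != 0.

Lemma cdiff_Xz a k z : z != a -> cdiff (fun w => (w - a) ^ k) z.
Proof.
move=> za; case: k => n; first exact: cdiff_subX.
apply: (@cdiff_eq _ (fun v => ((v - a) ^+ n.+1)^-1)); first by near=> v; rewrite NegzE -exprnN.
by apply: cdiffV; [rewrite expf_neq0// subr_eq0|exact: cdiff_subX].
Unshelve. all: by end_near. Qed.

Lemma mer_not_special g z : mer g -> \forall w \near pn z, ~ special g w.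
Proof.
move=> mg; have [k [e [[ce ge] e0]]] := mg z.
suff : \forall w \near pn z, cdiff g w /\ g w != 0.
  by move=> /pn_nb; apply: filterS => w h; apply.
have := pn_nb ge; have gn := mer_neq0 z mg => ge'.
near=> w; split; last by near: w.
apply: (@cdiff_eq _ (fun v => (v - z) ^ k * e v)); first by apply: filterS (near ge' w _) => // v ->.
have wz : w != z by near: w; exact: pn_ne.
by apply: cdiffM; [exact: cdiff_Xz|near: w; exact: nb_pn].
Unshelve. all: by end_near. Qed.

Lemma ord_special g z : mer g -> ~ special g z -> ord g z = 0.
Proof.
move=> mg /contrapT h; apply: (@ordE _ _ _ g); last by have [] := nb_self h.
split; first by apply: filterS h => w [].
by near=> w; rewrite expr0z mul1r.
Unshelve. all: by end_near. Qed.

(** One list for a whole family, so that a single circle can avoid the special points of all the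
    functions under study. *)
Lemma special_finite n (fam : nat -> C -> C) r : 0 < r -> (forall i, (i < n)%N -> mer (fam i)) ->
  exists2 S : seq C, uniq S & forall a, a \in S <-> cnorm a < r /\ exists2 i, (i < n)%N & special (fam i) a.
Proof.
move=> r0 hm; pose sp a := exists2 i, (i < n)%N & special (fam i) a.
have [s hs] : exists s : seq C, forall a, cnorm a <= r -> sp a -> a \in s.
  have := @disc_compact R (fun A => exists s : seq C, forall a, A a -> sp a -> a \in s) r r0.
  apply.
  - by move=> A B AB [s hs]; exists s => a /AB; exact: hs.
  - move=> A B [s hs] [t ht]; exists (s ++ t) => a + pa; rewrite mem_cat => -[Aa|Ba].
      by rewrite (hs a).
    by rewrite (ht a)// orbT.
  - move=> z _; have h : \forall w \near pn z, forall i : 'I_n, ~ special (fam i) w.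
      by apply: filter_forall => i; apply: mer_not_special; exact: hm.
    have [d d0 hd] := h; exists [set w | cnorm (w - z) < d]; first by exists d.
    exists [:: z] => a /= az [i ik si]; rewrite inE; apply: contrapT => /negP ane.
    by apply: (hd a ane az (Ordinal ik)).
exists [seq a <- undup s | (cnorm a < r) && `[< sp a >]]; first by rewrite filter_uniq// undup_uniq.
move=> a; rewrite mem_filter mem_undup; split.
  by move=> /andP[/andP[ar /asboolP pa] _].
by move=> [ar pa]; rewrite ar (hs a (ltW ar) pa) andbT; exact/asboolP.
Qed.

Lemma near_notin (S : seq C) z : \forall w \near pn z, w \notin S.
Proof.
elim: S => [|a S IH]; first by near=> w.
near=> w; rewrite inE negb_or; apply/andP; split; last by near: w.
near: w; have [->|az] := eqVneq a z; first exact: pn_ne.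
exists (cnorm (a - z)); first by rewrite cnorm_gt0 subr_eq0.
by move=> w _; apply: contraTneq => ->; rewrite ltxx.
Unshelve. all: by end_near. Qed.

Lemma cdiff_prodXz (S : seq C) (o : C -> int) z : z \notin S ->
  cdiff (fun w => \prod_(a <- S) (w - a) ^ o a) z /\ \prod_(a <- S) (z - a) ^ o a != 0.
Proof.
elim: S => [|a S IH] zS.
  rewrite big_nil oner_eq0; split=> //; apply: (@cdiff_eq _ (fun=> 1)); last exact: cdiff_cst.
  by near=> w; rewrite big_nil.
move: zS; rewrite inE negb_or => /andP[za /IH[h1 h2]]; rewrite big_cons; split.
  apply: (@cdiff_eq _ (fun w => (w - a) ^ o a * \prod_(a <- S) (w - a) ^ o a)).
    by near=> w; rewrite big_cons.
  by apply: cdiffM => //; exact: cdiff_Xz.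
by rewrite mulf_neq0// expfz_neq0// subr_eq0.
Unshelve. all: by end_near. Qed.

Lemma factorization g r (S : seq C) : mer g -> uniq S ->
  (forall a, cnorm a < r -> special g a -> a \in S) ->
  exists u, [/\ hol 0 r u, forall w, cnorm w < r -> u w != 0 &
    forall w, w \notin S -> g w = u w * \prod_(a <- S) (w - a) ^ ord g a].
Proof.
move=> mg uS hS.
have [E hE] := choice (fun z => ordP z mg).
pose P w := \prod_(a <- S) (w - a) ^ ord g a.
pose Q z w := \prod_(a <- rem z S) (w - a) ^ ord g a.
(* At a point of S the quotient g / P is meaningless, and the value of u is read from the Laurent
   form there. *)
pose u w := if w \in S then E w w / Q w w else g w / P w.
have nr z : z \in S -> z \notin rem z S by rewrite mem_rem_uniq// inE eqxx.
exists u; split.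
- move=> z; rewrite subr0 => zr; have [zS|zS] := boolP (z \in S).
    have [[ce ge] e0] := hE z.
    have [cQ Q0] := cdiff_prodXz (ord g) (nr z zS).
    apply: (@cdiff_eq _ (fun w => E z w / Q z w)); last first.
      by apply: cdiffM; [exact: nb_self ce|exact: cdiffV].
    apply/nb_pnP; split; first by rewrite /u zS.
    near=> w; rewrite /u ifN; last by near: w; exact: near_notin.
    rewrite (near ge w)// /P (perm_big _ (perm_to_rem zS)) big_cons -/(Q z w).
    have wz : (w - z) ^ ord g z != 0 by rewrite expfz_neq0// subr_eq0; near: w; exact: pn_ne.
    by rewrite invfM mulrACA divff// mul1r.
  have ns : ~ special g z by move=> sz; move: (hS z zr sz); rewrite (negPf zS).
  have /contrapT ns' := ns; have [cg g0] := nb_self ns'.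
  have [cP P0] := cdiff_prodXz (ord g) zS.
  apply: (@cdiff_eq _ (fun w => g w / P w)); last by apply: cdiffM => //; exact: cdiffV.
  apply/nb_pnP; split; first by rewrite /u (negPf zS).
  by near=> w; rewrite /u ifN//; near: w; exact: near_notin.
- move=> z zr; rewrite /u; case: ifPn => zS.
    have [_ e0] := hE z; have [_ Q0] := cdiff_prodXz (ord g) (nr z zS).
    by rewrite mulf_neq0// invr_eq0.
  have ns : ~ special g z by move=> sz; move: (hS z zr sz); rewrite (negPf zS).
  have /contrapT ns' := ns; have [_ g0] := nb_self ns'.
  by have [_ P0] := cdiff_prodXz (ord g) zS; rewrite mulf_neq0// invr_eq0.
- move=> w wS; rewrite /u (negPf wS) divfK//.
  by have [_ P0] := cdiff_prodXz (ord g) wS.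
Unshelve. all: by end_near. Qed.

Lemma cder_Xz a k z : z != a -> cder (fun w => (w - a) ^ k) z (k%:~R * (z - a) ^ (k - 1)).
Proof.
move=> za; have za0 : z - a != 0 by rewrite subr_eq0.
have h1 : cder (fun w => w - a) z 1 by have := cderB (cder_id z) (cder_cst a z); rewrite subr0.
have hn (n : nat) : cder (fun w => (w - a) ^+ n) z (n%:R * (z - a) ^+ n.-1).
  elim: n => [|n IH].
    by rewrite mul0r; apply: cder_eq (cder_cst 1 z); near=> w; rewrite expr0.
  have := cderM h1 IH; rewrite mul1r => h.
  rewrite (_ : n.+1%:R * _ = (z - a) ^+ n + (z - a) * (n%:R * (z - a) ^+ n.-1)).
    by apply: cder_eq h; near=> w; rewrite [RHS]exprS.
  by case: n {IH h} => [|n]; rewrite ?mul0r ?mulr0 ?addr0 ?mul1r// -[n.+2%:R]natr1 /= exprS; ring.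
case: k => n.
  case: n => [|n]; first by rewrite mul0r; have := hn 0%N; rewrite mul0r.
  have := hn n.+1; rewrite /= (_ : n.+1%:Z - 1 = n%:Z)//; lia.
have := @cderV _ (fun w => (w - a) ^+ n.+1) z _ (expf_neq0 n.+1 za0) (hn n.+1); rewrite NegzE /=.
rewrite (_ : (- n.+1%:Z)%:~R * (z - a) ^ (- n.+1%:Z - 1) = - (n.+1%:R * (z - a) ^+ n) / ((z - a) ^+ n.+1) ^+ 2).
  by apply: cder_eq; near=> w; rewrite -exprnN.
rewrite (_ : - n.+1%:Z - 1 = - n.+2%:Z); last lia.
rewrite -exprnN mulrNz !mulNr; congr (- _); rewrite -mulrA; congr (_ * _).
rewrite -exprM muln2 -addnn (_ : (n.+1 + n.+1 = n + n.+2)%N); last lia.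
by rewrite (exprD _ n n.+2) [in RHS]invfM [RHS]mulrA (divff (expf_neq0 n za0)) mul1r.
Unshelve. all: by end_near. Qed.

Lemma lform_cD g z k e : lform g z k e ->
  lform (cD g) z (k - 1) (fun w => k%:~R * e w + (w - z) * cD e w).
Proof.
move=> [ce ge]; split.
  near=> w; apply: cdiffD; first by apply: cdiffM; [exact: cdiff_cst|near: w].
  apply: cdiffM; first by apply: cdiffB; [exact: cdiff_id|exact: cdiff_cst].
  by apply: cD_cdiff; near: w; exact: nb_nb.
have ge' := pn_nb ge; near=> w.
have wz : w != z by near: w; exact: pn_ne.
have ew : cder e w (cD e w) by apply: cDP; near: w; exact: nb_pn.
apply: cDE; have := cderM (cder_Xz k wz) ew => h.
rewrite (_ : _ * _ = k%:~R * (w - z) ^ (k - 1) * e w + (w - z) ^ k * cD e w).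
  by apply: cder_eq h; apply: filterS (near ge' w _) => // v ->.
have -> : (w - z) ^ k = (w - z) ^ (k - 1) * (w - z).
  by rewrite -{3}(expr1z (w - z)) -expfzDr ?subr_eq0// subrK.
by ring.
Unshelve. all: by end_near. Qed.

Lemma mf_cD g : mf g -> mf (cD g).
Proof. by move=> mg z; have [k [e h]] := mg z; eexists _, _; exact: lform_cD h. Qed.

Lemma ord_cD g z : mer g -> ord g z != 0 -> ord (cD g) z = ord g z - 1.
Proof.
move=> mg g0; have [e [H e0]] := ordP z mg; apply: (ordE (lform_cD H)).
by rewrite subrr mul0r addr0 mulf_neq0// intr_eq0.
Qed.

Lemma ord_cD_ge0 g z : mer g -> mer (cD g) -> 0 <= ord g z -> 0 <= ord (cD g) z.
Proof.
move=> mg md; rewrite le_eqVlt => /orP[/eqP g0|g0]; last by rewrite ord_cD ?gt_eqF//; lia.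
have [e [[ce ge] e0]] := ordP z mg; rewrite -g0 in ge.
apply: (@ord_geP _ _ _ (cD e)) => //; split.
  by near=> w; apply: cD_cdiff; near: w; exact: nb_nb.
have ge' := pn_nb ge; near=> w; rewrite expr0z mul1r; apply: cDE.
have ew : cder e w (cD e w) by apply: cDP; near: w; exact: nb_pn.
apply: cder_eq ew; apply: filterS (near ge' w _) => // v ->.
by rewrite expr0z mul1r.
Unshelve. all: by end_near. Qed.

(** Near a point around which g is holomorphic, the segment bound with slope 0 makes g constant, and
    the identity theorem extends this to the plane. *)
Lemma null_cD g : mf g -> null (cD g) -> exists a, null (fun w => g w - a).
Proof.
move=> mg nd.
have [z hz] : exists z, \forall w \near nb z, cdiff g w.
  case: (mf_dichotomy mg) => [m|n].
    by have [z /contrapT hz] := filter_ex (mer_not_special 0 m); exists z; apply: filterS hz => w [].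
  have [z hz] := filter_ex (pn_nb (n 0)); exists z.
  apply: filterS (nb_nb hz) => w hw; apply: (@cdiff_eq _ (fun=> 0)); last exact: cdiff_cst.
  by apply: filterS hw => v ->.
exists (g z); have mga : mf (fun w => g w - g z) by exact: mfB mg (mf_cst _).
have [m|//] := mf_dichotomy mga.
have := mer_neq0 z m; have := nd z.
have [d d0 hd] := hz; move=> [d1 d10 hd1] [d2 d20 hd2].
pose q := Num.min d (Num.min d1 d2).
have q0 : 0 < q by rewrite !lt_min d0 d10.
have [w wz] := exists_near_ne z q0; rewrite !lt_min => /and3P[w0 w1 w2].
have := hd2 w wz w2; rewrite subr_eq0 => /eqP gw; exfalso; apply: gw.
apply: small_cnorm_eq => e e0; apply: le_trans (_ : 0 * cnorm (w - z) <= _); last by rewrite mul0r ltW.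
have cd : cdiff (cD g) z by exact: cD_cdiff.
have dz : cD g z = 0.
  apply/eqP; apply: contraT => /(near_neq0 cd) h.
  by have [x [/eqP]] := filter_ex (filterI (nb_pn h) (nd z)).
rewrite -{1}(subrKC z w); apply: (@segment_bound _ _ (cD g)) => t /andP[t0 t1];
  have tw : cnorm (z + t%:C * (w - z) - z) <= cnorm (w - z)
    by rewrite addrC addKr cnormM cnormR ger0_norm// ler_piMl// cnorm_ge0.
  by apply: cDP; apply: hd; exact: le_lt_trans tw w0.
have [->|xz] := eqVneq (z + t%:C * (w - z)) z; first by rewrite dz cnorm0.
by rewrite (hd1 _ xz) ?cnorm0//; exact: le_lt_trans tw w1.
Qed.

End MeromorphicGerms.

(** * Upper limits of circle averages and Jensen's formula *)

Section UpperMeans.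
Variable R : realType.
Local Notation C := (complex R).
Local Notation "x %:C" := (real_complex R x).
Implicit Types (z w a b c : C) (r d s B L : R) (u g h : C -> C) (phi psi : C -> R) (S : seq C).

(** An upper bound for the limsup in N. Most estimates are one-sided; true limits ([mlim]) are
    needed for Jensen's formula and for the proximity function. *)
Definition mb r phi B := forall e, 0 < e -> \forall N \near \oo, Mr N r phi <= B + e.

Definition mlim r phi L := mb r phi L /\ mb r (fun w => - phi w) (- L).

Lemma mb_le r phi psi B : 0 < r -> (forall w, cnorm w = r -> psi w <= phi w) -> mb r phi B -> mb r psi B.
Proof.
move=> r0 h hb e e0; apply: filterS (hb e e0) => N; apply: le_trans; apply: ler_Mr => w.
by rewrite gtr0_norm//; exact: h.
Qed.

Lemma mb_leB r phi B B' : mb r phi B -> B <= B' -> mb r phi B'.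
Proof. by move=> h hb e e0; apply: filterS (h e e0) => N; lra. Qed.

Lemma mb_cst r (t : R) : mb r (fun=> t) t.
Proof. by move=> e e0; near=> N; rewrite Mr_cst; lra. Unshelve. all: by end_near. Qed.

Lemma mbD r phi psi B B' : mb r phi B -> mb r psi B' -> mb r (fun w => phi w + psi w) (B + B').
Proof.
move=> h h' e e0; have e2 : 0 < e / 2 by rewrite divr_gt0.
by apply: filterS2 (h _ e2) (h' _ e2) => N; rewrite MrD; lra.
Qed.

Lemma mbZ r (t : R) phi B : 0 <= t -> mb r phi B -> mb r (fun w => t * phi w) (t * B).
Proof.
move=> t0 h e e0; have t1 : 0 < t + 1 by lra.
have et : 0 < e / (t + 1) by rewrite divr_gt0.
apply: filterS (h _ et) => N hN; rewrite MrZ.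
have h1 := ler_wpM2l t0 hN; apply: le_trans h1 _; rewrite mulrDr lerD2l.
by rewrite mulrCA ler_piMr ?(ltW e0)// ler_pdivrMr// mul1r; lra.
Qed.

Lemma mb_sum r (I : eqType) (t : seq I) (F : I -> C -> R) (B : I -> R) :
  (forall i, i \in t -> mb r (F i) (B i)) -> mb r (fun w => \sum_(i <- t) F i w) (\sum_(i <- t) B i).
Proof.
elim: t => [|i t IH] h e e0.
  by near=> N; rewrite Mr_sum !big_nil; lra.
have h1 := h i (mem_head _ _).
have h2 : mb r (fun w => \sum_(i <- t) F i w) (\sum_(i <- t) B i).
  by apply: IH => j jt; apply: h; rewrite inE jt orbT.
by apply: filterS (mbD h1 h2 e0) => N; rewrite MrD !Mr_sum !big_cons.
Unshelve. all: by end_near. Qed.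

Lemma mb_ge0 r phi B : 0 < r -> (forall w, cnorm w = r -> 0 <= phi w) -> mb r phi B -> 0 <= B.
Proof.
move=> r0 h hb; apply/ler_addgt0Pr => e e0; have [N hN] := filter_ex (hb e e0).
by apply: le_trans hN; apply: Mr_ge0 => w; rewrite gtr0_norm//; exact: h.
Qed.

Lemma mb_opp r phi B B' : 0 < r -> mb r phi B -> mb r (fun w => - phi w) B' -> - B' <= B.
Proof.
move=> r0 h h'; suff : 0 <= B + B' by lra.
by apply: (mb_ge0 r0 _ (mbD h h')) => w _; lra.
Qed.

Lemma mlimP r phi L : (forall e, 0 < e -> \forall N \near \oo, `|Mr N r phi - L| <= e) -> mlim r phi L.
Proof.
move=> h; split=> e e0; apply: filterS (h e e0) => N; rewrite ?MrN ler_norml => /andP[]; lra.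
Qed.

Lemma mlim_eq r phi psi L : 0 < r -> (forall w, cnorm w = r -> phi w = psi w) -> mlim r phi L -> mlim r psi L.
Proof. by move=> r0 h [h1 h2]; split; [apply: mb_le h1|apply: mb_le h2] => // w wr; rewrite h. Qed.

Lemma mlimD r phi psi L L' : 0 < r -> mlim r phi L -> mlim r psi L' -> mlim r (fun w => phi w + psi w) (L + L').
Proof.
move=> r0 [h1 h2] [h3 h4]; split; first exact: mbD.
by rewrite opprD; apply: (mb_le r0 _ (mbD h2 h4)) => w _; rewrite opprD.
Qed.

Lemma mlimZ r (t : R) phi L : 0 < r -> mlim r phi L -> mlim r (fun w => t * phi w) (t * L).
Proof.
move=> r0 [h1 h2]; have [t0|/ltW t0] := leP 0 t.
  by split; [exact: mbZ|rewrite -mulrN; apply: (mb_le r0 _ (mbZ t0 h2)) => w _; rewrite mulrN].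
have nt : 0 <= - t by lra.
split; first by apply: mb_leB (mb_le r0 _ (mbZ nt h2)) _ => [w _|]; rewrite mulrNN.
by rewrite -mulNr; apply: (mb_le r0 _ (mbZ nt h1)) => w _; rewrite mulNr.
Qed.

Lemma mlim_sum r (I : eqType) (t : seq I) (F : I -> C -> R) (B : I -> R) : 0 < r ->
  (forall i, i \in t -> mlim r (F i) (B i)) -> mlim r (fun w => \sum_(i <- t) F i w) (\sum_(i <- t) B i).
Proof.
move=> r0 h; split; first by apply: mb_sum => i it; have [] := h i it.
have : mb r (fun w => \sum_(i <- t) - F i w) (\sum_(i <- t) - B i).
  by apply: mb_sum => i it; have [] := h i it.
by rewrite sumrN; apply: mb_le => // w _; rewrite sumrN.
Qed.

Lemma mlim_uniq r phi L L' : 0 < r -> mlim r phi L -> mlim r phi L' -> L = L'.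
Proof.
move=> r0 [h1 h2] [h3 h4]; have := mb_opp r0 h1 h4; have := mb_opp r0 h3 h2; lra.
Qed.

Lemma ln_cnormM z w : z != 0 -> w != 0 -> ln (cnorm (z * w)) = ln (cnorm z) + ln (cnorm w).
Proof. by move=> z0 w0; rewrite cnormM lnM// posrE cnorm_gt0. Qed.

Lemma ln_cnormV z : z != 0 -> ln (cnorm z^-1) = - ln (cnorm z).
Proof. by move=> z0; rewrite cnormV lnV// posrE cnorm_gt0. Qed.

Lemma ln_cnormXz z (k : int) : z != 0 -> ln (cnorm (z ^ k)) = k%:~R * ln (cnorm z).
Proof.
move=> z0; case: k => n.
  by rewrite -exprnP cnormX lnXn ?cnorm_gt0// mulr_natl.
by rewrite NegzE -exprnN ln_cnormV ?expf_neq0// cnormX lnXn ?cnorm_gt0// mulrNz mulNr mulr_natl.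
Qed.

Lemma ln_cnorm_prod (t : seq C) (F : C -> C) : (forall a, a \in t -> F a != 0) ->
  ln (cnorm (\prod_(a <- t) F a)) = \sum_(a <- t) ln (cnorm (F a)).
Proof.
elim: t => [|a t IH] h; first by rewrite !big_nil cnorm1 ln1.
have ht b : b \in t -> F b != 0 by move=> bt; apply: h; rewrite inE bt orbT.
rewrite !big_cons ln_cnormM ?IH ?h ?mem_head//.
by rewrite prodf_seq_neq0; apply/allP => b /ht.
Qed.

Definition good S r := forall a, a \in S -> cnorm a != r.
Definition captures S r g := uniq S /\ forall a, cnorm a < r -> special g a -> a \in S.

Lemma good_notin S r w : good S r -> cnorm w = r -> w \notin S.
Proof. by move=> gr wr; apply/negP => /gr /eqP. Qed.

Lemma captured S r s g w : captures S s g -> good S r -> cnorm w = r -> r < s -> cdiff g w /\ g w != 0.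
Proof.
move=> [_ hS] gr wr rs; apply: contrapT => nw.
have sw : special g w by move/nb_self.
by have := good_notin gr wr; rewrite (hS w _ sw)// wr.
Qed.

(* nu r0 r a is the integral over [r0, r] of the indicator of |a| <= t against dt / t. *)
Definition nu r0 r a : R := ln (Num.max r (cnorm a)) - ln (Num.max r0 (cnorm a)).

Lemma nu_ge0 r0 r a : 0 < r0 <= r -> 0 <= nu r0 r a.
Proof.
move=> /andP[r0p rr]; rewrite /nu subr_ge0 ler_ln ?posrE ?lt_max ?r0p ?(lt_le_trans r0p rr)//.
by rewrite ge_max !le_max rr lexx !orbT.
Qed.

Lemma ln_ge (x : R) : 0 < x -> 1 - x^-1 <= ln x.
Proof.
move=> x0; have := @le_ln1Dx R (x^-1 - 1); rewrite subrKC lnV ?posrE//.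
rewrite ltrBrDr addNr invr_gt0 x0 => /(_ isT); lra.
Qed.

(** Because ln s - ln r >= (s - r) / s. It lets the integrated count at a larger radius bound the
    number of zeros and poles in |a| < r. *)
Lemma nu_gap r0 r s a : 0 < r0 <= r -> r < s -> cnorm a < r -> (s - r) / s <= nu r0 s a.
Proof.
move=> /andP[r0p rr] rs ar; have sp : 0 < s by lra.
have mp : 0 < Num.max r0 (cnorm a) by rewrite lt_max r0p.
have rp : 0 < r by lra.
rewrite /nu (max_idPl _); last lra.
apply: (@le_trans _ _ (ln s - ln r)).
  rewrite -ln_div ?posrE//; apply: le_trans (ln_ge _); last by rewrite divr_gt0.
  by rewrite invf_div mulrBl divff// gt_eqF.
by rewrite lerD2l lerN2 ler_ln ?posrE// ge_max rr ltW.
Qed.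

(** Jensen's formula between two circles rather than from the origin, so that no leading Laurent
    coefficient at 0 appears: L is the mean over |w| = r. *)
Lemma jensen0 g S r s : mer g -> captures S s g -> 0 < r < s -> good S r -> exists L, forall r', 0 < r' < s -> good S r' ->
  mlim r' (fun w => ln (cnorm (g w))) (L + \sum_(a <- S) (ord g a)%:~R * nu r r' a).
Proof.
move=> mg [uS hS] rs gr.
have [u [hu u0 gu]] := factorization mg uS hS.
pose M t := ln (cnorm (u 0)) + \sum_(a <- S) (ord g a)%:~R * ln (Num.max t (cnorm a)).
have hM t : 0 < t < s -> good S t -> mlim t (fun w => ln (cnorm (g w))) (M t).
  move=> ts gt; have t0 : 0 < t by case/andP: ts.
  have h1 : mlim t (fun w => ln (cnorm (u w))) (ln (cnorm (u 0))).
    by apply: mlimP => e e0; apply: happ_mean => //; exact: happ_log hu u0 ts.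
  have h2 a : a \in S -> mlim t (fun w => (ord g a)%:~R * ln (cnorm (w - a)))
      ((ord g a)%:~R * ln (Num.max t (cnorm a))).
    by move=> aS; apply: mlimZ => //; apply: mlimP => e e0; apply: mean_log_linear => //; exact: gt.
  apply: mlim_eq (mlimD t0 h1 (mlim_sum t0 h2)) => // w wt.
  have wS := good_notin gt wt.
  have wa a : a \in S -> w - a != 0 by move=> aS; rewrite subr_eq0; apply: contraNneq wS => ->.
  rewrite gu// ln_cnormM.
  - rewrite ln_cnorm_prod => [|a /wa ?]; last exact: expfz_neq0.
    by congr (_ + _); apply: eq_big_seq => a /wa ?; rewrite ln_cnormXz.
  - by apply: u0; rewrite wt; case/andP: ts.
  - by rewrite prodf_seq_neq0; apply/allP => a /wa ?; exact: expfz_neq0.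
exists (M r) => r' rs' gr'; suff <- : M r' = M r + \sum_(a <- S) (ord g a)%:~R * nu r r' a by exact: hM.
rewrite /M -addrA -big_split /=; congr (_ + _); apply: eq_bigr => a _.
by rewrite -mulrDr /nu subrKC.
Qed.

Lemma jensen g S r0 r s L : mer g -> captures S s g -> 0 < r0 < s -> good S r0 -> 0 < r < s -> good S r ->
  mlim r0 (fun w => ln (cnorm (g w))) L ->
  mlim r (fun w => ln (cnorm (g w))) (L + \sum_(a <- S) (ord g a)%:~R * nu r0 r a).
Proof.
move=> mg cS rs0 gr0 rs gr hL; have [L' hL'] := jensen0 mg cS rs0 gr0.
suff -> : L = L' by exact: hL'.
have r00 : 0 < r0 by case/andP: rs0.
have := hL' r0 rs0 gr0; rewrite big1 ?addr0; first exact: mlim_uniq hL.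
by move=> a _; rewrite /nu subrr mulr0.
Qed.

End UpperMeans.

(** * Lemmas on logarithmic differences and on the logarithmic derivative *)

Section LogDifferences.
Variable R : realType.
Local Notation C := (complex R).
Local Notation "x %:C" := (real_complex R x).
Implicit Types (z w a b c : C) (r d s B L : R) (u g h : C -> C) (phi psi v : C -> R) (S : seq C).

Lemma ln2_ge : 2^-1 <= ln (2 : R).
Proof. by apply: le_trans (ln_ge _) => //; lra. Qed.

Lemma ln1p_le (y : R) : 0 <= y -> ln (1 + y) <= y.
Proof. by move=> y0; apply: le_ln1Dx; lra. Qed.

Lemma ln1p_ge0 (y : R) : 0 <= y -> 0 <= ln (1 + y).
Proof. by move=> y0; apply: ln_ge0; lra. Qed.

Lemma ln1p_mono (x y : R) : 0 <= x -> x <= y -> ln (1 + x) <= ln (1 + y).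
Proof. by move=> x0 xy; rewrite ler_ln ?posrE; lra. Qed.

(* Means of ln (1 + y^2) scale linearly (mean_log_quad), so ln (1 + y) is split into dyadic pieces. *)
Lemma ln1p_dyadic (y : R) J : 0 <= y ->
  ln (1 + y) <= 2 ^- J + 4 * \sum_(j < J.+1) 2 ^- j * ln (1 + (2 ^+ j * y) ^+ 2).
Proof.
move=> y0; have t0 j : 0 <= 2 ^- j * ln (1 + (2 ^+ j * y) ^+ 2).
  by rewrite mulr_ge0 ?invr_ge0 ?exprn_ge0// ln1p_ge0// exprn_ge0// mulr_ge0// exprn_ge0.
elim: J => [|J IH].
  rewrite big_ord_recl big_ord0 addr0 expr0 invr1 !mul1r.
  have [y1|y1] := leP y 1.
    have := ln1p_le y0; have : 0 <= ln (1 + y ^+ 2) by rewrite ln1p_ge0// exprn_ge0.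
    lra.
  have : ln (1 + y) <= ln (1 + y ^+ 2) by apply: ln1p_mono => //; rewrite expr2; nra.
  have : 0 <= ln (1 + y ^+ 2) by rewrite ln1p_ge0// exprn_ge0.
  lra.
have s0 : 0 <= \sum_(j < J.+2) 2 ^- j * ln (1 + (2 ^+ j * y) ^+ 2) by apply: sumr_ge0 => j _.
have [yJ|yJ] := leP y (2 ^- J.+1).
  by have := ln1p_le y0; lra.
apply: le_trans IH _; rewrite [X in _ <= _ + 4 * X]big_ord_recr /=.
set X := \sum_(j < J.+1) _; pose q := 2 ^- J.+1 : R.
have q0 : 0 < q by rewrite invr_gt0 exprn_gt0.
have -> : 2 ^- J = 2 * q :> R by rewrite /q exprS invfM mulrA divff ?mul1r.
have : 2^-1 <= ln (1 + (2 ^+ J.+1 * y) ^+ 2).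
  apply: le_trans ln2_ge _; rewrite ler_ln ?posrE//; last first.
    by rewrite ltr_wpDr// exprn_ge0// mulr_ge0// exprn_ge0.
  rewrite -[2]/(1 + 1) lerD2l exprn_ege1// -ler_pdivrMl ?exprn_gt0// mulr1 ltW//.
rewrite -/q => h; have := ler_wpM2l (ltW q0) h; lra.
Qed.

(** Each dyadic piece has mean at most 2 b / r, because the scale 2^j cancels the weight 2^-j. The
    bound is therefore linear in J, with an error 2^-J. *)
Lemma mean_ln1p_dyadic r a (b : R) J : 0 < r -> 0 < b -> cnorm a != r ->
  mb r (fun w => ln (1 + b / cnorm (w - a))) (2 ^- J + 8 * b * J.+1%:R / r).
Proof.
move=> r0 b0 ar.
have h j : mb r (fun w => 2 ^- j * ln (1 + (2 ^+ j * (b / cnorm (w - a))) ^+ 2)) (2 * b / r).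
  have h1 : mb r (fun w => ln (1 + (2 ^+ j * b) ^+ 2 / cnorm (w - a) ^+ 2)) (2 * (2 ^+ j * b) / r).
    by move=> e e0; apply: mean_log_quad => //; rewrite mulr_gt0// exprn_gt0.
  have q0 : 0 <= 2 ^- j :> R by rewrite invr_ge0 exprn_ge0.
  have := mbZ q0 h1; rewrite (_ : _ * (2 * _ / r) = 2 * b / r); last first.
    by field; rewrite expf_neq0//= gt_eqF.
  by apply: mb_le => // w _; rewrite mulrA expr_div_n.
have := mbD (mb_cst r (2 ^- J : R)) (mbZ (ler0n R 4) (mb_sum (t := enum 'I_J.+1) (fun i _ => h i))).
rewrite big_const_seq count_predT size_enum_ord iter_addr_0 => H.
apply: mb_leB (mb_le r0 _ H) _.
  move=> w _; rewrite big_enum /=; apply: ln1p_dyadic.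
  by rewrite divr_ge0 ?cnorm_ge0// ltW.
by rewrite lerD2l -[_ *+ J.+1]mulr_natr le_eqVlt; apply/orP; left; apply/eqP; ring.
Qed.

(** Majorant for the mean of ln (1 + b / |w - a|) over |w| = r, uniform in a. Its factor ln r is
    what forces the step of the radii to be of order ln X. *)
Definition dlt (b r : R) : R := (1 + 16 * b * (ln r + 1)) / r.

Lemma mean_ln1p r a (b : R) : 1 <= r -> 0 < b -> cnorm a != r ->
  mb r (fun w => ln (1 + b / cnorm (w - a))) (dlt b r).
Proof.
move=> r1 b0 ar; have r0 : 0 < r by lra.
have l0 : 0 <= ln r by exact: ln_ge0.
(* About 2 ln r pieces: as ln 2 >= 1/2, this gives 2^J >= r, and the dyadic error is at most 1 /
   r. *)
pose J := (Num.truncn (2 * ln r)).+1.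
apply: mb_leB (mean_ln1p_dyadic J r0 b0 ar) _.
have J1 : 2 * ln r < J%:R by apply: truncnS_gt.
have J2 : J%:R <= 2 * ln r + 1 :> R.
  by rewrite /J -natr1 lerD2r truncn_le// mulr_ge0.
have h : r <= 2 ^+ J.
  rewrite -ler_ln ?posrE ?exprn_gt0// lnXn// -[leRHS]mulr_natl.
  have := ler_wpM2l (ler0n R J) ln2_ge; lra.
rewrite [leRHS]/dlt [leRHS]mulrDl mul1r lerD//; first by rewrite lef_pV2 ?posrE ?exprn_gt0.
rewrite ler_pM2r ?invr_gt0// -(natr1 J); have : 8 * b * (J%:R + 1) <= 8 * b * (2 * ln r + 1 + 1).
  by rewrite ler_pM2l ?mulr_gt0// lerD2r.
clear; lra.
Qed.

Lemma ln_diff_le (x y t : R) : 0 < x -> 0 < y -> 0 <= t -> y <= x + t -> ln y - ln x <= ln (1 + t / x).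
Proof.
move=> x0 y0 t0 h; rewrite -ln_div ?posrE// ler_ln ?posrE ?divr_gt0//; last first.
  by rewrite ltr_wpDr// divr_ge0// ltW.
by rewrite ler_pdivrMr// mulrDl mul1r divfK ?gt_eqF.
Qed.

Lemma ln_diff_sym (x y t s : R) : 0 < x -> 0 < y -> 0 <= t -> `|x - y| <= t ->
  `|ln y - ln x| <= ln (1 + t / x) + ln (1 + t / y).
Proof.
move=> x0 y0 t0; rewrite ler_norml => /andP[h1 h2].
have p1 : 0 <= ln (1 + t / x) by rewrite ln1p_ge0// divr_ge0// ltW.
have p2 : 0 <= ln (1 + t / y) by rewrite ln1p_ge0// divr_ge0// ltW.
have q1 : ln y - ln x <= ln (1 + t / x) by apply: ln_diff_le => //; lra.
have q2 : ln x - ln y <= ln (1 + t / y) by apply: ln_diff_le => //; lra.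
by rewrite ler_norml; lra.
Qed.

(* Of modulus |z - a| on |z| = r, and without zeros in |z| < r. *)
Definition bl r a z : C := if cnorm a < r then ((r ^+ 2)%:C - conjc a * z) / r%:C else z - a.

(** The added term is non-negative inside the circle and 0 on it; [bl_ge] and [bl_circle] both come
    from this identity. *)
Lemma bl_sqr r a z : 0 < r -> cnorm a < r ->
  cnorm (bl r a z) ^+ 2 = cnorm (z - a) ^+ 2 + (r ^+ 2 - cnorm a ^+ 2) * (r ^+ 2 - cnorm z ^+ 2) / r ^+ 2.
Proof.
move=> r0 ar; rewrite /bl ar cnormf cnormR gtr0_norm// expr_div_n !cnorm_sqr.
case: a {ar} => a1 a2; case: z => z1 z2 /=; field; exact: lt0r_neq0.
Qed.

Lemma bl_ge r a z : 0 < r -> cnorm z <= r -> cnorm (z - a) <= cnorm (bl r a z).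
Proof.
move=> r0 zr; have [ar|ar] := ltP (cnorm a) r; last by rewrite /bl ltNge ar.
rewrite -(@ler_pXn2r _ 2) ?nnegrE ?cnorm_ge0// bl_sqr// lerDl.
have a0 := cnorm_ge0 a; have z0 := cnorm_ge0 z.
by rewrite divr_ge0 ?exprn_ge0 ?(ltW r0)// mulr_ge0// subr_ge0 ler_pXn2r ?nnegrE ?(ltW r0)// ltW.
Qed.

Lemma bl_circle r a z : 0 < r -> cnorm z = r -> cnorm (bl r a z) = cnorm (z - a).
Proof.
move=> r0 zr; have [ar|ar] := ltP (cnorm a) r; last by rewrite /bl ltNge ar.
apply/eqP; rewrite -(@eqrXn2 _ 2) ?cnorm_ge0// bl_sqr// zr subrr mulr0 mul0r addr0//.
Qed.

Lemma bl_diff r a z b : 0 < r -> cnorm (bl r a (z + b) - bl r a z) <= cnorm b.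
Proof.
move=> r0; rewrite /bl; case: ifP => ar; last by rewrite (_ : _ - _ = b) //; ring.
rewrite -mulrBl (_ : _ - _ = - (conjc a * b)); last ring.
rewrite cnormf cnormN cnormM cnorm_conj cnormR gtr0_norm// mulrAC ler_piMl ?cnorm_ge0//.
by rewrite ler_pdivrMr// mul1r ltW.
Qed.

Lemma happ_bl r a : 0 < r -> cnorm a != r -> happ r (fun z => ln (cnorm (bl r a z))).
Proof.
move=> r0 ar; have a0 := cnorm_ge0 a.
have hb s : hol 0 s (bl r a).
  move=> z _; rewrite /bl; case: (cnorm a < r).
    apply: cdiffM; last exact: cdiff_cst.
    apply: cdiffB; first exact: cdiff_cst.
    by apply: cdiffM; [exact: cdiff_cst|exact: cdiff_id].
  by apply: cdiffB; [exact: cdiff_id|exact: cdiff_cst].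
have [lt|ge] := ltP (cnorm a) r.
  have p : 0 < r + cnorm a by lra.
  apply: (happ_log (hb (2 * r ^+ 2 / (r + cnorm a)))).
    move=> z; rewrite ltr_pdivlMr// => zs; rewrite /bl lt mulf_neq0//; last first.
      by rewrite invr_eq0 -cnorm_gt0 cnormR gtr0_norm.
    rewrite subr_eq0; apply/eqP => /(congr1 (@cnorm R)).
    rewrite cnormR cnormM cnorm_conj ger0_norm ?exprn_ge0 ?(ltW r0)// => E.
    have z0 := cnorm_ge0 z; rewrite expr2 in E zs; nra.
  by rewrite r0 ltr_pdivlMr// expr2; nra.
apply: (happ_log (hb (cnorm a))); last by rewrite r0 lt_neqAle eq_sym ar ge.
move=> z za; rewrite /bl ltNge ge /= subr_eq0; apply: contraTneq za => ->.
by rewrite ltxx.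
Qed.

(** Poisson-Jensen: trading each |z - a| with |a| < r for the zero-free factor [bl] changes nothing
    on the circle and leaves v harmonic inside. *)
Lemma blaschke g S r s : mer g -> captures S s g -> 0 < r < s -> good S r ->
  exists v, [/\ happ r v, forall w, cnorm w = r -> v w = ln (cnorm (g w)) &
   forall z, z \notin S -> cnorm z < r ->
     ln (cnorm (g z)) = v z + \sum_(a <- S | cnorm a < r)
       (ord g a)%:~R * (ln (cnorm (z - a)) - ln (cnorm (bl r a z)))].
Proof.
move=> mg [uS hS] rs gr; have r0 : 0 < r by case/andP: rs.
have [u [hu u0 gu]] := factorization mg uS hS.
pose v z := ln (cnorm (u z)) + \sum_(a <- S) (ord g a)%:~R * ln (cnorm (bl r a z)).
have G z : z \notin S -> cnorm z < s ->
    ln (cnorm (g z)) = ln (cnorm (u z)) + \sum_(a <- S) (ord g a)%:~R * ln (cnorm (z - a)).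
  move=> zS zs.
  have wa a : a \in S -> z - a != 0 by move=> aS; rewrite subr_eq0; apply: contraNneq zS => ->.
  rewrite gu// ln_cnormM; last 2 first.
  - exact: u0.
  - by rewrite prodf_seq_neq0; apply/allP => a /wa ?; exact: expfz_neq0.
  rewrite ln_cnorm_prod => [|a /wa ?]; last exact: expfz_neq0.
  by congr (_ + _); apply: eq_big_seq => a /wa ?; rewrite ln_cnormXz.
exists v; split.
- apply: happD; first exact: happ_log hu u0 rs.
  by apply: happ_sum => a aS; apply: happZ; apply: happ_bl => //; exact: gr.
- move=> w wr; rewrite G ?(good_notin gr wr) ?wr//; last by case/andP: rs.
  by congr (_ + _); apply: eq_bigr => a _; rewrite bl_circle.
- move=> z zS zr; rewrite G//; last by case/andP: rs => _; exact: lt_trans.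
  rewrite /v -addrA; congr (_ + _); rewrite [X in _ = _ + X]big_mkcond -big_split /=.
  apply: eq_bigr => a _; case: ifP => ar; first by rewrite -mulrDr subrKC.
  by rewrite addr0 /bl ar.
Qed.

Lemma ler_Mr_pts N r phi psi : (forall k : 'I_(2 ^ N), phi (r%:C * rt R N k) <= psi (r%:C * rt R N k)) ->
  Mr N r phi <= Mr N r psi.
Proof.
move=> h; rewrite /Mr ler_wpM2l ?invr_ge0 ?exprn_ge0//; apply: ler_sum => k _; exact: h.
Qed.

Lemma poisson_diff r z b v : happ r v -> 0 < r -> cnorm z + 2 * cnorm b <= r -> cnorm z < r ->
  cnorm (z + b) < r -> forall e, 0 < e -> \forall M \near \oo,
  `|v (z + b) - v z| <= 4 * r * cnorm b * Mr M r (fun w => `|v w| / cnorm (w - z) ^+ 2) + e.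
Proof.
move=> hv r0 zb zr zbr e e0; have e2 : 0 < e / 2 by rewrite divr_gt0.
apply: filterS2 (poisson hv zr e2) (poisson hv zbr e2) => M h1 h2.
set I1 := Mr M r _ in h1; set I2 := Mr M r _ in h2.
have h3 : `|I2 - I1| <= 4 * r * cnorm b * Mr M r (fun w => `|v w| / cnorm (w - z) ^+ 2).
  rewrite /I2 /I1 -MrB -MrZ; apply: le_trans (norm_Mr _ _ _) _; apply: ler_Mr => w.
  rewrite gtr0_norm// => wr; rewrite -mulrBl normrM mulrC.
  rewrite (_ : 4 * r * cnorm b * _ = `|v w| * (4 * r * cnorm b / cnorm (w - z) ^+ 2)); last ring.
  by rewrite ler_wpM2l// pk_diff.
move: h1 h2 h3; rewrite !ler_norml => /andP[? ?] /andP[? ?] /andP[? ?]; lra.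
Qed.

Lemma sqr_gap r s : 0 < r -> r < s -> 0 < s ^+ 2 - r ^+ 2.
Proof. by move=> r0 rs; rewrite !expr2; nra. Qed.

Lemma mean_inv_sqr_weight r s psi B : 0 < r < s -> mb s psi B -> (forall w, 0 <= psi w) ->
  forall e, 0 < e -> \forall N \near \oo, \forall M \near \oo,
  Mr N r (fun z => Mr M s (fun w => psi w / cnorm (w - z) ^+ 2)) <= 3 / (s ^+ 2 - r ^+ 2) * (B + e).
Proof.
move=> rs hB p0 e e0; apply: filterS (mean_inv_sqr rs) => N hN.
have [r0 rs'] : 0 < r /\ r < s by apply/andP.
apply: filterS (hB _ e0) => M hM; rewrite Mr_exchange.
apply: le_trans (_ : Mr M s (fun w => 3 / (s ^+ 2 - r ^+ 2) * psi w) <= _).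
  apply: ler_Mr => w; rewrite gtr0_norm; last lra.
  by move=> ws; rewrite MrZ mulrC ler_wpM2r// hN.
by rewrite MrZ ler_wpM2l// divr_ge0// ltW// sqr_gap.
Qed.

(** [poisson_diff] bounds the increment at z by an integral of |v| / |w - z|^2; averaging over z
    first, by [mean_inv_sqr], gives the constant 4 s |b| times 3 / (s^2 - r^2). *)
Lemma mean_poisson_diff r s b v B : happ s v -> 0 < r -> 0 < cnorm b -> r + 2 * cnorm b <= s ->
  mb s (fun w => `|v w|) B ->
  mb r (fun z => `|v (z + b) - v z|) (12 * s * cnorm b / (s ^+ 2 - r ^+ 2) * B).
Proof.
move=> hv r0 b0 rs hB e e0.
have q0 : 0 < s ^+ 2 - r ^+ 2 by apply: sqr_gap => //; lra.
pose k := 12 * s * cnorm b / (s ^+ 2 - r ^+ 2).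
have k0 : 0 < k by rewrite divr_gt0// !mulr_gt0//; lra.
have e2 : 0 < e / 2 by rewrite divr_gt0.
have e1 : 0 < e / 2 / k by rewrite divr_gt0.
have rs0 : 0 < r < s by lra.
apply: filterS (mean_inv_sqr_weight rs0 hB (fun w => normr_ge0 _) e1) => N hN.
have H : \forall M \near \oo, forall k : 'I_(2 ^ N), `|v (r%:C * rt R N k + b) - v (r%:C * rt R N k)| <=
   4 * s * cnorm b * Mr M s (fun w => `|v w| / cnorm (w - r%:C * rt R N k) ^+ 2) + e / 2.
  apply: filter_forall => i.
  have n1 : cnorm (r%:C * rt R N i) = r by rewrite cnormM cnorm_rt cnormR gtr0_norm ?mulr1.
  have n2 := cnormD (r%:C * rt R N i) b.
  by apply: poisson_diff => //; rewrite ?n1 in n2 *; lra.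
have [M [h1 h2]] := filter_ex (filterI H hN).
apply: le_trans (@ler_Mr_pts N r _ (fun z => 4 * s * cnorm b *
  Mr M s (fun w => `|v w| / cnorm (w - z) ^+ 2) + e / 2) h1) _; rewrite MrD MrZ Mr_cst.
have s0 : 0 <= 4 * s * cnorm b by rewrite !mulr_ge0//; lra.
have kE : 4 * s * cnorm b * (3 / (s ^+ 2 - r ^+ 2)) = k by rewrite /k; field; lra.
have := ler_wpM2l s0 h2; rewrite [leRHS]mulrA kE.
by rewrite mulrDr [k * (e / 2 / k)]mulrCA divff ?gt_eqF// -/k; lra.
Qed.

(** The increments of z - a and of [bl] are both at most |b|, and |z - a| <= |[bl]| lets the second
    contribution be bounded by the first: this is the factor 2. *)
Lemma log_diff_bound g S r v z b :
  (forall z, z \notin S -> cnorm z < r -> ln (cnorm (g z)) = v z + \sum_(a <- S | cnorm a < r)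
       (ord g a)%:~R * (ln (cnorm (z - a)) - ln (cnorm (bl r a z)))) ->
  0 < r -> z \notin S -> z + b \notin S -> cnorm z < r -> cnorm (z + b) < r ->
  `|ln (cnorm (g (z + b))) - ln (cnorm (g z))| <= `|v (z + b) - v z| + \sum_(a <- S | cnorm a < r)
     `|(ord g a)%:~R : R| * (2 * (ln (1 + cnorm b / cnorm (z - a)) + ln (1 + cnorm b / cnorm (z + b - a)))).
Proof.
move=> hg r0 zS zbS zr zbr; rewrite !hg// opprD addrACA -sumrB.
apply: le_trans (ler_normD _ _) _; rewrite lerD2l; apply: le_trans (ler_norm_sum _ _ _) _.
rewrite big_seq_cond [leRHS]big_seq_cond; apply: ler_sum => a /andP[aS ar].
rewrite -mulrBr normrM ler_wpM2l//.
have p1 : 0 < cnorm (z - a) by rewrite cnorm_gt0 subr_eq0; apply: contraNneq zS => ->.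
have p2 : 0 < cnorm (z + b - a) by rewrite cnorm_gt0 subr_eq0; apply: contraNneq zbS => ->.
have q1 : cnorm (z - a) <= cnorm (bl r a z) by rewrite bl_ge// ltW.
have q2 : cnorm (z + b - a) <= cnorm (bl r a (z + b)) by rewrite bl_ge// ltW.
have b0 := cnorm_ge0 b.
have d1 : `|cnorm (z - a) - cnorm (z + b - a)| <= cnorm b.
  rewrite ler_norml; have := cnorm_subl (z - a) (z + b - a); have := cnorm_subl (z + b - a) (z - a).
  rewrite (_ : z + b - a - (z - a) = b); last ring.
  rewrite (_ : z - a - (z + b - a) = - b); last ring.
  by rewrite cnormN; lra.
have d2 : `|cnorm (bl r a z) - cnorm (bl r a (z + b))| <= cnorm b.
  rewrite ler_norml; have := cnorm_subl (bl r a z) (bl r a (z + b)).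
  have := cnorm_subl (bl r a (z + b)) (bl r a z); have := bl_diff a z b r0.
  by rewrite [cnorm (bl r a z - _)]cnormBC; lra.
have e1 := ln_diff_sym 0 p1 p2 b0 d1.
have e2 := ln_diff_sym 0 (lt_le_trans p1 q1) (lt_le_trans p2 q2) b0 d2.
have mono (x y : R) : 0 < x -> x <= y -> ln (1 + cnorm b / y) <= ln (1 + cnorm b / x).
  move=> x0 xy; apply: ln1p_mono; first by rewrite divr_ge0//; lra.
  by rewrite ler_wpM2l// lef_pV2 ?posrE//; lra.
have e3 := mono _ _ p1 q1; have e4 := mono _ _ p2 q2.
by move: e1 e2; rewrite !ler_norml => /andP[? ?] /andP[? ?]; lra.
Qed.

(** The translated points a - b must avoid the circle as well, since the terms in z + b - a are
    averages centred at a - b. *)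
Lemma mean_log_diff g S r s t b B : mer g -> captures S t g -> 1 <= r -> 0 < cnorm b ->
  r + 2 * cnorm b <= s -> s < t -> good S r -> good S s -> (forall a, a \in S -> cnorm (a - b) != r) ->
  mb s (fun w => `|ln (cnorm (g w))|) B ->
  mb r (fun z => `|ln (cnorm (g (z + b))) - ln (cnorm (g z))|)
    (12 * s * cnorm b / (s ^+ 2 - r ^+ 2) * B +
     \sum_(a <- S | cnorm a < s) `|(ord g a)%:~R : R| * (2 * (dlt (cnorm b) r + dlt (cnorm b) r))).
Proof.
move=> mg cS r1 b0 rs st gr gs gb hB.
have r0 : 0 < r by lra.
have st0 : 0 < s < t by lra.
have [v [hv vg gv]] := blaschke mg cS st0 gs.
have hB' : mb s (fun w => `|v w|) B by apply: mb_le hB => [|w ws]; [lra|rewrite vg].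
have s0 : 0 < s by lra.
have h1 := mean_poisson_diff hv r0 b0 rs hB'.
have h2 : mb r (fun z => \sum_(a <- [seq a <- S | cnorm a < s]) `|(ord g a)%:~R : R| *
     (2 * (ln (1 + cnorm b / cnorm (z - a)) + ln (1 + cnorm b / cnorm (z + b - a)))))
     (\sum_(a <- [seq a <- S | cnorm a < s]) `|(ord g a)%:~R : R| * (2 * (dlt (cnorm b) r + dlt (cnorm b) r))).
  apply: mb_sum => a; rewrite mem_filter => /andP[_ aS].
  apply: mbZ => //; apply: mbZ => //; apply: mbD; first by apply: mean_ln1p => //; exact: gr.
  apply: mb_le (mean_ln1p r1 b0 (gb a aS)) => // w _.
  by rewrite (_ : w - (a - b) = w + b - a)//; ring.
have := mbD h1 h2; rewrite [X in mb _ _ (_ + X)]big_filter; apply: mb_le => // z zr; rewrite big_filter; apply: log_diff_bound => //.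
- exact: good_notin gr zr.
- apply/negP => /gb; rewrite addrK zr eqxx//.
- by lra.
- by have := cnormD z b; lra.
Qed.

(** The derivative is reached from finite differences, without differentiating Poisson's formula: a
    small step b in the direction of the conjugate of g'/g increases ln |g| by about |b| |g'/g|. *)
Lemma log_deriv_pointwise g S r s z l : mer g -> captures S s g -> 0 < r < s -> good S r ->
  z \notin S -> cnorm z < r -> cder g z l -> g z != 0 ->
  \forall M \near \oo, cnorm (l / g z) <= 1 +
    4 * r * Mr M r (fun w => `|ln (cnorm (g w))| / cnorm (w - z) ^+ 2) +
    \sum_(a <- S | cnorm a < r) `|(ord g a)%:~R : R| * (6 / cnorm (z - a)).
Proof.
move=> mg cS rs gr zS zr dg gz.
have r0 : 0 < r by case/andP: rs.
have [v [hv vg gv]] := blaschke mg cS rs gr.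
pose q := l / g z.
have za a : a \in S -> 0 < cnorm (z - a).
  by move=> aS; rewrite cnorm_gt0 subr_eq0; apply: contraNneq zS => ->.
have [l0|l0] := eqVneq q 0.
  near=> M; rewrite -/q l0 cnorm0 !addr_ge0//; last first.
    by apply: sumr_ge0 => a _; rewrite mulr_ge0// divr_ge0// cnorm_ge0.
  rewrite mulr_ge0//; first by lra.
  by apply: Mr_ge0 => w _; rewrite divr_ge0// exprn_ge0// cnorm_ge0.
have q0 : 0 < cnorm q by rewrite cnorm_gt0.
have near_a : \forall w \near nb z, forall a, a \in S -> cnorm (z - a) / 2 <= cnorm (w - a).
  have : \forall w \near nb z, forall i : 'I_(size S), cnorm (z - S`_i) / 2 <= cnorm (w - S`_i).
    apply: filter_forall => i; have p := za _ (mem_nth 0 (ltn_ord i)).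
    have p2 : 0 < cnorm (z - S`_i) / 2 by rewrite divr_gt0.
    apply: filterS (nb_ball z p2) => w hw.
    by have := cnorm_triangle w z S`_i; rewrite [cnorm (z - w)]cnormBC; lra.
  apply: filterS => w hw a /(nthP 0)[i iS <-]; exact: (hw (Ordinal iS)).
(* Two errors of t / 4, from the expansion of ln |g| and from Poisson's formula, are what the
   summand 1 absorbs after division by t. *)
have e4 : 0 < 4^-1 :> R by rewrite invr_gt0.
have [d [dp [hd1 hd2 hd3]]] : exists d, 0 < d /\ [/\ forall w, cnorm (w - z) < d ->
    `|ln (cnorm (g w)) - ln (cnorm (g z)) - complex.Re (q * (w - z))| <= 4^-1 * cnorm (w - z),
    forall w, cnorm (w - z) < d -> forall a, a \in S -> cnorm (z - a) / 2 <= cnorm (w - a) &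
    cnorm z + 2 * d < r].
  have [d1 d10 h1] := ln_cder gz dg e4; have [d2 d20 h2] := near_a.
  have d30 : 0 < (r - cnorm z) / 4 by rewrite divr_gt0//; lra.
  exists (Num.min d1 (Num.min d2 ((r - cnorm z) / 4))); rewrite !lt_min d10 d20 d30; split=> //.
  split=> [w|w|]; rewrite ?lt_min.
  - by move=> /andP[? _]; exact: h1.
  - by move=> /and3P[_ ? _]; exact: h2.
  - have : Num.min d1 (Num.min d2 ((r - cnorm z) / 4)) <= (r - cnorm z) / 4 by rewrite !ge_min lexx !orbT.
    lra.
pose t := d / 2; have t0 : 0 < t by rewrite divr_gt0.
have td : t < d by rewrite /t; lra.
(* The step of length t for which Re (q b) = t |q|. *)
pose b := (t / cnorm q)%:C * conjc q.
have nbt : cnorm b = t.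
  rewrite /b cnormM cnormR cnorm_conj ger0_norm ?(divfK (lt0r_neq0 q0))//.
  by rewrite divr_ge0// ltW.
have zbz : z + b - z = b by ring.
have qb : complex.Re (q * b) = t * cnorm q.
  rewrite /b mulrCA mul_conjc -rmorphM /= expr2; field; exact: lt0r_neq0.
have hb1 := hd1 (z + b); have hb2 := hd2 (z + b); rewrite zbz nbt in hb1 hb2.
have := hb1 td; rewrite qb => {}hb1; have {}hb2 := hb2 td.
have zbr : cnorm (z + b) < r by have := cnormD z b; rewrite nbt; lra.
have zbS : z + b \notin S.
  apply/negP => zS'; have := hb2 _ zS'; rewrite subrr cnorm0.
  by have := za _ zS'; lra.
have LB := log_diff_bound gv r0 zS zbS zr zbr; rewrite nbt in LB.
have hzb : cnorm z + 2 * cnorm b <= r by rewrite nbt; lra.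
have e5 : 0 < t / 4 by rewrite divr_gt0.
apply: filterS (poisson_diff hv r0 hzb zr zbr e5) => M; rewrite nbt => hM.
have vM : Mr M r (fun w => `|v w| / cnorm (w - z) ^+ 2) = Mr M r (fun w => `|ln (cnorm (g w))| / cnorm (w - z) ^+ 2).
  by apply: Mr_ext => w; rewrite gtr0_norm// => wr; rewrite vg.
rewrite vM in hM; set X := Mr M r _ in hM *.
have LS : \sum_(a <- S | cnorm a < r) `|(ord g a)%:~R : R| *
     (2 * (ln (1 + t / cnorm (z - a)) + ln (1 + t / cnorm (z + b - a)))) <=
   t * \sum_(a <- S | cnorm a < r) `|(ord g a)%:~R : R| * (6 / cnorm (z - a)).
  rewrite mulr_sumr big_seq_cond [leRHS]big_seq_cond; apply: ler_sum => a /andP[aS _].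
  rewrite [leRHS]mulrCA ler_wpM2l//; have p1 := za _ aS; have p2 := hb2 _ aS.
  have t1 : ln (1 + t / cnorm (z - a)) <= t / cnorm (z - a).
    by apply: ln1p_le; rewrite divr_ge0// ltW.
  have t2 : ln (1 + t / cnorm (z + b - a)) <= 2 * t / cnorm (z - a).
    apply: le_trans (ln1p_le _) _; first by rewrite divr_ge0 ?cnorm_ge0// ltW.
    rewrite ler_pdivrMr; last lra.
    rewrite mulrAC ler_pdivlMr//.
    have := ler_wpM2l (ltW t0) p2; lra.
  rewrite (_ : t * (6 / _) = 2 * (t / cnorm (z - a) + 2 * t / cnorm (z - a))); last by field; exact: lt0r_neq0.
  by rewrite ler_wpM2l// lerD.
rewrite -/q -(ler_pM2l t0).
move: hb1; rewrite ler_norml => /andP[hb1 _].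
have := ler_norm (ln (cnorm (g (z + b))) - ln (cnorm (g z))).
move: LS LB hM; set Y := \sum_(a <- S | _) _ * (6 / _); set Z := \sum_(a <- S | _) _.
rewrite !mulrDr mulr1 => LS LB hM hn.
have -> : t * (4 * r * X) = 4 * r * t * X by ring.
by lra.
Unshelve. all: by end_near. Qed.

Lemma ln1p_sum (I : Type) (t : seq I) (P : pred I) (F : I -> R) : (forall i, 0 <= F i) ->
  ln (1 + \sum_(i <- t | P i) F i) <= \sum_(i <- t | P i) ln (1 + F i).
Proof.
move=> F0; elim: t => [|i t IH]; first by rewrite !big_nil addr0 ln1.
rewrite !big_cons; case: ifP => // _; apply: le_trans (_ : ln ((1 + F i) * (1 + \sum_(j <- t | P j) F j)) <= _).
  have s0 : 0 <= \sum_(j <- t | P j) F j by exact: sumr_ge0.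
  have p := mulr_ge0 (F0 i) s0; have := F0 i => f0.
  by rewrite ler_ln ?posrE; nra.
rewrite lnM ?posrE ?ltr_wpDr ?sumr_ge0//; first by rewrite lerD2l.
Qed.

Lemma ln1p_natM n (y : R) : 0 <= y -> ln (1 + n%:R * y) <= n%:R * ln (1 + y).
Proof.
move=> y0; have p : 0 < 1 + y by lra.
rewrite [leRHS]mulr_natl -lnXn// ler_ln ?posrE ?exprn_gt0//; first exact: bernoulli.
by rewrite ltr_wpDr// mulr_ge0.
Qed.

(** The pointwise bound is 1 + X + Y. From 2 + X + Y <= 2 (1 + X) (1 + Y), the Poisson part X enters
    linearly, and the sum Y over zeros and poles only through its logarithm, to which [mean_ln1p]
    applies. *)
Lemma mean_log_deriv g S r s t B : mer g -> captures S t g -> 1 <= r -> r < s < t ->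
  good S r -> good S s -> mb s (fun w => `|ln (cnorm (g w))|) B ->
  mb r (fun z => ln (1 + cnorm (cD g z / g z)))
    (1 + 12 * s / (s ^+ 2 - r ^+ 2) * B + \sum_(a <- S | cnorm a < s) `|(ord g a)%:~R : R| * dlt 6 r).
Proof.
move=> mg cS r1 rst gr gs hB e e0.
have [r0 s0 rs st] : [/\ 0 < r, 0 < s, r < s & s < t] by split; lra.
have q0 : 0 < s ^+ 2 - r ^+ 2 by apply: sqr_gap => //; lra.
pose k := 12 * s / (s ^+ 2 - r ^+ 2).
have k0 : 0 < k by rewrite divr_gt0// mulr_gt0.
have e2 : 0 < e / 2 by rewrite divr_gt0.
have e1 : 0 < e / 2 / k by rewrite divr_gt0.
have rs0 : 0 < r < s by rewrite r0.
have st0 : 0 < s < t by rewrite s0.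
have h2 : mb r (fun z => \sum_(a <- [seq a <- S | cnorm a < s]) `|(ord g a)%:~R : R| * ln (1 + 6 / cnorm (z - a)))
     (\sum_(a <- [seq a <- S | cnorm a < s]) `|(ord g a)%:~R : R| * dlt 6 r).
  apply: mb_sum => a; rewrite mem_filter => /andP[_ aS].
  by apply: mbZ => //; apply: mean_ln1p => //; exact: gr.
apply: filterS2 (mean_inv_sqr_weight rs0 hB (fun w => normr_ge0 _) e1) (h2 _ e2) => N hN h2N.
have H : \forall M \near \oo, forall k : 'I_(2 ^ N), let z := r%:C * rt R N k in
    cnorm (cD g z / g z) <= 1 +
    4 * s * Mr M s (fun w => `|ln (cnorm (g w))| / cnorm (w - z) ^+ 2) +
    \sum_(a <- S | cnorm a < s) `|(ord g a)%:~R : R| * (6 / cnorm (z - a)).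
  apply: filter_forall => i /=.
  have n1 : cnorm (r%:C * rt R N i) = r by rewrite cnormM cnorm_rt cnormR gtr0_norm ?mulr1.
  have [cg g0] := captured cS gr n1 (lt_trans rs st).
  apply: (log_deriv_pointwise mg cS st0 gs) => //; first exact: good_notin gr n1.
    by rewrite n1.
  exact: cDP.
have [M [h1 h3]] := filter_ex (filterI H hN).
pose X z := 4 * s * Mr M s (fun w => `|ln (cnorm (g w))| / cnorm (w - z) ^+ 2).
have X0 z : 0 <= X z.
  rewrite mulr_ge0//; first by lra.
  by apply: Mr_ge0 => w _; rewrite divr_ge0// exprn_ge0// cnorm_ge0.
apply: le_trans (_ : Mr N r (fun z => 1 + X z + \sum_(a <- [seq a <- S | cnorm a < s])
    `|(ord g a)%:~R : R| * ln (1 + 6 / cnorm (z - a))) <= _).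
  apply: ler_Mr_pts => i; have := h1 i => /=; set z := r%:C * rt R N i; rewrite -/(X z) big_filter.
  have F0 a : 0 <= `|(ord g a)%:~R : R| * (6 / cnorm (z - a)) by rewrite mulr_ge0// divr_ge0// cnorm_ge0.
  set Y := \sum_(a <- S | _) _; have Y0 : 0 <= Y by exact: sumr_ge0.
  move=> hz; have c0 := cnorm_ge0 (cD g z / g z).
  apply: le_trans (_ : ln (2 * (1 + X z) * (1 + Y)) <= _).
    have := X0 z => x0; have p := mulr_ge0 x0 Y0.
    by clear -x0 Y0 p hz c0; rewrite ler_ln ?posrE; nra.
  rewrite lnM ?posrE ?mulr_gt0 ?ltr_wpDr// lnM ?posrE ?ltr_wpDr//.
  have l2 : ln 2 <= 1 :> R by have := ln1p_le (@ler01 R).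
  have lX := ln1p_le (X0 z).
  apply: lerD; first by lra.
  apply: le_trans (ln1p_sum _ _ F0) _; apply: ler_sum => a _.
  rewrite -intr_norm (_ : `|ord g a|%:~R = `|ord g a|%N%:R); last by rewrite -abszE.
  by apply: ln1p_natM; rewrite divr_ge0// cnorm_ge0.
rewrite !MrD Mr_cst MrZ -!addrA lerD2l.
have s4 : 0 <= 4 * s by lra.
have kE : 4 * s * (3 / (s ^+ 2 - r ^+ 2)) = k by rewrite /k; field; lra.
have := ler_wpM2l s4 h3; rewrite [leRHS]mulrA kE.
move: h2N; rewrite big_filter -/k mulrDr [k * (e / 2 / k)]mulrCA divff ?gt_eqF//; clear; lra.
Qed.

End LogDifferences.

(** * Counting functions and bounds for the characteristic *)

Section Counting.
Variable R : realType.
Local Notation C := (complex R).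
Local Notation "x %:C" := (real_complex R x).
Implicit Types (z w a b c : C) (r d s B L T : R) (u g h F G Q : C -> C) (phi psi v : C -> R) (S : seq C).

Local Notation lp z := (logplus (cnorm z)).

Lemma lp_ge0 z : 0 <= lp z. Proof. by rewrite /logplus le_max lexx. Qed.

Lemma ln_le_lp z : ln (cnorm z) <= lp z. Proof. by rewrite /logplus le_max lexx orbT. Qed.

Lemma lpM z w : lp (z * w) <= lp z + lp w.
Proof.
have lp0 : lp (0 : C) = 0 by rewrite cnorm0 /logplus ln0// maxxx.
have [->|z0] := eqVneq z 0; first by rewrite mul0r lp0 add0r lp_ge0.
have [->|w0] := eqVneq w 0; first by rewrite mulr0 lp0 addr0 lp_ge0.
by rewrite {1}/logplus ge_max addr_ge0 ?lp_ge0// ln_cnormM// lerD// ln_le_lp.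
Qed.

Lemma lp_le_ln1D z : lp z <= ln (1 + cnorm z).
Proof.
have z0 := cnorm_ge0 z; rewrite /logplus ge_max ln1p_ge0//=.
have [->|p] := eqVneq z 0; first by rewrite cnorm0 addr0 ln0// ln1.
by rewrite ler_ln ?posrE ?cnorm_gt0// ?ltr_wpDr//; lra.
Qed.

Lemma ln1D_le_lp z : ln (1 + cnorm z) <= lp z + 1.
Proof.
have z0 := cnorm_ge0 z; have l2 : ln 2 <= 1 :> R by have := ln1p_le (@ler01 R).
have [z1|z1] := leP (cnorm z) 1.
  have : ln (1 + cnorm z) <= ln 2 by rewrite ler_ln ?posrE; lra.
  by have := lp_ge0 z; lra.
have : ln (1 + cnorm z) <= ln (2 * cnorm z) by rewrite ler_ln ?posrE; lra.
rewrite lnM ?posrE//; last lra.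
by have := ln_le_lp z; lra.
Qed.

Lemma lpD z w : lp (z + w) <= lp z + lp w + 2.
Proof.
have z0 := cnorm_ge0 z; have w0 := cnorm_ge0 w.
apply: le_trans (lp_le_ln1D _) _; apply: le_trans (_ : ln ((1 + cnorm z) * (1 + cnorm w)) <= _).
  have p := mulr_ge0 z0 w0; have := cnormD z w; have := cnorm_ge0 (z + w).
  by move=> h1 h2; rewrite ler_ln ?posrE; nra.
rewrite lnM ?posrE ?ltr_wpDr//; have := ln1D_le_lp z; have := ln1D_le_lp w; lra.
Qed.

Lemma lpN z : lp (- z) = lp z. Proof. by rewrite cnormN. Qed.

Lemma lpB z w : lp (z - w) <= lp z + lp w + 2.
Proof. by have := lpD z (- w); rewrite lpN. Qed.

Lemma lpV z : z != 0 -> lp z^-1 = lp z - ln (cnorm z).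
Proof.
move=> z0; rewrite /logplus ln_cnormV//.
by have [h|h] := leP 0 (ln (cnorm z)); [rewrite (max_idPl _)|rewrite (max_idPr _)]; lra.
Qed.

Definition NZ r0 S r g : R := \sum_(a <- S) (Num.max (ord g a) 0)%:~R * nu r0 r a.
Definition NP r0 S r g : R := \sum_(a <- S) (Num.max (- ord g a) 0)%:~R * nu r0 r a.

Definition rad r0 s S r := [/\ 0 < r0, r0 <= r, r < s & good S r].
(** L, the mean of ln |g| on |w| = r0, plays the part of ln |g(0)| in Jensen's formula. It does not
    depend on s and S, so one constant serves all radii. *)
Definition adm r0 s S g L := [/\ mer g, captures S s g, 0 < r0 < s, good S r0 &
  mlim r0 (fun w => ln (cnorm (g w))) L].
(* T bounds the Nevanlinna characteristic of g at r, normalised at r0. *)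
Definition Tb r0 S g r T := mb r (fun w => lp (g w)) (T - NP r0 S r g).

Lemma sum_nu_le r0 s S r (k l : C -> int) : rad r0 s S r -> (forall a, a \in S -> (k a <= l a)%R) ->
  \sum_(a <- S) (k a)%:~R * nu r0 r a <= \sum_(a <- S) (l a)%:~R * nu r0 r a.
Proof.
move=> [r00 r0r _ _] kl; rewrite big_seq [leRHS]big_seq; apply: ler_sum => a aS.
by rewrite ler_wpM2r ?nu_ge0 ?r00// ler_int kl.
Qed.

Lemma sum_nu_ge0 r0 s S r (k : C -> int) : rad r0 s S r -> (forall a, a \in S -> (0 <= k a)%R) ->
  0 <= \sum_(a <- S) (k a)%:~R * nu r0 r a.
Proof.
move=> hr k0; apply: le_trans (sum_nu_le (k := fun=> 0) hr k0).
by rewrite big1// => a _; rewrite mul0r.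
Qed.

Lemma NZ_ge0 r0 s S r g : rad r0 s S r -> 0 <= NZ r0 S r g.
Proof. by move=> hr; apply: (sum_nu_ge0 hr) => a _; rewrite le_max lexx orbT. Qed.

Lemma NP_ge0 r0 s S r g : rad r0 s S r -> 0 <= NP r0 S r g.
Proof. by move=> hr; apply: (sum_nu_ge0 hr) => a _; rewrite le_max lexx orbT. Qed.

Lemma NZ_NP r0 S r g : NZ r0 S r g - NP r0 S r g = \sum_(a <- S) (ord g a)%:~R * nu r0 r a.
Proof.
rewrite /NZ /NP -sumrB; apply: eq_bigr => a _; rewrite -mulrBl -rmorphB /=; congr (_%:~R * _); lia.
Qed.

Lemma rad_gt0 r0 s S r : rad r0 s S r -> 0 < r.
Proof. by move=> [r00 h _ _]; exact: lt_le_trans h. Qed.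

Lemma jensen_NZ r0 s S r g L : adm r0 s S g L -> rad r0 s S r ->
  mlim r (fun w => ln (cnorm (g w))) (L + (NZ r0 S r g - NP r0 S r g)).
Proof.
move=> [mg cS r0s g0 hL] hr; have rp := rad_gt0 hr; case: hr => _ _ rs gr.
have rrs : 0 < r < s by rewrite rp.
by rewrite NZ_NP; exact: jensen mg cS r0s g0 rrs gr hL.
Qed.

Lemma rad_neq0 r0 s S r g L w : adm r0 s S g L -> rad r0 s S r -> cnorm w = r -> g w != 0.
Proof. by move=> [mg cS _ _ _] [_ _ rs gr] wr; have [] := captured cS gr wr rs. Qed.

(** First main theorem in the form used here: ln <= log+ inside Jensen's formula. *)
Lemma Tb_NZ r0 s S r g L T : adm r0 s S g L -> rad r0 s S r -> Tb r0 S g r T -> NZ r0 S r g <= T - L.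
Proof.
move=> ag hr hT; have r0p := rad_gt0 hr; have [_ h2] := jensen_NZ ag hr.
have h : mb r (fun w => ln (cnorm (g w))) (T - NP r0 S r g).
  by apply: mb_le hT => // w _; exact: ln_le_lp.
by have := mb_opp r0p h h2; lra.
Qed.

Lemma Tb_ge r0 s S r g L T : adm r0 s S g L -> rad r0 s S r -> Tb r0 S g r T -> L <= T.
Proof. by move=> ag hr hT; have := Tb_NZ ag hr hT; have := NZ_ge0 g hr; lra. Qed.

Lemma Tb_NP r0 s S r g T : rad r0 s S r -> Tb r0 S g r T -> NP r0 S r g <= T.
Proof.
move=> hr hT; have r0p := rad_gt0 hr; have : 0 <= T - NP r0 S r g by apply: mb_ge0 hT => // w _; exact: lp_ge0.
lra.
Qed.

Lemma Tb_ge0 r0 s S r g T : rad r0 s S r -> Tb r0 S g r T -> 0 <= T.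
Proof. by move=> hr hT; apply: le_trans (Tb_NP hr hT); exact: NP_ge0 hr. Qed.

Lemma Tb_leT r0 S r g T T' : Tb r0 S g r T -> T <= T' -> Tb r0 S g r T'.
Proof. by move=> hT TT; apply: mb_leB hT _; lra. Qed.

(** |ln x| = 2 log+ x - ln x, and Jensen's formula evaluates the mean of the last term. *)
Lemma Tb_abs r0 s S r g L T : adm r0 s S g L -> rad r0 s S r -> Tb r0 S g r T ->
  mb r (fun w => `|ln (cnorm (g w))|) (2 * (T + `|L|)).
Proof.
move=> ag hr hT; have r0p := rad_gt0 hr; have [_ h2] := jensen_NZ ag hr.
have z := NZ_ge0 g hr; have p := NP_ge0 g hr.
apply: mb_leB (mb_le r0p _ (mbD (mbZ (ler0n R 2) hT) h2)) _.
  move=> w _; rewrite /logplus.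
  have [h|h] := leP 0 (ln (cnorm (g w))); first by rewrite ger0_norm; lra.
  by rewrite ltr0_norm; lra.
by have := ler_norm (- L); rewrite normrN; have := normr_ge0 L; lra.
Qed.

(** By [nu_gap], each zero or pole in |a| < r weighs at least (r' - r) / r' in the integrated counts
    at r'. *)
Lemma count_le r0 s S r r' g L T : adm r0 s S g L -> rad r0 s S r -> rad r0 s S r' -> r < r' ->
  Tb r0 S g r' T ->
  \sum_(a <- S | cnorm a < r) `|(ord g a)%:~R : R| <= r' / (r' - r) * (2 * (T + `|L|)).
Proof.
move=> ag hr hr' rr' hT; have := Tb_NZ ag hr' hT; have := Tb_NP hr' hT => hP hZ.
have r'0 := rad_gt0 hr'; have q : 0 < (r' - r) / r' by rewrite divr_gt0//; lra.
have -> : r' / (r' - r) * (2 * (T + `|L|)) = 2 * (T + `|L|) / ((r' - r) / r') by field; lra.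
rewrite ler_pdivlMr// mulr_suml.
apply: (@le_trans _ _ (NZ r0 S r' g + NP r0 S r' g)); last first.
  by have := ler_norm (- L); rewrite normrN; have := normr_ge0 L; have := NP_ge0 g hr'; lra.
rewrite /NZ /NP -big_split /= big_mkcond; apply: ler_sum => a _; rewrite -mulrDl -rmorphD /=.
have -> : Num.max (ord g a) 0 + Num.max (- ord g a) 0 = `|ord g a| by lia.
case: hr => r00 r0r _ _; case: hr' => _ r0r' _ _; have n0 := @nu_ge0 R r0 r' a; rewrite r00 r0r' in n0.
case: ifP => ar; last by rewrite mulr_ge0// ?n0// ler0z.
by rewrite -intr_norm ler_wpM2l ?ler0z// nu_gap// r00.
Qed.

(** log+ |1 / G| is rewritten as log+ |G| - ln |G|, and Jensen's formula turns the last mean into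
    orders of G; the poles of F and G, both majorised by p, are thereby paid for only once. *)
Lemma Tb_quot r0 s S r F G Q L (p : C -> int) mF mG : adm r0 s S G L -> rad r0 s S r ->
  (forall w, cnorm w = r -> Q w = F w / G w) ->
  (forall a, [/\ ord Q a = ord F a - ord G a, - p a <= ord F a, - p a <= ord G a & 0 <= p a]) ->
  mb r (fun w => lp (F w)) mF -> mb r (fun w => lp (G w)) mG ->
  Tb r0 S Q r (mF + mG - L + \sum_(a <- S) (p a)%:~R * nu r0 r a).
Proof.
move=> aG hr hQ ho hF hG; have r0p := rad_gt0 hr; have [_ hJ] := jensen_NZ aG hr.
apply: mb_leB (mb_le r0p _ (mbD (mbD hF hG) hJ)) _.
  move=> w wr; rewrite hQ//; apply: le_trans (lpM _ _) _.
  by rewrite lpV ?(rad_neq0 aG hr wr)//; lra.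
rewrite NZ_NP; suff : NP r0 S r Q <= \sum_(a <- S) (ord G a)%:~R * nu r0 r a + \sum_(a <- S) (p a)%:~R * nu r0 r a.
  lra.
rewrite -big_split /= -(eq_bigr _ (fun a _ => mulrDl _ _ _)) /NP.
under [leRHS]eq_bigr do rewrite -rmorphD /=.
by apply: (sum_nu_le hr) => a _; have [] := ho a; lia.
Qed.

(** As r and r + 2 K stay within [X, 3X], ln r is comparable with ln X and (r + 2 K) / r is at most
    3. *)
Lemma window_step (X K r be : R) : expR 1 <= X -> 0 < K -> X <= r -> r + 2 * K <= 3 * X -> 0 <= be ->
  12 * (r + K) / ((r + K) ^+ 2 - r ^+ 2) <= 12 / K /\
  (r + 2 * K) / ((r + 2 * K) - (r + K)) * dlt be r <= 3 / K * ((1 + 64 * be) * ln X).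
Proof.
move=> X1 K0 Xr rK b0; have X0 : 0 < X by apply: lt_le_trans X1; exact: expR_gt0.
have r0 : 0 < r by lra.
split.
  have -> : (r + K) ^+ 2 - r ^+ 2 = K * (2 * r + K) by ring.
  have q : 0 < 2 * r + K by lra.
  have -> : 12 * (r + K) / (K * (2 * r + K)) = 12 / K * ((r + K) / (2 * r + K)) by field; lra.
  by rewrite ler_piMr ?divr_ge0// ?(ltW K0)// ler_pdivrMr//; lra.
have lX : 1 <= ln X by rewrite -[1]expRK ler_ln ?posrE ?expR_gt0.
have e1 : 2 <= expR 1 :> R by have := expR_ge1Dx (1 : R); lra.
have lr : ln r <= ln X + 2.
  have : ln r <= ln (X * (2 * 2)) by rewrite ler_ln ?posrE; lra.
  rewrite lnM ?posrE// lnM ?posrE//; have : ln 2 <= 1 :> R by have := ln1p_le (@ler01 R).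
  lra.
have -> : r + 2 * K - (r + K) = K by ring.
rewrite /dlt.
have -> : (r + 2 * K) / K * ((1 + 16 * be * (ln r + 1)) / r) = (r + 2 * K) / K / r * (1 + 16 * be * (ln r + 1)) by field; lra.
have n0 : 0 <= ln r by apply: ln_ge0; lra.
apply: ler_pM.
- by rewrite !divr_ge0//; lra.
- by have := mulr_ge0 b0 n0; lra.
- rewrite ler_pdivrMr// (_ : 3 / K * r = 3 * r / K); last by ring.
  by rewrite ler_pM2r ?invr_gt0//; lra.
- by have h1 := ler_wpM2l b0 lr; have h2 := ler_wpM2l b0 lX; lra.
Qed.

Definition step (X K r : R) := [/\ expR 1 <= X, 0 < K, X <= r & r + 2 * K <= 3 * X].

(** Poisson's formula is used on |w| = r + K, and the zeros and poles inside are counted from r + 2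
    K. The proof needs only 24 |b| + 24 (1 + 64 |b|); the powers of ten round up. *)
Lemma ldl_shift r0 s S g L X K (eps : R) b r T : adm r0 s S g L -> step X K r ->
  rad r0 s S r -> rad r0 s S (r + K) -> rad r0 s S (r + 2 * K) ->
  0 < cnorm b -> 2 * cnorm b <= K -> ((2 * 10 ^+ 3) * cnorm b + (3 * 10 ^+ 3)) * ln X <= eps * K ->
  (forall a, a \in S -> cnorm (a - b) != r) ->
  Tb r0 S g (r + K) T -> Tb r0 S g (r + 2 * K) T ->
  mb r (fun z => `|ln (cnorm (g (z + b))) - ln (cnorm (g z))|) (eps * (T + `|L|)).
Proof.
move=> ag [X1 K0 Xr rK] hr hr1 hr2 b0 bK heps gb hT1 hT2.
have [h1 h2] := window_step X1 K0 Xr rK (ltW b0).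
have [mg cS _ _ _] := ag; case: (hr) => _ _ _ gr; case: (hr1) => _ _ r1s gr1.
have r1 : 1 <= r by apply: le_trans Xr; apply: le_trans X1; have := expR_ge1Dx (1 : R); lra.
have rb : r + 2 * cnorm b <= r + K by lra.
have := mean_log_diff mg cS r1 b0 rb r1s gr gr1 gb (Tb_abs ag hr1 hT1).
move/mb_leB; apply; rewrite -mulr_suml.
have hc := count_le ag hr1 hr2 _ hT2; have {}hc := hc (_ : r + K < r + 2 * K).
have {hc} := hc ltac:(lra); set n := \sum_(a <- S | _) _ => hn.
have E0 : 0 <= T + `|L|.
  by have := Tb_ge ag hr1 hT1; have := ler_norm (- L); rewrite normrN; lra.
have lX : 1 <= ln X.
  by rewrite -[1]expRK ler_ln ?posrE ?expR_gt0//; apply: lt_le_trans X1; exact: expR_gt0.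
have d0 : 0 <= dlt (cnorm b) r.
  rewrite /dlt divr_ge0//; last lra.
  by have := mulr_ge0 (ltW b0) (ln_ge0 r1); lra.
set E := T + `|L| in E0 hn *.
have s1 : 12 * (r + K) * cnorm b / ((r + K) ^+ 2 - r ^+ 2) * (2 * E) <= 24 * cnorm b / K * E.
  have h3 := ler_wpM2r (mulr_ge0 (ltW b0) (mulr_ge0 (ler0n R 2) E0)) h1.
  rewrite (_ : _ * (2 * E) = 12 * (r + K) / ((r + K) ^+ 2 - r ^+ 2) * (cnorm b * (2 * E))); last by ring.
  by apply: le_trans h3 _; rewrite le_eqVlt; apply/orP; left; apply/eqP; field; lra.
have s2 : n * (2 * (dlt (cnorm b) r + dlt (cnorm b) r)) <= 24 / K * ((1 + 64 * cnorm b) * ln X) * E.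
  have h3 := ler_wpM2r (mulr_ge0 (ler0n R 4) d0) hn.
  have h4 := ler_wpM2r (mulr_ge0 (ler0n R 8) E0) h2.
  lra.
have s3 : 24 * cnorm b / K * E + 24 / K * ((1 + 64 * cnorm b) * ln X) * E <= eps * E.
  rewrite -mulrDl ler_wpM2r//.
  rewrite (_ : 24 * cnorm b / K + 24 / K * ((1 + 64 * cnorm b) * ln X) = (24 * cnorm b + 24 * ((1 + 64 * cnorm b) * ln X)) / K); last by field; lra.
  by rewrite ler_pdivrMr//; have := ler_wpM2l (ltW b0) lX; lra.
lra.
Qed.

(** 3000 rounds up 24 + 6 (1 + 64 x 6), where the last 6 is the numerator in
    [log_deriv_pointwise]. *)
Lemma ldl_deriv r0 s S g L X K (eps : R) r T : adm r0 s S g L -> step X K r ->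
  rad r0 s S r -> rad r0 s S (r + K) -> rad r0 s S (r + 2 * K) ->
  (3 * 10 ^+ 3) * ln X <= eps * K -> Tb r0 S g (r + K) T -> Tb r0 S g (r + 2 * K) T ->
  mb r (fun z => ln (1 + cnorm (cD g z / g z))) (1 + eps * (T + `|L|)).
Proof.
move=> ag [X1 K0 Xr rK] hr hr1 hr2 heps hT1 hT2.
have [h1 h2] := window_step X1 K0 Xr rK (ler0n R 6).
have [mg cS _ _ _] := ag; case: (hr) => _ _ _ gr; case: (hr1) => _ _ r1s gr1.
have r1 : 1 <= r by apply: le_trans Xr; apply: le_trans X1; have := expR_ge1Dx (1 : R); lra.
have rs : r < r + K < s by rewrite r1s andbT; lra.
have := mean_log_deriv mg cS r1 rs gr gr1 (Tb_abs ag hr1 hT1).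
move/mb_leB; apply; rewrite -mulr_suml -addrA lerD2l.
have hc := count_le ag hr1 hr2 _ hT2; have {}hc := hc (_ : r + K < r + 2 * K).
have {hc} := hc ltac:(lra); set n := \sum_(a <- S | _) _ => hn.
have E0 : 0 <= T + `|L|.
  by have := Tb_ge ag hr1 hT1; have := ler_norm (- L); rewrite normrN; lra.
have lX : 1 <= ln X.
  by rewrite -[1]expRK ler_ln ?posrE ?expR_gt0//; apply: lt_le_trans X1; exact: expR_gt0.
have d0 : 0 <= dlt 6 r.
  by rewrite /dlt divr_ge0//; have := ln_ge0 r1; lra.
set E := T + `|L| in E0 hn *.
have s1 : 12 * (r + K) / ((r + K) ^+ 2 - r ^+ 2) * (2 * E) <= 24 / K * E.
  have h3 := ler_wpM2r (mulr_ge0 (ler0n R 2) E0) h1.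
  by apply: le_trans h3 _; rewrite le_eqVlt; apply/orP; left; apply/eqP; ring.
have s2 : n * dlt 6 r <= 6 / K * ((1 + 64 * 6) * ln X) * E.
  have h3 := ler_wpM2r d0 hn.
  have h4 := ler_wpM2r (mulr_ge0 (ler0n R 2) E0) h2.
  lra.
have s3 : 24 / K * E + 6 / K * ((1 + 64 * 6) * ln X) * E <= eps * E.
  rewrite -mulrDl ler_wpM2r//.
  rewrite (_ : 24 / K + 6 / K * ((1 + 64 * 6) * ln X) = (24 + 6 * ((1 + 64 * 6) * ln X)) / K); last by field; lra.
  by rewrite ler_pdivrMr//; lra.
lra.
Qed.

End Counting.

(** * Second main theorem for three small entire functions *)

Section SecondMain.
Variable R : realType.
Local Notation C := (complex R).
Local Notation "x %:C" := (real_complex R x).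
Implicit Types (z w a b c : C) (r d s B L T k : R) (u g h f F G Q : C -> C) (S : seq C).
Local Notation lp z := (logplus (cnorm z)).

Lemma ordB_lt g h z : mer g -> mer h -> ord g z < ord h z -> ord (fun w => g w - h w) z = ord g z.
Proof. by move=> mg mh lt; apply: (ordD_lt mg (merN mh)); rewrite ordN. Qed.

Lemma ordB_ge g h z (k : int) : mer g -> mer h -> mer (fun w => g w - h w) ->
  k <= ord g z -> k <= ord h z -> k <= ord (fun w => g w - h w) z.
Proof. by move=> mg mh mgh kg kh; apply: (ordD_ge mg (merN mh)) => //; rewrite ordN. Qed.

Lemma ordf g h z : mer g -> mer h -> ord (fun w => g w / h w) z = ord g z - ord h z.
Proof. by move=> mg mh; rewrite ordM ?ordV//; exact: merV. Qed.

Lemma merf g h : mer g -> mer h -> mer (fun w => g w / h w).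
Proof. by move=> mg mh; apply: merM => //; exact: merV. Qed.

Lemma lp1 : lp (1 : C) = 0.
Proof. by rewrite cnorm1 /logplus ln1 maxxx. Qed.

Lemma mb_lpM r g h (x y : R) : 0 < r -> mb r (fun w => lp (g w)) x -> mb r (fun w => lp (h w)) y ->
  mb r (fun w => lp (g w * h w)) (x + y).
Proof. by move=> r0 hg hh; apply: mb_le (mbD hg hh) => // w _; exact: lpM. Qed.

Lemma mb_lpB r g h (x y : R) : 0 < r -> mb r (fun w => lp (g w)) x -> mb r (fun w => lp (h w)) y ->
  mb r (fun w => lp (g w - h w)) (x + y + 2).
Proof. by move=> r0 hg hh; apply: mb_le (mbD (mbD hg hh) (mb_cst r (2 : R))) => // w _; exact: lpB. Qed.

Lemma mb_lpD r g h (x y : R) : 0 < r -> mb r (fun w => lp (g w)) x -> mb r (fun w => lp (h w)) y ->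
  mb r (fun w => lp (g w + h w)) (x + y + 2).
Proof. by move=> r0 hg hh; apply: mb_le (mbD (mbD hg hh) (mb_cst r (2 : R))) => // w _; exact: lpD. Qed.

Lemma cD_1D g z : cdiff g z -> cD (fun w => 1 + g w) z = cD g z.
Proof.
by move=> /cDP h; apply: cDE; have := cderD (cder_cst 1 z) h; rewrite add0r.
Qed.

Lemma near_cdiff g z : mer g -> \forall w \near pn z, cdiff g w.
Proof. by move=> mg; apply: filterS (mer_not_special z mg) => w /contrapT /nb_self[]. Qed.

Lemma NP_entire r0 S r g : (forall a, 0 <= ord g a) -> NP r0 S r g = 0.
Proof.
move=> h; rewrite /NP big1// => a _; have := h a => ha.
by rewrite (_ : Num.max _ _ = 0) ?mul0r//; lia.
Qed.

Lemma Tb_entire r0 S r g k : (forall a, 0 <= ord g a) -> mb r (fun w => lp (g w)) k -> Tb r0 S g r k.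
Proof. by move=> h; rewrite /Tb NP_entire// subr0. Qed.

Lemma NZ_entire r0 s S r g L k : adm r0 s S g L -> rad r0 s S r -> (forall a, 0 <= ord g a) ->
  mb r (fun w => lp (g w)) k -> NZ r0 S r g <= k - L.
Proof. by move=> ag hr h0 hk; apply: Tb_NZ ag hr _; exact: Tb_entire. Qed.

Lemma second_main_arith (eps T k n B a0 LG Lp Lp1 Lps L12 L23 L31 : R) :
  0 <= eps -> eps <= 1 -> - B <= LG -> `|Lp| <= B -> `|Lp1| <= B -> - B <= Lps ->
  - B <= L12 -> - B <= L23 -> - B <= L31 -> eps * k <= k -> eps * B <= B -> 0 <= k -> 0 <= B -> 0 <= a0 ->
  1 + eps * (2 * T + 6 * k + 8 - LG + `|Lp|) + (1 + eps * (2 * T + 6 * k + 8 - LG + 2 + `|Lp1|)) -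
    Lps + n + (6 * k + 6 - L12 - L23 - L31) <= 4 * eps * T + n + 31 * k + 80 + 15 * B + a0.
Proof.
move=> e0 e1 bG Bp Bp1 bs b1 b2 b3 ek eB k0 B0 a00.
have q1 : eps * (2 * T + 6 * k + 8 - LG + `|Lp|) <= eps * (2 * T + 6 * k + 8 + 2 * B).
  by rewrite ler_wpM2l//; lra.
have q2 : eps * (2 * T + 6 * k + 8 - LG + 2 + `|Lp1|) <= eps * (2 * T + 6 * k + 10 + 2 * B).
  by rewrite ler_wpM2l//; lra.
lra.
Qed.

Variables (f K1 K2 K3 : C -> C).
Hypothesis mf : mer f.
Hypothesis mK1 : mer K1. Hypothesis mK2 : mer K2. Hypothesis mK3 : mer K3.
Hypothesis oK1 : forall a, 0 <= ord K1 a.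
Hypothesis oK2 : forall a, 0 <= ord K2 a.
Hypothesis oK3 : forall a, 0 <= ord K3 a.
Let D1 w := f w - K1 w.
Let D2 w := f w - K2 w.
Let D3 w := f w - K3 w.
Let E12 w := K2 w - K1 w.
Let E23 w := K2 w - K3 w.
Let E31 w := K3 w - K1 w.
Hypothesis mD1 : mer D1. Hypothesis mD2 : mer D2. Hypothesis mD3 : mer D3.
Hypothesis mE12 : mer E12. Hypothesis mE23 : mer E23. Hypothesis mE31 : mer E31.
Let F w := D1 w * E23 w.
Let G w := D2 w * E31 w.

(* The cross ratio of f with K1, K2, K3: its zeros, poles and (-1)-points lie over the zeros of the
   f - K_i and of the differences K_i - K_j. *)
Definition crossr w := F w / G w.
Local Notation phi := crossr.

Let mF : mer F. Proof. exact: merM. Qed.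
Let mG : mer G. Proof. exact: merM. Qed.
Lemma mer_crossr : mer phi. Proof. exact: merf. Qed.

Lemma crossr1_eq w : G w != 0 -> 1 + phi w = D3 w * E12 w / G w.
Proof. by move=> g0; rewrite /phi -{1}(divff g0) -mulrDl; congr (_ / _); rewrite /F /G /D1 /D2 /D3 /E12 /E23 /E31; ring. Qed.

Let aeq1 : aeq (fun w => D3 w * E12 w / G w) (fun w => 1 + phi w).
Proof. by move=> z; apply: filterS (mer_neq0 z mG) => w g0; rewrite crossr1_eq. Qed.

Lemma mer_crossr1 : mer (fun w => 1 + phi w).
Proof. by apply: mer_aeq aeq1 _; apply: merf => //; exact: merM. Qed.

Lemma ord_crossr z : ord phi z = ord D1 z + ord E23 z - (ord D2 z + ord E31 z).
Proof. by rewrite /phi ordf// /F /G !ordM. Qed.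

Lemma ord_crossr1 z : ord (fun w => 1 + phi w) z = ord D3 z + ord E12 z - (ord D2 z + ord E31 z).
Proof.
have m3 : mer (fun w => D3 w * E12 w) by exact: merM.
by rewrite (ord_aeq z aeq1) ?ordf ?[ord G z]ordM ?ordM//; exact: merf.
Qed.

Let ordE_ge0 z : [/\ 0 <= ord E12 z, 0 <= ord E23 z & 0 <= ord E31 z].
Proof. by split; apply: ordB_ge. Qed.

Let ordD_neg z : ord f z < 0 -> [/\ ord D1 z = ord f z, ord D2 z = ord f z & ord D3 z = ord f z].
Proof.
move=> h; have := oK1 z; have := oK2 z; have := oK3 z => h3 h2 h1.
by split; apply: ordB_lt => //; apply: lt_le_trans h _.
Qed.

Let ordD_nneg z : 0 <= ord f z -> [/\ 0 <= ord D1 z, 0 <= ord D2 z & 0 <= ord D3 z].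
Proof. by move=> h; split; apply: ordB_ge. Qed.

Let p z : int := Num.max (- ord f z) 0.

Let ordD_p z : [/\ - p z <= ord D1 z, - p z <= ord D2 z & - p z <= ord D3 z].
Proof.
rewrite /p; have [h|h] := ltP (ord f z) 0.
  by have [-> -> ->] := ordD_neg h; split; lia.
by have [? ? ?] := ordD_nneg h; split; lia.
Qed.

(** At a pole of f the three differences f - K_i have the same order, the K_i having no poles, and
    this order cancels in the cross ratio; only zeros remain to be counted. *)
Lemma crossr_bad z : ord phi z != 0 \/ 0 < ord (fun w => 1 + phi w) z ->
  [\/ 0 < ord D1 z, 0 < ord D2 z | 0 < ord D3 z] \/ [\/ 0 < ord E12 z, 0 < ord E23 z | 0 < ord E31 z].
Proof.
rewrite ord_crossr ord_crossr1 => h; have [e1 e2 e3] := ordE_ge0 z.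
apply: contrapT => /not_orP[n1 n2].
have [a1 a2 a3] : [/\ ord D1 z <= 0, ord D2 z <= 0 & ord D3 z <= 0].
  by split; rewrite leNgt; apply/negP => q; apply: n1; [exact: Or31|exact: Or32|exact: Or33].
have [b1 b2 b3] : [/\ ord E12 z <= 0, ord E23 z <= 0 & ord E31 z <= 0].
  by split; rewrite leNgt; apply/negP => q; apply: n2; [exact: Or31|exact: Or32|exact: Or33].
have [hf|hf] := ltP (ord f z) 0.
  by have [c1 c2 c3] := ordD_neg hf; rewrite c1 c2 c3 in h; lia.
by have [c1 c2 c3] := ordD_nneg hf; lia.
Qed.

Section AtRadius.
Variables (r0 s r k T B : R) (S : seq C).
Hypothesis hr : rad r0 s S r.
Hypothesis hT : Tb r0 S f r T.
Hypothesis hK1 : mb r (fun w => lp (K1 w)) k.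
Hypothesis hK2 : mb r (fun w => lp (K2 w)) k.
Hypothesis hK3 : mb r (fun w => lp (K3 w)) k.
Let rp : 0 < r. Proof. exact: rad_gt0 hr. Qed.

(** The coefficient 2 of T is harmless: this bound is only fed to the lemma on the logarithmic
    derivative, which multiplies it by eps. *)
Lemma Tb_crossr_crude L : adm r0 s S G L -> Tb r0 S phi r (2 * T + 6 * k + 8 - L).
Proof.
move=> aG.
have hD1 := mb_lpB rp hT hK1; have hD2 := mb_lpB rp hT hK2.
have hE23 := mb_lpB rp hK2 hK3; have hE31 := mb_lpB rp hK3 hK1.
have := @Tb_quot _ r0 s S r F G phi L p _ _ aG hr (fun w _ => erefl) _ (mb_lpM rp hD1 hE23) (mb_lpM rp hD2 hE31).
move=> /(_ _)/Tb_leT; apply.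
  move=> a; have [q1 q2 _] := ordD_p a; have [? e2 e3] := ordE_ge0 a.
  by rewrite /phi ordf// !ordM//; split=> //; rewrite /p in q1 q2 *; lia.
rewrite -/(NP r0 S r f); have := NP_ge0 f hr; lra.
Qed.

Lemma Tb_crossr1 t : Tb r0 S phi r t -> Tb r0 S (fun w => 1 + phi w) r (t + 2).
Proof.
move=> ht; have m1 := mb_cst r (0 : R).
have h1 : mb r (fun w => lp (1 : C)) 0 by apply: mb_le m1 => // w _; rewrite lp1.
apply: mb_leB (mb_lpD rp h1 ht) _.
suff -> : NP r0 S r (fun w => 1 + phi w) = NP r0 S r phi by lra.
apply: eq_bigr => a _; congr (_%:~R * _).
have m0 : mer (fun=> 1 : C) by apply: mer_cst; exact: oner_neq0.
have o0 := ord_cst a (oner_neq0 C).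
have mp := mer_crossr; have mp1 := mer_crossr1.
have [h|h] := ltP (ord phi a) 0.
  rewrite (_ : ord (fun w => 1 + phi w) a = ord phi a)//.
  have ae : aeq (fun w => phi w + 1) (fun w => 1 + phi w) by move=> z; near=> w; exact: addrC.
  by rewrite (ord_aeq a ae) ?(ordD_lt mp m0) ?o0//; apply: mer_aeq (aeq_sym ae) mp1.
have : 0 <= ord (fun w => 1 + phi w) a by apply: (ordD_ge m0 mp mp1) => //; rewrite o0.
lia.
Unshelve. all: by end_near. Qed.

(* f is recovered from its cross ratio as K2 + (K2 - K3)(K2 - K1) / (phi (K3 - K1) - (K2 - K3)). *)
Definition crossr_den w := phi w * E31 w - E23 w.

Lemma crossr_denE w : D2 w != 0 -> E31 w != 0 -> crossr_den w = E23 w * E12 w / D2 w.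
Proof.
rewrite /crossr_den /phi /F /G => d0 e0.
rewrite (_ : D1 w * E23 w / (D2 w * E31 w) * E31 w = D1 w * E23 w / D2 w); last first.
  by rewrite invfM mulrA divfK.
rewrite -{2}(mulfK d0 (E23 w)) -mulrBl; congr (_ / _).
by rewrite /D1 /D2 /E12; ring.
Qed.

Let aeq_den : aeq (fun w => E23 w * E12 w / D2 w) crossr_den.
Proof. by move=> z; apply: filterS2 (mer_neq0 z mD2) (mer_neq0 z mE31) => w d0 e0; rewrite crossr_denE. Qed.

Lemma mer_crossr_den : mer crossr_den.
Proof. by apply: mer_aeq aeq_den _; apply: merf => //; exact: merM. Qed.

(** Here t must keep the coefficient 1: f - K2 is the quotient of (K2 - K3) (K2 - K1) by
    [crossr_den], and [Tb_quot] charges to it only the poles of the cross ratio. *)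
Lemma Tb_from_crossr L L2 L31 t : adm r0 s S crossr_den L -> adm r0 s S D2 L2 -> adm r0 s S E31 L31 ->
  Tb r0 S phi r t -> Tb r0 S f r (t + 9 * k + 12 - L).
Proof.
move=> aden aD2 aE31 ht.
have hE23 := mb_lpB rp hK2 hK3; have hE31 := mb_lpB rp hK3 hK1; have hE12 := mb_lpB rp hK2 hK1.
have hden := mb_lpB rp (mb_lpM rp ht hE31) hE23.
pose q a : int := Num.max (- ord phi a) 0.
have m2 : mer (fun w => E23 w * E12 w) by exact: merM.
have od a : ord crossr_den a = ord E23 a + ord E12 a - ord D2 a.
  by rewrite (ord_aeq a aeq_den) ?ordf ?ordM//; exact: merf.
have hD2 : Tb r0 S D2 r (t + 8 * k + 10 - L).
  have := @Tb_quot _ r0 s S r (fun w => E23 w * E12 w) crossr_den D2 L q _ _ aden hr _ _ (mb_lpM rp hE23 hE12) hden.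
  move=> /(_ _ _)/Tb_leT; apply.
  - move=> w wr; have d0 := rad_neq0 aD2 hr wr; have e0 := rad_neq0 aE31 hr wr.
    have n0 := rad_neq0 aden hr wr; move: n0; rewrite crossr_denE// => n0.
    by rewrite invf_div mulrC divfK//; apply: contraNneq n0 => ->; rewrite mul0r.
  - move=> a; have [e1 e2 e3] := ordE_ge0 a.
    rewrite ordM// -/(ord _ _) od; split=> //.
    + by rewrite opprB addrCA subrr addr0.
    + by rewrite /q; lia.
    + rewrite -od; have mpe : mer (fun w => phi w * E31 w) by apply: merM => //; exact: mer_crossr.
      apply: (ordB_ge mpe mE23 mer_crossr_den); last by rewrite /q; lia.
      by rewrite (ordM _ mer_crossr mE31) /q; lia.
    + by rewrite /q; lia.
  - rewrite -/(NP r0 S r phi); lra.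
have hf : mb r (fun w => lp (D2 w + K2 w)) (t + 8 * k + 10 - L - NP r0 S r D2 + k + 2) by exact: mb_lpD.
have NPE : NP r0 S r f = NP r0 S r D2.
  apply: eq_bigr => a _; congr (_%:~R * _).
  have [h|h] := ltP (ord f a) 0; first by have [_ -> _] := ordD_neg h.
  by have [_ ? _] := ordD_nneg h; lia.
have {}hf : mb r (fun w => lp (f w)) (t + 8 * k + 10 - L - NP r0 S r D2 + k + 2).
  by apply: mb_le hf => // w _; rewrite subrK.
by apply: mb_leB hf _; rewrite NPE; lra.
Qed.

(** Equal to phi' / phi - phi' / (1 + phi): the usual auxiliary function of the second main theorem
    for the values 0, -1 and infinity. *)
Definition psi w := cD phi w / (phi w * (1 + phi w)).

Lemma mer_psi : mer (cD phi) -> mer psi.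
Proof.
by move=> md; apply: merf => //; apply: merM; [exact: mer_crossr|exact: mer_crossr1].
Qed.

(** At a pole of phi of order m, [psi] has order m - 1, and at zeros and (-1)-points of any
    multiplicity it has order -1: the correction is 1 per point. This truncation is essential, since
    nothing is known about multiplicities of 1-points. *)
Lemma ord_psi a : mer (cD phi) -> Num.max (- ord phi a) 0 <= ord psi a + Num.max 0
  (if (ord phi a != 0) || (0 < ord (fun w => 1 + phi w) a) then 1 else 0).
Proof.
move=> md; have mp := mer_crossr; have mp1 := mer_crossr1.
have m0 : mer (fun=> 1 : C) by apply: mer_cst; exact: oner_neq0.
have o0 := ord_cst a (oner_neq0 C).
have mpp : mer (fun w => phi w * (1 + phi w)) by exact: merM.
rewrite /psi ordf// ordM//.
have ae : aeq (fun w => phi w + 1) (fun w => 1 + phi w) by move=> z; near=> w; exact: addrC.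
have aed : aeq (cD (fun w => 1 + phi w)) (cD phi).
  by move=> z; apply: filterS (near_cdiff z mp) => w; exact: cD_1D.
have [h|h|h] := ltgtP (ord phi a) 0.
- rewrite (ord_aeq a ae) ?(ordD_lt mp m0) ?o0//; last by apply: mer_aeq (aeq_sym ae) mp1.
  by rewrite ord_cD ?lt_eqF//=; lia.
- by rewrite (ordD_lt m0 mp) ?o0// ord_cD ?gt_eqF//=; lia.
have q0 : 0 <= ord (fun w => 1 + phi w) a by apply: (ordD_ge m0 mp mp1); rewrite ?o0 ?h.
rewrite h /=; move: q0; rewrite le_eqVlt => /orP[/eqP <-|q0].
  by have := @ord_cD_ge0 _ phi a mp md; rewrite h ltxx /= => /(_ (lexx _)); lia.
have md1 : mer (cD (fun w => 1 + phi w)) by apply: mer_aeq (aeq_sym aed) md.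
by rewrite q0 (ord_aeq a aed md1) ord_cD ?gt_eqF//=; lia.
Unshelve. all: by end_near. Qed.

(** If |phi| <= 1, then |[psi]| = |x - y| is bounded directly; otherwise [psi] phi = y. The product
    (1 + |x|) (1 + |y|) dominates in both cases. *)
Lemma psi_bound w : cdiff phi w -> phi w != 0 -> 1 + phi w != 0 -> psi w != 0 ->
  ln (cnorm (psi w)) + lp (phi w) <=
  ln (1 + cnorm (cD phi w / phi w)) + ln (1 + cnorm (cD (fun w => 1 + phi w) w / (1 + phi w))).
Proof.
move=> cp p0 q0 s0; rewrite cD_1D//.
set x := cD phi w / phi w; set y := cD phi w / (1 + phi w).
have x0 := cnorm_ge0 x; have y0 := cnorm_ge0 y; have xy := mulr_ge0 x0 y0.
have E1 : psi w = x - y by rewrite /psi /x /y; field; rewrite p0 q0.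
have E2 : psi w * phi w = y by rewrite /psi /y; field; rewrite p0 q0.
have s1 : 0 < cnorm (psi w) by rewrite cnorm_gt0.
rewrite -lnM ?posrE ?ltr_wpDr//; have [h|h] := leP (cnorm (phi w)) 1.
  rewrite /logplus (max_idPl _) ?ln_le0// addr0.
  have := cnormB x y; rewrite -E1 => h1.
  by rewrite ler_ln ?posrE; nra.
rewrite /logplus (max_idPr _) ?ln_ge0 ?(ltW h)// -ln_cnormM// E2.
have y1 : 0 < cnorm y by rewrite -E2 cnorm_gt0 mulf_neq0.
by rewrite ler_ln ?posrE; nra.
Qed.

(** Averaging [psi_bound] and evaluating the mean of ln |[psi]| by Jensen's formula leaves the
    logarithmic derivatives and one unit per bad point. [W] covers those over zeros of the f - K_i,
    the zeros of the differences of the K_i cover the rest. *)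
Lemma Tb_crossr_fine (W : C -> int) Lpsi Lphi Lphi1 L12 L23 L31 x y n : mer (cD phi) ->
  (forall a, [/\ 0 <= W a, 0 < ord D1 a -> 1 <= W a, 0 < ord D2 a -> 1 <= W a & 0 < ord D3 a -> 1 <= W a]) ->
  \sum_(a <- S) (W a)%:~R * nu r0 r a <= n ->
  adm r0 s S psi Lpsi -> adm r0 s S phi Lphi -> adm r0 s S (fun w => 1 + phi w) Lphi1 ->
  adm r0 s S E12 L12 -> adm r0 s S E23 L23 -> adm r0 s S E31 L31 ->
  mb r (fun z => ln (1 + cnorm (cD phi z / phi z))) x ->
  mb r (fun z => ln (1 + cnorm (cD (fun w => 1 + phi w) z / (1 + phi z)))) y ->
  Tb r0 S phi r (x + y - Lpsi + n + (6 * k + 6 - L12 - L23 - L31)).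
Proof.
move=> md hW hn aps aph aph1 a12 a23 a31 hx hy.
have hE23 := mb_lpB rp hK2 hK3; have hE31 := mb_lpB rp hK3 hK1; have hE12 := mb_lpB rp hK2 hK1.
have [_ hJ] := jensen_NZ aps hr.
have z12 := NZ_entire a12 hr (fun a => let: And3 q _ _ := ordE_ge0 a in q) hE12.
have z23 := NZ_entire a23 hr (fun a => let: And3 _ q _ := ordE_ge0 a in q) hE23.
have z31 := NZ_entire a31 hr (fun a => let: And3 _ _ q := ordE_ge0 a in q) hE31.
apply: mb_leB (mb_le rp _ (mbD (mbD hx hy) hJ)) _.
  move=> w wr; have [_ _ rs gr] := hr; have [mp cS _ _ _] := aph.
  have [cp p0] := captured cS gr wr rs.
  have := psi_bound cp p0 (rad_neq0 aph1 hr wr) (rad_neq0 aps hr wr); lra.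
rewrite NZ_NP; suff : NP r0 S r phi <= \sum_(a <- S) (ord psi a)%:~R * nu r0 r a +
    (\sum_(a <- S) (W a)%:~R * nu r0 r a + NZ r0 S r E12 + NZ r0 S r E23 + NZ r0 S r E31) by lra.
rewrite /NZ -!big_split /=.
have -> : NP r0 S r phi = \sum_(a <- S) (Num.max (- ord phi a) 0)%:~R * nu r0 r a by [].
apply: le_trans (sum_nu_le (l := fun a => ord psi a + (W a + Num.max (ord E12 a) 0 + Num.max (ord E23 a) 0 + Num.max (ord E31 a) 0)) hr _) _.
  move=> a _; apply: le_trans (ord_psi a md) _; rewrite lerD2l.
  have [w0 w1 w2 w3] := hW a; case: ifP => h; last by lia.
  have := @crossr_bad a => /(_ _)[||].
  - by move/orP: h => [h|h]; [left|right].
  - by move=> [/w1|/w2|/w3]; lia.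
  - by move=> [h1|h1|h1]; lia.
by rewrite le_eqVlt; apply/orP; left; apply/eqP; apply: eq_bigr => a _; rewrite !rmorphD /= !mulrDl !addrA.
Qed.

(** For a constant cross ratio [psi] is zero and Jensen's formula fails for it, but then the
    characteristic is just log+ |a|. *)
Lemma Tb_crossr_const a L : adm r0 s S phi L -> null (fun w => phi w - a) -> Tb r0 S phi r (lp a).
Proof.
move=> aph na; have [mp cS _ _ _] := aph; have [_ _ rs gr] := hr.
have ae : aeq phi (fun=> a).
  by move=> z; apply: filterS (na z) => w /eqP; rewrite subr_eq0 => /eqP.
have a0 : a != 0.
  apply/eqP => a0; apply: (mer_not_null mp) => z; apply: filterS (ae z) => w ->; exact: a0.
apply: Tb_entire.
  by move=> z; rewrite -(ord_aeq z ae mp) ord_cst.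
apply: mb_le (mb_cst r (lp a)) => // w wr.
have [cp p0] := captured cS gr wr rs.
suff -> : phi w = a by [].
apply: small_cnorm_eq => e e0; have cc := cdiff_ccont cp e0.
have [v [v1 v2]] := filter_ex (filterI (nb_pn cc) (ae w)).
by rewrite cnormBC -v2 ltW.
Qed.

End AtRadius.

(** Crude bounds at r + K and r + 2 K feed the logarithmic derivatives at r; the refined bound for
    the cross ratio is then carried back to f. B majorises the Jensen constants in the resulting
    bound. *)
Lemma second_main r0 s S X K (eps r k T B n a0 : R) (W : C -> int) (Lf LG Lp Lp1 Lps L12 L23 L31 L2 Ld : R) :
  adm r0 s S f Lf -> adm r0 s S G LG -> adm r0 s S phi Lp -> adm r0 s S (fun w => 1 + phi w) Lp1 ->
  (mer (cD phi) /\ adm r0 s S psi Lps \/ exists2 a, null (fun w => phi w - a) & lp a <= a0) ->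
  adm r0 s S E12 L12 -> adm r0 s S E23 L23 -> adm r0 s S E31 L31 -> adm r0 s S D2 L2 ->
  adm r0 s S crossr_den Ld ->
  [/\ `|LG| <= B, `|Lp| <= B, `|Lp1| <= B, `|Lps| <= B & [/\ `|L12| <= B, `|L23| <= B, `|L31| <= B & `|Ld| <= B]] ->
  step X K r -> (3 * 10 ^+ 3) * ln X <= eps * K -> 0 <= eps <= 1 -> 0 <= a0 ->
  rad r0 s S r -> rad r0 s S (r + K) -> rad r0 s S (r + 2 * K) ->
  Tb r0 S f (r + K) T -> Tb r0 S f (r + 2 * K) T ->
  (forall t : R, t = r \/ t = r + K \/ t = r + 2 * K ->
    [/\ mb t (fun w => lp (K1 w)) k, mb t (fun w => lp (K2 w)) k & mb t (fun w => lp (K3 w)) k]) ->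
  (forall a, [/\ 0 <= W a, 0 < ord D1 a -> 1 <= W a, 0 < ord D2 a -> 1 <= W a & 0 < ord D3 a -> 1 <= W a]) ->
  \sum_(a <- S) (W a)%:~R * nu r0 r a <= n ->
  Tb r0 S f r (4 * eps * T + n + 40 * k + 100 + 20 * B + a0).
Proof.
move=> af aG ap ap1 hps a12 a23 a31 a2 ad [BG Bp Bp1 Bps [B12 B23 B31 Bd]] hst heps /andP[eps0 eps1] ha0.
move=> hr hr1 hr2 hT1 hT2 hK hW hn.
have [k1 k2 k3] := hK r (or_introl erefl).
have [k11 k12 k13] := hK (r + K) (or_intror (or_introl erefl)).
have [k21 k22 k23] := hK (r + 2 * K) (or_intror (or_intror erefl)).
have nb x : `|x| <= B -> - B <= x <= B by rewrite ler_norml.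
have /andP[bG _] := nb _ BG; have /andP[bs _] := nb _ Bps; have /andP[bd bd'] := nb _ Bd.
have /andP[b12 _] := nb _ B12; have /andP[b23 _] := nb _ B23; have /andP[b31 _] := nb _ B31.
have B0 : 0 <= B by apply: le_trans BG.
have rp := rad_gt0 hr.
have kp : 0 <= k by apply: (mb_ge0 rp _ k1) => w _; exact: lp_ge0.
have T0 := Tb_ge0 hr1 hT1.
have n0 : 0 <= n by apply: le_trans hn; apply: (sum_nu_ge0 hr) => a _; have [] := hW a.
have eT : 0 <= eps * T by exact: mulr_ge0.
have ek : eps * k <= k by rewrite ler_piMl.
have eB : eps * B <= B by rewrite ler_piMl.
suff [t ht tle] : exists2 t, Tb r0 S phi r t & t <= 4 * eps * T + n + 31 * k + 80 + 15 * B + a0.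
  apply: Tb_leT (Tb_from_crossr hr k1 k2 k3 ad a2 a31 ht) _; lra.
case: hps => [[md aps]|[a na la]]; last first.
  exists (lp a); first exact: Tb_crossr_const ap na.
  by lra.
have c1 := Tb_crossr_crude hr1 hT1 k11 k12 k13 aG.
have c2 := Tb_crossr_crude hr2 hT2 k21 k22 k23 aG.
have d1 := Tb_crossr1 hr1 c1; have d2 := Tb_crossr1 hr2 c2.
have l1 := ldl_deriv ap hst hr hr1 hr2 heps c1 c2.
have l2 := ldl_deriv ap1 hst hr hr1 hr2 heps d1 d2.
exists (1 + eps * (2 * T + 6 * k + 8 - LG + `|Lp|) + (1 + eps * (2 * T + 6 * k + 8 - LG + 2 + `|Lp1|)) -
  Lps + n + (6 * k + 6 - L12 - L23 - L31)).
  exact: (Tb_crossr_fine hr k1 k2 k3 md hW hn aps ap ap1 a12 a23 a31 l1 l2).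
exact: second_main_arith eps0 eps1 bG Bp Bp1 bs b12 b23 b31 ek eB kp B0 ha0.
Qed.

End SecondMain.

(** * From poles and a-points, as defined in the statement, to orders *)

Section Bridge.
Variable R : realType.
Local Notation C := (complex R).
Local Notation "x %:C" := (real_complex R x).
Implicit Types (z w a b c : C) (r d s B L T : R) (u g h f q : C -> C) (m : nat).

Lemma is_pole_near f z : is_pole f z -> forall M : R, \forall w \near pn z, M < cnorm (f w).
Proof. by move=> [_ h] M; have [d [d0 hd]] := h M; exists d. Qed.

Lemma is_poleP f z : is_pole f z <->
  (\forall w \near pn z, cdiff f w) /\ forall M : R, \forall w \near pn z, M < cnorm (f w).
Proof.
split=> [h|[[d d0 hd] h]].
  by split; [case: h => [[r [r0 hr]] _]; exists r|exact: is_pole_near].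
split; first by exists d.
by move=> M; have [d' d'0 hd'] := h M; exists d'.
Qed.

(** f is bounded near a point of differentiability, so it has no pole nearby. *)
Lemma near_cdiff_meromorphic f z : meromorphic f -> cdiff f z -> \forall w \near nb z, cdiff f w.
Proof.
move=> mf cf; apply: filterS (nb_nb (ccont_bounded (cdiff_ccont cf))) => w hw.
have [//|hp] := mf w; exfalso.
have [v [h1 h2]] := filter_ex (filterI (is_pole_near hp (cnorm (f z) + 1)) (nb_pn hw)).
by move: h1; rewrite ltNge h2.
Qed.

Lemma lform_bounded g z (k : int) e : lform g z k e -> 0 <= k -> \forall w \near pn z, cnorm (g w) <= cnorm (e z) + 1.
Proof.
case: k => [n [ce ge] _|//]; near=> w.
rewrite (near ge w)// cnormM -exprnP cnormX.
have h : cnorm (w - z) < 1 by near: w; apply: nb_pn; exact: nb_ball.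
have h2 : cnorm (e w) <= cnorm (e z) + 1.
  by near: w; apply: nb_pn; apply: ccont_bounded; apply: cdiff_ccont; exact: nb_self ce.
have e0 := cnorm_ge0 (e w); have w0 := cnorm_ge0 (w - z).
by apply: le_trans h2; rewrite ler_piMl// exprn_ile1// ltW.
Unshelve. all: by end_near. Qed.

Lemma lform_unbounded g z (k : int) e : lform g z k e -> e z != 0 -> k < 0 ->
  forall M : R, \forall w \near pn z, M < cnorm (g w).
Proof.
case: k => [//|n] [ce ge] e0 _ M.
have ez : 0 < cnorm (e z) / 2 by rewrite divr_gt0// cnorm_gt0.
have M0 : 0 < `|M| + 1 by rewrite ltr_wpDl.
have d0 : 0 < Num.min 1 (cnorm (e z) / 2 / (`|M| + 1)) by rewrite lt_min ltr01 divr_gt0.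
near=> w.
have wz : w != z by near: w; exact: pn_ne.
have : cnorm (w - z) < Num.min 1 (cnorm (e z) / 2 / (`|M| + 1)) by near: w; apply: nb_pn; exact: nb_ball.
rewrite lt_min ltr_pdivlMr// => /andP[w1 w2].
have h3 : cnorm (e z) / 2 <= cnorm (e w).
  by near: w; apply: nb_pn; apply: ccont_neq0 => //; apply: cdiff_ccont; exact: nb_self ce.
have p : 0 < cnorm (w - z) by rewrite cnorm_gt0 subr_eq0.
rewrite (near ge w)// NegzE -exprnN cnormM cnormV cnormX mulrC ltr_pdivlMr ?exprn_gt0//.
apply: le_lt_trans (_ : M * cnorm (w - z) ^+ n.+1 <= (`|M| + 1) * cnorm (w - z)) _; last lra.
apply: le_trans (_ : (`|M| + 1) * cnorm (w - z) ^+ n.+1 <= _).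
  by rewrite ler_wpM2r ?exprn_ge0 ?(ltW p)//; have := ler_norm M; lra.
by rewrite ler_wpM2l ?(ltW M0)// exprS ler_piMr ?(ltW p)// exprn_ile1// ltW.
Unshelve. all: by end_near. Qed.

(** q = (w - z)^2 / f, extended by 0, is differentiable at z with derivative 0 simply because |f| is
    large near z; the square spares a separate theorem on removable singularities. *)
Lemma pole_lform f z : is_pole f z -> exists n e, lform f z (- n.+1%:Z) e /\ e z != 0.
Proof.
move=> /is_poleP[cf fM].
pose q w := if w == z then 0 else (w - z) ^+ 2 / f w.
have fne : \forall w \near pn z, f w != 0.
  by apply: filterS (fM 0) => w; rewrite cnorm_gt0.
have qz : cdiff q z.
  apply/cdiffP; exists 0 => e e0; have M := fM e^-1.
  apply/nb_pnP; split; first by rewrite !subrr mul0r subr0 cnorm0 mulr0.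
  near=> w; have wz : w != z by near: w; exact: pn_ne.
  have fw : e^-1 < cnorm (f w) by near: w.
  have w1 : cnorm (w - z) < 1 by near: w; apply: nb_pn; exact: nb_ball.
  have p : 0 <= cnorm (w - z) by exact: cnorm_ge0.
  have ei : 0 < e^-1 by rewrite invr_gt0.
  rewrite /q (negPf wz) eqxx subr0 mul0r subr0 cnormM cnormX cnormV ler_pdivrMr; last lra.
  apply: le_trans (_ : cnorm (w - z) <= _); first by rewrite expr2 ler_piMl// ltW.
  rewrite mulrAC ler_peMl//; have := ler_wpM2l (ltW e0) (ltW fw); rewrite divff ?gt_eqF//.
have [d d0 hq] : \forall w \near nb z, cdiff q w.
  have fc : \forall w \near pn z, nb w (fun v => cdiff f v /\ f v != 0).
    by apply: pn_nb; exact: filterI cf fne.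
  apply/nb_pnP; split=> //; near=> w.
  have wz : w != z by near: w; exact: pn_ne.
  have [cw fw] : cdiff f w /\ f w != 0.
    by apply: (@nb_self _ w (fun v => cdiff f v /\ f v != 0)); near: w; exact: fc.
  apply: (@cdiff_eq _ (fun v => (v - z) ^+ 2 / f v)).
    have : \forall v \near nb w, v != z.
      have p : 0 < cnorm (w - z) by rewrite cnorm_gt0 subr_eq0.
      by apply: filterS (nb_ball w p) => v; apply: contraTneq => ->; rewrite cnormBC ltxx.
    by apply: filterS => v /negPf vz; rewrite /q vz.
  by apply: cdiffM; [exact: cdiff_subX|exact: cdiffV].
have zz : cnorm (z - z) < d by rewrite subrr cnorm0.
have [q0|[n [E [hE Ez qE]]]] := hol_order (hq : hol z d q) zz.
  have [w [[q1 f1] w1]] := filter_ex (filterI (filterI (nb_pn q0) fne) (pn_ne z)); exfalso.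
  move: q1; rewrite /q (negPf w1) => /eqP; apply/negP.
  by rewrite mulf_neq0// ?invr_eq0// expf_neq0// subr_eq0.
have L : lform f z (2 - n%:Z) (fun w => (E w)^-1).
  have cE := hol_near hE zz; split.
    near=> w; apply: cdiffV; last by near: w.
    by near: w; apply: near_neq0 => //; exact: nb_self cE.
  near=> w; have wz : w != z by near: w; exact: pn_ne.
  have wz0 : w - z != 0 by rewrite subr_eq0.
  have fw : f w != 0 by near: w.
  have := qE w; rewrite {1}/q (negPf wz) => h.
  rewrite expfzDr// -exprnP -exprnN -mulrA -invfM -h invf_div mulrCA divff ?mulr1//.
  by rewrite expf_neq0.
have Ei : (E z)^-1 != 0 by rewrite invr_eq0.
(* The exponent 2 - n must be negative, for otherwise f would be bounded near z. *)
have [n2|n2] := leP (2%:Z - n%:Z) (-1).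
  exists `|2%:Z - n%:Z|%N.-1, (fun w => (E w)^-1); split=> //.
  by have -> : - (`|2%:Z - n%:Z|%N.-1).+1%:Z = 2 - n%:Z by lia.
have n0 : 0 <= 2%:Z - n%:Z by lia.
have [w [h1 h2]] := filter_ex (filterI (lform_bounded L n0) (fM (cnorm (E z)^-1 + 1))).
by exfalso; move: h2; rewrite ltNge h1.
Unshelve. all: by end_near. Qed.

Lemma mf_meromorphic f : meromorphic f -> mf f.
Proof.
move=> mf z; have [cf|hp] := mf z.
  exists 0, f; split; first exact: near_cdiff_meromorphic.
  by near=> w; rewrite expr0z mul1r.
by have [n [e [h _]]] := pole_lform hp; exists (- n.+1%:Z), e.
Unshelve. all: by end_near. Qed.

Lemma ccont_val g h z : cdiff g z -> cdiff h z -> (\forall w \near pn z, g w = h w) -> g z = h z.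
Proof.
move=> cg ch gh; apply: small_cnorm_eq => e e0; have e2 : 0 < e / 2 by rewrite divr_gt0.
have [w [[h1 h2] h3]] := filter_ex (filterI (filterI (nb_pn (cdiff_ccont cg e2)) (nb_pn (cdiff_ccont ch e2))) gh).
by have := cnorm_triangle (g w) (g z) (h z); rewrite [cnorm (g z - g w)]cnormBC {2}h3; lra.
Qed.

Section Meromorphic.
Variable f : C -> C.
Hypothesis merof : meromorphic f.

Lemma pole_ord z : mer f -> is_pole f z <-> ord f z < 0.
Proof.
move=> mf; split=> [/pole_lform[n [e [L e0]]]|lt].
  by rewrite (ordE L e0).
have [cf|//] := merof z; exfalso.
have [e [L e0]] := ordP z mf; have fM := lform_unbounded L e0 lt.
have [w [h1 h2]] := filter_ex (filterI (fM (cnorm (f z) + 1)) (nb_pn (ccont_bounded (cdiff_ccont cf)))).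
by move: h1; rewrite ltNge h2.
Qed.

Lemma not_pole_cdiff z : ~ is_pole f z -> cdiff f z.
Proof. by have [] := merof z. Qed.

Lemma nonconstant_mer a : nonconstant f -> mer (fun w => f w - a).
Proof.
move=> nc; apply: mf_mer; first by apply: mfB (mf_cst a); exact: mf_meromorphic.
move=> na; apply: nc; exists a => z /not_pole_cdiff cf.
apply: (ccont_val cf (cdiff_cst a z)).
by apply: filterS (na z) => w /eqP; rewrite subr_eq0 => /eqP.
Qed.

Lemma nonconstant_mer0 : nonconstant f -> mer f.
Proof.
move=> /(nonconstant_mer 0); apply: mer_aeq => z; near=> w; exact: subr0.
Unshelve. all: by end_near. Qed.

Lemma amult_inf z m : mer f -> amult f None z m <-> (0 < m)%N /\ ord f z = - m%:Z.
Proof.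
move=> mf; split=> [[m0 [_ [r [r0 [h [ch [h0 fh]]]]]]]|[m0 om]].
  split=> //; apply: (ordE (e := h)) => //; split; first by exists r.
  by exists r => // w wz wr; rewrite fh// mulrC exprnN.
split=> //; split; first by apply/pole_ord => //; rewrite om; lia.
have [e [[ce fe] e0]] := ordP z mf; have [d d0 hd] := ce; have [d' d'0 hd'] := fe.
exists (Num.min d d'); rewrite lt_min d0; split=> //; exists e; split.
  by move=> w; rewrite lt_min => /andP[? _]; exact: hd.
split=> // w wz; rewrite lt_min => /andP[_ wd].
by rewrite hd'// om -exprnN mulrC.
Qed.

Lemma amult_fin z a m : nonconstant f ->
  amult f (Some a) z m <-> (0 < m)%N /\ ord (fun w => f w - a) z = m.
Proof.
move=> nc; have mf := nonconstant_mer0 nc; have mfa := nonconstant_mer a nc.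
split=> [[m0 [_ [r [r0 [h [ch [h0 fh]]]]]]]|[m0 om]].
  split=> //; apply: (ordE (e := h)) => //; split; first by exists r.
  by exists r => // w wz wr; rewrite fh// exprnP.
have [e [L e0]] := ordP z mfa.
have np : ~ is_pole f z.
  move=> /is_pole_near/(_ (cnorm (e z) + 1 + cnorm a)) hM.
  have o0 : 0 <= ord (fun w => f w - a) z by rewrite om.
  have [w [h1 h2]] := filter_ex (filterI hM (lform_bounded L o0)).
  by have := cnorm_subl (f w) a; lra.
split=> //; split=> //; have cf := not_pole_cdiff np.
have [[d d0 hd] [d' d'0 hd']] := L.
exists (Num.min d d'); rewrite lt_min d0; split=> //; exists e; split.
  by move=> w; rewrite lt_min => /andP[? _]; exact: hd.
split=> // w; rewrite lt_min => /andP[wd wd'].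
have [->|wz] := eqVneq w z; last by rewrite hd'// om exprnP.
apply: (@ccont_val (fun w => f w - a) (fun w => (w - z) ^+ m * e w)).
- by apply: cdiffB => //; exact: cdiff_cst.
- by apply: cdiffM; [exact: cdiff_subX|apply: hd; rewrite subrr cnorm0].
- by exists d' => // v vz vd; rewrite hd'// om exprnP.
Qed.

Lemma meromorphic_shift c : meromorphic (fshift f c).
Proof.
move=> z; have [cf|/is_poleP[h1 h2]] := merof (z + c); first by left; exact: cdiff_add.
right; apply/is_poleP; split; first by apply: filterS (pn_add h1) => w; exact: cdiff_add.
by move=> M; exact: pn_add (h2 M).
Qed.

Lemma meromorphic_scale a : a != 0 -> meromorphic (fun z => a * f z).
Proof.
move=> a0 z; have [cf|/is_poleP[h1 h2]] := merof z.
  by left; apply: cdiffM => //; exact: cdiff_cst.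
right; apply/is_poleP; split; first by apply: filterS h1 => w cf; apply: cdiffM => //; exact: cdiff_cst.
move=> M; apply: filterS (h2 (M / cnorm a)) => w; have p : 0 < cnorm a by rewrite cnorm_gt0.
by rewrite ltr_pdivrMr// cnormM mulrC.
Qed.

End Meromorphic.

Lemma null_meq g h : meromorphic g -> meromorphic h -> null (fun w => g w - h w) -> meq g h.
Proof.
move=> mg mh n z pg ph; apply: ccont_val; [exact: not_pole_cdiff|exact: not_pole_cdiff|].
by apply: filterS (n z) => w /eqP; rewrite subr_eq0 => /eqP.
Qed.

Lemma nonconstant_shift f c : nonconstant f -> nonconstant (fshift f c).
Proof.
move=> nc [a ha]; apply: nc; exists a => z pz; have := ha (z - c); rewrite /fshift subrK; apply.
move=> /is_poleP[h1 h2]; apply: pz; apply/is_poleP.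
have h A : pn (z - c) (fun w => A (w + c)) -> pn z A.
  move=> /(@pn_add _ z (- c) (fun w => A (w + c))); apply: filterS => w; by rewrite subrK.
split; last by move=> M; exact: h (h2 M).
apply: h; apply: filterS h1 => w hw; apply: (@cdiff_eq _ (fun v => fshift f c (v - c))).
  by near=> v; rewrite /fshift subrK.
by apply: cdiff_add; rewrite addrK.
Unshelve. all: by end_near. Qed.

(** The hypothesis on zeros settles ord f z > 0; otherwise a violation would make z a pole of f(z +
    c) of larger order than f has at z. *)
Lemma Esub_ord f c : meromorphic f -> nonconstant f ->
  Esub f (Some (0 : C)) (fshift f c) (Some (0 : C)) -> Esub (fshift f c) None f None ->
  forall z, ord f z <= ord f (z + c).
Proof.
move=> merof nc h0 hi z; have mf := nonconstant_mer0 merof nc.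
have ms := meromorphic_shift merof c; have ncs := @nonconstant_shift f c nc.
have mfs := nonconstant_mer0 ms ncs.
have e0 g : mer g -> forall z, ord (fun w => g w - 0) z = ord g z.
  by move=> mg v; apply: ord_aeq => // y; near=> w; rewrite subr0.
have os : ord (fshift f c) z = ord f (z + c) by exact: ord_shift.
rewrite leNgt; apply/negP => lt.
have [p|p] := ltP 0 (ord f z).
  have := h0 z `|ord f z|%N; rewrite amult_fin// e0// => /(_ _)[|m' []].
    by split; lia.
  by move=> m1; rewrite amult_fin// e0// os => -[_ om]; lia.
pose t := ord f (z + c); have := hi z `|t|%N; rewrite amult_inf// os -/t => /(_ _)[|m' []].
  by split; rewrite /t; lia.
by move=> m1; rewrite amult_inf// => -[_ om]; rewrite /t in m1; lia.
Unshelve. all: by end_near. Qed.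

Lemma Ebarsub_ord f c A : meromorphic f -> nonconstant f ->
  Ebarsub f (Some (1 : C)) (fshift f c) (Some A) ->
  forall z, 0 < ord (fun w => f w - 1) z -> 0 < ord (fun w => f w - A) (z + c).
Proof.
move=> merof nc h z p.
have ms := meromorphic_shift merof c; have ncs := @nonconstant_shift f c nc.
pose t := ord (fun w => f w - 1) z; have [|m'] := h z.
  by exists `|t|%N; rewrite amult_fin// -/t; split; rewrite /t; lia.
rewrite amult_fin// => -[m0].
by rewrite (@ord_shift _ (fun v => f v - A) c z (nonconstant_mer merof A nc)) => ->.
Qed.

End Bridge.

Import numFieldNormedType.Exports.

(** * The characteristic as a limit of circle averages *)

Section Characteristic.
Variable R : realType.
Local Notation C := (complex R).
Local Notation "x %:C" := (real_complex R x).
Local Notation mu := (@lebesgue_measure R).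
Implicit Types (z w a b c : C) (r d s B L T : R) (u g f q : C -> C) (h : R -> R) (S : seq C).
Local Notation lp z := (logplus (cnorm z)).

Definition ucont h := forall e : R, 0 < e -> exists2 d, 0 < d & forall x y : R, `|x - y| <= d -> `|h x - h y| <= e.

Lemma ucont_integrable h (x y : R) : ucont h -> mu.-integrable `[x, y] (EFin \o h).
Proof.
move=> hu; apply: continuous_compact_integrable; first exact: segment_compact.
apply: continuous_subspaceT => t; apply/cvgrPdist_le => e e0.
have [d d0 hd] := hu e e0; near=> v; apply: hd; apply: ltW.
by near: v; exists d.
Unshelve. all: by end_near. Qed.

Lemma integral_cell h (x y e : R) : x <= y -> mu.-integrable `[x, y] (EFin \o h) ->
  (forall t : R, x <= t <= y -> `|h t - h x| <= e) ->
  `|\int[mu]_(t in `]x, y]) h t - h x * (y - x)| <= e * (y - x).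
Proof.
move=> xy ih hh.
have sub : `]x, y] `<=` `[x, y] by apply: subset_itv; rewrite ?bnd_simp.
have ih' : mu.-integrable `]x, y] (EFin \o h) by apply: (@integrableS _ _ R mu `[x, y] `]x, y] (EFin \o h) _ _ sub ih).
have ic (t : R) : mu.-integrable `]x, y] (EFin \o (fun=> t)).
  apply: (@integrableS _ _ R mu `[x, y] `]x, y] _ _ _ sub) => //; apply: continuous_compact_integrable; first exact: segment_compact.
  by apply: continuous_subspaceT => v; exact: cvg_cst.
have int_cst (t : R) : \int[mu]_(_ in `]x, y]) t = t * (y - x).
  have E : lebesgue_measure [set` `]x, y]] = (y - x)%:E :> \bar R.
    by rewrite lebesgue_measure_itv /= lte_fin; case: ltgtP xy => [_|//|->] _; rewrite ?subrr.
  by rewrite Rintegral_cst//; congr (_ * _); exact: (congr1 fine E).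
have lo : \int[mu]_(_ in `]x, y]) (h x - e) <= \int[mu]_(t in `]x, y]) h t.
  apply: le_Rintegral => // t /=; rewrite in_itv /= => /andP[t1 t2].
  by have := hh t; rewrite (ltW t1) t2 ler_norml => /(_ isT) /andP[]; lra.
have up : \int[mu]_(t in `]x, y]) h t <= \int[mu]_(_ in `]x, y]) (h x + e).
  apply: le_Rintegral => // t /=; rewrite in_itv /= => /andP[t1 t2].
  by have := hh t; rewrite (ltW t1) t2 ler_norml => /(_ isT) /andP[]; lra.
move: lo up; rewrite !int_cst; move: (\int[mu]_(t in `]x, y]) h t) => I lo up.
by rewrite ler_norml; apply/andP; split; lra.
Qed.

Lemma riemann_sum h (d e : R) n : ucont h -> (0 < n)%N -> 0 < d ->
  (forall x y : R, `|x - y| <= d -> `|h x - h y| <= e) ->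
  forall k, (k <= n)%N -> `|\int[mu]_(t in `[0, k%:R * d]) h t - d * \sum_(j < k) h (j%:R * d)| <= e * (k%:R * d).
Proof.
move=> hu n0 d0 hd; elim=> [_|k IH kn].
  have -> : 0%:R * d = 0 by rewrite mul0r.
  by rewrite big_ord0 mulr0 subr0 set_itv1 Rintegral_set1 normr0 mulr0.
have kd : k%:R * d <= k.+1%:R * d by rewrite ler_wpM2r ?ler_nat// ltW.
have k0 : 0 <= k%:R * d by rewrite mulr_ge0// ltW.
have i1 := ucont_integrable 0 (k.+1%:R * d) hu.
have := @Rintegral_itvB R h (BLeft 0) (BRight (k.+1%:R * d)) (k%:R * d) i1.
rewrite !bnd_simp => /(_ k0 kd) hB.
have ste : k.+1%:R * d - k%:R * d = d by rewrite -natr1; ring.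
have := @integral_cell h (k%:R * d) (k.+1%:R * d) e kd (ucont_integrable _ _ hu) _.
rewrite -hB ste => /(_ _) hc; have {}hc := hc _.
have hc' : `|\int[mu]_(t in `[0, k.+1%:R * d]) h t - \int[mu]_(t in `[0, k%:R * d]) h t - h (k%:R * d) * d| <= e * d.
  apply: hc => t /andP[t1 t2]; apply: hd; rewrite ger0_norm; last lra.
  by move: ste; lra.
have := IH (ltnW kn); rewrite big_ord_recr /= mulrDr.
have -> : e * (k.+1%:R * d) = e * (k%:R * d) + e * d by rewrite -natr1; ring.
by move: hc'; clear; rewrite !ler_norml => /andP[? ?] /andP[? ?]; apply/andP; split; lra.
Qed.

Definition circ g r (t : R) : R := lp (g (r%:C * expi t)).

Lemma lp_lip z w : `|lp z - lp w| <= cnorm (z - w).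
Proof.
suff H (x y : C) : lp y <= lp x + cnorm (x - y).
  by have := H z w; have := H w z; rewrite [cnorm (w - z)]cnormBC ler_norml => ? ?; apply/andP; split; lra.
have t0 := cnorm_ge0 (x - y); have x0 := lp_ge0 x; have y0 := cnorm_ge0 y.
have yx : cnorm y <= cnorm x + cnorm (x - y) by have := cnorm_subl y x; rewrite cnormBC; lra.
rewrite {1}/logplus ge_max; apply/andP; split; first lra.
have [x1|x1] := leP 1 (cnorm x).
  have [->|yp] := eqVneq (cnorm y) 0; first by rewrite ln0//; lra.
  have yp' : 0 < cnorm y by rewrite lt_neqAle eq_sym yp.
  apply: le_trans (_ : ln (cnorm x * (1 + cnorm (x - y))) <= _).
    by rewrite ler_ln ?posrE//; nra.
  rewrite lnM ?posrE; try lra.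
  by have := ln1p_le t0; have := ln_le_lp x; lra.
have [->|yp] := eqVneq (cnorm y) 0; first by rewrite ln0//; lra.
have yp' : 0 < cnorm y by rewrite lt_neqAle eq_sym yp.
have := @le_ln1Dx R (cnorm y - 1); rewrite subrKC => /(_ ltac:(lra)); lra.
Qed.

Lemma circ_ucont g r : 0 < r -> (forall w, cnorm w = r -> cdiff g w) -> ucont (circ g r).
Proof.
move=> r0 hg e e0.
pose P (A : set C) := exists2 d, 0 < d & forall w v, A w -> cnorm w = r -> cnorm v = r ->
  cnorm (v - w) < d -> `|lp (g v) - lp (g w)| <= e.
have [d d0 hd] : P [set z | cnorm z <= r].
  apply: (@disc_compact R P r r0).
  - by move=> A B AB [d d0 hd]; exists d => // w v /AB; exact: hd.
  - move=> A B [d d0 hd] [d' d'0 hd']; exists (Num.min d d'); first by rewrite lt_min d0.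
    by move=> w v [Aw|Bw] wr vr; rewrite lt_min => /andP[? ?]; [exact: hd|exact: hd'].
  (* A point off the circle has a neighbourhood missing it, on which the property is vacuous; g is
     controlled on the circle only. *)
  - move=> z zr; have [zE|zE] := eqVneq (cnorm z) r; last first.
      exists [set w | cnorm w < r]; first by apply: nb_disc; rewrite lt_neqAle zE.
      by exists 1 => // w v /= wr wE; rewrite wE ltxx in wr.
    have e2 : 0 < e / 2 by rewrite divr_gt0.
    have [d d0 hd] := cdiff_ccont (hg z zE) e2.
    have d2 : 0 < d / 2 by rewrite divr_gt0.
    exists [set w | cnorm (w - z) < d / 2]; first by exists (d / 2).
    exists (d / 2) => // w v wz wr vr vw.
    have vz : cnorm (v - z) < d by have := cnorm_triangle w v z; move: wz => /=; lra.
    have wz' : cnorm (w - z) < d by move: wz => /=; lra.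
    have h1 := hd _ vz; have h2 := hd _ wz'.
    apply: le_trans (lp_lip _ _) _; have := cnorm_triangle (g z) (g v) (g w).
    by rewrite [cnorm (g z - _)]cnormBC; lra.
exists (d / 2 / (2 * r)); first by rewrite !divr_gt0// mulr_gt0.
move=> x y xy; have n t : cnorm (r%:C * expi t) = r by rewrite cnormM cnorm_expi mulr1 cnormR gtr0_norm.
apply: hd; rewrite ?n//=; first by rewrite n.
rewrite -mulrBr cnormM cnormR gtr0_norm//.
have := expi_lip x y; move: xy; rewrite ler_pdivlMr ?mulr_gt0// => xy el.
by have := ler_wpM2l (ltW r0) el; lra.
Qed.

(** log+ |g| is uniformly continuous on a circle along which g is differentiable, so its Lebesgue
    integral is the limit of Riemann sums, and these are the averages over roots of unity. *)
Lemma proximity_mlim g r : 0 < r -> (forall w, cnorm w = r -> cdiff g w) ->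
  exists2 m, proximity g r = m%:E & mlim r (fun w => lp (g w)) m.
Proof.
move=> r0 hg; have hu := circ_ucont r0 hg.
have p0 : 0 < 2 * pi :> R by rewrite mulr_gt0// pi_gt0.
have hi := ucont_integrable 0 (2 * pi) hu.
pose I : R := \int[mu]_(t in `[0, 2 * pi]) circ g r t.
have IE : (\int[mu]_(t in `[0%R, (2 * pi)%R]) (circ g r t)%:E)%E = I%:E.
  by rewrite /I /Rintegral fineK//; exact: integrable_fin_num.
exists ((2 * pi)^-1 * I); first by rewrite /proximity -[X in (_ * X)%E]/(\int[mu]_(t in _) (circ g r t)%:E)%E IE.
apply: mlimP => e e0; have [d d0 hd] := hu e e0.
have dp : 0 < d / (2 * pi) by rewrite divr_gt0.
apply: filterS (pow2_inv dp) => N hN.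
have q0 : 0 < 2 ^+ N :> R by rewrite exprn_gt0.
have nN : (2 ^ N)%:R = 2 ^+ N :> R by rewrite natrX.
have dl0 : 0 < 2 * pi / 2 ^+ N :> R by rewrite divr_gt0.
have := @riemann_sum (circ g r) (2 * pi / 2 ^+ N) e (2 ^ N) hu _ dl0 _ (2 ^ N) (leqnn _).
have -> : (2 ^ N)%:R * (2 * pi / 2 ^+ N) = 2 * pi :> R by rewrite nN; field; exact: lt0r_neq0.
move=> /(_ _ _) hR; have {}hR : `|I - 2 * pi / 2 ^+ N * \sum_(j < 2 ^ N) circ g r (j%:R * (2 * pi / 2 ^+ N))| <= e * (2 * pi).
  apply: hR; first by rewrite expn_gt0.
  move=> x y xy; apply: hd; apply: le_trans xy _.
  by move: hN; rewrite ler_pdivlMr// mulrC.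
have -> : Mr N r (fun w => lp (g w)) = (2 ^+ N)^-1 * \sum_(j < 2 ^ N) circ g r (j%:R * (2 * pi / 2 ^+ N)).
  rewrite /Mr; congr (_ * _); apply: eq_bigr => j _; rewrite /circ /rt; congr (logplus (cnorm (g (_ * expi _)))); ring.
set s := \sum_(j < _) _ in hR *.
have p1 : 0 <= (2 * pi)^-1 :> R by rewrite invr_ge0 ltW.
rewrite distrC; have := ler_wpM2l p1 hR; rewrite -{1}(ger0_norm p1) -normrM.
rewrite [X in _ <= X -> _]mulrCA mulVf ?gt_eqF// mulr1.
rewrite (_ : (2 * pi)^-1 * (I - 2 * pi / 2 ^+ N * s) = (2 * pi)^-1 * I - (2 ^+ N)^-1 * s)//.
by rewrite mulrBr -[2 * pi / _ * s]mulrA mulKf ?gt_eqF.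
Qed.

Lemma integral_inv (x y : R) : 0 < x -> x <= y ->
  (\int[mu]_(t in `[x, y]) (t^-1)%:E = (ln y - ln x)%:E)%E.
Proof.
move=> x0; rewrite le_eqVlt => /orP[/eqP <-|xy].
  by rewrite set_itv1 integral_set1 subrr.
have ci : {within `[x, y], continuous (fun t : R => t^-1)}.
  apply: continuous_in_subspaceT => t; rewrite inE /= in_itv /= => /andP[xt _].
  by apply: inv_continuous; rewrite gt_eqF//; lra.
rewrite (@continuous_FTC2 R (fun t => t^-1) (@ln R) x y xy ci)//; last first.
  move=> t; rewrite in_itv /= => /andP[xt _].
  have tp : 0 < t by lra.
  by rewrite derive1E; have := is_derive1_ln tp => /@derive_val.
split.
- move=> t; rewrite in_itv /= => /andP[xt _].
  have tp : 0 < t by exact: lt_trans x0 xt.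
  by have := is_derive1_ln tp => /@ex_derive.
- by apply: cvg_at_right_filter; apply: continuous_ln.
- by apply: cvg_at_left_filter; apply: continuous_ln; lra.
Qed.


Section Counting.
Variables (f : C -> C) (S : seq C) (s : R).
Hypothesis merof : meromorphic f.
Hypothesis mf : mer f.
Hypothesis cS : captures S s f.

Let m a : int := Num.max (- ord f a) 0.

Lemma pole_order_ord a : is_pole f a -> (pole_order f a)%:Z = m a.
Proof.
move=> pa; have oa := (pole_ord merof a mf).1 pa.
have h : amult f None a `|ord f a|%N by rewrite amult_inf//; split; lia.
have : amult f None a (pole_order f a).
  by apply: (@xgetPex _ 0%N [set k | amult f None a k]); exists `|ord f a|%N.
by rewrite amult_inf// => -[_]; rewrite /m; lia.
Qed.

Lemma npolesE t : t < s -> npoles f t = (\sum_(a <- S | cnorm a <= t) (m a)%:~R)%:E.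
Proof.
move=> ts; have [uS hS] := cS.
have E : [set z : C | cnorm z <= t /\ is_pole f z] = [set` [seq a <- S | (cnorm a <= t) && (ord f a < 0)]].
  apply/seteqP; split=> a /=; rewrite mem_filter.
    move=> [at_ pa]; have oa := (pole_ord merof a mf).1 pa; rewrite at_ oa /=.
    apply: hS; first exact: le_lt_trans at_ ts.
    by apply: contrapT => /(ord_special mf); lia.
  by move=> /andP[/andP[at_ oa] _]; split=> //; exact: (pole_ord merof a mf).2.
rewrite /npoles E esum_fset; [|exact: finite_seq|by move=> a _; rewrite lee_fin].
rewrite -fsbig_seq ?filter_uniq// big_filter sumEFin; congr EFin.
rewrite big_mkcondr; apply: eq_bigr => a _; case: ifP => oa.
  have pa := (pole_ord merof a mf).2 oa; rewrite -(pole_order_ord pa) //.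
by rewrite /m (_ : Num.max _ _ = 0) ?mulr0z//; lia.
Qed.

(** Contribution of one pole, without its multiplicity, to the integrand of [Ncount]; defined on the
    whole line so that sum and integral can be exchanged. *)
Let gq a (t : R) : \bar R := (((fun x : R => (x^-1)%:E) \_ `[cnorm a, +oo[) t).

Lemma mgq a r : measurable_fun `]0, r] (gq a).
Proof.
apply: (measurable_restrict _ _ _).1 => //.
have h : measurable_fun (`]0%R, +oo[%classic : set R) (fun x : R => x^-1).
  apply: open_continuous_measurable_fun; first exact: interval_open.
  by move=> x; rewrite inE /= in_itv /= andbT => x0; apply: inv_continuous; rewrite gt_eqF.
apply/measurable_EFinP; apply: measurable_funS h => //.
by move=> x [] /=; rewrite !in_itv /= => /andP[-> _].
Qed.

Lemma integral_gq a r : a != 0 -> cnorm a <= r -> (\int[mu]_(t in `]0%R, r]) gq a t = (ln r - ln (cnorm a))%:E)%E.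
Proof.
move=> a0 ar; have p : 0 < cnorm a by rewrite cnorm_gt0.
rewrite -integral_inv// -integral_mkcondr; congr integral.
apply/seteqP; split=> t /=; rewrite !in_itv /=.
  by move=> [/andP[_ ->]]; rewrite andbT => ->.
by move=> /andP[h1 ->]; rewrite h1 (lt_le_trans p h1).
Qed.

Lemma integral_gq0 a r : r < cnorm a -> (\int[mu]_(t in `]0%R, r]) gq a t = 0)%E.
Proof.
move=> ar; rewrite -integral_mkcondr (_ : _ `&` _ = set0) ?integral_set0//.
apply/seteqP; split=> t //=; rewrite !in_itv /= => -[/andP[_ h1]]; rewrite andbT => h2.
by have := lt_le_trans ar (le_trans h2 h1); rewrite ltxx.
Qed.

(** The integrand is a finite combination of functions 1 / t cut off below |a|. The pole at the
    origin stands apart because the definition subtracts it and adds its logarithm. *)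
Lemma NcountE r : 0 < r < s -> Ncount f r =
  (\sum_(a <- S | a != 0) (m a)%:~R * (if cnorm a <= r then ln r - ln (cnorm a) else 0) +
   \sum_(a <- S | a == 0) (m a)%:~R * ln r)%:E.
Proof.
move=> /andP[r0 rs]; have s0 : 0 < s by lra.
have m0 a : 0 <= (m a)%:~R :> R by rewrite ler0z le_max lexx orbT.
rewrite /Ncount npolesE// EFinD; congr (_ + _)%E; last first.
  rewrite -EFinM mulr_suml; congr EFin; apply: eq_bigl => a.
  by rewrite cnorm_le0.
have -> : (\int[mu]_(t in `]0%R, r]) ((npoles f t - (\sum_(a <- S | cnorm a <= 0) (m a)%:~R)%:E) * (t^-1)%:E) =
   \int[mu]_(t in `]0%R, r]) (\sum_(a <- [seq a <- S | a != 0%R]) ((m a)%:~R)%:E * gq a t))%E.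
  apply: eq_integral => t; rewrite inE /= in_itv /= => /andP[t0 tr].
  rewrite npolesE; last lra.
  rewrite -EFinB -EFinM.
  have -> : \sum_(a <- S | cnorm a <= t) (m a)%:~R - \sum_(a <- S | cnorm a <= 0) (m a)%:~R
     = \sum_(a <- S | a != 0) (if cnorm a <= t then (m a)%:~R else 0) :> R.
    rewrite big_mkcond [X in _ - X]big_mkcond -sumrB [RHS]big_mkcond; apply: eq_bigr => a _.
    rewrite cnorm_le0; have [->|a0] := eqVneq a 0; first by rewrite cnorm0 (ltW t0) /= subrr.
    by rewrite subr0.
  rewrite big_filter mulr_suml -sumEFin; apply: eq_bigr => a a0.
  rewrite /gq patchE; case: ifP => at_; case: ifPn; rewrite ?inE ?notin_setE /= in_itv /= andbT => h.
  - by rewrite EFinM.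
  - by rewrite at_ in h.
  - by rewrite h in at_.
  - by rewrite mul0r mule0.
rewrite ge0_integral_sum//; last 2 first.
- by move=> a; apply: measurable_funeM; exact: mgq.
- move=> a t /=; rewrite in_itv /= => /andP[t0 _]; rewrite mule_ge0 ?lee_fin//.
  by rewrite /gq patchE; case: ifP => // _; rewrite lee_fin invr_ge0 ltW.
rewrite big_filter -sumEFin; apply: eq_bigr => a a0.
rewrite ge0_integralZl//.
- rewrite EFinM; congr (_ * _)%E; case: ifPn => ar; first exact: integral_gq.
  by rewrite integral_gq0// ltNge.
- exact: mgq.
- move=> t /=; rewrite in_itv /= => /andP[t0 _].
  by rewrite /gq patchE; case: ifP => // _; rewrite lee_fin invr_ge0 ltW.
- by rewrite lee_fin.
Qed.

(* r0 is so small that Ncount and NP differ only through the pole at the origin. *)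
Lemma charT_mlim r0 r : rad r0 s S r -> (forall a, a \in S -> a != 0 -> r0 < cnorm a) ->
  exists2 mm, mlim r (fun w => lp (f w)) mm &
  charT f r = (mm + NP r0 S r f + (m 0)%:~R * ln r0)%:E.
Proof.
move=> hr hS0; have rp := rad_gt0 hr; have [r00 r0r rs gr] := hr; have [uS hS] := cS.
have hc w : cnorm w = r -> cdiff f w by move=> wr; have [] := captured cS gr wr rs.
have [mm pE hm] := proximity_mlim rp hc; exists mm => //.
rewrite /charT pE NcountE ?rp// -EFinD; congr EFin; rewrite -addrA; congr (_ + _).
have m0S : (m 0)%:~R * ln r0 = \sum_(a <- S | a == 0) (m a)%:~R * ln r0.
  have [z|z] := boolP (0 \in S).
    rewrite big_mkcond (bigD1_seq 0 z uS) /= eqxx big1 ?addr0// => a a0.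
    by rewrite (negPf a0).
  rewrite big_seq_cond big1 => [|a /andP[aS /eqP a0]]; last by rewrite a0 (negPf z) in aS.
  have : ~ special f 0 by move=> s0; move: (hS 0); rewrite cnorm0 (negPf z) => /(_ (lt_trans rp rs) s0).
  by move=> /(ord_special mf); rewrite /m => ->; rewrite oppr0 maxxx mul0r.
rewrite m0S /NP [\sum_(a <- S) _](bigID (fun a => a != 0)) /= -addrA; congr (_ + _).
  rewrite big_seq_cond [RHS]big_seq_cond; apply: eq_bigr => a /andP[aS a0]; congr (_ * _).
  rewrite /nu (max_idPr (ltW (hS0 _ aS a0))); case: ifPn => ar; first by rewrite (max_idPl ar).
  by rewrite (max_idPr _) ?subrr// ltW// ltNge.
under [X in _ = X + _]eq_bigl do rewrite negbK.
rewrite -big_split /=; apply: eq_bigr => a /eqP ->; rewrite -mulrDr; congr (_ * _).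
by rewrite /nu cnorm0 (max_idPl (ltW rp)) (max_idPl (ltW r00)) subrK.
Qed.

End Counting.

End Characteristic.

(** * Choice of radii and growth of the characteristic *)

Section Windows.
Variable R : realType.
Local Notation C := (complex R).
Local Notation "x %:C" := (real_complex R x).
Implicit Types (z w a b c : C) (r d s B T : R) (u g f : C -> C) (S bs : seq C).
Local Notation lp z := (logplus (cnorm z)).

Lemma avoid (t : seq R) (a b : R) : a < b -> exists2 x, a < x < b & x \notin t.
Proof.
elim: t a b => [|y t IH] a b ab; first by exists ((a + b) / 2) => //; lra.
have [ym|my] := leP y ((a + b) / 2).
  have [|x x1 x2] := IH ((a + b) / 2) b; first by lra.
  by exists x; [lra|rewrite inE negb_or x2 andbT; apply/eqP => xy; lra].
have [|x x1 x2] := IH a ((a + b) / 2); first by lra.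
by exists x; [lra|rewrite inE negb_or x2 andbT; apply/eqP => xy; lra].
Qed.

Definition env r0 n (fam : nat -> C -> C) (L : nat -> R) s S :=
  forall i, (i < n)%N -> adm r0 s S (fam i) (L i).

Definition grid r0 n (fam : nat -> C -> C) (L : nat -> R) bs (X K rho s : R) S :=
  [/\ env r0 n fam L s S, X < rho < X + 1, forall a, a \in S -> a != 0 -> r0 < cnorm a &
   forall j : nat, rho + j%:R * K <= 3 * X -> rad r0 s S (rho + j%:R * K) /\
     forall b, b \in bs -> forall a, a \in S -> cnorm (a - b) != rho + j%:R * K].

(** r0 and the constants L are fixed before the scale X, and only S, s and rho depend on X;
    otherwise the additive errors could grow with X. *)
Lemma env_exists n (fam : nat -> C -> C) : (forall i, (i < n)%N -> mer (fam i)) ->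
  exists r0 L, 0 < r0 <= 1 /\ forall bs (X K : R), 1 <= X -> 0 < K ->
    exists rho s S, grid r0 n fam L bs X K rho s S.
Proof.
(* Special points in |a| < 2 suffice to choose r0 <= 1: those farther out exceed r0 anyway. *)
move=> hm; have [S2 uS2 hS2] := special_finite (ltr0n R 2) hm.
have [r0 /andP[r00 r01] hr0] : exists2 r0 : R, 0 < r0 <= 1 & forall a, a \in S2 -> a != 0 -> r0 < cnorm a.
  elim: S2 {uS2 hS2} => [|a S2 [r0 r01 IH]]; first by exists 1 => //; lra.
  have [->|a0] := eqVneq a 0.
    by exists r0 => // b; rewrite inE => /predU1P[->|/IH//]; rewrite eqxx.
  exists (Num.min r0 (cnorm a / 2)); first by rewrite lt_min ge_min !(andP r01).1 (andP r01).2 divr_gt0// cnorm_gt0.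
  move=> b; rewrite inE gt_min => /predU1P[->|bS b0]; last by rewrite IH.
  by have p : 0 < cnorm a by [rewrite cnorm_gt0]; move=> _; apply/orP; right; lra.
have gS2 : good S2 r0.
  move=> a aS; have [->|a0] := eqVneq a 0; first by rewrite cnorm0 lt_eqF.
  by rewrite gt_eqF// hr0.
have cap2 i : (i < n)%N -> captures S2 2 (fam i).
  by move=> ni; split=> // a a2 sa; apply/hS2; split=> //; exists i.
have r02 : 0 < r0 < 2 by rewrite r00 /=; lra.
have hL i : exists l, (i < n)%N -> mlim r0 (fun w => ln (cnorm (fam i w))) l.
  have [ni|ni] := boolP (i < n)%N; last by exists 0.
  have [l hl] := jensen0 (hm i ni) (cap2 i ni) r02 gS2; exists l => _.
  have := hl r0 r02 gS2; rewrite big1 ?addr0// => a _.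
  by rewrite /nu subrr mulr0.
have [L hL'] := choice hL.
exists r0, L; rewrite r00 r01; split=> // bs X K X1 K0.
pose s := 3 * X + 2; have s0 : 0 < s by rewrite /s; lra.
have [S uS hS] := special_finite s0 hm.
have S0 a : a \in S -> a != 0 -> r0 < cnorm a.
  move=> /hS[_ hs] a0; rewrite ltNge; apply/negP => ar.
  have : a \in S2 by apply/hS2; split=> //; lra.
  by move=> /hr0/(_ a0); rewrite ltNge ar.
have gS : good S r0.
  move=> a aS; have [->|a0] := eqVneq a 0; first by rewrite cnorm0 lt_eqF.
  by rewrite gt_eqF// S0.
pose J := (Num.truncn (3 * X / K)).+1.
(* Values of rho for which some radius of the grid would meet a point of S or of S - b; finitely
   many, because j K <= 3X bounds j. *)
pose bad := [seq cnorm (p.1 - p.2.1) - (p.2.2)%:R * K | p <- allpairs pair S (allpairs pair (0 :: bs) (iota 0 J))].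
have XX1 : X < X + 1 by lra.
have [x /andP[x0 x1] xb] := avoid bad XX1.
have xb' a b j : a \in S -> b \in 0 :: bs -> (j < J)%N -> cnorm (a - b) != x + j%:R * K.
  move=> aS bS jJ; apply: contraNneq xb => E; apply/mapP; exists (a, (b, j)).
    by apply: allpairs_f => //; apply: allpairs_f => //; rewrite mem_iota add0n.
  by rewrite /= E addrK.
exists x, s, S; split=> //.
- move=> i ni; split=> //; [exact: hm| |by rewrite r00 /s /=; lra|exact: hL'].
  by split=> // a as_ sa; apply/hS; split=> //; exists i.
- by rewrite x0 x1.
- move=> j jX; have xp : 0 < x by lra.
  have jJ : (j < J)%N.
    rewrite ltnS truncn_ge_nat ?divr_ge0//; try lra.
    by rewrite ler_pdivlMr//; lra.
  have jK : 0 <= j%:R * K by rewrite mulr_ge0// ltW.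
  split; last by move=> b bb a aS; apply: xb' => //; rewrite inE bb orbT.
  split=> //; [lra|rewrite /s; lra|].
  by move=> a aS; have := xb' a 0 j aS (mem_head _ _) jJ; rewrite subr0.
Qed.

(** Otherwise from every j some j + i with i <= 4 more than doubles T, and m such moves from T 0 >=
    1 reach 2^m within 4 m steps. Five consecutive radii are kept because two estimates, each
    looking two radii ahead, will be chained. *)
Lemma doubling_window (T : nat -> R) m : 1 <= T 0%N -> (forall j, (j <= 4 * m)%N -> T j < 2 ^+ m) ->
  exists j, [/\ (j + 4 <= 4 * m)%N, T 0%N <= T j & forall i, (i <= 4)%N -> T (j + i)%N <= 2 * T j].
Proof.
move=> T1 hT; apply: contrapT => no.
suff H n : (n <= m)%N -> exists j, [/\ (j <= 4 * n)%N, 2 ^+ n <= T j & T 0%N <= T j].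
  by have [j [jm h _]] := H m (leqnn _); have := hT j jm; rewrite ltNge h.
elim: n => [|n IH] nm; first by exists 0%N; rewrite expr0.
have [j [jn h1 h2]] := IH (ltnW nm).
have [i [i4 hi]] : exists i, (i <= 4)%N /\ 2 * T j < T (j + i)%N.
  apply: contrapT => noi; apply: no; exists j; split=> //; first by lia.
  by move=> i i4; rewrite leNgt; apply/negP => lt; apply: noi; exists i.
have p : 1 <= T j by lra.
by exists (j + i)%N; split; [lia|rewrite exprS; lra|lra].
Qed.

Lemma expR_ge_sqr (u : R) : 0 <= u -> (u / 2) ^+ 2 <= expR u.
Proof.
move=> u0; have -> : expR u = expR (u / 2) ^+ 2 by rewrite -expRM_natl; congr expR; lra.
have h := expR_ge1Dx (u / 2); rewrite ler_pXn2r ?nnegrE ?expR_ge0//; lra.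
Qed.

(** The number m of disjoint windows is about X / (4 lam ln X), against (3X)^q for the logarithm of
    the characteristic; q < 1 is decisive, as X^(1-q) beats ln X. *)
Lemma growth_gap (q lam B : R) : 0 < q < 1 -> 0 < lam -> 0 <= B -> exists X0 : R, forall X, X0 <= X ->
  [/\ expR 1 <= X, 4 * (lam * ln X) <= X &
   exists m, 4 * m%:R * (lam * ln X) <= X /\ expR (q * ln (3 * X)) + B < m%:R / 2].
Proof.
(* D collects the constants so that D ln X <= X^(1-q) suffices; the threshold below ensures this
   through e^u >= (u / 2)^2. *)
move=> /andP[q0 q1] l0 B0; pose D := 8 * lam * (3 * 3 + B + 1) + 4 * lam.
have D0 : 0 < D by rewrite /D; nra.
pose p := 1 - q; have p0 : 0 < p by rewrite /p; lra.
exists (expR (1 + 4 * D / p ^+ 2)) => X hX.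
have Xp : 0 < X by apply: lt_le_trans hX; exact: expR_gt0.
pose t := ln X; have tX : expR t = X by rewrite /t lnK.
have t1 : 1 + 4 * D / p ^+ 2 <= t by rewrite /t -ler_expR lnK.
have Dp : 0 <= 4 * D / p ^+ 2 by rewrite divr_ge0 ?exprn_ge0//; lra.
have t0 : 1 <= t by lra.
have et : D * t <= expR (p * t).
  apply: le_trans (expR_ge_sqr _); last by rewrite mulr_ge0//; lra.
  have -> : (p * t / 2) ^+ 2 = p ^+ 2 / 4 * t * t by field.
  rewrite ler_wpM2r//; first lra.
  have h : 4 * D / p ^+ 2 <= t by lra.
  by move: h; rewrite ler_pdivrMr ?exprn_gt0// => h; lra.
have eq1 : 1 <= expR (q * t) by rewrite -expR0 ler_expR mulr_ge0//; lra.
have Xe : X = expR (p * t) * expR (q * t) by rewrite -expRD -tX /p; congr expR; ring.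
have XD : D * t * expR (q * t) <= X by rewrite Xe ler_wpM2r// expR_ge0.
have XD1 : D * t <= X by apply: le_trans XD; rewrite ler_peMr//; apply: mulr_ge0; lra.
have l3 : ln 3 <= 2 :> R.
  have -> : 3 = 1 + 2 :> R by lra.
  by apply: ln1p_le.
have q3 : expR (q * ln (3 * X)) <= 9 * expR (q * t).
  rewrite lnM ?posrE// mulrDr expRD -/t ler_wpM2r ?expR_ge0//.
  have l30 : 0 <= ln 3 :> R by apply: ln_ge0; lra.
  apply: le_trans (_ : expR (ln 3) <= _); last by rewrite lnK ?posrE//; lra.
  by rewrite ler_expR ler_piMl// ltW.
have lt0 : 0 < lam * t by apply: mulr_gt0 => //; lra.
split.
- apply: le_trans hX; rewrite ler_expR; lra.
- apply: le_trans XD1; rewrite /D -/t; have : 0 <= lam * (3 * 3 + B + 1) * t by rewrite !mulr_ge0//; lra.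
  lra.
exists (Num.truncn (X / (4 * (lam * t)))); rewrite -/t.
have Xq : 0 <= X / (4 * (lam * t)) by rewrite divr_ge0//; lra.
split.
  have : (Num.truncn (X / (4 * (lam * t))))%:R <= X / (4 * (lam * t)) by rewrite truncn_le.
  rewrite ler_pdivlMr; last lra.
  by lra.
have := truncnS_gt (X / (4 * (lam * t))); set mm := Num.truncn _.
rewrite -(natr1 mm) ltr_pdivrMr; last lra.
set m : R := mm%:R => hm; have m0 : 0 <= m by [].
have h : 8 * lam * (3 * 3 + B + 1) * t * expR (q * t) + 4 * lam * t * expR (q * t) < (m + 1) * (4 * (lam * t)).
  by apply: le_lt_trans hm; apply: le_trans XD; rewrite /D; lra.
have h2 : 4 * (lam * t) * (2 * (3 * 3 + B + 1) * expR (q * t) + expR (q * t)) < 4 * (lam * t) * (m + 1).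
  by lra.
move: h2; rewrite ltr_pM2l; last lra.
move=> h2; have h3 : (B + 1) * 1 <= (B + 1) * expR (q * t) by rewrite ler_wpM2l//; lra.
lra.
Qed.

Lemma window_exists (q lam B : R) : 0 < q < 1 -> 0 < lam -> 0 <= B -> exists X0 : R, forall X, X0 <= X ->
  expR 1 <= X /\ forall (rho : R) (tau : R -> R), X < rho < X + 1 -> 1 <= tau rho ->
   (forall j : nat, rho + (j + 2)%:R * (lam * ln X) <= 3 * X ->
      tau (rho + j%:R * (lam * ln X)) <= B * (1 + expR (expR (q * ln (3 * X))))) ->
   exists j : nat, [/\ rho + (j + 6)%:R * (lam * ln X) <= 3 * X,
     tau rho <= tau (rho + j%:R * (lam * ln X)) &
     forall i, (i <= 4)%N -> tau (rho + (j + i)%:R * (lam * ln X)) <= 2 * tau (rho + j%:R * (lam * ln X))].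
Proof.
move=> q01 l0 B0; have B2 : 0 <= 2 * B by lra.
have [X0 hX0] := growth_gap q01 l0 B2.
exists (Num.max X0 2) => X; rewrite ge_max => /andP[XX X2].
have [X1 XK [m [mK hm]]] := hX0 X XX; split=> // rho tau /andP[r1 r2] t1 hT.
set K := lam * ln X in XK mK hT *.
have lX : 1 <= ln X by rewrite -[1]expRK ler_ln ?posrE ?expR_gt0//; lra.
have K0 : 0 < K by apply: mulr_gt0 => //; lra.
have [] := @doubling_window (fun j => tau (rho + j%:R * K)) m.
- by rewrite mul0r addr0.
- move=> j jm; have jm' : j%:R <= 4 * m%:R :> R by rewrite -natrM ler_nat.
  have jK := ler_wpM2r (ltW K0) jm'.
  apply: le_lt_trans (hT j _) _; first by rewrite natrD mulrDl; lra.
  set E := expR (q * ln (3 * X)) in hm *; have E0 : 0 <= E by exact: expR_ge0.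
  have e1 : 1 <= expR E by rewrite -expR0 ler_expR.
  apply: le_lt_trans (_ : expR (2 * B + E) < _).
    have h := expR_ge1Dx (2 * B); rewrite expRD.
    apply: le_trans (_ : 2 * B * expR E <= _); last by rewrite ler_wpM2r//; lra.
    by have := ler_wpM2l B0 e1; lra.
  rewrite -[X in _ < X]lnK ?posrE ?exprn_gt0// ltr_expR lnXn// -[ltRHS]mulr_natl.
  have := ler_wpM2l (ler0n R m) (@ln2_ge R); lra.
- move=> j [jm h0 h]; rewrite mul0r addr0 in h0; exists j; split=> //.
  have jm' : (j + 4)%:R <= 4 * m%:R :> R by rewrite -natrM ler_nat.
  have jK := ler_wpM2r (ltW K0) jm'.
  by rewrite natrD mulrDl in jK *; rewrite -[6%N]/(4 + 2)%N natrD mulrDl; lra.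
Qed.

(** A limsup strictly below 1 leaves room for a fixed exponent q < 1, valid from some radius on. *)
Lemma hyper_growth f : (hyper_order f < 1%:E)%E -> exists (q M : R), 0 < q < 1 /\
  forall r : R, M <= r -> fine (charT f r) <= expR (expR (q * ln r)).
Proof.
rewrite /hyper_order limf_esupE => /ereal_inf_lt[_ [V [M [_ hM]] <-]] hsup.
set F := fun r : R => _ in hsup.
have [q q01 hq] : exists2 q : R, 0 < q < 1 & (ereal_sup [set F r | r in V] <= q%:E)%E.
  case: (ereal_sup _) hsup => [y| |] //=; last by move=> _; exists 2^-1; [lra|rewrite leNye].
  (* Raised to at least 1/2 so that q is positive whatever the limsup. *)
  rewrite lte_fin => y1; exists (Num.max y 2^-1); last by rewrite lee_fin le_max lexx.
  by rewrite lt_max gt_max y1 invr_gt0 ltr0n orbT /=; lra.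
exists q, (Num.max (M + 1) 2); split=> // r; rewrite ge_max => /andP[rM r2].
have Vr : V r by apply: hM; lra.
have : (F r <= q%:E)%E by apply: le_trans hq; apply: ereal_sup_ubound; exists r.
rewrite /F lee_fin; set T := fine _; have lr : 0 < ln r by rewrite ln_gt0//; lra.
rewrite ler_pdivrMr// => h.
have e1 : 1 <= expR (expR (q * ln r)) by rewrite -expR0 ler_expR expR_ge0.
(* For T <= 1 the iterated logarithm carries no information, but the bound is then trivial. *)
have [T1|T1] := leP T 1; first exact: le_trans e1.
have lT : 0 < ln T by rewrite ln_gt0.
have : ln T <= expR (q * ln r) by rewrite -[ln T]lnK ?posrE// ler_expR.
by rewrite -ler_expR lnK ?posrE//; lra.
Qed.

Lemma ord_gt0 g z : mer g -> (\forall w \near nb z, cdiff g w) -> g z = 0 -> 0 < ord g z.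
Proof.
move=> mg cg g0; have [e [[ce ge] e0]] := ordP z mg.
have : 0 <= ord g z.
  by apply: (ord_geP mg (e := g)); split=> //; near=> w; rewrite expr0z mul1r.
rewrite le_eqVlt => /orP[/eqP o0|//]; exfalso; move/eqP: e0; apply; rewrite -g0.
apply: ccont_val; [exact: nb_self ce|exact: nb_self cg|].
by near=> w; rewrite (near ge w)// -o0 expr0z mul1r.
Unshelve. all: by end_near. Qed.

Lemma regular_point f : mer f -> exists z, \forall w \near nb z, cdiff f w.
Proof.
move=> mf; have [z /contrapT hz] := filter_ex (mer_not_special 0 mf).
by exists z; apply: filterS hz => w [].
Qed.

(** A single zero of f - b already contributes ln r - O(1) to the counting function; hence the
    characteristic eventually exceeds any fixed constant. *)
Lemma Tb_lower r0 s S r f b z T Lf Lb : adm r0 s S f Lf -> adm r0 s S (fun w => f w - b) Lb -> rad r0 s S r ->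
  0 < ord (fun w => f w - b) z -> cnorm z < r -> Tb r0 S f r T ->
  ln r - ln (Num.max r0 (cnorm z)) <= T + lp b + 2 - Lb.
Proof.
move=> af ab hr oz zr hT; have rp := rad_gt0 hr; have [r00 r0r rs gr] := hr.
have [mf cS _ _ _] := af; have [mb' cSb _ _ _] := ab.
have hcst : mb r (fun=> lp b) (lp b) by exact: mb_cst.
have hTb : Tb r0 S (fun w => f w - b) r (T + lp b + 2).
  apply: mb_leB (mb_lpB rp hT hcst) _.
  suff -> : NP r0 S r (fun w => f w - b) = NP r0 S r f by lra.
  apply: eq_bigr => a _; congr (_%:~R * _).
  have [b0|b0] := eqVneq b 0.
    congr (Num.max (- _) 0); apply: ord_aeq => // y; near=> w; by rewrite b0 subr0.
  have mc := mer_cst b0; have oc := ord_cst a b0.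
  have [h|h] := ltP (ord f a) 0; first by rewrite (ordB_lt mf mc) ?oc.
  have : 0 <= ord (fun w => f w - b) a by apply: (ordB_ge mf mc) => //; rewrite oc.
  by lia.
have zS : z \in S.
  have [uS hS] := cSb; apply: hS; first exact: lt_trans zr rs.
  by apply: contrapT => /(ord_special mb'); lia.
apply: le_trans (Tb_NZ ab hr hTb); rewrite /NZ (bigD1_seq z zS) ?(proj1 cSb)//=.
have h1 : ln r - ln (Num.max r0 (cnorm z)) <= (Num.max (ord (fun w => f w - b) z) 0)%:~R * nu r0 r z.
  have n0 : 0 <= nu r0 r z by rewrite nu_ge0// r00.
  have E : nu r0 r z = ln r - ln (Num.max r0 (cnorm z)) by rewrite /nu (max_idPl (ltW zr)).
  by rewrite -E ler_peMl// ler1z; lia.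
have h2 : 0 <= \sum_(a <- S | a != z) (Num.max (ord (fun w => f w - b) a) 0)%:~R * nu r0 r a.
  by apply: sumr_ge0 => a _; rewrite mulr_ge0 ?nu_ge0 ?r00// ler0z le_max lexx orbT.
lra.
Unshelve. all: by end_near. Qed.

End Windows.

(** * The main case: f(z+c) and f(z+2c) differ from f(z), and f(z+c) from A f(z) *)

Section MainCase.
Variable R : realType.
Local Notation C := (complex R).
Local Notation "x %:C" := (real_complex R x).
Implicit Types (z w a b : C) (r d s B T : R) (S bs : seq C).
Local Notation lp z := (logplus (cnorm z)).

Section Tau.
Variables (f : C -> C).
Hypothesis merof : meromorphic f.
Hypothesis mf : mer f.

(* The characteristic normalised at r0, so that it is exactly the mean of log+|f| plus NP. *)
Definition tau (r0 r : R) : R := fine (charT f r) - (Num.max (- ord f 0) 0)%:~R * ln r0.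

(** The averages converge, so [tau] is the least admissible T; this turns the conclusion of
    [second_main] into an inequality for the characteristic itself. *)
Lemma tauP r0 s S r L : adm r0 s S f L -> rad r0 s S r -> (forall a, a \in S -> a != 0 -> r0 < cnorm a) ->
  Tb r0 S f r (tau r0 r) /\ forall T, Tb r0 S f r T -> tau r0 r <= T.
Proof.
move=> af hr hS; have [_ cS _ _ _] := af; have rp := rad_gt0 hr.
have [mm [h1 h2] E] := charT_mlim merof mf cS hr hS.
have -> : tau r0 r = mm + NP r0 S r f by rewrite /tau E /=; ring.
split; first by apply: mb_leB h1 _; lra.
by move=> T hT; have := mb_opp rp hT h2; lra.
Qed.

Lemma tau_growth (q M r0 r X : R) : 0 < q -> 0 < r0 <= 1 -> 0 < r -> M <= r -> r <= 3 * X ->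
  (forall r, M <= r -> fine (charT f r) <= expR (expR (q * ln r))) ->
  tau r0 r <= (1 - (Num.max (- ord f 0) 0)%:~R * ln r0) * (1 + expR (expR (q * ln (3 * X)))).
Proof.
move=> q0 /andP[r00 r01] rp Mr rX hM; rewrite /tau.
have h1 : fine (charT f r) <= expR (expR (q * ln (3 * X))).
  apply: le_trans (hM _ Mr) _; rewrite !ler_expR ler_pM2l// ler_ln ?posrE//; lra.
set m := (Num.max _ _)%:~R; have m0 : 0 <= m :> R by rewrite ler0z le_max lexx orbT.
have l0 : ln r0 <= 0 by rewrite ln_le0.
have E0 := expR_ge0 (expR (q * ln (3 * X))).
have h2 : 0 <= - (m * ln r0) by rewrite -mulrN mulr_ge0// oppr_ge0.
have := mulr_ge0 h2 E0; lra.
Qed.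

End Tau.

(** Abstract in the size function [ta], which will be the characteristic of f here and the proximity
    function of a zero-free function later. *)
Lemma window_config r0 n (fam : nat -> C -> C) (L : nat -> R) bs (lam q G D : R) (ta : R -> R) :
  (forall bs (X K : R), 1 <= X -> 0 < K -> exists rho s S, grid r0 n fam L bs X K rho s S) ->
  0 < q < 1 -> 0 < lam -> 0 <= G -> 1 <= D ->
  (exists X1 : R, forall X rho s S, X1 <= X -> grid r0 n fam L bs X (lam * ln X) rho s S ->
    D <= ta rho /\ forall j : nat, rho + (j + 2)%:R * (lam * ln X) <= 3 * X ->
      ta (rho + j%:R * (lam * ln X)) <= G * (1 + expR (expR (q * ln (3 * X))))) ->
  exists X K r s S, [/\ K = lam * ln X, 1 <= ln X, env r0 n fam L s S &
   [/\ forall a, a \in S -> a != 0 -> r0 < cnorm a, D <= ta r,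
     forall i, (i <= 4)%N -> ta (r + i%:R * K) <= 2 * ta r &
     forall i, (i <= 4)%N -> [/\ step X K (r + i%:R * K), rad r0 s S (r + i%:R * K) &
     forall b, b \in bs -> forall a, a \in S -> cnorm (a - b) != r + i%:R * K]]].
Proof.
move=> hE q01 lam0 G0 D1 [X1 hX1]; have [X0 hX0] := window_exists q01 lam0 G0.
pose X := Num.max X0 (Num.max X1 1).
have [XX0 XX1 X1'] : [/\ X0 <= X, X1 <= X & 1 <= X] by rewrite /X !le_max !lexx !orbT.
have [Xe hwin] := hX0 X XX0; move: X XX0 XX1 X1' Xe hwin => X XX0 XX1 X1' Xe hwin {hX0}.
have lX : 1 <= ln X by rewrite -[1]expRK ler_ln ?posrE ?expR_gt0//; apply: lt_le_trans Xe; exact: expR_gt0.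
pose K := lam * ln X; have K0 : 0 < K by apply: mulr_gt0 => //; exact: lt_le_trans lX.
have [rho [s [S hgrid]]] := hE bs X K X1' K0.
have [Dr hT] := hX1 X rho s S XX1 hgrid; have [hadm rX hS0 hg] := hgrid.
have [j [jX jr jT]] := hwin rho ta rX (le_trans D1 Dr) hT.
rewrite -/K in jX jr jT; have [rX1 _] := andP rX.
exists X, K, (rho + j%:R * K), s, S; split=> //.
have ri i : rho + j%:R * K + i%:R * K = rho + (j + i)%:R * K by rewrite natrD mulrDl addrA.
have iX i : (i <= 6)%N -> rho + (j + i)%:R * K <= 3 * X.
  by move=> i6; apply: le_trans jX; rewrite lerD2l ler_wpM2r ?(ltW K0)// ler_nat leq_add2l.
split=> //; first exact: le_trans Dr jr.
  by move=> i i4; rewrite ri; exact: jT.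
move=> i i4; have i6 : (i <= 6)%N by exact: leq_trans i4 _.
rewrite ri; have [hr hb] := hg _ (iX i i6); split=> //; split=> //.
  apply: le_trans (ltW rX1) _; rewrite lerDl mulr_ge0// ltW//.
have i26 : (i + 2 <= 6)%N by rewrite -[6%N]/(4 + 2)%N leq_add2r.
by have := iX _ i26; rewrite addnA [(j + i + 2)%:R]natrD mulrDl addrA.
Qed.

Variables (f : C -> C) (c A : C) (q M : R).
Hypothesis merof : meromorphic f.
Hypothesis nc : nonconstant f.
Hypothesis q01 : 0 < q < 1.
Hypothesis growth : forall r, M <= r -> fine (charT f r) <= expR (expR (q * ln r)).
Hypothesis c0 : c != 0.
Hypothesis A0 : A != 0.
Hypothesis H0 : forall z, ord f z <= ord f (z + c).
Hypothesis H1 : forall z, 0 < ord (fun w => f w - 1) z -> 0 < ord (fun w => f w - A) (z + c).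
Hypothesis N1 : mer (fun w => f (w + c) - f w).
Hypothesis N2 : mer (fun w => f (w + c) - A * f w).
Hypothesis N3 : mer (fun w => f (w + 2%:R * c) - f w).

Let mf : mer f. Proof. exact: nonconstant_mer0. Qed.
Let mfa a : mer (fun w => f w - a). Proof. exact: nonconstant_mer. Qed.

Definition bk i w := f (w + - (i%:R * c)).
Definition quo i w := f w / bk i w.
(** For i > 0 it vanishes identically exactly when f(z+c) = A f(z), which is why that case is set
    apart. *)
Definition qdev i w := quo i w - A * quo i.-1 w.

Lemma mer_bk i : mer (bk i). Proof. exact: mer_shift. Qed.
Lemma mer_quo i : mer (quo i). Proof. by apply: merf => //; exact: mer_bk. Qed.

Lemma ord_bk i z : ord (bk i) z = ord f (z - i%:R * c). Proof. exact: ord_shift. Qed.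

Lemma ord_bk_le i z : ord (bk i) z <= ord f z.
Proof.
rewrite ord_bk; elim: i => [|i IH]; first by rewrite mul0r subr0.
apply: le_trans IH; have := H0 (z - i.+1%:R * c).
by rewrite (_ : _ + c = z - i%:R * c)// -natr1; ring.
Qed.

Lemma ord_quo i z : ord (quo i) z = ord f z - ord (bk i) z.
Proof. by apply: ordf => //; exact: mer_bk. Qed.

Lemma ord_quo_ge0 i z : 0 <= ord (quo i) z.
Proof. by rewrite ord_quo subr_ge0 ord_bk_le. Qed.

Let near_f z : \forall w \near pn z, f w != 0. Proof. exact: mer_neq0. Qed.
Let near_bk i z : \forall w \near pn z, bk i w != 0. Proof. by apply: mer_neq0; exact: mer_bk. Qed.

Lemma mer_quoB i j : mer (fun w => bk j w - bk i w) -> mer (fun w => quo i w - quo j w).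
Proof.
move=> mb'; apply: (@mer_aeq _ (fun w => f w * (bk j w - bk i w) / (bk i w * bk j w))).
  move=> z; apply: filterS2 (near_bk i z) (near_bk j z) => w i0 j0.
  by rewrite /quo; field; rewrite ?i0 ?j0.
by apply: merf; apply: merM => //; exact: mer_bk.
Qed.

Lemma mer_bk_step i : mer (fun w => bk i w - bk i.+1 w).
Proof.
apply: mer_aeq (mer_shift (- (i.+1%:R * c)) N1) => z; near=> w.
by rewrite /bk; congr (f _ - f _); rewrite -natr1; ring.
Unshelve. all: by end_near. Qed.

Lemma mer_bk_step2 i : mer (fun w => bk i w - bk i.+2 w).
Proof.
apply: mer_aeq (mer_shift (- (i.+2%:R * c)) N3) => z; near=> w.
by rewrite /bk; congr (f _ - f _); rewrite -natr1 -(natr1 i); ring.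
Unshelve. all: by end_near. Qed.

Lemma mer_bk_stepA i : mer (fun w => bk i w - A * bk i.+1 w).
Proof.
apply: mer_aeq (mer_shift (- (i.+1%:R * c)) N2) => z; near=> w.
by rewrite /bk; congr (f _ - A * f _); rewrite -natr1; ring.
Unshelve. all: by end_near. Qed.

Lemma mer_bk1 i a : mer (fun w => bk i w - a).
Proof. exact: mer_shift (mfa a). Qed.

Lemma aeq_fquo i : aeq (fun w => quo i w * (bk i w - 1)) (fun w => f w - quo i w).
Proof. by move=> z; apply: filterS (near_bk i z) => w i0; rewrite /quo; field. Qed.

Lemma mer_fquo i : mer (fun w => f w - quo i w).
Proof. by apply: mer_aeq (@aeq_fquo i) _; apply: merM; [exact: mer_quo|exact: mer_bk1]. Qed.

Lemma aeq_qdev i : aeq (fun w => quo i.+1 w * ((bk i w - A * bk i.+1 w) / bk i w)) (qdev i.+1).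
Proof.
move=> z; apply: filterS2 (near_bk i z) (near_bk i.+1 z) => w i0 j0.
by rewrite /qdev /quo /=; field; rewrite i0.
Qed.

Lemma mer_qdev i : mer (qdev i.+1).
Proof.
apply: mer_aeq (@aeq_qdev i) _; apply: merM; first exact: mer_quo.
by apply: merf; [exact: mer_bk_stepA|exact: mer_bk].
Qed.

Lemma ord_qdev_ge0 i z : 0 <= ord (qdev i.+1) z.
Proof.
have mA := mer_cst A0; have mAq : mer (fun w => A * quo i w) by apply: merM => //; exact: mer_quo.
apply: (ordB_ge (mer_quo i.+1) mAq (mer_qdev i)); first exact: ord_quo_ge0.
by rewrite ordM ?ord_cst ?add0r ?ord_quo_ge0//; exact: mer_quo.
Qed.

Lemma ord_sub_cst g a z : mer g -> a != 0 -> 0 < ord (fun w => g w - a) z -> ord g z = 0.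
Proof.
move=> mg a0 h; have ma := mer_cst a0; have oa := ord_cst z a0.
have [p|p|//] := ltgtP (ord g z) 0.
  by move: h; rewrite (ordB_lt mg ma) ?oa//; lia.
have na : - a != 0 by rewrite oppr_eq0.
have lt : ord (fun=> - a) z < ord g z by rewrite ord_cst.
move: h; rewrite (_ : (fun w => g w - a) = (fun w => - a + g w)); last by apply/funext => w; exact: addrC.
by rewrite (ordD_lt (mer_cst na) mg lt) ord_cst.
Qed.

(** With n = i + 1: where K_n is not zero, f - K_n = K_n (f(z - nc) - 1) vanishes only at 1-points
    of f(z - nc). There f(z - (n-1)c) takes the value A, so both translates have order 0 and the
    numerator f(z - (n-1)c) - A f(z - nc) of [qdev] vanishes. *)
Lemma fquo_zero i a : 0 < ord (fun w => f w - quo i.+1 w) a -> 0 < ord (quo i.+1) a \/ 0 < ord (qdev i.+1) a.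
Proof.
have mb1 := @mer_bk1 i.+1 1; have mq := mer_quo i.+1.
have m1 : mer (fun w => quo i.+1 w * (bk i.+1 w - 1)) by exact: merM.
rewrite (ord_aeq a (@aeq_fquo i.+1) m1) ordM// => h.
have := ord_quo_ge0 i.+1 a; rewrite le_eqVlt => /predU1P[q0|]; last by left.
right; rewrite -q0 add0r in h.
have o1 : ord (bk i.+1) a = 0 := ord_sub_cst (mer_bk _) (oner_neq0 _) h.
have h1 : 0 < ord (fun w => bk i w - A) a.
  have := @ord_shift R (fun w => f w - 1) (- (i.+1%:R * c)) a (mfa 1).
  have := @ord_shift R (fun w => f w - A) (- (i%:R * c)) a (mfa A).
  move=> -> E; rewrite E in h; have := H1 h.
  by rewrite (_ : a - i.+1%:R * c + c = a - i%:R * c)// -natr1; ring.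
have o0 := ord_sub_cst (mer_bk i) A0 h1.
have mA := mer_cst A0.
have mbA := @mer_bk1 i A.
have mAb : mer (fun w => A * (bk i.+1 w - 1)) by exact: merM.
have E : (fun w => (bk i w - A) - A * (bk i.+1 w - 1)) = (fun w => bk i w - A * bk i.+1 w).
  by apply/funext => w; ring.
have h2 : 1 <= ord (fun w => bk i w - A * bk i.+1 w) a.
  rewrite -E; apply: (ordB_ge mbA mAb); first by rewrite E; exact: mer_bk_stepA.
    by lia.
  by rewrite ordM// ord_cst//; lia.
have mst := mer_bk_stepA i; have mbi := mer_bk i.
have mq2 : mer (fun w => (bk i w - A * bk i.+1 w) / bk i w) by exact: merf.
have m2 : mer (fun w => quo i.+1 w * ((bk i w - A * bk i.+1 w) / bk i w)) by exact: merM.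
rewrite (ord_aeq a (@aeq_qdev i) m2) ordM// ordf// o0 -q0; lia.
Qed.

(** ln |f / f(z - nc)| is, up to sign, the logarithmic difference for the shift -nc, so [ldl_shift]
    covers its positive part. *)
Lemma mb_quo r0 s S X K r T Lf Lb i (eps : R) : adm r0 s S f Lf -> adm r0 s S (bk i.+1) Lb -> step X K r ->
  rad r0 s S r -> rad r0 s S (r + K) -> rad r0 s S (r + 2 * K) ->
  2 * (i.+1%:R * cnorm c) <= K -> ((2 * 10 ^+ 3) * (i.+1%:R * cnorm c) + (3 * 10 ^+ 3)) * ln X <= eps * K ->
  (forall a, a \in S -> cnorm (a - - (i.+1%:R * c)) != r) ->
  Tb r0 S f (r + K) T -> Tb r0 S f (r + 2 * K) T ->
  mb r (fun w => lp (quo i.+1 w)) (eps * (T + `|Lf|)).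
Proof.
move=> af ab hst hr hr1 hr2 cK cX hS hT1 hT2; have rp := rad_gt0 hr.
have nb : cnorm (- (i.+1%:R * c)) = i.+1%:R * cnorm c by rewrite cnormN cnormM cnormn.
have nb0 : 0 < cnorm (- (i.+1%:R * c)) by rewrite nb mulr_gt0// cnorm_gt0.
rewrite -nb in cK cX; have := ldl_shift af hst hr hr1 hr2 nb0 cK cX hS hT1 hT2.
apply: mb_le => // w wr; have f0 := rad_neq0 af hr wr; have b0 := rad_neq0 ab hr wr.
rewrite /quo /logplus ln_cnormM ?invr_eq0// ln_cnormV// ge_max normr_ge0 /= -/(bk i.+1 w).
by rewrite distrC ler_norm.
Qed.

Lemma maxD_ge0 (x y : int) : 0 <= Num.max x 0 + Num.max y 0.
Proof. lia. Qed.

Lemma maxD_ge1 (x y : int) : 0 < x \/ 0 < y -> 1 <= Num.max x 0 + Num.max y 0.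
Proof. lia. Qed.

(** [W] counts zeros of K_n and of K_n - A K_(n-1) for n = 1, 2, 3. These functions have no poles,
    so Jensen's formula bounds the counts by means of log+, hence by a multiple of eps (T + B) plus
    a constant. *)
Lemma main_radius r0 s S X K (eps r T B : R) (L : nat -> R) :
  let fam := nth (fun=> 0) [:: f; quo 1; quo 2; quo 3; bk 1; bk 2; bk 3; qdev 1; qdev 2; qdev 3] in
  (forall i, (i < 10)%N -> adm r0 s S (fam i) (L i) /\ `|L i| <= B) ->
  0 <= eps <= 1 -> (forall j, (j <= 2)%N -> step X K (r + j%:R * K)) ->
  (forall j, (j <= 4)%N -> rad r0 s S (r + j%:R * K)) ->
  ((6 * 10 ^+ 3) * cnorm c + (3 * 10 ^+ 3)) * ln X <= eps * K -> 6 * cnorm c <= K ->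
  (forall j i a, (j <= 2)%N -> (i < 3)%N -> a \in S -> cnorm (a - - (i.+1%:R * c)) != r + j%:R * K) ->
  (forall j, (j <= 4)%N -> Tb r0 S f (r + j%:R * K) T) ->
  (forall j i, (j <= 2)%N -> (i < 3)%N -> mb (r + j%:R * K) (fun w => lp (quo i.+1 w)) (eps * (T + B))) /\
  exists2 W : C -> int,
  (forall a, [/\ 0 <= W a, 0 < ord (fun w => f w - quo 1 w) a -> 1 <= W a, 0 < ord (fun w => f w - quo 2 w) a -> 1 <= W a &
     0 < ord (fun w => f w - quo 3 w) a -> 1 <= W a]) &
  \sum_(a <- S) (W a)%:~R * nu r0 r a <= 9 * (eps * (T + B)) + 6 * B + 3 * lp A + 6.
Proof.
move=> fam hadm /andP[e0 e1] hst hrad hX hK hS hT.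
have af : adm r0 s S f (L 0%N) by have [] := hadm 0%N isT.
have Lf : `|L 0%N| <= B by have [] := hadm 0%N isT.
have ab i : (i < 3)%N -> exists l, adm r0 s S (bk i.+1) l.
  by case: i => [|[|[|//]]] _; [exists (L 4%N); have [] := hadm 4%N isT|
    exists (L 5%N); have [] := hadm 5%N isT|exists (L 6%N); have [] := hadm 6%N isT].
have c1 := cnorm_ge0 c.
have X1 : expR 1 <= X by have [] := hst 0%N isT.
have lX : 1 <= ln X by rewrite -[1]expRK ler_ln ?posrE ?expR_gt0//; apply: lt_le_trans X1; exact: expR_gt0.
have hk j i : (j <= 2)%N -> (i < 3)%N -> mb (r + j%:R * K) (fun w => lp (quo i.+1 w)) (eps * (T + B)).
  move=> j2 i3; have [l al] := ab i i3.
  have j3 : (j.+1 <= 4)%N by exact: leq_ltn_trans j2 _.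
  have j4 : (j.+2 <= 4)%N by rewrite !ltnS.
  have i3' : i.+1%:R <= 3 :> R by rewrite ler_nat.
  have ic : i.+1%:R * cnorm c <= 3 * cnorm c by rewrite ler_wpM2r.
  have E1 : r + j%:R * K + K = r + j.+1%:R * K by rewrite -natr1; ring.
  have E2 : r + j%:R * K + 2 * K = r + j.+2%:R * K by rewrite -addn2 natrD; ring.
  apply: mb_leB (@mb_quo r0 s S X K _ T (L 0%N) l i eps af al (hst j j2) _ _ _ _ _ _ _ _) _.
  - by apply: hrad; exact: leq_trans j2 _.
  - by rewrite E1; apply: hrad.
  - by rewrite E2; apply: hrad.
  - by lra.
  - apply: le_trans hX; rewrite ler_wpM2r//; lra.
  - by move=> a aS; exact: hS.
  - by rewrite E1; apply: hT.
  - by rewrite E2; apply: hT.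
  - by rewrite ler_wpM2l// lerD2l.
split=> //; set k' := eps * (T + B) in hk *.
have E0 : r + 0%:R * K = r by ring.
have hr : rad r0 s S r by have := hrad 0%N isT; rewrite E0.
have rp := rad_gt0 hr.
have hkr i : (i < 3)%N -> mb r (fun w => lp (quo i.+1 w)) k' by move=> i3; rewrite -{1}E0; exact: hk.
have k0 : 0 <= k' by apply: (mb_ge0 rp _ (hkr 0%N isT)) => w _; exact: lp_ge0.
have hq0 : mb r (fun w => lp (quo 0 w)) k'.
  apply: mb_le (mb_cst r k') => // w wr; have f0 := rad_neq0 af hr wr.
  by rewrite /quo /bk mul0r subr0 divff// lp1.
have hq i : (i < 3)%N -> mb r (fun w => lp (quo i w)) k'.
  by case: i => [//|i] i3; apply: hkr; exact: ltnW i3.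
pose W a : int := \sum_(i < 3) (Num.max (ord (quo i.+1) a) 0 + Num.max (ord (qdev i.+1) a) 0).
have Wi a (i : 'I_3) : 0 < ord (fun w => f w - quo i.+1 w) a -> 1 <= W a.
  move=> h; rewrite /W (bigD1 i)//=.
  rewrite ler_wpDr ?maxD_ge1//; last exact: fquo_zero h.
  by apply: sumr_ge0 => ? _; exact: maxD_ge0.
exists W.
  move=> a; split; [by apply: sumr_ge0 => ? _; exact: maxD_ge0|exact: (Wi a ord0)|exact: (Wi a (@Ordinal 3 1 isT))|exact: (Wi a (@Ordinal 3 2 isT))].
have aq i : (i < 3)%N -> exists2 l, adm r0 s S (quo i.+1) l & `|l| <= B.
  by case: i => [|[|[|//]]] _; [exists (L 1%N); have [] := hadm 1%N isT|
    exists (L 2%N); have [] := hadm 2%N isT|exists (L 3%N); have [] := hadm 3%N isT].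
have ad i : (i < 3)%N -> exists2 l, adm r0 s S (qdev i.+1) l & `|l| <= B.
  by case: i => [|[|[|//]]] _; [exists (L 7%N); have [] := hadm 7%N isT|
    exists (L 8%N); have [] := hadm 8%N isT|exists (L 9%N); have [] := hadm 9%N isT].
have -> : \sum_(a <- S) (W a)%:~R * nu r0 r a = \sum_(i < 3) (NZ r0 S r (quo i.+1) + NZ r0 S r (qdev i.+1)).
  rewrite /NZ; under [RHS]eq_bigr do rewrite -big_split /=.
  rewrite exchange_big /=; apply: eq_bigr => a _.
  rewrite /W rmorph_sum /= mulr_suml; apply: eq_bigr => i _.
  by rewrite rmorphD /= mulrDl.
apply: le_trans (_ : \sum_(i < 3) (3 * k' + 2 * B + lp A + 2) <= _); last first.
  by rewrite sumr_const card_ord -mulr_natl; lra.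
apply: ler_sum => i _; have i3 := ltn_ord i.
have [l1 a1] := aq i i3; have [l2 a2] := ad i i3; rewrite !ler_norml => /andP[? ?] /andP[? ?].
have z1 := NZ_entire a1 hr (ord_quo_ge0 i.+1) (hkr i i3).
have hA : mb r (fun=> lp A) (lp A) by exact: mb_cst.
have hd : mb r (fun w => lp (qdev i.+1 w)) (k' + (lp A + k') + 2).
  exact: (mb_lpB rp (hkr i i3) (mb_lpM rp hA (hq i i3))).
by have z2 := NZ_entire a2 hr (ord_qdev_ge0 i) hd; lra.
Qed.


(** Makes K = lam ln X large enough for eps = 1/1000 in [ldl_shift] with the largest shift 3c: 6000
    is 3 times the 2000 found there. *)
Definition lamc (x : R) : R := 10 ^+ 3 * ((6 * 10 ^+ 3) * x + (3 * 10 ^+ 3)).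

Lemma lam_gt0 (x : R) : 0 <= x -> 0 < lamc x.
Proof. rewrite /lamc; lra. Qed.

Lemma D_ge1 (x y z : R) : 0 <= x -> 0 <= y -> 0 <= z -> 1 <= 10 ^+ 3 * (1 + x + y + z).
Proof. lra. Qed.

Lemma lam_small (x y K : R) : 0 <= x -> 1 <= y -> K = lamc x * y ->
  [/\ ((6 * 10 ^+ 3) * x + (3 * 10 ^+ 3)) * y <= (10 ^+ 3)^-1 * K, (3 * 10 ^+ 3) * y <= (10 ^+ 3)^-1 * K & 6 * x <= K].
Proof. by move=> x0 y1 ->; have p := mulr_ge0 x0 (le_trans ler01 y1); rewrite /lamc; split; nra. Qed.

Lemma eps01 : 0 <= ((10 ^+ 3)^-1 : R) <= 1.
Proof. lra. Qed.

Lemma radius_bounds (X D B lb l m ta z rho : R) : expR (D + (m + lb + 2 + B)) <= X -> z <= X -> X < rho ->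
  `|l| <= B -> ln rho - m <= ta + lb + 2 - l -> z < rho /\ D <= ta.
Proof.
move=> XD zX Xr; rewrite ler_norml => /andP[l1 l2] h; split; first lra.
have : D + (m + lb + 2 + B) <= ln rho by rewrite -ler_expR lnK ?posrE//; have := expR_gt0 (D + (m + lb + 2 + B)); lra.
by lra.
Qed.

Lemma grid_bounds (X lam rho m : R) (j : nat) : 1 <= X -> 0 < lam -> X < rho -> m <= X ->
  rho + (j + 2)%:R * (lam * ln X) <= 3 * X ->
  [/\ 0 < rho + j%:R * (lam * ln X), m <= rho + j%:R * (lam * ln X) & rho + j%:R * (lam * ln X) <= 3 * X].
Proof.
move=> X1 l0 Xr mX; set K := lam * ln X; have K0 : 0 <= K by rewrite mulr_ge0 ?ln_ge0// ltW.
have jK : 0 <= j%:R * K by rewrite mulr_ge0.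
by rewrite natrD [(_ + _) * K]mulrDl => jX; split; lra.
Qed.

Lemma rho_le (X rho : R) : 1 <= X -> X < rho < X + 1 -> rho <= 3 * X.
Proof. by move=> X1 /andP[h1 h2]; lra. Qed.

Lemma expR1_ge1 : 1 <= expR 1 :> R.
Proof. by have := expR_ge1Dx (1 : R); lra. Qed.

(** On a doubling window T = 2 t, and the coefficient of t on the right is then (8 + 98) / 1000; D
    makes t large enough to absorb the additive constants. *)
Lemma main_arith (eps T t k n B lA a0 D : R) : eps = (10 ^+ 3)^-1 -> T = 2 * t -> k = eps * (T + B) -> 0 <= B -> 0 <= lA -> 0 <= a0 ->
  n = 9 * k + 6 * B + 3 * lA + 6 -> D = (10 ^+ 3) * (1 + B + lA + a0) -> D <= t ->
  t <= 4 * eps * T + n + 40 * k + 100 + 20 * B + a0 -> False.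
Proof. by move=> -> -> -> B0 l0 a00 -> ->; lra. Qed.

Lemma main_false : False.
Proof.
have mq i := mer_quo i.
have mb32 : mer (fun w => bk 3 w - bk 2 w).
  by apply: mer_aeq (merN (mer_bk_step 2)) => v; near=> w; rewrite opprB.
have mE12 := mer_quoB (mer_bk_step 1); have mE23 := mer_quoB mb32; have mE31 := mer_quoB (mer_bk_step2 1).
have mD1 := mer_fquo 1; have mD2 := mer_fquo 2; have mD3 := mer_fquo 3.
pose phi := crossr f (quo 1) (quo 2) (quo 3).
have mphi : mer phi := mer_crossr mD1 mD2 mE23 mE31.
have mphi1 : mer (fun w => 1 + phi w) := mer_crossr1 mD2 mD3 mE12 mE31.
have mden := mer_crossr_den mD2 mE12 mE23 mE31.
have [ps [a0 [mps a00 hps]]] : exists (ps : C -> C) (a0 : R), [/\ mer ps, 0 <= a0 &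
    mer (cD phi) /\ ps = psi f (quo 1) (quo 2) (quo 3) \/ exists2 a, null (fun w => phi w - a) & lp a <= a0].
  have [m|n] := mf_dichotomy (mf_cD (mer_mf mphi)).
    exists (psi f (quo 1) (quo 2) (quo 3)), 0; split=> //; last by left.
    exact: (mer_psi mD1 mD2 mD3 mE12 mE23 mE31).
  (* When the cross ratio is constant [psi] degenerates, and the constant 1 merely fills its place
     in the family below. *)
  have [a na] := null_cD (mer_mf mphi) n; exists (fun=> 1), (lp a); split; last by right; exists a.
    exact: mer_cst (oner_neq0 _).
  exact: lp_ge0.
(* b is a value that f takes at a point of holomorphy, so f - b has a zero, from which [Tb_lower]
   gets the growth of the characteristic. *)
have [z1 hz1] := regular_point mf; pose b := f z1.
have oz1 : 0 < ord (fun w => f w - b) z1.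
  apply: ord_gt0 (mfa b) _ _; last by rewrite /b subrr.
  by apply: filterS hz1 => w cw; apply: cdiffB => //; exact: cdiff_cst.
(* All functions to which Jensen's formula is applied, so that one r0 and one grid of radii serve
   them together; the first ten are those of [main_radius]. *)
pose fam := nth (fun=> 0 : C) [:: f; quo 1; quo 2; quo 3; bk 1; bk 2; bk 3; qdev 1; qdev 2; qdev 3;
  (fun w => (f w - quo 2 w) * (quo 3 w - quo 1 w)); phi; (fun w => 1 + phi w); ps;
  (fun w => quo 2 w - quo 1 w); (fun w => quo 2 w - quo 3 w); (fun w => quo 3 w - quo 1 w);
  (fun w => f w - quo 2 w); crossr_den f (quo 1) (quo 2) (quo 3); (fun w => f w - b)].
have hm i : (i < 20)%N -> mer (fam i).
  by do 20?[case: i => [_|i]; rewrite /fam /=; [by [exact: mer_bk|exact: mer_qdev|exact: merM|idtac]|]].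
have [r0 [L [r01 hE]]] := env_exists hm.
pose B := \sum_(i < 20) `|L i|.
have LB i : (i < 20)%N -> `|L i| <= B.
  by move=> i20; rewrite /B (bigD1 (Ordinal i20))//= lerDl sumr_ge0.
have B0 : 0 <= B by exact: sumr_ge0.
have cn := cnorm_ge0 c; have lA := lp_ge0 A.
pose lam := lamc (cnorm c); have lam0 : 0 < lam by exact: lam_gt0.
pose G0 := 1 - (Num.max (- ord f 0) 0)%:~R * ln r0.
have G1 : 0 <= G0.
  rewrite /G0 subr_ge0; apply: le_trans ler01; rewrite mulr_ge0_le0 ?ler0z ?le_max ?lexx ?orbT// ln_le0//.
  by case/andP: r01.
pose D : R := 10 ^+ 3 * (1 + B + lp A + a0).
have D1 : 1 <= D by exact: D_ge1.
have m0f := mf.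
have htau s S r : env r0 20 fam L s S -> (forall a, a \in S -> a != 0 -> r0 < cnorm a) -> rad r0 s S r ->
  Tb r0 S f r (tau f r0 r) /\ forall T, Tb r0 S f r T -> tau f r0 r <= T.
  by move=> hadm hS0 hr; exact: (tauP merof m0f (hadm 0%N isT) hr hS0).
have [|X [K [r [s [S [KE lX hadm [hS0 Dr hT hg]]]]]]] :=
    @window_config r0 20 fam L [:: - (1%:R * c); - (2%:R * c); - (3%:R * c)] lam q G0 D (tau f r0) hE q01 lam0 G1 D1.
  pose Cl := ln (Num.max r0 (cnorm z1)) + lp b + 2 + B.
  exists (Num.max (expR (D + Cl)) (Num.max M (Num.max (cnorm z1) 1))) => X rho s S.
  rewrite !ge_max => /and4P[XD XM Xz X1] [hadm rX hS0 hg].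
  split.
    have r0X : rho + 0%:R * (lam * ln X) <= 3 * X by rewrite mul0r addr0; exact: rho_le rX.
    have [hr _] := hg 0%N r0X; rewrite mul0r addr0 in hr.
    have [hT _] := htau s S rho hadm hS0 hr.
    have zr : cnorm z1 < rho by apply: le_lt_trans Xz _; case/andP: rX.
    have hl := Tb_lower (hadm 0%N isT) (hadm 19%N isT) hr oz1 zr hT.
    by case: (andP rX) => Xr _; case: (radius_bounds XD Xz Xr (LB 19%N isT) hl).
  move=> j jX; case/andP: rX => Xr _; have [p1 p2 p3] := grid_bounds X1 lam0 Xr XM jX.
  by have [q0 q1] := andP q01; exact: (tau_growth q0 r01 p1 p2 p3 growth).
have [h6 h3 h2] := lam_small cn lX KE.
pose T := 2 * tau f r0 r; pose eps : R := (10 ^+ 3)^-1.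
have hTb i : (i <= 4)%N -> Tb r0 S f (r + i%:R * K) T.
  move=> i4; have [_ hr _] := hg i i4; have [h _] := htau s S _ hadm hS0 hr.
  by apply: Tb_leT h _; exact: hT.
have hst i : (i <= 2)%N -> step X K (r + i%:R * K).
  have i4 : (i <= 2)%N -> (i <= 4)%N by move=> i2; exact: leq_trans i2 _.
  by move=> /i4 i5; have [] := hg i i5.
have hrad i : (i <= 4)%N -> rad r0 s S (r + i%:R * K).
  by move=> i4; have [] := hg i i4.
have hav j i a : (j <= 2)%N -> (i < 3)%N -> a \in S -> cnorm (a - - (i.+1%:R * c)) != r + j%:R * K.
  move=> j2 i3 aS; have j4 : (j <= 4)%N by exact: leq_trans j2 _.
  have [_ _ h] := hg j j4.
  by apply: h => //; case: i i3 => [|[|[|//]]] _; rewrite !inE eqxx ?orbT.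
have hadm' i : (i < 10)%N -> adm r0 s S (nth (fun=> 0) [:: f; quo 1; quo 2; quo 3; bk 1; bk 2; bk 3; qdev 1; qdev 2; qdev 3] i) (L i) /\ `|L i| <= B.
  move=> i10; have i20 : (i < 20)%N by exact: leq_trans i10 _.
  split; last exact: LB.
  have := hadm i i20; rewrite /fam.
  by case: i i10 {i20} => [|[|[|[|[|[|[|[|[|[|i]]]]]]]]]].
have [hk [W hW hn]] := main_radius hadm' eps01 hst hrad h6 h2 hav hTb.
have R0 : r + 0%:R * K = r by rewrite mul0r addr0.
have R1 : r + 1%:R * K = r + K by rewrite mul1r.
have hr := hrad 0%N isT; have hr1 := hrad 1%N isT; have hr2 := hrad 2%N isT.
have hT1 := hTb 1%N isT; have hT2 := hTb 2%N isT; have hs := hst 0%N isT.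
rewrite R0 in hr hs; rewrite R1 in hr1 hT1.
have hkk (t : R) : t = r \/ t = r + K \/ t = r + 2 * K ->
    [/\ mb t (fun w => lp (quo 1 w)) (eps * (T + B)), mb t (fun w => lp (quo 2 w)) (eps * (T + B)) & mb t (fun w => lp (quo 3 w)) (eps * (T + B))].
  move=> [->|[->|->]]; [rewrite -R0|rewrite -R1|]; split.
  - exact: (hk 0%N 0%N).
  - exact: (hk 0%N 1%N).
  - exact: (hk 0%N 2%N).
  - exact: (hk 1%N 0%N).
  - exact: (hk 1%N 1%N).
  - exact: (hk 1%N 2%N).
  - exact: (hk 2%N 0%N).
  - exact: (hk 2%N 1%N).
  - exact: (hk 2%N 2%N).
have hps' : mer (cD phi) /\ adm r0 s S (psi f (quo 1) (quo 2) (quo 3)) (L 13%N) \/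
    exists2 a, null (fun w => phi w - a) & lp a <= a0.
  by case: hps => [[m E]|h]; [left; split=> //; rewrite -E; exact: (hadm 13%N isT)|right].
have bnds : [/\ `|L 10%N| <= B, `|L 11%N| <= B, `|L 12%N| <= B, `|L 13%N| <= B &
   [/\ `|L 14%N| <= B, `|L 15%N| <= B, `|L 16%N| <= B & `|L 18%N| <= B]] by split; [| | | |split]; exact: LB.
have := second_main mf (mq 1) (mq 2) (mq 3) (ord_quo_ge0 1) (ord_quo_ge0 2) (ord_quo_ge0 3) mD1 mD2 mD3 mE12 mE23 mE31
  (hadm 0%N isT) (hadm 10%N isT) (hadm 11%N isT) (hadm 12%N isT) hps' (hadm 14%N isT) (hadm 15%N isT) (hadm 16%N isT)
  (hadm 17%N isT) (hadm 18%N isT) bnds hs h3 eps01 a00 hr hr1 hr2 hT1 hT2 hkk hW hn.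
have [_ hmin] := htau s S r hadm hS0 hr.
by move=> /hmin; exact: (main_arith erefl erefl erefl B0 lA a00 erefl erefl Dr).
Unshelve. all: by end_near. Qed.

End MainCase.

(** * Functions without zeros and poles that satisfy E(z+c) E(z) = 1 *)

Section Inversion.
Variable R : realType.
Local Notation C := (complex R).
Local Notation "x %:C" := (real_complex R x).
Implicit Types (z w a b : C) (r d s B T : R) (S bs : seq C).
Local Notation lp z := (logplus (cnorm z)).
Local Notation lam c := (lamc (cnorm c)).

Lemma grid_sub r0 n n' (fam fam' : nat -> C -> C) (L : nat -> R) bs (X K rho s : R) S :
  (n' <= n)%N -> (forall i, (i < n')%N -> fam' i = fam i) ->
  grid r0 n fam L bs X K rho s S -> grid r0 n' fam' L bs X K rho s S.
Proof.
move=> nn hf [h1 h2 h3 h4]; split=> // i ni; rewrite hf//; apply: h1; exact: leq_trans nn.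
Qed.

Lemma inversion_arith (t t1 l x k : R) : 0 <= x -> lamc x <= k ->
  t1 <= 2 * t -> 0 <= l -> 1 + l <= t -> 2 * t <= 12 / k * x * (2 * (t1 + l)) -> False.
Proof.
rewrite /lamc => x0 hk ht l0 hl h; have k0 : 0 < k by lra.
have h1 : 12 / k * x <= 100^-1 by rewrite mulrAC ler_pdivrMr//; lra.
have h2 : 0 <= 2 * (2 * t + l) by lra.
have h3 : 12 / k * x * (2 * (t1 + l)) <= 12 / k * x * (2 * (2 * t + l)).
  have p : 0 <= 12 / k * x by rewrite mulr_ge0// divr_ge0// ltW.
  by apply: ler_wpM2l => //; lra.
have := ler_wpM2r h2 h1; lra.
Qed.

Lemma mean_coef (r K : R) : 0 < r -> 0 < K -> 12 * (r + K) / ((r + K) ^+ 2 - r ^+ 2) <= 12 / K.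
Proof.
move=> r0 K0; have -> : (r + K) ^+ 2 - r ^+ 2 = K * (2 * r + K) by ring.
have q : 0 < 2 * r + K by lra.
have -> : 12 * (r + K) / (K * (2 * r + K)) = 12 / K * ((r + K) / (2 * r + K)) by field; lra.
by rewrite ler_piMr ?divr_ge0 ?(ltW K0)// ler_pdivrMr//; lra.
Qed.

Lemma double_le (x y : R) : x <= 2^-1 * y -> 2 * x <= y.
Proof. lra. Qed.

Lemma sub_double (x y : R) : x + y = 0 -> x - y = 2 * - y.
Proof. lra. Qed.

Lemma shift_le (r x k : R) : 0 <= x -> 6 * x <= k -> r + 2 * x <= r + k.
Proof. lra. Qed.

(** Since E(w+c) E(w) = 1, the logarithmic difference is -2 ln |E(w)|, so the mean of log+ |E| is at
    most half the mean logarithmic difference. Without zeros and poles this is a small multiple of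
    the characteristic on the next circle, impossible on a doubling window unless E is constant. The
    growth bound is asked for on grids adapted to [fam0], the functions needed to prove it. *)
Lemma inversion_const (E : C -> C) (c : C) (q : R) n0 (fam0 : nat -> C -> C) : c != 0 -> 0 < q < 1 -> mer E ->
  (forall z, ord E z = 0) -> aeq (fun w => E (w + c) * E w) (fun=> 1) ->
  (forall i, (i < n0)%N -> mer (fam0 i)) ->
  (forall r0 (L : nat -> R), 0 < r0 <= 1 -> exists G : R, 0 <= G /\ exists X1 : R, forall X rho s S, X1 <= X ->
     grid r0 n0 fam0 L [:: c] X (lam c * ln X) rho s S -> forall j : nat, rho + (j + 2)%:R * (lam c * ln X) <= 3 * X ->
     mb (rho + j%:R * (lam c * ln X)) (fun w => lp (E w)) (G * (1 + expR (expR (q * ln (3 * X)))))) ->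
  exists a, null (fun w => E w - a).
Proof.
move=> c0 q01 mE oE Einv mfam0 hgr; apply: contrapT => nnull.
have mEa a : mer (fun w => E w - a).
  by apply: mf_mer; [exact: mfB (mer_mf mE) (mf_cst _)|move=> na; apply: nnull; exists a].
have [z1 hz1] := regular_point mE; pose b := E z1.
have oz1 : 0 < ord (fun w => E w - b) z1.
  apply: ord_gt0 (mEa b) _ _; last by rewrite /b subrr.
  by apply: filterS hz1 => w cw; apply: cdiffB => //; exact: cdiff_cst.
pose ext := nth (fun=> 0 : C) [:: E; (fun w => E (w + c)); (fun w => E w - b)].
pose fam i := if (i < n0)%N then fam0 i else ext (i - n0)%N.
pose n := (n0 + 3)%N.
have fe i : fam (n0 + i)%N = ext i by rewrite /fam ltnNge leq_addr /= addKn.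
have hm i : (i < n)%N -> mer (fam i).
  rewrite /fam /n; have [h|h1] := ltnP i n0; first by move=> _; exact: mfam0.
  move=> h2; rewrite /ext.
  have : (i - n0 < 3)%N by rewrite ltn_subLR.
  case: (i - n0)%N => [|[|[|//]]] _ //=; exact: mer_shift.
have [r0 [L [r01 hE]]] := env_exists hm.
have [G [G0 [X1 hX1]]] := hgr r0 L r01.
have cn := cnorm_ge0 c; have lam0 := lam_gt0 cn.
have nlt i : (i < 3)%N -> (n0 + i < n)%N by rewrite /n ltn_add2l.
(* With neither zeros nor poles, the proximity function is the whole characteristic. *)
pose ta r := fine (proximity E r).
have adE s S : env r0 n fam L s S -> adm r0 s S E (L n0).
  by move=> /(_ _ (nlt 0%N isT)); rewrite fe addn0.
have htau s S r : env r0 n fam L s S -> rad r0 s S r -> Tb r0 S E r (ta r) /\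
    forall T, mb r (fun w => lp (E w)) T -> ta r <= T.
  move=> hadm hr; have aE := adE s S hadm; have rp := rad_gt0 hr; have [_ _ rs gr] := hr; have [_ cS _ _ _] := aE.
  have hc w : cnorm w = r -> cdiff E w by move=> wr; have [] := captured cS gr wr rs.
  have [m pE [h1 h2]] := proximity_mlim rp hc; rewrite /ta pE /=; split.
    by apply: Tb_entire => // a; rewrite oE.
  by move=> T hT; have := mb_opp rp hT h2; rewrite opprK.
have aEb s S : env r0 n fam L s S -> adm r0 s S (fun w => E w - b) (L (n0 + 2)%N).
  by move=> /(_ _ (nlt 2%N isT)); rewrite fe.
have aEc s S : env r0 n fam L s S -> adm r0 s S (fun w => E (w + c)) (L (n0 + 1)%N).
  by move=> /(_ _ (nlt 1%N isT)); rewrite fe.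
pose D := 1 + `|L n0|; have D1 : 1 <= D by rewrite /D lerDl.
have [|X [K [r [s [S [KE lX hadm [hS0 Dr hT hg]]]]]]] :=
    @window_config R r0 n fam L [:: c] (lam c) q G D ta hE q01 lam0 G0 D1.
  pose B := `|L (n0 + 2)%N|; pose Cl := ln (Num.max r0 (cnorm z1)) + lp b + 2 + B.
  exists (Num.max (expR (D + Cl)) (Num.max X1 (Num.max (cnorm z1) 1))) => X rho s S.
  rewrite !ge_max => /and4P[XD XX1 Xz X1'] hgrid; have [hadm rX hS0 hg] := hgrid.
  split.
    have r0X : rho + 0%:R * (lam c * ln X) <= 3 * X by rewrite mul0r addr0; exact: rho_le rX.
    have [hr _] := hg 0%N r0X; rewrite mul0r addr0 in hr.
    have [hT _] := htau s S rho hadm hr.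
    have zr : cnorm z1 < rho by apply: le_lt_trans Xz _; case/andP: rX.
    have hl := Tb_lower (adE s S hadm) (aEb s S hadm) hr oz1 zr hT.
    by case: (andP rX) => Xr _; case: (radius_bounds XD Xz Xr (lexx _) hl).
  move=> j jX; case/andP: (rX) => Xr _; have [p1 _ p3] := grid_bounds X1' lam0 Xr X1' jX.
  have [hr _] := hg j p3; have [_ h] := htau s S _ hadm hr; apply: h.
  apply: (hX1 X rho s S XX1 _ j jX); apply: grid_sub hgrid; first by rewrite /n leq_addr.
  by move=> i ni; rewrite /fam ni.
have [[Xe K0 Xr rK] hr _] := hg 0%N isT; have [_ hr1 _] := hg 1%N isT.
have [_ _ h2] := lam_small cn lX KE.
have hT1 := hT 1%N isT; have [_ _ hS] := hg 0%N isT.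
rewrite mul0r addr0 in hr Xr hS; rewrite mul1r in hr1 hT1.
have aE := adE s S hadm; have aC := aEc s S hadm.
have [hT0 hmin] := htau s S r hadm hr; have [hTT _] := htau s S _ hadm hr1.
have [_ cS _ _ _] := aE; have [_ cSc _ _ _] := aC; have [r00 r0r rs gr] := hr; have [_ _ r1s gr1] := hr1.
have rp := rad_gt0 hr.
have r1 : 1 <= r by apply: le_trans Xr; apply: le_trans Xe; exact: expR1_ge1.
have cp : 0 < cnorm c by rewrite cnorm_gt0.
have rc : r + 2 * cnorm c <= r + K by exact: shift_le cn h2.
have hav a : a \in S -> cnorm (a - c) != r by apply: hS; rewrite mem_seq1.
have := mean_log_diff mE cS r1 cp rc r1s gr gr1 hav (Tb_abs aE hr1 hTT).
rewrite [X in _ + X]big1 => [|a _]; last by rewrite oE mulr0z normr0 mul0r.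
rewrite addr0 => hM.
have hB : 0 <= 2 * (ta (r + K) + `|L n0|).
  by apply: mulr_ge0 (ler0n R 2) _; apply: addr_ge0 (Tb_ge0 hr1 hTT) _; exact: normr_ge0.
have := hmin (2^-1 * (12 / K * cnorm c * (2 * (ta (r + K) + `|L n0|)))).
have lK : lam c <= K by rewrite KE ler_peMr// ltW.
move=> /(_ _) h; apply: (@inversion_arith (ta r) (ta (r + K)) `|L n0| (cnorm c) K) => //.
suff : ta r <= 2^-1 * (12 / K * cnorm c * (2 * (ta (r + K) + `|L n0|))) by exact: double_le.
apply: h; have h20 : 0 <= 2^-1 :> R by rewrite invr_ge0.
apply: mb_leB (mb_le rp _ (mbZ h20 hM)) _.
  move=> w wr; have [cE E0] := captured cS gr wr rs; have [cEc Ec0] := captured cSc gr wr rs.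
  have E1 : E (w + c) * E w = 1.
    by apply: (@ccont_val _ (fun w => E (w + c) * E w) (fun=> 1)); [exact: cdiffM|exact: cdiff_cst|exact: Einv].
  have : ln (cnorm (E (w + c) * E w)) = 0 by rewrite E1 cnorm1 ln1.
  rewrite ln_cnormM// => l1.
  have -> : ln (cnorm (E (w + c))) - ln (cnorm (E w)) = 2 * (- ln (cnorm (E w))) by exact: sub_double.
  rewrite normrM normrN ger0_norm// mulKf// /logplus ge_max normr_ge0 /=.
  exact: ler_norm.
rewrite ler_wpM2l// ler_wpM2r//.
have := mean_coef rp K0 => hc; rewrite mulrAC ler_wpM2r// ltW//.
Qed.


Lemma coef_le (x y k : R) : 0 <= x -> 1 <= y -> 0 <= k -> ((6 * 10 ^+ 3) * x + (3 * 10 ^+ 3)) * y <= (10 ^+ 3)^-1 * k ->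
  ((2 * 10 ^+ 3) * x + (3 * 10 ^+ 3)) * y <= 1 * k.
Proof. by move=> x0 y1 k0 h; have := mulr_ge0 x0 (le_trans ler01 y1); lra. Qed.

Lemma cayley_arith (g e l l' p p' : R) : 1 <= e -> - l <= l' -> 0 <= l' -> 0 <= p -> 0 <= p' ->
  0 + (g * e - p) + 2 + (0 + (g * e - p) + 2) - l + p - p' <= (2 * g + 4 + l') * e.
Proof. by move=> e1 ll l0 p0 p1; have := ler_wpM2l l0 e1; lra. Qed.

Lemma opp_max_le0 (x : int) : - Num.max (- x) 0 <= 0.
Proof. lia. Qed.

Lemma opp_max_le (x : int) : - Num.max (- x) 0 <= x.
Proof. lia. Qed.

(** * Growth of f(z+c) / f(z) and of (1+f) / (1-f) *)

Section Periodic.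
Variables (f : C -> C) (c A : C) (q M : R).
Hypothesis merof : meromorphic f.
Hypothesis nc : nonconstant f.
Hypothesis q01 : 0 < q < 1.
Hypothesis growth : forall r, M <= r -> fine (charT f r) <= expR (expR (q * ln r)).
Hypothesis c0 : c != 0.

Let mf : mer f. Proof. exact: nonconstant_mer0. Qed.
Let mfa a : mer (fun w => f w - a). Proof. exact: nonconstant_mer. Qed.

Lemma grid_tau r0 n fam (L : nat -> R) (X rho s : R) S j : 0 < r0 <= 1 -> (0 < n)%N -> fam 0%N = f ->
  1 <= X -> M <= X -> grid r0 n fam L [:: c] X (lam c * ln X) rho s S ->
  rho + j%:R * (lam c * ln X) <= 3 * X ->
  [/\ rad r0 s S (rho + j%:R * (lam c * ln X)), X <= rho + j%:R * (lam c * ln X) &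
    Tb r0 S f (rho + j%:R * (lam c * ln X))
    ((1 - (Num.max (- ord f 0) 0)%:~R * ln r0) * (1 + expR (expR (q * ln (3 * X)))))].
Proof.
move=> r01 n0 f0 X1 MX [hadm /andP[Xr _] hS0 hg] jX; have [hr _] := hg j jX.
have af : adm r0 s S f (L 0%N) by rewrite -f0; exact: hadm.
have XK : X <= rho + j%:R * (lam c * ln X).
  apply: le_trans (ltW Xr) _; rewrite lerDl.
  exact: mulr_ge0 (ler0n _ _) (mulr_ge0 (ltW (lam_gt0 (cnorm_ge0 c))) (ln_ge0 X1)).
split=> //; have [hT _] := tauP merof mf af hr hS0.
apply: Tb_leT hT _; have [q0 _] := andP q01.
by apply: (tau_growth q0 r01 _ _ jX growth); [exact: rad_gt0 hr|exact: le_trans MX XK].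
Qed.

Let G0_ge0 (r0 : R) : 0 < r0 <= 1 -> 0 <= 1 - (Num.max (- ord f 0) 0)%:~R * ln r0.
Proof.
move=> /andP[_ r1]; rewrite subr_ge0; apply: le_trans ler01.
by rewrite mulr_ge0_le0 ?ler0z ?le_max ?lexx ?orbT// ln_le0.
Qed.

Definition ratio w := f (w + c) / f w.

(** Only a growth bound is wanted, so [ldl_shift] is used with eps = 1: the mean of log+ |ratio| is
    bounded by the bound for f on two larger circles, up to a constant. *)
Lemma ratio_growth r0 (L : nat -> R) : 0 < r0 <= 1 -> exists G : R, 0 <= G /\ exists X1 : R, forall X rho s S, X1 <= X ->
  grid r0 2 (nth (fun=> 0) [:: f; (fun w => f (w + c))]) L [:: c] X (lam c * ln X) rho s S ->
  forall j : nat, rho + (j + 2)%:R * (lam c * ln X) <= 3 * X ->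
  mb (rho + j%:R * (lam c * ln X)) (fun w => lp (ratio w)) (G * (1 + expR (expR (q * ln (3 * X))))).
Proof.
move=> r01; pose G0 := 1 - (Num.max (- ord f 0) 0)%:~R * ln r0; have hG0 := G0_ge0 r01.
exists (G0 + `|L 0%N|); split; first by rewrite addr_ge0.
exists (Num.max (expR 1) M) => X rho s S; rewrite ge_max => /andP[Xe XM] hgrid j jX.
have X1 : 1 <= X by apply: le_trans Xe; exact: expR1_ge1.
have lX : 1 <= ln X by rewrite -[1]expRK ler_ln ?posrE ?expR_gt0//; apply: lt_le_trans Xe; exact: expR_gt0.
have cn := cnorm_ge0 c; have lam0 := lam_gt0 cn.
have [hadm /andP[Xr _] hS0 hg] := hgrid.
pose K := lam c * ln X; have K0 : 0 < K by apply: mulr_gt0 => //; exact: lt_le_trans lX.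
rewrite -/K in hgrid hg jX *; set r := rho + j%:R * K.
have E1 : r + K = rho + (j + 1)%:R * K by rewrite /r natrD; ring.
have E2 : r + 2 * K = rho + (j + 2)%:R * K by rewrite /r natrD; ring.
have jle i : (i <= 2)%N -> rho + (j + i)%:R * K <= 3 * X.
  by move=> i2; apply: le_trans jX; rewrite lerD2l ler_wpM2r ?(ltW K0)// ler_nat leq_add2l.
have [hr Xr' _] := grid_tau r01 (ltn0Sn 1) erefl X1 XM hgrid (jle 0%N isT).
have [hr1 _ hT1] := grid_tau r01 (ltn0Sn 1) erefl X1 XM hgrid (jle 1%N isT).
have [hr2 _ hT2] := grid_tau r01 (ltn0Sn 1) erefl X1 XM hgrid (jle 2%N isT).
rewrite addn0 -/K -/r in hr Xr'; rewrite -/K -E1 in hr1 hT1; rewrite -/K -E2 in hr2 hT2.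
have rp := rad_gt0 hr.
have hst : step X K r by split=> //; rewrite E2.
have [h6 _ h2] := lam_small cn lX (erefl K).
have cp : 0 < cnorm c by rewrite cnorm_gt0.
have af := hadm 0%N isT; have afc := hadm 1%N isT.
have hcK : 2 * cnorm c <= K by apply: le_trans h2; rewrite ler_wpM2r// ler_nat.
have heps : ((2 * 10 ^+ 3) * cnorm c + (3 * 10 ^+ 3)) * ln X <= 1 * K by exact: (coef_le cn lX (ltW K0) h6).
have hav a : a \in S -> cnorm (a - c) != r.
  have jX0 := jle 0%N isT; rewrite addn0 in jX0.
  by move=> aS; have [_ h] := hg j jX0; apply: h => //; rewrite mem_seq1.
have := ldl_shift af hst hr hr1 hr2 cp hcK heps hav hT1 hT2; rewrite mul1r => hM.
apply: mb_leB (mb_le rp _ hM) _.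
  move=> w wr; have f0 := rad_neq0 af hr wr; have fc0 := rad_neq0 afc hr wr.
  by rewrite /ratio /logplus ge_max normr_ge0 /= ln_cnormM ?invr_eq0// ln_cnormV// ler_norm.
rewrite [leRHS]mulrDl lerD2l ler_peMr// lerDl expR_ge0//.
Qed.

(** Sends the values 1 and -1 of f to infinity and 0, and turns f(z+c) = - f(z) into the relation
    required by [inversion_const]. *)
Definition cayley w := (1 + f w) / (1 - f w).

Let mp1 : mer (fun w => 1 + f w).
Proof.
by rewrite (_ : (fun w => 1 + f w) = (fun w => f w - -1))//; apply/funext => w; rewrite opprK addrC.
Qed.

Let mm1 : mer (fun w => 1 - f w).
Proof.
rewrite (_ : (fun w => 1 - f w) = (fun w => - (f w - 1))); first exact: merN.
by apply/funext => w; rewrite opprB.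
Qed.

Lemma mer_cayley : mer cayley. Proof. exact: merf. Qed.

Let m1 : mer (fun=> 1 : C). Proof. exact: mer_cst (oner_neq0 _). Qed.

Let ord1 a : ord (fun=> 1 : C) a = 0. Proof. exact: ord_cst (oner_neq0 _). Qed.

Lemma ord_1pm a : - Num.max (- ord f a) 0 <= ord (fun w => 1 + f w) a /\
  - Num.max (- ord f a) 0 <= ord (fun w => 1 - f w) a.
Proof.
by split; [apply: (ordD_ge m1 mf mp1)|apply: (ordB_ge m1 mf mm1)]; rewrite ?ord1 ?opp_max_le0 ?opp_max_le.
Qed.

Lemma cayley_growth r0 (L : nat -> R) : 0 < r0 <= 1 -> exists G : R, 0 <= G /\ exists X1 : R, forall X rho s S, X1 <= X ->
  grid r0 2 (nth (fun=> 0) [:: f; (fun w => 1 - f w)]) L [:: c] X (lam c * ln X) rho s S ->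
  forall j : nat, rho + (j + 2)%:R * (lam c * ln X) <= 3 * X ->
  mb (rho + j%:R * (lam c * ln X)) (fun w => lp (cayley w)) (G * (1 + expR (expR (q * ln (3 * X))))).
Proof.
move=> r01; pose G0 := 1 - (Num.max (- ord f 0) 0)%:~R * ln r0; have hG0 := G0_ge0 r01.
exists (2 * G0 + 4 + `|L 1%N|); split; first by rewrite !addr_ge0 ?mulr_ge0.
exists (Num.max 1 M) => X rho s S; rewrite ge_max => /andP[X1 XM] hgrid j jX.
have lX : 0 <= ln X by exact: ln_ge0.
have cn := cnorm_ge0 c; have lam0 := lam_gt0 cn.
pose K := lam c * ln X; have K0 : 0 <= K by apply: mulr_ge0 => //; exact: ltW.
have j0 : rho + j%:R * K <= 3 * X.
  by apply: le_trans jX; rewrite lerD2l ler_wpM2r// ler_nat leq_addr.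
have [hr _ hT] := grid_tau r01 (ltn0Sn 1) erefl X1 XM hgrid j0.
have [hadm _ _ _] := hgrid; have a1 := hadm 1%N isT.
rewrite -/K in hr hT *; set r := rho + j%:R * K in hr hT *; have rp := rad_gt0 hr.
have h1 : mb r (fun w => lp (1 : C)) 0 by apply: mb_le (mb_cst r 0) => // w _; rewrite lp1.
have := @Tb_quot R r0 s S r (fun w => 1 + f w) (fun w => 1 - f w) cayley (L 1%N) (fun a => Num.max (- ord f a) 0) _ _
  a1 hr (fun w _ => erefl) _ (mb_lpD rp h1 hT) (mb_lpB rp h1 hT).
move=> /(_ _) h; have {}h := h _; rewrite -/(NP r0 S r f) in h.
set EE := 1 + expR _ in hT h *; have E1 : 1 <= EE by rewrite /EE lerDl expR_ge0.
have nl := ler_norm (- L 1%N); rewrite normrN in nl.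
apply: mb_leB (h _) _.
  move=> a; have [u1 u2] := ord_1pm a; split=> //; last by rewrite le_max lexx orbT.
  exact: ordf.
exact: (cayley_arith _ E1 nl (normr_ge0 _) (NP_ge0 f hr) (NP_ge0 cayley hr)).
Qed.

End Periodic.

End Inversion.

(** * The case f(z+2c) = f(z) *)

Section PeriodTwo.
Variable R : realType.
Local Notation C := (complex R).
Implicit Types (z w a b : C).
Variables (f : C -> C) (c A : C) (q M : R).
Hypothesis merof : meromorphic f.
Hypothesis nc : nonconstant f.
Hypothesis q01 : 0 < q < 1.
Hypothesis growth : forall r, M <= r -> fine (charT f r) <= expR (expR (q * ln r)).
Hypothesis c0 : c != 0.
Hypothesis H0 : forall z, ord f z <= ord f (z + c).
Hypothesis H1 : forall z, 0 < ord (fun w => f w - 1) z -> 0 < ord (fun w => f w - A) (z + c).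
Hypothesis N1 : mer (fun w => f (w + c) - f w).
Hypothesis N2 : mer (fun w => f (w + c) - A * f w).
Hypothesis N3 : null (fun w => f (w + 2%:R * c) - f w).

Let mf : mer f. Proof. exact: nonconstant_mer0. Qed.
Let mfa a : mer (fun w => f w - a). Proof. exact: nonconstant_mer. Qed.
Let mfc : mer (fun w => f (w + c)). Proof. exact: mer_shift. Qed.

Let per z : \forall w \near pn z, f (w + 2%:R * c) = f w.
Proof. by apply: filterS (N3 z) => w /eqP; rewrite subr_eq0 => /eqP. Qed.

(** The order does not decrease along z, z + c, z + 2c and returns to its initial value, so it is
    constant. *)
Let ord_per z : ord f (z + c) = ord f z.
Proof.
apply/eqP; rewrite eq_le H0 andbT; apply: le_trans (H0 (z + c)) _.
have ae : aeq (fun w => f (w + 2%:R * c)) f by exact: per.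
have -> : z + c + c = z + 2%:R * c by ring.
by rewrite -(@ord_shift R f (2%:R * c) z mf) -(ord_aeq z ae (mer_shift _ mf)).
Qed.

Lemma ratio_const : exists a, null (fun w => ratio f c w - a).
Proof.
have mr : mer (ratio f c) by exact: merf.
apply: (@inversion_const R (ratio f c) c q 2 (nth (fun=> 0) [:: f; (fun w => f (w + c))])) => //.
- by move=> z; rewrite ordf// ord_shift// ord_per subrr.
- move=> z; have h1 := mer_neq0 z mf; have h2 := mer_neq0 z mfc; near=> w.
  have f0 : f w != 0 by near: w.
  have fc0 : f (w + c) != 0 by near: w.
  rewrite /ratio (_ : w + c + c = w + 2%:R * c); last ring.
  have -> : f (w + 2%:R * c) = f w by near: w; exact: per.
  by field; rewrite f0 fc0.
- by case=> [|[|//]] _.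
- by move=> r0 L r01; exact: (@ratio_growth R f c q M merof nc q01 growth c0 r0 L r01).
Unshelve. all: by end_near. Qed.

(** The constant ratio a satisfies a^2 = 1 by periodicity, and a = 1 is excluded by [N1]. *)
Lemma antiperiodic : aeq (fun w => f (w + c)) (fun w => - f w).
Proof.
have [a na] := ratio_const.
have ra z : \forall w \near pn z, f (w + c) = a * f w.
  apply: filterS2 (na z) (mer_neq0 z mf) => w; rewrite /ratio => /eqP; rewrite subr_eq0 => /eqP <- f0.
  by rewrite divfK.
have aa : a * a = 1.
  have [w [[[h1 h2] h3] h4]] := filter_ex (filterI (filterI (filterI (ra 0) (pn_add (ra (0 + c)))) (per 0)) (mer_neq0 0 mf)).
  apply: (mulIf h4); rewrite mul1r -mulrA -h1 -h2 (_ : w + c + c = w + 2%:R * c) ?h3//; ring.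
have : (a - 1) * (a + 1) == 0 by rewrite (_ : _ * _ = a * a - 1); [rewrite aa subrr|ring].
rewrite mulf_eq0 => /orP[|] /eqP E.
  exfalso; apply: (mer_not_null N1) => z; apply: filterS (ra z) => w ->.
  by rewrite -[X in _ - X]mul1r -mulrBl E mul0r.
by move=> z; apply: filterS (ra z) => w ->; rewrite (_ : a = -1) ?mulN1r//; apply/eqP; rewrite -addr_eq0 E.
Qed.

Lemma period_two_false : False.
Proof.
have ap := antiperiodic.
(* A = -1 would give f(z+c) = A f(z), against [N2]. *)
have A1 : - 1 - A != 0.
  apply/eqP => E; apply: (mer_not_null N2) => z; apply: filterS (ap z) => w ->.
  have -> : - f w - A * f w = (- 1 - A) * f w by ring.
  by rewrite E mul0r.
(* At a 1-point z the value f(z+c) would be both -1 and A. *)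
have P1 z : ord (fun w => f w - 1) z <= 0.
  rewrite leNgt; apply/negP => h; have h' := H1 h.
  have mfcA : mer (fun w => f (w + c) - A) by exact: (mer_shift c (mfa A)).
  have oA : ord (fun w => f (w + c) - A) z = ord (fun w => f w - A) (z + c) by exact: (@ord_shift R (fun w => f w - A)).
  have ae : aeq (fun=> - 1 - A) (fun w => (f (w + c) - A) + (f w - 1)).
    by move=> v; apply: filterS (ap v) => w ->; ring.
  have mk := mer_cst A1.
  have : 1 <= ord (fun w => (f (w + c) - A) + (f w - 1)) z.
    apply: (ordD_ge mfcA (mfa 1)); [exact: mer_aeq ae mk|by rewrite oA -gtz0_ge1|by rewrite -gtz0_ge1].
  by rewrite (ord_aeq z ae mk) ord_cst.
have E1 : (fun w => 1 + f w) = (fun w => f w - -1) by apply/funext => w; rewrite opprK addrC.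
have E2 : (fun w => 1 - f w) = (fun w => - (f w - 1)) by apply/funext => w; rewrite opprB.
have mp1 : mer (fun w => 1 + f w) by rewrite E1.
have mm1 : mer (fun w => 1 - f w) by rewrite E2; exact: merN.
have om z : ord (fun w => 1 - f w) z = ord (fun w => f w - 1) z by rewrite E2 ordN.
have P2 z : ord (fun w => 1 + f w) z <= 0.
  have := P1 (z - c); rewrite -(@ord_shift R (fun w => f w - 1) (- c) z (mfa 1)).
  have ae : aeq (fun w => - (1 + f w)) (fun w => f (w - c) - 1).
    move=> v; have h := ap (v - c); have := @pn_add R v (- c) _ h; apply: filterS => w.
    by rewrite subrK => ->; ring.
  by rewrite (ord_aeq z ae (merN mp1)) ordN.
have m1 : mer (fun=> 1 : C) := mer_cst (oner_neq0 _).
have o1 z : ord (fun=> 1 : C) z = 0 := ord_cst z (oner_neq0 _).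
have mc := mer_cayley merof nc.
have oc z : ord (cayley f) z = 0.
  have h1 := P1 z; have h2 := P2 z; have [h3 h4] := ord_1pm merof nc z.
  rewrite ordf//; have [h|h] := ltP (ord f z) 0; last by move: h1 h2 h3 h4; rewrite om; lia.
  have -> : ord (fun w => 1 + f w) z = ord f z.
    rewrite (_ : (fun w => 1 + f w) = (fun w => f w + 1)); last by apply/funext => w; exact: addrC.
    by rewrite (ordD_lt mf m1)// o1.
  by rewrite om (ordB_lt mf m1) ?o1// subrr.
have [k nk] : exists k, null (fun w => cayley f w - k).
  apply: (@inversion_const R (cayley f) c q 2 (nth (fun=> 0) [:: f; (fun w => 1 - f w)])) => //.
  - move=> z; have h1 := mer_neq0 z mp1; have h2 := mer_neq0 z mm1; near=> w.
    have f0 : 1 + f w != 0 by near: w.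
    have f1 : 1 - f w != 0 by near: w.
    rewrite /cayley (_ : f (w + c) = - f w); last by near: w; exact: ap.
    by rewrite opprK; field; rewrite f0 f1.
  - by case=> [|[|//]] _.
  - by move=> r0 L r01; exact: (@cayley_growth R f c q M merof nc q01 growth r0 L r01).
have hk z : \forall w \near pn z, f w * (1 + k) = k - 1.
  apply: filterS2 (nk z) (mer_neq0 z mm1) => w; rewrite /cayley => /eqP; rewrite subr_eq0 => /eqP <- f1.
  by field.
have k1 : 1 + k != 0.
  apply/eqP => k1; have [w] := filter_ex (hk 0); rewrite k1 mulr0 => E.
  have : (2 : C) == 0 by rewrite (_ : 2 = (1 + k) - (k - 1)); [rewrite k1 -E subrr|ring].
  by rewrite pnatr_eq0.
apply: (mer_not_null (mfa ((k - 1) / (1 + k)))) => z; apply: filterS (hk z) => w <-.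
by rewrite mulfK ?subrr.
Unshelve. all: by end_near. Qed.

End PeriodTwo.

Theorem theorem2 (R : realType) (f : complex R -> complex R) (c A : complex R) :
  meromorphic f -> nonconstant f ->
  (hyper_order f < 1%:E)%E ->
  c != 0 :> complex R -> A != 0 :> complex R ->
  Esub f (Some (0 : complex R)) (fshift f c) (Some (0 : complex R)) ->
  Esub (fshift f c) None f None ->
  Ebarsub f (Some (1 : complex R)) (fshift f c) (Some A) ->
  (meq (fshift f c) (fun z => A * f z) \/ meq (fshift f c) f) /\
  (A = 1 :> complex R -> meq (fshift f c) f).
Proof.
move=> merof nc ho c0 A0 h0 hi h1.
suff H : meq (fshift f c) (fun z => A * f z) \/ meq (fshift f c) f.
  split=> // A1; case: H => //; rewrite A1.
  by rewrite (_ : (fun z => 1 * f z) = f)//; apply/funext => z; rewrite mul1r.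
have [q [M [q01 growth]]] := hyper_growth ho.
have H0 := Esub_ord merof nc h0 hi; have H1 := Ebarsub_ord merof nc h1.
have mf := mf_meromorphic merof; have ms := meromorphic_shift merof c.
(* The first two differences, if identically zero, are the two conclusions; only the vanishing for
   the shift 2c opens a further case, and that case is contradictory. *)
have [N1|n] := mf_dichotomy (mfB (mf_shift c mf) mf); last by right; exact: null_meq n.
have [N2|n] := mf_dichotomy (mfB (mf_shift c mf) (mfM (mf_cst A) mf)); last first.
  by left; apply: null_meq n => //; exact: meromorphic_scale.
exfalso; have [N3|N3] := mf_dichotomy (mfB (mf_shift (2%:R * c) mf) mf).
  exact: (main_false merof nc q01 growth c0 A0 H0 H1 N1 N2 N3).
exact: (period_two_false merof nc q01 growth c0 H0 H1 N1 N2 N3).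
Qed.
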